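(* Let $F \colon \mathcal U \to \mathcal V$ be a complex box mapping that satisfies the no permutation condition. Assume that each component of $\mathcal V$ contains a critical point of $F$, or contains an open set which is not in $\mathcal U$. Let $\hat{\mathcal U}$ be a finite union of puzzle pieces of $F$ such that $\hat{\mathcal U}$ is a nice set compactly contained in $\mathcal V$, and let $\mathrm{Crit}_{\hat{\mathcal U}}(F) \subset \mathrm{Crit}(F)$ be the subset of critical points whose orbits visit $\hat{\mathcal U}$ infinitely many times. Then there exists an induced, dynamically natural complex box mapping $F_1 \colon \mathcal U_1 \to \mathcal V_1$ such that $\mathrm{Crit}_{\hat{\mathcal U}}(F)\subset \mathrm{Crit}(F_1)\subset \mathrm{Crit}(F)$.
   Context: A topological disk is an open simply connected subset of $\mathbb C$; a Jordan disk is a topological disk whose boundary is a Jordan curve; $\mathrm{mod}$ is the conformal modulus of an annulus; $\mathrm{Comp}_xB$ is the connected component of $B$ containing $x$. A complex box mapping is a holomorphic map $F\colon\mathcal U\to\mathcal V$ between open sets $\mathcal U\subset\mathcal V\subset\mathbb C$ such that: (i) $F$ has finitely many critical points; (ii) $\mathcal V$ is a union of finitely many Jordan disks with disjoint closures; (iii) every component $V$ of $\mathcal V$ is either a component of $\mathcal U$, or $V\cap\mathcal U$ is a (possibly infinite) union of Jordan disks with pairwise disjoint closures, each compactly contained in $V$; (iv) for every component $U$ of $\mathcal U$, $F(U)$ is a component of $\mathcal V$ and $F\colon U\to F(U)$ is proper. $\mathrm{Crit}(F)$ is the set of critical points. The components of $F^{-n}(\mathcal V)$ are the puzzle pieces of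 depth $n\ge0$; $K(F)=\bigcap_{n\ge0}F^{-n}(\mathcal V)$. An open set $B$ is nice if $F^k(\partial B)\cap B=\emptyset$ for all $k\ge1$. A box mapping $F_1\colon\mathcal U_1\to\mathcal V_1$ is induced from $F$ if $\mathcal U_1$ and $\mathcal V_1$ are unions of puzzle pieces of $F$ and the branches of $F_1$ are compositions of branches of $F$. A puzzle neighborhood of a finite set $A$ is a finite union $W$ of puzzle pieces with $A\subset W$ and each component of $W$ intersecting $A$. $K_{\text{off-crit}}(F)$ is the set of $x\in K(F)$ whose forward orbit is disjoint from some puzzle neighborhood of $\mathrm{Crit}(F)$ (all of $K(F)$ if $\mathrm{Crit}(F)=\emptyset$). Let $m_F(x)=\mathrm{mod}(\mathrm{Comp}_x\mathcal V\setminus\overline{\mathrm{Comp}_x\mathcal U})$ ($0$ if the two components are equal), $K_\delta(F)=\{y\in K(F):\limsup_{k}m_F(F^k(y))>\delta\}$, $K_{\text{well-inside}}(F)=\bigcup_{\delta>0}K_\delta(F)$. No permutation condition: for each component $U$ of $\mathcal U$ there is $n\ge0$ with $F^n(U)\setminus\mathcal U\ne\emptyset$. $F$ is dynamically natural if it satisfies the no permutation condition, $K_{\text{off-crit}}(F)$ has Lebesgue measure zero and $K(F)=K_{\text{well-inside}}(F)$. *)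

(* Defs.v *)
From HB Require Import structures.
From mathcomp Require Import all_boot all_order all_algebra.
From mathcomp Require Import all_classical all_reals all_analysis.
From mathcomp Require Import complex.

Set Implicit Arguments.
Unset Strict Implicit.
Unset Printing Implicit Defensive.

Import Order.TTheory GRing.Theory Num.Theory.
Import numFieldNormedType.Exports.

Local Open Scope classical_set_scope.
Local Open Scope ring_scope.

(* Declaring the structure explicitly gives [R[i]] the topology and the normed
   module structure over itself that every [numFieldType] carries; hence
   [derivable f z 1] and [derive1] below are complex differentiation. *)
Definition Cplane (R : realType) : numClosedFieldType := R[i].

Section PlaneTopology.
Variable R : realType.
Local Notation C := (Cplane R).
Implicit Types A B : set C.

Definition boundary A : set C := closure A `\` interior A.

Definition components A : set (set C) := connected_component A @` A.

Definition compactly_contained A B : Prop :=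
  compact (closure A) /\ closure A `<=` B.

Definition unit_circle : set C := [set z | `|z| = 1].

Definition jordan_curve (J : set C) : Prop :=
  exists f : C -> C, [/\ {within unit_circle, continuous f},
    set_inj unit_circle f & f @` unit_circle = J].

Definition path_connected A : Prop :=
  forall x y, A x -> A y -> exists g : R -> C,
    [/\ {within `[0, 1]%classic, continuous g},
        g @` `[0, 1]%classic `<=` A, g 0 = x & g 1 = y].

Definition null_homotopic A (g : R -> C) : Prop :=
  exists H : R * R -> C,
    [/\ {within `[0, 1]%classic `*` `[0, 1]%classic, continuous H},
        H @` (`[0, 1]%classic `*` `[0, 1]%classic) `<=` A,
        forall t : R, t \in `[0, 1] -> H (0, t) = g t,
        forall t : R, t \in `[0, 1] -> H (1, t) = g 0 &
        forall s : R, s \in `[0, 1] -> H (s, 0) = g 0 /\ H (s, 1) = g 0].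

Definition simply_connected A : Prop :=
  [/\ A !=set0, path_connected A &
      forall g : R -> C, {within `[0, 1]%classic, continuous g} ->
        g @` `[0, 1]%classic `<=` A -> g 0 = g 1 -> null_homotopic A g].

Definition topological_disk A : Prop := open A /\ simply_connected A.

Definition jordan_disk A : Prop :=
  topological_disk A /\ jordan_curve (boundary A).

Definition holomorphic_on A (f : C -> C) : Prop :=
  forall z, A z -> derivable f z 1.

Definition conformally_equivalent A B : Prop :=
  exists f : C -> C, holomorphic_on A f /\ set_bij A B f.

Definition round_annulus (r : R) (s : \bar R) : set C :=
  [set z | r < ComplexField.Normc.normc z
           /\ ((ComplexField.Normc.normc z)%:E < s)%E].

Definition round_modulus (r : R) (s : \bar R) : \bar R :=
  match s with
  | s'%:E => if r == 0 then +oo%E else ((2 * pi)^-1 * ln (s' / r))%:E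
  | _ => +oo%E
  end.

Definition has_modulus A (m : \bar R) : Prop :=
  exists (r : R) (s : \bar R),
    [/\ 0 <= r, (r%:E < s)%E, conformally_equivalent A (round_annulus r s) &
        m = round_modulus r s].

(* The round annulus conformally equivalent to a given annulus is unique up to
   scaling, so the choice made by [xget] is immaterial; the default value is
   taken only if [A] is not an annulus. *)
Definition modulus A : \bar R := xget 0%E (has_modulus A).

Definition planar_null A : Prop :=
  (lebesgue_measure \x lebesgue_measure)%E.-negligible
    [set p : R * R | A (p.1 +i* p.2)%C].

End PlaneTopology.

(* A partial map from [src] to [tgt]; the values of [pfun] outside [src] are
   irrelevant. *)
Record plane_map (R : realType) := PlaneMap {
  src : set (Cplane R);
  tgt : set (Cplane R);
  pfun :> Cplane R -> Cplane R }.

Section BoxMappings.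
Variable R : realType.
Local Notation C := (Cplane R).
Implicit Types F : plane_map R.

Definition crit F : set C := [set z | src F z /\ derive1 (F : C -> C) z = 0].

Record box_mapping F : Prop := {
  box_src_open : open (src F);
  box_tgt_open : open (tgt F);
  box_src_tgt : src F `<=` tgt F;
  box_holomorphic : holomorphic_on (src F) F;
  box_maps : F @` src F `<=` tgt F;
  box_crit : finite_set (crit F);
  box_tgt : exists D : set (set C),
    [/\ finite_set D, forall A, D A -> jordan_disk A,
        trivIset D closure & tgt F = \bigcup_(A in D) A];
  box_src : forall V, components (tgt F) V ->
    components (src F) V \/
    exists D : set (set C),
      [/\ forall A, D A -> jordan_disk A /\ compactly_contained A V,
          trivIset D closure & V `&` src F = \bigcup_(A in D) A];
  box_proper : forall A, components (src F) A ->
    components (tgt F) (F @` A) /\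
    forall K, compact K -> K `<=` F @` A -> compact (A `&` F @^-1` K) }.

(* [iter_dom F n] is F^{-n}(tgt F), which is also the set of points at which
   the n-th iterate of the partial map [F] is defined. *)
Fixpoint iter_dom F (n : nat) : set C :=
  match n with
  | 0%N => tgt F
  | m.+1 => [set z | src F z /\ iter_dom F m (F z)]
  end.

Definition puzzle_piece F (P : set C) : Prop :=
  exists n, components (iter_dom F n) P.

Definition nonescaping F : set C := \bigcap_n iter_dom F n.

Definition nice F (B : set C) : Prop :=
  open B /\
  forall k, (1 <= k)%N ->
    (iter k F @` (boundary B `&` iter_dom F k)) `&` B = set0.

Definition puzzle_union F (W : set C) : Prop :=
  exists2 P : set (set C), P `<=` puzzle_piece F & W = \bigcup_(A in P) A.

Definition finite_puzzle_union F (W : set C) : Prop :=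
  exists P : set (set C),
    [/\ finite_set P, P `<=` puzzle_piece F & W = \bigcup_(A in P) A].

(* The branches of a partial map are its restrictions to the components of its
   domain; the composition of the branches of [F] on [B 0], ..., [B n.-1] is
   the n-th iterate, restricted to points whose i-th image lies in [B i]. *)
Definition induced_from F1 F : Prop :=
  [/\ puzzle_union F (src F1), puzzle_union F (tgt F1) &
      forall A, components (src F1) A ->
        exists (n : nat) (B : nat -> set C),
          [/\ (0 < n)%N,
              forall i, (i < n)%N ->
                components (src F) (B i) /\ iter i F @` A `<=` B i &
              forall z, A z -> F1 z = iter n F z]].

Definition puzzle_neighborhood F (A W : set C) : Prop :=
  [/\ finite_puzzle_union F W, A `<=` W &
      forall W', components W W' -> W' `&` A !=set0].

Definition off_crit F : set C :=
  [set x | nonescaping F x /\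
    (crit F = set0 \/
     exists2 W, puzzle_neighborhood F (crit F) W &
                forall k, ~ W (iter k F x))].

Definition comp_modulus F (x : C) : \bar R :=
  let V := connected_component (tgt F) x in
  let U := connected_component (src F) x in
  if `[< V = U >] then 0%E else modulus (V `\` closure U).

Definition delta_inside F (delta : R) : set C :=
  [set y | nonescaping F y /\
    (delta%:E < limn_esup (fun k => comp_modulus F (iter k F y)))%E].

Definition well_inside F : set C :=
  \bigcup_(delta in [set d : R | 0 < d]) delta_inside F delta.

Definition no_permutation F : Prop :=
  forall A, components (src F) A ->
    exists n, (iter n F @` (A `&` iter_dom F n)) `\` src F !=set0.

Definition dynamically_natural F : Prop :=
  [/\ no_permutation F, planar_null (off_crit F) &
      nonescaping F = well_inside F].

Definition crit_visiting F (B : set C) : set C :=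
  [set c | crit F c /\
    forall N, exists k, [/\ (N <= k)%N, iter_dom F k c & B (iter k F c)]].

End BoxMappings.

(* Main.v *)
(* Restrict [F] to the components of its source that contain a critical point.
   This map has the same critical points and only finitely many source
   components, which already makes it dynamically natural. By the no permutation
   condition every nonescaping orbit visits infinitely often a source component
   [U] that is compactly contained in its target component [V]. The set
   [V `\` closure U] is conformally a round annulus, hence has positive modulus:
   map [V] to the disk, pass to the exponential cover of the image of
   [V `\` closure U], map this cover to the disk as well, and bring the deck
   transformation to the form of a translation. Finally, for some [M], all
   [iter_dom F (N + M)] are relatively compact in [iter_dom F N]; since disks
   lift through [F] along orbits that avoid the critical components of depth
   [N], the iterates of [F] expand there, and such an expanding set has no
   interior, is porous and therefore null. *)
Require Import Defs.
From mathcomp Require Import all_boot all_order all_algebra.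
From mathcomp Require Import all_classical all_reals all_analysis.
From mathcomp Require Import complex ring lra zify.

Import Order.TTheory GRing.Theory Num.Theory.
Import numFieldNormedType.Exports.

Set Implicit Arguments.
Unset Strict Implicit.
Unset Printing Implicit Defensive.

Local Open Scope classical_set_scope.
Local Open Scope ring_scope.

(** * Arithmetic of the complex plane over a real type *)

Section Plane.
Variable R : realType.
Local Notation C := (Cplane R).
Implicit Types (z w : C) (x y : R).

(** The modulus is a choice made by [xget], so its positivity requires an actual round model of the
    annulus. The Jordan curve bounding [U] enters there: winding numbers along its image show that
    the disk minus the image of [closure U] is connected, and this makes the exponential cover
    connected as well. Homotopies in that cover are hard to construct, so the Riemann mapping
    theorem is stated for domains on which zero-free holomorphic functions have square roots. For
    [V] the roots come from null-homotopies, for the cover from Cauchy's theorem for polygons of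
    index zero. Finiteness of the set of source components makes preimages of compact sets compact,
    and this yields an [M] that serves all [N]. Lifting a disk through [F] costs a factor [s < 1],
    since it is lifted only over a smaller concentric disk, while relative compactness gains a
    factor [1 + t] per block of levels; [s] is taken so close to 1 that the gain wins. A high
    iterate then has derivative at least [4] in modulus on the set in question, which leaves
    expansion by [2] once the distortion of one step is subtracted. *)

Definition nm z : R := ComplexField.Normc.normc z.
Definition rc x : C := (x%:C)%C.
Definition cI : C := ('i)%C.
Definition cRe z : R := complex.Re z.
Definition cIm z : R := complex.Im z.

Lemma nmE z : nm z = Num.sqrt (cRe z ^+ 2 + cIm z ^+ 2).
Proof. by case: z. Qed.

(** The norm of [C] has values in [C]; all estimates are made with the real-valued [nm] and carried
    over here. *)
Lemma normE z : `|z| = rc (nm z).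
Proof. by []. Qed.

Lemma nm_ge0 z : 0 <= nm z.
Proof. by rewrite nmE sqrtr_ge0. Qed.

Lemma nmM z w : nm (z * w) = nm z * nm w.
Proof. exact: ComplexField.Normc.normcM. Qed.

Lemma nmV z : nm z^-1 = (nm z)^-1.
Proof. exact: ComplexField.Normc.normcV. Qed.

Lemma nmN z : nm (- z) = nm z.
Proof. exact: normcN. Qed.

Lemma nm0 : nm 0 = 0.
Proof. exact: ComplexField.Normc.normc0. Qed.

Lemma nm1 : nm 1 = 1.
Proof. exact: ComplexField.Normc.normc1. Qed.

Lemma nmX z n : nm (z ^+ n) = nm z ^+ n.
Proof. by elim: n => [|n IH]; rewrite ?expr0 ?nm1 // !exprS nmM IH. Qed.

Lemma nm_eq0 z : (nm z == 0) = (z == 0).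
Proof.
apply/eqP/eqP=> [|->]; last exact: nm0.
exact: ComplexField.Normc.eq0_normc.
Qed.

Lemma nm_gt0 z : (0 < nm z) = (z != 0).
Proof. by rewrite lt0r nm_eq0 nm_ge0 andbT. Qed.

Lemma le_nmD z w : nm (z + w) <= nm z + nm w.
Proof. exact: le_normcD. Qed.

Lemma nmB z w : nm (z - w) = nm (w - z).
Proof. by rewrite -nmN opprB. Qed.

Lemma le_nm_sub (b a c : C) : nm (a - c) <= nm (a - b) + nm (b - c).
Proof. by rewrite (_ : a - c = (a - b) + (b - c)) ?le_nmD //; ring. Qed.

Lemma le_nmB z w : nm z <= nm w + nm (z - w).
Proof. by rewrite -{1}(subrK w z) addrC le_nmD. Qed.

Lemma nm_rc x : nm (rc x) = `|x|.
Proof. by rewrite nmE /= expr0n addr0 sqrtr_sqr. Qed.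

Lemma nmI : nm cI = 1.
Proof. by rewrite nmE /= expr0n add0r expr1n sqrtr1. Qed.

Lemma rcD x y : rc (x + y) = rc x + rc y. Proof. exact: rmorphD. Qed.
Lemma rcN x : rc (- x) = - rc x. Proof. exact: rmorphN. Qed.
Lemma rcB x y : rc (x - y) = rc x - rc y. Proof. exact: rmorphB. Qed.
Lemma rcM x y : rc (x * y) = rc x * rc y. Proof. exact: rmorphM. Qed.
Lemma rc0 : rc 0 = 0. Proof. by []. Qed.
Lemma rc1 : rc 1 = 1. Proof. by []. Qed.
Lemma rcV x : rc x^-1 = (rc x)^-1. Proof. exact: fmorphV. Qed.
Lemma rc_nat n : rc n%:R = n%:R. Proof. exact: rmorph_nat. Qed.
Lemma rc_inj : injective rc. Proof. by move=> x y []. Qed.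
Lemma rc_eq0 x : (rc x == 0) = (x == 0).
Proof. by rewrite -rc0; apply/eqP/eqP => [/rc_inj|->]. Qed.

Lemma cRe_rc x : cRe (rc x) = x. Proof. by []. Qed.
Lemma cIm_rc x : cIm (rc x) = 0. Proof. by []. Qed.
Lemma cReD z w : cRe (z + w) = cRe z + cRe w. Proof. by case: z; case: w. Qed.
Lemma cImD z w : cIm (z + w) = cIm z + cIm w. Proof. by case: z; case: w. Qed.
Lemma cReN z : cRe (- z) = - cRe z. Proof. by case: z. Qed.
Lemma cImN z : cIm (- z) = - cIm z. Proof. by case: z. Qed.
Lemma cReM z w : cRe (z * w) = cRe z * cRe w - cIm z * cIm w.
Proof. by case: z; case: w. Qed.
Lemma cImM z w : cIm (z * w) = cRe z * cIm w + cIm z * cRe w.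
Proof. by case: z => a b; case: w => c d /=; rewrite (mulrC b) /=. Qed.
Lemma cRe_I : cRe cI = 0. Proof. by []. Qed.
Lemma cIm_I : cIm cI = 1. Proof. by []. Qed.
Lemma cI_neq0 : cI != 0. Proof. by rewrite -nm_gt0 nmI ltr01. Qed.

Lemma cplxE z : z = rc (cRe z) + cI * rc (cIm z).
Proof. exact: complexE. Qed.

Lemma cplx_eq z w : cRe z = cRe w -> cIm z = cIm w -> z = w.
Proof. by move=> e1 e2; rewrite (cplxE z) (cplxE w) e1 e2. Qed.

Lemma le_cRe z : `|cRe z| <= nm z.
Proof. by rewrite nmE -sqrtr_sqr ler_sqrt ?addr_ge0 ?sqr_ge0 // lerDl sqr_ge0. Qed.

Lemma le_cIm z : `|cIm z| <= nm z.
Proof. by rewrite nmE -sqrtr_sqr ler_sqrt ?addr_ge0 ?sqr_ge0 // lerDr sqr_ge0. Qed.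

Lemma nm_sqr z : nm z ^+ 2 = cRe z ^+ 2 + cIm z ^+ 2.
Proof. by rewrite nmE sqr_sqrtr // addr_ge0 ?sqr_ge0. Qed.

Lemma le_nm_ReIm z : nm z <= `|cRe z| + `|cIm z|.
Proof.
rewrite {1}(cplxE z); apply: le_trans (le_nmD _ _) _.
by rewrite nmM nmI mul1r !nm_rc.
Qed.

Definition cbar z : C := (z^*)%C.
Lemma mul_cbar z : z * cbar z = rc (nm z ^+ 2).
Proof.
apply: cplx_eq; rewrite ?cReM ?cImM ?cRe_rc ?cIm_rc ?nm_sqr.
  by case: z => a b /=; rewrite mulrN opprK -!expr2.
by case: z => a b /=; rewrite mulrN mulrC addNr.
Qed.
Lemma nm_cbar z : nm (cbar z) = nm z.
Proof. by rewrite !nmE; case: z => a b /=; rewrite sqrrN. Qed.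
(** * Topology *)

Definition disk (c : C) (r : R) : set C := [set z | nm (z - c) < r].

Lemma disk_center c r : 0 < r -> disk c r c.
Proof. by rewrite /disk /= subrr nm0. Qed.

Lemma nbhs_disk z r : 0 < r -> nbhs z (disk z r).
Proof.
move=> r0; apply/nbhs_normP; exists (rc r) => /=; first by rewrite ltcR.
by move=> w /=; rewrite normE ltcR nmB.
Qed.

Lemma nbhsP z (A : set C) :
  nbhs z A <-> exists2 r : R, 0 < r & disk z r `<=` A.
Proof.
split=> [/nbhs_normP [e /= e0 eA]|[r r0 rA]]; last first.
  exact: filterS rA (nbhs_disk z r0).
(* [0 < e] in [C] includes that the imaginary part of [e] vanishes. *)
have eE : e = rc (cRe e).
  by move: e0; rewrite ltcE => /andP[/eqP /= h _]; apply: cplx_eq.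
exists (cRe e); first by move: e0; rewrite ltcE => /andP[_].
by move=> w wz; apply: eA => /=; rewrite eE normE ltcR nmB.
Qed.

Lemma openP (A : set C) :
  open A <-> forall z, A z -> exists2 r : R, 0 < r & disk z r `<=` A.
Proof.
rewrite openE; split=> h z /h; first by move/nbhsP.
by move=> ?; apply/nbhsP.
Qed.

Lemma open_disk c r : open (disk c r).
Proof.
apply/openP => z zc; exists (r - nm (z - c)); first by rewrite subr_gt0.
move=> w wz; rewrite /disk /=; apply: le_lt_trans (le_nm_sub z w c) _.
by rewrite -ltrBrDr.
Qed.

Lemma disk_subset (c : C) (r s : R) : r <= s -> disk c r `<=` disk c s.
Proof. by move=> rs z /lt_le_trans; apply. Qed.

Lemma cvgcP (T : Type) (F : set_system T) (FF : Filter F) (f : T -> C) z :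
  f @ F --> z <-> forall e : R, 0 < e -> \forall t \near F, nm (f t - z) < e.
Proof.
split=> [h e e0|h].
  by have := h _ (nbhs_disk z e0).
move=> A /nbhsP[r r0 rA]; apply: filterS (h r r0) => t; exact: rA.
Qed.

(** Pointwise continuity gets a name of its own, made opaque once its calculus is in place, so that
    later unification does not unfold filters. *)
Definition cts (T : topologicalType) (f : T -> C) (t : T) : Prop :=
  {for t, continuous f}.

Lemma cts_atP (T : topologicalType) (f : T -> C) (t : T) :
  cts f t <->
  forall e : R, 0 < e -> \forall u \near t, nm (f u - f t) < e.
Proof. exact: cvgcP. Qed.

Lemma ccontP (f : C -> C) z : cts f z <->
  forall e : R, 0 < e -> exists2 d : R, 0 < d &
    forall w, nm (w - z) < d -> nm (f w - f z) < e.
Proof.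
rewrite cts_atP; split=> h e e0; first by have /nbhsP[d] := h e e0; exists d.
by apply/nbhsP; have [d d0 hd] := h e e0; exists d.
Qed.

Lemma rcontP (f : R -> C) t : cts f t <->
  forall e : R, 0 < e -> exists2 d : R, 0 < d &
    forall u, `|u - t| < d -> nm (f u - f t) < e.
Proof.
rewrite cts_atP; split=> h e e0.
  have /nbhs_ballP[d d0 hd] := h e e0; exists d => // u ut.
  by apply: hd; rewrite /ball /= distrC.
apply/nbhs_ballP; have [d d0 hd] := h e e0; exists d => // u ut.
by apply: hd; rewrite distrC.
Qed.

Lemma rfun_contP (f : C -> R) z : {for z, continuous f} <->
  forall e : R, 0 < e -> exists2 d : R, 0 < d &
    forall w, nm (w - z) < d -> `|f w - f z| < e.
Proof.
split=> [h e e0|h A /nbhs_ballP[e /= e0 eA]]; last first.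
  have [d d0 hd] := h e e0; apply/nbhsP; exists d => // w /hd fw.
  by apply: eA; rewrite /ball /= distrC.
have /nbhsP[d d0 hd] := h _ (nbhsx_ballx (f z) e e0).
by exists d => // w /hd; rewrite /= /ball /= distrC.
Qed.

Lemma continuous_lip1 (f : C -> R) :
  (forall z w, `|f w - f z| <= nm (w - z)) -> continuous f.
Proof.
move=> h z; apply/rfun_contP => e e0; exists e => // w.
exact: le_lt_trans.
Qed.

Lemma continuous_nm : continuous nm.
Proof.
apply: continuous_lip1 => z w; have h1 := le_nmB z w; have h2 := le_nmB w z.
by rewrite (nmB z w) in h1; rewrite ler_norml; apply/andP; split; lra.
Qed.

Lemma continuous_cRe : continuous cRe.
Proof. by apply: continuous_lip1 => z w; rewrite -cReN -cReD le_cRe. Qed.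

Lemma continuous_cIm : continuous cIm.
Proof. by apply: continuous_lip1 => z w; rewrite -cImN -cImD le_cIm. Qed.

Lemma continuous_rc : continuous rc.
Proof.
move=> t; apply/rcontP => e e0; exists e => // u; by rewrite -rcB nm_rc.
Qed.

Section Continuity.
Variable T : topologicalType.
Implicit Types (f g : T -> C) (t : T).

Lemma cts_cst (c : C) t : cts (fun _ : T => c) t.
Proof. exact: cvg_cst. Qed.

Lemma ctsD f g t : cts f t -> cts g t ->
  cts (fun u => f u + g u) t.
Proof. exact: continuousD. Qed.

Lemma ctsN f t : cts f t -> cts (fun u => - f u) t.
Proof. exact: continuousN. Qed.

Lemma ctsB f g t : cts f t -> cts g t ->
  cts (fun u => f u - g u) t.
Proof. by move=> cf /ctsN; exact: ctsD. Qed.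

Lemma ctsM f g t : cts f t -> cts g t ->
  cts (fun u => f u * g u) t.
Proof. exact: continuousM. Qed.

Lemma ctsV f t : f t != 0 -> cts f t ->
  cts (fun u => (f u)^-1) t.
Proof. exact: continuousV. Qed.

Lemma cts_rc (f : T -> R) t : {for t, continuous f} ->
  cts (fun u => rc (f u)) t.
Proof. by move=> cf; apply: continuous_comp cf _; exact: continuous_rc. Qed.

Lemma cts_comp (S : topologicalType) (f : T -> S) (g : S -> C) t :
  {for t, continuous f} -> cts g (f t) ->
  cts (fun u => g (f u)) t.
Proof. exact: continuous_comp. Qed.

Lemma ctsRD (f g : T -> R) t : {for t, continuous f} -> {for t, continuous g} ->
  {for t, continuous (fun u => f u + g u)}.
Proof. exact: (@continuousD R R^o). Qed.

Lemma ctsRM (f g : T -> R) t : {for t, continuous f} -> {for t, continuous g} ->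
  {for t, continuous (fun u => f u * g u)}.
Proof. exact: continuousM. Qed.

Lemma ctsR_cst (k : R) t : {for t, continuous (fun _ : T => k)}.
Proof. exact: cvg_cst. Qed.

End Continuity.

Lemma cts_id z : cts (fun u : C => u) z.
Proof. exact: cvg_id. Qed.

Lemma hausdorff_C : hausdorff_space C.
Proof. exact: norm_hausdorff. Qed.

End Plane.

Arguments cts_cst {R T} c t.
Arguments cts_id {R} z.
Arguments ctsR_cst {R T} k t.

Section Derivative.
Variable R : realType.
Local Notation C := (Cplane R).
Local Notation nm := (@nm R).
Local Notation rc := (@rc R).
Local Notation cRe := (@cRe R).
Local Notation cIm := (@cIm R).
Local Notation cI := (cI R).
Implicit Types (z w a b d : C) (x y t s : R).

(** * Derivatives *)

Lemma cts_aff (k l : R) t : {for t, continuous (fun u : R => k * u + l)}.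
Proof.
apply: cvgD; last exact: cvg_cst.
exact: (cvgM (cvg_cst _) cvg_id).
Qed.

Lemma cts_shift (s t : R) : {for t, continuous (fun u : R => u - s)}.
Proof.
have := @cts_aff 1 (- s) t.
by have -> : (fun u => 1 * u - s) = (fun u => u - s) by apply/funext => u; rewrite mul1r.
Qed.

(* Caratheodory's formulation of complex differentiability. *)
Definition cder (f : C -> C) z d := exists phi : C -> C,
  [/\ cts phi z, phi z = d &
      forall w, f w - f z = phi w * (w - z)].

Definition rder (p : R -> C) t d := exists phi : R -> C,
  [/\ cts phi t, phi t = d &
      forall u, p u - p t = phi u * rc (u - t)].

(** Links the two working forms: with a slope function, sums, products and compositions are plain
    algebra; estimates are made with the epsilon form. *)
Lemma cderP (f : C -> C) z d : cder f z d <->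
  forall e : R, 0 < e -> exists2 r : R, 0 < r &
    forall w, nm (w - z) < r -> nm (f w - f z - d * (w - z)) <= e * nm (w - z).
Proof.
split=> [[phi [/ccontP cphi <- fE]] e e0|h].
  have [r r0 hr] := cphi e e0; exists r => // w /hr lte.
  by rewrite fE -mulrBl nmM ler_wpM2r ?nm_ge0 ?ltW.
exists (fun w => if w == z then d else (f w - f z) / (w - z)); split.
- apply/ccontP => e e0; have [r r0 hr] := h (e / 2) (divr_gt0 e0 (ltr0Sn R 1)).
  exists r => // w /hr lte; rewrite eqxx; have [_|wz] := eqVneq w z.
    by rewrite subrr nm0.
  have wz0 : w - z != 0 by rewrite subr_eq0.
  have -> : (f w - f z) / (w - z) - d = (f w - f z - d * (w - z)) / (w - z).
    by field.
  have n0 : 0 < nm (w - z) by rewrite nm_gt0.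
  rewrite nmM nmV; apply: le_lt_trans (_ : e / 2 < e); last by lra.
  by rewrite ler_pdivrMr.
- by rewrite eqxx.
- move=> w; have [->|wz] := eqVneq w z; first by rewrite !subrr mulr0.
  by rewrite divfK // subr_eq0.
Qed.

Lemma cder_cont f z d : cder f z d -> cts f z.
Proof.
move=> [phi [cphi _ fE]].
have -> : f = (fun w => phi w * (w - z) + f z).
  by apply/funext => w; rewrite -fE subrK.
apply: ctsD; last exact: cts_cst.
apply: (ctsM cphi); apply: ctsB; first exact: cts_id.
exact: cts_cst.
Qed.

Lemma cder_unique f z d1 d2 : cder f z d1 -> cder f z d2 -> d1 = d2.
Proof.
move=> /cderP h1 /cderP h2; apply/eqP; rewrite -subr_eq0 -nm_eq0.
apply/eqP/le_anti; rewrite nm_ge0 andbT; apply/ler_addgt0Pl => e e0.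
rewrite addr0; have e20 : 0 < e / 2 by lra.
have [r1 r10 hr1] := h1 _ e20; have [r2 r20 hr2] := h2 _ e20.
pose r := Num.min r1 r2 / 2.
have r0 : 0 < r by rewrite /r; case: (leP r1 r2) => _; lra.
have rr1 : r < r1 by rewrite /r; case: (leP r1 r2) => ?; lra.
have rr2 : r < r2 by rewrite /r; case: (leP r1 r2) => ?; lra.
pose w := z + rc r.
have wz : nm (w - z) = r by rewrite addrC addKr nm_rc gtr0_norm.
have := hr1 w; have := hr2 w; rewrite wz => /(_ rr2) k2 /(_ rr1) k1.
have : nm ((d1 - d2) * (w - z)) <= e * r.
  have -> : (d1 - d2) * (w - z) = (f w - f z - d2 * (w - z)) - (f w - f z - d1 * (w - z)) by ring.
  apply: le_trans (le_nmD _ _) _; rewrite nmN; lra.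
by rewrite nmM wz ler_pM2r.
Qed.

Lemma derivableP_cder f z : derivable f z 1 <-> exists d, cder f z d.
Proof.
split=> [df|[d [phi [cphi phiz fE]]]].
  exists (derive1 f z); apply/cderP => e e0.
  have : h^-1 *: ((f \o shift z) (h *: 1) - f z) @[h --> 0^'] --> derive1 f z.
    by rewrite derive1E /derive; exact: df.
  move=> /(_ _ (nbhs_disk _ e0)) /nbhsP[r r0 hr]; exists r => // w wr.
  have [->|wz] := eqVneq w z; first by rewrite !subrr mulr0 subr0 nm0 mulr0.
  have wz0 : w - z != 0 by rewrite subr_eq0.
  have := hr (w - z); rewrite /disk /= subr0 => /(_ wr wz0).
  rewrite /= /shift /= scaler1 subrK /disk /= => lte.
  have -> : f w - f z - derive1 f z * (w - z) =
     ((w - z)^-1 *: (f w - f z) - derive1 f z) * (w - z).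
    by rewrite /GRing.scale /=; field.
  by rewrite nmM ler_wpM2r ?nm_ge0 ?ltW.
apply/cvg_ex; exists d; apply/cvgcP => e e0.
move/ccontP: cphi => /(_ e e0)[r r0 hr]; apply/nbhsP; exists r => // h.
rewrite /disk /= subr0 => hr' h0.
rewrite /shift /= scaler1 fE addrK -phiz.
rewrite /GRing.scale /= mulrCA mulVf // mulr1.
by apply: hr; rewrite addrK.
Qed.

Lemma cder_derive1 f z d : cder f z d -> derive1 f z = d.
Proof.
move=> fd; have [d' [phi [cphi phiz fE]]] : exists d, cder f z d by exists d.
have {d' phi cphi phiz fE} df : derivable f z 1 by apply/derivableP_cder; exists d.
apply: (cder_unique (f := f) (z := z)) => //; apply/cderP => e e0.
have : h^-1 *: ((f \o shift z) (h *: 1) - f z) @[h --> 0^'] --> derive1 f z.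
  by rewrite derive1E /derive; exact: df.
move=> /(_ _ (nbhs_disk _ e0)) /nbhsP[r r0 hr]; exists r => // w wr.
have [->|wz] := eqVneq w z; first by rewrite !subrr mulr0 subr0 nm0 mulr0.
have wz0 : w - z != 0 by rewrite subr_eq0.
have := hr (w - z); rewrite /disk /= subr0 => /(_ wr wz0).
rewrite /= /shift /= scaler1 subrK /disk /= => lte.
have -> : f w - f z - derive1 f z * (w - z) =
   ((w - z)^-1 *: (f w - f z) - derive1 f z) * (w - z).
  by rewrite /GRing.scale /=; field.
by rewrite nmM ler_wpM2r ?nm_ge0 ?ltW.
Qed.

Lemma cder_near f g z d r : 0 < r ->
  (forall w, disk z r w -> f w = g w) -> cder f z d -> cder g z d.
Proof.
move=> r0 fg /cderP h; apply/cderP => e e0; have [s s0 hs] := h e e0.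
exists (Num.min r s); first by rewrite lt_min r0.
move=> w; rewrite lt_min => /andP[wr ws].
by rewrite -!fg ?hs //; exact: disk_center.
Qed.

Lemma cder_cst c z : cder (fun _ => c) z 0.
Proof.
exists (fun _ => 0); split; [exact: cts_cst|by []|].
by move=> w; rewrite subrr mul0r.
Qed.

Lemma cder_id z : cder id z 1.
Proof.
exists (fun _ => 1); split; [exact: cts_cst|by []|].
by move=> w; rewrite mul1r.
Qed.

Lemma cderD f g z df dg : cder f z df -> cder g z dg ->
  cder (fun w => f w + g w) z (df + dg).
Proof.
move=> [p [cp <- fE]] [q [cq <- gE]]; exists (fun w => p w + q w); split; [exact (ctsD cp cq)|by []|].
by move=> w; rewrite mulrDl -fE -gE; ring.
Qed.

Lemma cderM f g z df dg : cder f z df -> cder g z dg ->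
  cder (fun w => f w * g w) z (df * g z + f z * dg).
Proof.
move=> hf [q [cq <- gE]]; have cf := cder_cont hf; have [p [cp <- fE]] := hf.
exists (fun w => p w * g z + f w * q w); split; [|by []|].
  apply: ctsD; last exact: ctsM.
  by apply: ctsM cp _; exact: cts_cst.
move=> w; rewrite mulrDl -mulrA (mulrC (g z)) mulrA -fE -mulrA -gE; ring.
Qed.

Lemma cderZ c f z d : cder f z d -> cder (fun w => c * f w) z (c * d).
Proof. by move=> fd; have := cderM (cder_cst c z) fd; rewrite mul0r add0r. Qed.

Lemma cderN f z d : cder f z d -> cder (fun w => - f w) z (- d).
Proof.
move=> /(cderZ (-1)); rewrite mulN1r.
by have -> : (fun w => -1 * f w) = (fun w => - f w) by apply/funext => w; rewrite mulN1r.
Qed.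

Lemma cderB f g z df dg : cder f z df -> cder g z dg ->
  cder (fun w => f w - g w) z (df - dg).
Proof. by move=> hf /cderN; exact: cderD. Qed.

Lemma cder_comp f g z df dg : cder g z dg -> cder f (g z) df ->
  cder (fun w => f (g w)) z (df * dg).
Proof.
move=> hg [p [cp <- fE]]; have cg := cder_cont hg; have [q [cq <- gE]] := hg.
exists (fun w => p (g w) * q w); split; [|by []|].
  by apply: ctsM _ cq; exact: cts_comp.
by move=> w; rewrite fE gE mulrA.
Qed.

Lemma cder_inv z : z != 0 -> cder (fun w => w^-1) z (- z ^- 2).
Proof.
move=> z0; have n0 : 0 < nm z by rewrite nm_gt0.
(* The usual slope [- (w * z)^-1] fails the equation at [w = 0], where the inverse is [0] by
   convention; there the slope is defined by the equation itself. Near [z] the special case does not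
   occur. *)
exists (fun w => if w == 0 then (w^-1 - z^-1) / (w - z)
   else - (w * z)^-1); split.
- apply/ccontP => e e0.
  have : cts (fun w : C => - (w * z)^-1) z.
    apply: ctsN; apply: ctsV; first by rewrite mulf_neq0.
    apply: ctsM; [exact: cts_id|exact: cts_cst].
  move=> /ccontP /(_ e e0)[r r0 hr]; exists (Num.min r (nm z)).
    by rewrite lt_min r0.
  move=> w; rewrite lt_min (negbTE z0) => /andP[wr wz].
  case: eqVneq => [w0|w0]; last exact: hr.
  by move: wz; rewrite w0 sub0r nmN ltxx.
- by rewrite (negbTE z0) expr2.
- move=> w; have [w0|w0] := eqVneq w 0; last by field; rewrite w0 z0.
  by rewrite divfK // w0 sub0r oppr_eq0.
Qed.

Lemma cderV f z d : f z != 0 -> cder f z d ->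
  cder (fun w => (f w)^-1) z (- d / f z ^+ 2).
Proof.
move=> f0 fd; have := cder_comp fd (cder_inv f0).
by rewrite mulNr mulNr mulrC.
Qed.

Lemma cder_div f g z df dg : g z != 0 -> cder f z df -> cder g z dg ->
  cder (fun w => f w / g w) z ((df * g z - f z * dg) / g z ^+ 2).
Proof.
move=> g0 hf hg; have := cderM hf (cderV g0 hg).
by congr cder; field.
Qed.

Lemma cderX f z d n : cder f z d ->
  cder (fun w => f w ^+ n) z (n%:R * f z ^+ n.-1 * d).
Proof.
move=> fd; elim: n => [|n IH].
  by rewrite !mul0r; exact: cder_cst.
have := cderM fd IH.
have -> : (fun w => f w * f w ^+ n) = (fun w => f w ^+ n.+1).
  by apply/funext => w; rewrite exprS.
congr cder; case: n {IH} => [|n] /=; first by rewrite expr0 !mul0r !mulr0 !mulr1 addr0 mul1r.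
by rewrite exprS -[in n.+2%:R]addn1 natrD; ring.
Qed.

Lemma rder_cont p t v : rder p t v -> cts p t.
Proof.
move=> [q [cq _ pE]].
have -> : p = (fun u => q u * rc (u - t) + p t).
  by apply/funext => w; rewrite -pE subrK.
apply: ctsD; last exact: cts_cst.
apply: (ctsM cq).
apply: cts_rc; exact: cts_shift.
Qed.

Lemma rder_comp f p t d v : rder p t v -> cder f (p t) d ->
  rder (fun u => f (p u)) t (d * v).
Proof.
move=> hp; have cp := rder_cont hp; move: hp => [q [cq <- pE]] [phi [cphi <- fE]].
exists (fun u => phi (p u) * q u); split; [|by []|].
  exact (ctsM (cts_comp cp cphi) cq).
by move=> u; rewrite fE pE mulrA.
Qed.

Lemma rder_affine a b t : rder (fun u => a + rc u * b) t b.
Proof.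
exists (fun _ => b); split; [exact: cts_cst|by []|].
by move=> u; rewrite rcB; ring.
Qed.

Lemma rderD p q t v w : rder p t v -> rder q t w ->
  rder (fun u => p u + q u) t (v + w).
Proof.
move=> [f [cf <- fE]] [g [cg <- gE]]; exists (fun u => f u + g u); split; [exact (ctsD cf cg)|by []|].
by move=> u; rewrite mulrDl -fE -gE; ring.
Qed.

Lemma rderZ c p t v : rder p t v -> rder (fun u => c * p u) t (c * v).
Proof.
move=> [f [cf <- fE]]; exists (fun u => c * f u); split; [|by []|].
  by apply: ctsM _ cf; exact: cts_cst.
by move=> u; rewrite -mulrA -fE; ring.
Qed.

Lemma rder_reparam p (k l : R) t v : rder p (k * t + l) v ->
  rder (fun u => p (k * u + l)) t (rc k * v).
Proof.
move=> [f [cf <- fE]]; exists (fun u => rc k * f (k * u + l)); split; [|by []|].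
  apply: ctsM; first exact: cts_cst.
  by apply: (cts_comp (f := fun u : R => k * u + l)) => //; exact: cts_aff.
move=> u; rewrite fE -(mulrA _ _ (rc (u - t))) (mulrC (rc k)) -mulrA -rcM.
by congr (_ * rc _); ring.
Qed.

Lemma rder_near (p q : R -> C) t v r : 0 < r ->
  (forall u, `|u - t| < r -> p u = q u) -> rder p t v -> rder q t v.
Proof.
move=> r0 pq [f [cf fv fE]].
exists (fun u => if `|u - t| < r then f u else (q u - q t) / rc (u - t)); split.
- apply/rcontP => e e0; move/rcontP: cf => /(_ e e0)[d d0 hd].
  exists (Num.min r d); first by rewrite lt_min r0.
  move=> u; rewrite lt_min => /andP[ur ud]; rewrite ur subrr normr0 r0; exact: hd.
- by rewrite subrr normr0 r0.
- move=> u; case: ifPn => [ur|]; first by rewrite -!pq ?subrr ?normr0.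
  move=> ur; rewrite divfK // rc_eq0; apply: contra ur => /eqP ->.
  by rewrite normr0.
Qed.

End Derivative.

Section Integral.
Variable R : realType.
Local Notation C := (Cplane R).
Local Notation nm := (@nm R).
Local Notation rc := (@rc R).
Local Notation cRe := (@cRe R).
Local Notation cIm := (@cIm R).
Local Notation cI := (cI R).
Implicit Types (z w a b d : C) (x y t s : R).

(** * The exponential function *)

Definition cexp z : C :=
  rc (expR (cRe z)) * (rc (cos (cIm z)) + cI * rc (sin (cIm z))).

Lemma cRe_cexp z : cRe (cexp z) = expR (cRe z) * cos (cIm z).
Proof. by rewrite /cexp !(cReM, cReD, cImD, cImM, cRe_rc, cIm_rc, cRe_I, cIm_I); ring. Qed.

Lemma cIm_cexp z : cIm (cexp z) = expR (cRe z) * sin (cIm z).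
Proof. by rewrite /cexp !(cReM, cReD, cImD, cImM, cRe_rc, cIm_rc, cRe_I, cIm_I); ring. Qed.

Opaque cexp.

Lemma cexpD z w : cexp (z + w) = cexp z * cexp w.
Proof.
apply: cplx_eq; [rewrite cReM|rewrite cImM]; rewrite !(cRe_cexp, cIm_cexp) cReD cImD expRD ?cosD ?sinD; ring.
Qed.

Lemma cexp0 : cexp 0 = 1.
Proof. by apply: cplx_eq; rewrite ?cRe_cexp ?cIm_cexp /= expR0 ?cos0 ?sin0 ?mulr1 ?mulr0. Qed.

Lemma nm_cexp z : nm (cexp z) = expR (cRe z).
Proof.
rewrite nmE cRe_cexp cIm_cexp !exprMn -mulrDr cos2Dsin2 mulr1 sqrtr_sqr.
by rewrite gtr0_norm ?expR_gt0.
Qed.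

Lemma cexp_neq0 z : cexp z != 0.
Proof. by rewrite -nm_gt0 nm_cexp expR_gt0. Qed.

Lemma cexpN z : cexp (- z) = (cexp z)^-1.
Proof.
apply: (mulIf (cexp_neq0 z)); rewrite -cexpD addNr cexp0 mulVf //.
exact: cexp_neq0.
Qed.

Lemma cexpB z w : cexp (z - w) = cexp z / cexp w.
Proof. by rewrite cexpD cexpN. Qed.

Lemma caratheodory0 (f : R -> R) (a : R) : is_derive (0 : R) 1 f a ->
  forall e : R, 0 < e -> exists2 d : R, 0 < d &
    forall u : R, `|u| < d -> `|f u - f 0 - a * u| <= e * `|u|.
Proof.
move=> /is_derive1_caratheodory[g [fE cg ga]] e e0.
have /nbhs_ballP[d /= d0 hd] := cg _ (nbhsx_ballx (g 0) e e0).
exists d => // u ud; have := fE u; rewrite subr0 => ->.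
rewrite -mulrBl normrM ler_wpM2r //; apply: ltW.
have := hd u; rewrite /ball /= sub0r normrN => /(_ ud).
by rewrite -ga distrC.
Qed.

Lemma cder_cexp0 : cder cexp 0 1.
Proof.
(* The errors add up to at most [13 / 2 * (k * nm w)], hence the denominator 12; [k <= 1 / 2]
   absorbs the product of two errors. *)
apply/cderP => e e0; pose k := Num.min (e / 12) (1 / 2).
have k0 : 0 < k by rewrite lt_min; apply/andP; split; lra.
have ke : k <= e / 12 by rewrite ge_min lexx.
have k1 : k <= 1 / 2 by rewrite ge_min lexx orbT.
clearbody k.
have [d1 d10 h1] := caratheodory0 (is_derive_expR 0) k0.
have [d2 d20 h2] := caratheodory0 (is_derive_cos 0) k0.
have [d3 d30 h3] := caratheodory0 (is_derive_sin 0) k0.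
have m0 : 0 < Num.min (Num.min d1 d2) (Num.min d3 k).
  by rewrite lt_min lt_min d10 d20 lt_min d30 k0.
exists (Num.min (Num.min d1 d2) (Num.min d3 k)); first exact: m0.
move=> w; rewrite subr0 !lt_min => /andP[/andP[w1 w2]/andP[w3 wk]].
have le1 := le_cRe w; have le2 := le_cIm w.
set x := cRe w in le1 *; set y := cIm w in le2 *.
have := h1 x (le_lt_trans le1 w1); rewrite expR0 mul1r => k1'.
have := h2 y (le_lt_trans le2 w2); rewrite cos0 sin0 oppr0 mul0r subr0 => k2'.
have := h3 y (le_lt_trans le2 w3); rewrite sin0 cos0 mul1r subr0 => k3'.
set W := nm w in le1 le2 wk *.
have W0 : 0 <= W by exact: nm_ge0.
rewrite cexp0 mul1r.
apply: le_trans (le_nm_ReIm _) _.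
rewrite !(cReD, cImD, cReN, cImN) cRe_cexp cIm_cexp -/x -/y.
have -> : cRe 1 = 1 by [].
have -> : cIm 1 = 0 by [].
set E := expR x in k1' *; set c := cos y in k2' *; set s := sin y in k3' *.
have E2 : `|E| <= 2.
  have -> : E = (E - 1 - x) + 1 + x by ring.
  apply: le_trans (ler_normD _ _) _; apply: le_trans (lerD (ler_normD _ _) (lexx _)) _.
  rewrite normr1; nra.
have A1 : `|E - 1 - x| <= k * W by nra.
have A2 : `|c - 1| <= k * W by nra.
have A3 : `|s - y| <= k * W by nra.
have A4 : `|E * (c - 1)| <= 2 * (k * W) by rewrite normrM ler_pM.
have A5 : `|E * (s - y)| <= 2 * (k * W) by rewrite normrM ler_pM.
have A6 : `|(E - 1) * y| <= (k * W + W) * k.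
  rewrite normrM ler_pM //; last by apply: le_trans le2 (ltW wk).
  have -> : E - 1 = E - 1 - x + x by ring.
  by apply: le_trans (ler_normD _ _) _; rewrite lerD.
have B1 : `|E * c - 1 - x| <= 3 * (k * W).
  have -> : E * c - 1 - x = E * (c - 1) + (E - 1 - x) by ring.
  apply: le_trans (ler_normD _ _) _; lra.
have B2 : `|E * s - 0 - y| <= 2 * (k * W) + (k * W + W) * k.
  have -> : E * s - 0 - y = E * (s - y) + (E - 1) * y by ring.
  by apply: le_trans (ler_normD _ _) _; rewrite lerD.
have kW : k * W <= e / 12 * W by rewrite ler_wpM2r.
have kkW : k * (k * W) <= 1 / 2 * (k * W) by rewrite ler_wpM2r // mulr_ge0 // ltW.
have kW0 : 0 <= k * W by rewrite mulr_ge0 // ltW.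
apply: le_trans (lerD B1 B2) _.
clear -kW kkW kW0 e0 W0; lra.
Qed.

Lemma cder_cexp z : cder cexp z (cexp z).
Proof.
have h : cder (fun w => w - z) z (1 - 0) := cderB (cder_id z) (cder_cst z z).
have h0 : cder cexp (z - z) 1 by rewrite subrr; exact: cder_cexp0.
have := cderZ (cexp z) (cder_comp h h0).
have -> : (fun w => cexp z * cexp (w - z)) = cexp.
  by apply/funext => w; rewrite -cexpD addrC subrK.
by rewrite subr0 !mulr1.
Qed.

Lemma cts_cexp z : cts cexp z.
Proof. exact: cder_cont (cder_cexp z). Qed.

(** * Newton integrals along [0, 1] *)

(** Retraction of the line onto [[0, 1]]: composing with it turns a map known on the interval into
    one that is continuous on the whole line. *)
Definition clamp t : R := Num.max 0 (Num.min t 1).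

Lemma clamp01 t : 0 <= clamp t <= 1.
Proof. by rewrite /clamp le_max lexx /= ge_max ler01 ge_min lexx orbT. Qed.

Lemma clamp_id t : 0 <= t <= 1 -> clamp t = t.
Proof. by case/andP => t0 t1; rewrite /clamp (min_idPl t1) (max_idPr t0). Qed.

Lemma continuous_clamp t : {for t, continuous clamp}.
Proof.
move=> A /nbhs_ballP[e /= e0 eA]; apply/nbhs_ballP; exists e => // u tu.
apply: eA; apply: le_lt_trans tu; rewrite /clamp /Num.max /Num.min.
do ! case: ifPn; rewrite -?leNgt => *; rewrite ler_norml; have := ler_norm (t - u);
  have := ler_norm (- (t - u)); rewrite normrN => *; apply/andP; split; lra.
Qed.

Definition seg a b t : C := a + rc t * (b - a).

(** Differentiability is asked for only inside the interval. [mvp_C1] uses this freedom: there the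
    derivative is known to vanish only for positive parameters. *)
Definition antider (g G : R -> C) : Prop :=
  (forall t, 0 <= t <= 1 -> cts G t) /\
  (forall t, 0 < t < 1 -> rder G t (g t)).

Lemma rder_Re c (p : R -> C) t v : rder p t v ->
  is_derive t 1 (fun u => cRe (c * p u)) (cRe (c * v)).
Proof.
move=> [q [cq <- pE]]; apply/is_derive1_caratheodory.
exists (fun u => cRe (c * q u)); split=> [u||//].
  rewrite -cReN -cReD -mulrBr pE mulrA [LHS]cReM cRe_rc cIm_rc mulr0 subr0 //.
apply: (@continuous_comp _ _ _ (fun u => c * q u) cRe).
  exact (ctsM (cts_cst c t) cq).
exact: continuous_cRe.
Qed.

(** The mean value theorem fails for complex values, so [G] is projected on the direction of its own
    increment [v]: the real function [cRe (cbar v * G t)] increases by exactly [nm v ^+ 2]. *)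
Lemma antider_le g G (M : R) : antider g G ->
  (forall t, 0 < t < 1 -> nm (g t) <= M) -> nm (G 1 - G 0) <= M.
Proof.
move=> [cG dG] gM; have M0 : 0 <= M.
  by apply: le_trans (nm_ge0 (g (1 / 2))) (gM _ _); apply/andP; split; lra.
have [v0|v0] := eqVneq (G 1 - G 0) 0; first by rewrite v0 nm0.
set v := G 1 - G 0 in v0 *.
pose f t := cRe (cbar v * G t).
have [] := @MVT R f (fun t => cRe (cbar v * g t)) 0 1 ltr01.
- by move=> t; rewrite in_itv /= => t01; apply: rder_Re; exact: dG.
- apply/subspace_continuousP => t /=; rewrite in_itv /= => t01.
  apply: cvg_within_filter; apply: (@continuous_comp _ _ _ (fun u => cbar v * G u) cRe).
    exact (ctsM (cts_cst (cbar v) t) (cG t t01)).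
  exact: continuous_cRe.
move=> c; rewrite in_itv /= subr0 mulr1 => c01 fE.
have v1 : 0 < nm v by rewrite nm_gt0.
have : nm v ^+ 2 <= nm v * M.
  have -> : nm v ^+ 2 = cRe (cbar v * g c).
    rewrite -fE /f -cReN -cReD -mulrBr -/v mulrC mul_cbar cRe_rc //.
  apply: le_trans (ler_norm _) _; apply: le_trans (le_cRe _) _.
  by rewrite nmM nm_cbar ler_wpM2l ?nm_ge0 ?gM.
by rewrite expr2 ler_pM2l.
Qed.

Lemma antiderD g1 G1 g2 G2 : antider g1 G1 -> antider g2 G2 ->
  antider (fun t => g1 t + g2 t) (fun t => G1 t + G2 t).
Proof.
move=> [c1 d1] [c2 d2]; split=> t t01; last exact: rderD (d1 t t01) (d2 t t01).
exact (ctsD (c1 t t01) (c2 t t01)).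
Qed.

Lemma antiderZ c g G : antider g G -> antider (fun t => c * g t) (fun t => c * G t).
Proof.
move=> [c1 d1]; split=> t t01; last exact: rderZ (d1 t t01).
exact (ctsM (cts_cst c t) (c1 t t01)).
Qed.

Lemma antider_unique g G1 G2 : antider g G1 -> antider g G2 ->
  G1 1 - G1 0 = G2 1 - G2 0.
Proof.
move=> a1 a2; apply/eqP; rewrite -subr_eq0 -nm_eq0; apply/eqP/le_anti.
rewrite nm_ge0 andbT.
have := antider_le (antiderD a1 (antiderZ (-1) a2)) (M := 0).
have -> : G1 1 + -1 * G2 1 - (G1 0 + -1 * G2 0) = G1 1 - G1 0 - (G2 1 - G2 0) by ring.
by apply=> t _; rewrite mulN1r subrr nm0.
Qed.

Lemma real_antider (f : R -> R) : continuous f ->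
  exists F : R -> R, forall t, 0 <= t <= 1 -> is_derive t 1 F (f t).
Proof.
(* Integrating from [-1] makes all of [[0, 1]] interior to the interval of integration, so the
   derivatives are two-sided even at [0] and [1]. *)
move=> cf; exists (fun x => \int[lebesgue_measure]_(t in `[-1, x]) f t)%R.
move=> t /andP[t0 t1].
have fi : lebesgue_measure.-integrable `[-1, 3] (EFin \o f).
  apply: continuous_compact_integrable; first exact: segment_compact.
  exact: continuous_subspaceT.
have t3 : t < 3 by lra.
have t2 : -1 < t by lra.
have [d1 d2] := continuous_FTC1_closed t3 fi t2 (cf t).
by apply: DeriveDef; [exact: d1|rewrite -derive1E; exact: d2].
Qed.

Lemma antider_ex_cts g : (forall t, cts g t) -> exists G, antider g G.
Proof.
move=> cg.
have [F1 h1] := @real_antider (cRe \o g)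
  (fun t => @continuous_comp _ _ _ g cRe t (cg t) (@continuous_cRe R _)).
have [F2 h2] := @real_antider (cIm \o g)
  (fun t => @continuous_comp _ _ _ g cIm t (cg t) (@continuous_cIm R _)).
have dG t : 0 <= t <= 1 -> rder (fun u => rc (F1 u) + cI * rc (F2 u)) t (g t).
  move=> t01; have /is_derive1_caratheodory[p [pE cp pt]] := h1 t t01.
  have /is_derive1_caratheodory[q [qE cq qt]] := h2 t t01.
  exists (fun u => rc (p u) + cI * rc (q u)); split.
  - exact (ctsD (cts_rc cp) (ctsM (cts_cst cI t) (cts_rc cq))).
  - by rewrite pt qt /= -cplxE.
  - move=> u; rewrite mulrDl -!mulrA -!rcM -pE -qE !rcB; ring.
exists (fun u => rc (F1 u) + cI * rc (F2 u)); split=> t t01.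
  exact (rder_cont (dG t t01)).
by apply: dG; case/andP: t01 => t0 t1; rewrite !ltW.
Qed.

Definition cts01 (g : R -> C) := forall t, 0 <= t <= 1 -> cts g t.

Lemma antider_ex g : cts01 g -> exists G, antider g G.
Proof.
move=> cg; have [|G [cG dG]] := @antider_ex_cts (fun t => g (clamp t)).
  move=> t; exact (cts_comp (@continuous_clamp t) (cg _ (clamp01 t))).
exists G; split=> // t /andP[t0 t1].
by have := dG t; rewrite clamp_id ?t0 ?t1 ?ltW //; apply.
Qed.

(** The integral over [[0, 1]] is the increment of an antiderivative, so that linearity and bounds
    are inherited from [antider]. The default [0] is taken only if no antiderivative exists. *)
Definition cint g : C := xget 0 [set v | exists2 G, antider g G & v = G 1 - G 0].

Lemma cintE g G : antider g G -> cint g = G 1 - G 0.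
Proof.
move=> gG; rewrite /cint; case: xgetP => [v _ [G' gG' ->]|/(_ (G 1 - G 0)) []].
  exact: antider_unique gG' gG.
by exists G.
Qed.

Lemma eq_cint g1 g2 : (forall t, 0 < t < 1 -> g1 t = g2 t) -> cint g1 = cint g2.
Proof.
move=> g12; rewrite /cint; congr xget; apply/seteqP; split=> v [G [cG dG] ->];
  exists G => //; split=> // t t01; first by rewrite -g12 //; exact: dG.
by rewrite g12 //; exact: dG.
Qed.

Lemma cintD g1 g2 : cts01 g1 -> cts01 g2 ->
  cint (fun t => g1 t + g2 t) = cint g1 + cint g2.
Proof.
move=> /antider_ex[G1 h1] /antider_ex[G2 h2].
rewrite (cintE (antiderD h1 h2)) (cintE h1) (cintE h2); ring.
Qed.

Lemma cintZ c g : cts01 g -> cint (fun t => c * g t) = c * cint g.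
Proof.
by move=> /antider_ex[G h]; rewrite (cintE (antiderZ c h)) (cintE h); ring.
Qed.

Lemma cintB g1 g2 : cts01 g1 -> cts01 g2 ->
  cint (fun t => g1 t - g2 t) = cint g1 - cint g2.
Proof.
move=> c1 c2.
have := cintD c1 (fun t t01 => ctsM (cts_cst (-1) t) (c2 t t01)).
rewrite cintZ // mulN1r => <-; apply: eq_cint => t _; by rewrite mulN1r.
Qed.

Lemma cint_le g (M : R) : cts01 g ->
  (forall t, 0 < t < 1 -> nm (g t) <= M) -> nm (cint g) <= M.
Proof. by move=> /antider_ex[G h] gM; rewrite (cintE h) (antider_le h). Qed.

Lemma cint_cst c : cint (fun _ => c) = c.
Proof.
have : antider (fun _ => c) (fun t => 0 + rc t * c).
  by split=> t _; [exact (rder_cont (rder_affine 0 c t))|exact: rder_affine].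
by move=> /cintE ->; rewrite rc1 rc0; ring.
Qed.

(** A one-sided bound on the real part; a bound on the modulus would be too weak for the mean value
    argument in [max_principle]. *)
Lemma cint_Re_le g (M : R) : cts01 g ->
  (forall t, cRe (g t) <= M) -> cRe (cint g) <= M.
Proof.
move=> /antider_ex[G gG] gM; rewrite (cintE gG); have [cG dG] := gG.
have [] := @MVT R (fun u => cRe (1 * G u)) (fun t => cRe (1 * g t)) 0 1 ltr01.
- by move=> t; rewrite in_itv /= => t01; apply: rder_Re; exact: dG.
- apply/subspace_continuousP => t /=; rewrite in_itv /= => t01.
  apply: cvg_within_filter; apply: (@continuous_comp _ _ _ (fun u => 1 * G u) cRe).
    exact (ctsM (cts_cst 1 t) (cG t t01)).
  exact: continuous_cRe.
by move=> u _; rewrite !mul1r subr0 mulr1 -cReN -cReD => ->.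
Qed.

End Integral.

Arguments cts_cexp {R} z.

Opaque cts cexp.

(** * Integrals along segments, Goursat's theorem, primitives on convex sets *)

Section Goursat.
Variable R : realType.
Local Notation C := (Cplane R).
Local Notation nm := (@nm R).
Local Notation rc := (@rc R).
Local Notation cRe := (@cRe R).
Local Notation cIm := (@cIm R).
Local Notation cI := (cI R).
Implicit Types (z w a b c d : C) (x y t s : R) (f F : C -> C).

Lemma seg0 a b : seg a b 0 = a. Proof. by rewrite /seg rc0 mul0r addr0. Qed.
Lemma seg1 a b : seg a b 1 = b. Proof. by rewrite /seg rc1 mul1r addrC subrK. Qed.

Lemma rder_seg a b t : rder (seg a b) t (b - a).
Proof. exact: rder_affine. Qed.

Lemma cts_seg a b t : cts (seg a b) t.
Proof. exact: rder_cont (rder_seg a b t). Qed.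

Lemma nm_seg a b t : 0 <= t <= 1 -> nm (seg a b t - a) <= nm (b - a).
Proof.
case/andP=> t0 t1; rewrite /seg addrC addKr nmM nm_rc ger0_norm //.
by rewrite ler_piMl ?nm_ge0.
Qed.

Definition cseg f a b := forall t, 0 <= t <= 1 -> cts f (seg a b t).

Lemma cts_cseg f a b : cseg f a b -> cts01 (fun t => f (seg a b t)).
Proof. by move=> cf t t01; apply: (cts_comp (f := seg a b)) (cf t t01); exact: cts_seg. Qed.

Definition sint f a b : C := (b - a) * cint (fun t => f (seg a b t)).

Lemma antider_seg F f a b :
  (forall t, 0 <= t <= 1 -> cder F (seg a b t) (f (seg a b t))) ->
  antider (fun t => f (seg a b t) * (b - a)) (fun t => F (seg a b t)).
Proof.
move=> dF; have h t : 0 <= t <= 1 ->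
    rder (fun u => F (seg a b u)) t (f (seg a b t) * (b - a)).
  by move=> t01; apply: rder_comp (rder_seg a b t) (dF t t01).
split=> t t01; first exact (rder_cont (h t t01)).
by apply: h; case/andP: t01 => t0 t1; rewrite !ltW.
Qed.

Lemma sint_FTC F f a b :
  (forall t, 0 <= t <= 1 -> cder F (seg a b t) (f (seg a b t))) ->
  sint f a b = F b - F a.
Proof.
move=> dF; have [<-|ab] := eqVneq a b; first by rewrite /sint !subrr mul0r.
have ba : b - a != 0 by rewrite subr_eq0 eq_sym.
have /cintE := antiderZ (b - a)^-1 (antider_seg dF).
rewrite seg0 seg1 -mulrBr => h.
rewrite /sint (eq_cint (g2 := fun t => (b - a)^-1 * (f (seg a b t) * (b - a)))).
  by rewrite h mulrA divff // mul1r.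
by move=> t _; rewrite mulrC mulfK.
Qed.

Lemma sint_le f a b (M : R) : cseg f a b ->
  (forall t, 0 < t < 1 -> nm (f (seg a b t)) <= M) ->
  nm (sint f a b) <= M * nm (b - a).
Proof.
move=> cf fM; rewrite nmM mulrC ler_wpM2r ?nm_ge0 //.
exact: cint_le (cts_cseg cf) fM.
Qed.

Lemma sintB f g a b : cseg f a b -> cseg g a b ->
  sint (fun z => f z - g z) a b = sint f a b - sint g a b.
Proof.
move=> /cts_cseg cf /cts_cseg cg; rewrite /sint -mulrBr.
by congr (_ * _); exact: cintB.
Qed.

Lemma sintZ k f a b : cseg f a b -> sint (fun z => k * f z) a b = k * sint f a b.
Proof.
move=> /cts_cseg cf; rewrite /sint mulrCA; congr (_ * _); exact: cintZ.
Qed.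

Lemma cts_affcomp (G : R -> C) (k l t : R) :
  cts G (k * t + l) -> cts (fun u => G (k * u + l)) t.
Proof. exact: (cts_comp (f := fun u : R => k * u + l) (@cts_aff R k l t)). Qed.

Lemma sint_rev f a b : cseg f a b -> sint f b a = - sint f a b.
Proof.
move=> /cts_cseg/antider_ex[G GE]; rewrite /sint (cintE GE).
have E t : seg b a t = seg a b (1 - t) by rewrite /seg rcB rc1; ring.
have [cG dG] := GE.
have h : antider (fun t => f (seg b a t)) (fun t => - G (-1 * t + 1)).
  split=> t /andP[t0 t1].
    apply: (ctsN (cts_affcomp (cG (-1 * t + 1) _))).
    by apply/andP; split; lra.
  have t01 : 0 < -1 * t + 1 < 1 by apply/andP; split; lra.
  have := rderZ (-1) (rder_reparam (dG _ t01)).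
  have -> : -1 * (rc (-1) * f (seg a b (-1 * t + 1))) = f (seg b a t).
    by rewrite rcN rc1 mulrA mulN1r opprK mul1r E mulN1r addrC.
  suff -> : (fun u => -1 * G (-1 * u + 1)) = (fun u => - G (-1 * u + 1)) by [].
  by apply/funext => x; rewrite mulN1r.
rewrite (cintE h) (_ : -1 * 1 + 1 = 0 :> R); last by ring.
rewrite (_ : -1 * 0 + 1 = 1 :> R); last by ring.
ring.
Qed.

Lemma seg_seg1 a b s t : seg a (seg a b s) t = seg a b (s * t).
Proof. by rewrite /seg rcM; ring. Qed.

Lemma seg_seg2 a b s t : seg (seg a b s) b t = seg a b ((1 - s) * t + s).
Proof. by rewrite /seg rcD rcM rcB rc1; ring. Qed.

Lemma cseg1 f a b s : 0 <= s <= 1 -> cseg f a b -> cseg f a (seg a b s).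
Proof.
move=> /andP[s0 s1] cf t /andP[t0 t1]; rewrite seg_seg1; apply: cf.
by apply/andP; split; nra.
Qed.

Lemma cseg2 f a b s : 0 <= s <= 1 -> cseg f a b -> cseg f (seg a b s) b.
Proof.
move=> /andP[s0 s1] cf t /andP[t0 t1]; rewrite seg_seg2; apply: cf.
by apply/andP; split; nra.
Qed.

Lemma antider_sub (g G : R -> C) (k l : R) : 0 <= k -> 0 <= l -> k + l <= 1 ->
  antider g G -> antider (fun t => rc k * g (k * t + l)) (fun t => G (k * t + l)).
Proof.
move=> k0 l0 kl [cG dG]; split=> t /andP[t0 t1].
  apply: cts_affcomp; apply: cG.
  by apply/andP; split; nra.
have [k00|kp] := eqVneq k 0.
  rewrite k00 rc0 mul0r; apply: (rder_near (p := fun _ => G l) ltr01).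
    by move=> u _; rewrite mul0r add0r.
  have := rder_affine (G l) 0 t.
  by congr rder; apply/funext => u; rewrite mulr0 addr0.
have kp0 : 0 < k by rewrite lt0r kp.
have t01 : 0 < k * t + l < 1 by apply/andP; split; nra.
exact: rder_reparam (dG _ t01).
Qed.

Lemma sint_split f a b s : 0 <= s <= 1 -> cseg f a b ->
  sint f a b = sint f a (seg a b s) + sint f (seg a b s) b.
Proof.
move=> s01 cf; have [s0 s1] := andP s01.
have [G gG] := antider_ex (cts_cseg cf).
have h1 : antider (fun t => rc s * f (seg a (seg a b s) t)) (fun t => G (s * t + 0)).
  have := antider_sub s0 (lexx 0) (_ : s + 0 <= 1) gG.
  rewrite addr0 => /(_ s1); congr antider; apply/funext => t.
  by rewrite seg_seg1 addr0.
have h2 : antider (fun t => rc (1 - s) * f (seg (seg a b s) b t))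
    (fun t => G ((1 - s) * t + s)).
  have := antider_sub (_ : 0 <= 1 - s) s0 (_ : 1 - s + s <= 1) gG.
  rewrite subr_ge0 subrK lexx => /(_ s1 isT); congr antider; apply/funext => t.
  by rewrite seg_seg2.
have aE : seg a b s - a = (b - a) * rc s by rewrite /seg; ring.
have bE : b - seg a b s = (b - a) * rc (1 - s) by rewrite /seg rcB rc1; ring.
have e1 := cintZ (rc s) (cts_cseg (cseg1 s01 cf)).
have e2 := cintZ (rc (1 - s)) (cts_cseg (cseg2 s01 cf)).
rewrite /sint aE bE (cintE gG) -!mulrA -e1 -e2 (cintE h1) (cintE h2) mulr1 mulr0 !addr0 mulr0 add0r mulr1 subrK; ring.
Qed.

Definition convexC (D : set C) :=
  forall a b t, D a -> D b -> 0 <= t <= 1 -> D (seg a b t).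

Definition tri f a b c : C := sint f a b + sint f b c + sint f c a.

Definition mid a b := seg a b (1 / 2).

Lemma midC a b : mid a b = mid b a.
Proof.
have h : rc (1 / 2) + rc (1 / 2) = 1.
  by rewrite -rcD -rc1; congr rc; lra.
apply/eqP; rewrite -subr_eq0 /mid /seg; set k := rc (1 / 2) in h *.
have -> : a + k * (b - a) - (b + k * (a - b)) = (1 - (k + k)) * (a - b) by ring.
by rewrite h subrr mul0r.
Qed.

Lemma half01 : 0 <= (1 / 2 : R) <= 1. Proof. by apply/andP; split; lra. Qed.

(** Each inner side is traversed once in either direction and cancels by [sint_rev]; each outer side
    is cut at its midpoint. *)
Lemma tri_split (D : set C) f a b c : convexC D -> D a -> D b -> D c ->
  (forall z, D z -> cts f z) ->
  tri f a b c = tri f a (mid a b) (mid a c) + tri f (mid a b) b (mid b c)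
    + tri f (mid a c) (mid b c) c + tri f (mid b c) (mid a c) (mid a b).
Proof.
move=> cD Da Db Dc cf.
have cfD u v : D u -> D v -> cseg f u v.
  by move=> Du Dv t t01; apply: cf; exact: cD.
have Dm u v : D u -> D v -> D (mid u v) by move=> Du Dv; apply: cD half01.
have sp u v : D u -> D v -> sint f u v = sint f u (mid u v) + sint f (mid u v) v.
  by move=> Du Dv; apply: sint_split half01 _; exact: cfD.
rewrite /tri (sp a b) // (sp b c) // (sp c a) // (midC c a).
rewrite (@sint_rev f (mid a b) (mid a c)); last by apply: cfD; apply: Dm.
rewrite (@sint_rev f (mid b c) (mid a b)); last by apply: cfD; apply: Dm.
rewrite (@sint_rev f (mid a c) (mid b c)); last by apply: cfD; apply: Dm.
ring.
Qed.

(** The intervals of radius [2 * K / 2 ^+ n] about [u n] are nested, so the supremum of their left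
    ends lies in all of them. *)
Lemma geo_lim (u : nat -> R) (K : R) : 0 <= K ->
  (forall n, `|u n.+1 - u n| <= K / 2 ^+ n) ->
  exists l, forall n, `|u n - l| <= 2 * K / 2 ^+ n.
Proof.
move=> K0 hu; pose h n := K / 2 ^+ n.
have h0 n : 0 <= h n by rewrite divr_ge0 // exprn_ge0.
have hS n : h n = 2 * h n.+1.
  by rewrite /h exprS; field; rewrite expf_neq0 //.
have hu' n : u n.+1 <= u n + h n /\ u n <= u n.+1 + h n.
  by have := hu n; rewrite ler_norml => /andP[]; rewrite -/(h n) => *; split; lra.
have up n k : u (n + k)%N + 2 * h (n + k)%N <= u n + 2 * h n
   /\ u n - 2 * h n <= u (n + k)%N - 2 * h (n + k)%N.
  elim: k => [|k [IH1 IH2]]; first by rewrite addn0.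
  have [a1 a2] := hu' (n + k)%N; rewrite addnS; have := hS (n + k)%N.
  by move=> *; split; lra.
pose S := [set x | exists n, x = u n - 2 * h n].
have ub m : ubound S (u m + 2 * h m).
  move=> _ [n ->]; have [nm|mn] := leqP n m.
    have [_] := up n (m - n)%N; rewrite subnKC // => ?; have := h0 m; lra.
  have [] := up m (n - m)%N; rewrite subnKC; last exact: ltnW.
  by move=> ? _; have := h0 n; lra.
have S0 : S !=set0 by exists (u 0%N - 2 * h 0%N), 0%N.
exists (sup S) => n; rewrite -mulrA -/(h n) ler_norml.
have b1 : sup S <= u n + 2 * h n by apply: ge_sup => //; exact: ub.
have b2 : u n - 2 * h n <= sup S.
  by apply: ub_le_sup; [exists (u 0%N + 2 * h 0%N); exact: ub|exists n].
by apply/andP; split; lra.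
Qed.

Lemma half_pow_lt (e : R) : 0 < e -> exists n, 1 / 2 ^+ n < e.
Proof.
move=> e0; exists (Num.bound e^-1); rewrite div1r.
have h : e^-1 < 2 ^+ Num.bound e^-1.
  apply: lt_le_trans (archi_boundP _) _; first by rewrite invr_ge0 ltW.
  by rewrite -natrX ler_nat ltnW // ltn_expl.
by rewrite invf_plt // posrE exprn_gt0.
Qed.

Lemma half_pow_ge0 (x K : R) : 0 <= K -> (forall n, - (K / 2 ^+ n) <= x) -> 0 <= x.
Proof.
move=> K0 h; rewrite leNgt; apply/negP => x0.
have x1 : 0 < - x by lra.
have K1 : 0 < K + 1 by lra.
have [n hn] := half_pow_lt (divr_gt0 x1 K1).
have := h n; move: hn; rewrite ?ltr_pdivlMr; last by lra.
rewrite div1r => h1 h2; have : K / 2 ^+ n <= (2 ^+ n)^-1 * (K + 1).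
  by rewrite mulrC ler_wpM2l ?invr_ge0 ?exprn_ge0 // lerDl.
by move=> h3; lra.
Qed.

Lemma disk_convex c r : convexC (fun z => nm (z - c) <= r).
Proof.
move=> a b t /= ha hb /andP[t0 t1].
have -> : seg a b t - c = rc (1 - t) * (a - c) + rc t * (b - c).
  by rewrite /seg rcB rc1; ring.
apply: le_trans (le_nmD _ _) _; rewrite !nmM !nm_rc !ger0_norm; [nra|lra|lra].
Qed.

Lemma open_disk_convex c r : convexC (disk c r).
Proof.
move=> a b t ha hb t01; rewrite /disk /=; pose m := Num.max (nm (a - c)) (nm (b - c)).
apply: le_lt_trans (_ : m < r); last by rewrite gt_max ha.
by apply: disk_convex => //; rewrite le_max lexx ?orbT.
Qed.

(** Affine coordinates on the triangle with corner [a] and edge vectors [u] and [v]. They reduce the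
    nested triangles of Goursat's proof to sequences of reals. *)
Definition pt a (u v : C) s t : C := a + rc s * u + rc t * v.

Lemma pt_convex (D : set C) a u v s t : convexC D -> D a -> D (a + u) -> D (a + v) ->
  0 <= s -> 0 <= t -> s + t <= 1 -> D (pt a u v s t).
Proof.
move=> cD Da Du Dv s0 t0 st.
have [st0|st0] := eqVneq (s + t) 0.
  have [-> ->] : s = 0 /\ t = 0 by split; lra.
  by rewrite /pt rc0 !mul0r !addr0.
have stp : 0 < s + t by rewrite lt0r st0 addr_ge0.
have t01 : 0 <= t / (s + t) <= 1.
  apply/andP; split; first by rewrite divr_ge0 // ltW.
  by rewrite ler_pdivrMr // mul1r; lra.
have st01 : 0 <= s + t <= 1 by apply/andP; split; lra.
have := cD _ _ _ Da (cD _ _ _ Du Dv t01) st01.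
rewrite /seg /pt; congr D.
have -> : rc (t / (s + t)) = rc t / (rc s + rc t) by rewrite rcM rcV rcD.
rewrite rcD; field; by rewrite -rcD rc_eq0.
Qed.

Lemma cder_affine0 (l0 l1 z : C) : cder (fun w => l0 * w + l1 * w ^+ 2) z (l0 + l1 * (2 * z)).
Proof.
have := cderD (cderZ l0 (cder_id z)) (cderZ l1 (cderX 2 (cder_id z))).
by rewrite !mulr1 /= expr1.
Qed.

Lemma tri_le (D : set C) f a b c (M L : R) : convexC D -> D a -> D b -> D c ->
  (forall z, D z -> cts f z) ->
  (forall z, D z -> nm (f z) <= M) -> 0 <= M ->
  nm (b - a) <= L -> nm (c - b) <= L -> nm (a - c) <= L ->
  nm (tri f a b c) <= 3 * (M * L).
Proof.
move=> cD Da Db Dc cf fM M0 l1 l2 l3.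
have h u v : D u -> D v -> nm (v - u) <= L -> nm (sint f u v) <= M * L.
  move=> Du Dv uv; apply: le_trans (_ : M * nm (v - u) <= _).
    apply: sint_le => [t t01|t /andP[t0 t1]]; first by apply: cf; exact: cD.
    by apply: fM; apply: cD => //; rewrite !ltW.
  by rewrite ler_wpM2l.
apply: le_trans (le_nmD _ _) _; apply: le_trans (lerD (le_nmD _ _) (lexx _)) _.
have := h a b Da Db l1; have := h b c Db Dc l2; have := h c a Dc Da l3.
by move=> *; lra.
Qed.

Lemma tri_affine l0 l1 a b c : tri (fun w => l0 + l1 * (2 * w)) a b c = 0.
Proof.
have h u v := @sint_FTC _ (fun w => l0 + l1 * (2 * w)) u v (fun t _ => cder_affine0 l0 l1 (seg u v t)).
by rewrite /tri !h; ring.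
Qed.

Lemma sub3_eq (x1 x2 x3 y1 y2 y3 : C) : - (y1 + y2 + y3) = 0 ->
  x1 - y1 + (x2 - y2) + (x3 - y3) = x1 + x2 + x3.
Proof. by move=> h; rewrite -[RHS]addr0 -h; ring. Qed.

Lemma edge_bounds (k x y : R) : 0 < k -> 0 <= x -> 0 <= y ->
  [/\ k * x <= 2 * (x + y) * k, k * y <= 2 * (x + y) * k &
      k * x + k * y <= 2 * (x + y) * k].
Proof.
move=> k0 x0 y0; have kx : 0 <= k * x by rewrite mulr_ge0 // ltW.
have ky : 0 <= k * y by rewrite mulr_ge0 // ltW.
by split; lra.
Qed.

Lemma quarter (x x1 x2 x3 x4 : R) : x <= x1 + x2 + x3 + x4 ->
  4 * x1 < x -> 4 * x2 < x -> 4 * x3 < x -> x <= 4 * x4.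
Proof. lra. Qed.

(** Of the four midpoint triangles one carries at least a quarter of the integral. All triangles
    that arise are homothetic to the first, so one is encoded by the coordinates of a corner and a
    scale [q.2], which changes sign when the inverted middle triangle is chosen. Perimeters halve
    while [f] differs from its linearization by a small multiple of the distance, so the factors
    [4 ^+ n] are compensated. *)
Theorem goursat (D : set C) f a b c : convexC D -> D a -> D b -> D c ->
  (forall z, D z -> exists d, cder f z d) -> tri f a b c = 0.
Proof.
move=> cD Da Db Dc df.
have cf z : D z -> cts f z by move=> /df[d]; exact: cder_cont.
pose u := b - a; pose v := c - a.
have Du : D (a + u) by rewrite /u addrC subrK.
have Dv : D (a + v) by rewrite /v addrC subrK.
pose P := pt a u v.
pose T (q : R * R * R) := tri f (P q.1.1 q.1.2) (P (q.1.1 + q.2) q.1.2) (P q.1.1 (q.1.2 + q.2)).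
pose ok (q : R * R * R) := [/\ 0 <= q.1.1, 0 <= q.1.2, q.1.1 + q.1.2 <= 1,
  0 <= q.1.1 + q.2 & 0 <= q.1.2 + q.2 /\ q.1.1 + q.1.2 + q.2 <= 1].
have okP q : ok q -> [/\ D (P q.1.1 q.1.2), D (P (q.1.1 + q.2) q.1.2) & D (P q.1.1 (q.1.2 + q.2))].
  by case=> h1 h2 h3 h4 [h5 h6]; split; apply: pt_convex => //; lra.
pose child (q q' : R * R * R) := [/\ ok q', `|q'.1.1 - q.1.1| <= `|q.2| / 2,
   `|q'.1.2 - q.1.2| <= `|q.2| / 2, `|q'.2| = `|q.2| / 2 & nm (T q) <= 4 * nm (T q')].
have step q : ok q -> exists q', child q q'.
  move=> okq; have [D1 D2 D3] := okP q okq.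
  have := tri_split cD D1 D2 D3 cf.
  have m2 s t s' t' : mid (P s t) (P s' t') = P ((s + s') / 2) ((t + t') / 2).
    have h : rc (1 / 2) + rc (1 / 2) = 1 by rewrite -rcD -rc1; congr rc; lra.
    have e x x' : rc ((x + x') / 2) = (rc x + rc x') * rc (1 / 2).
      by rewrite -rcD -rcM; congr rc; lra.
    apply/eqP; rewrite -subr_eq0 /mid /seg /P /pt !e; set k := rc (1 / 2) in h *.
    have -> : a + rc s * u + rc t * v +
      k * (a + rc s' * u + rc t' * v - (a + rc s * u + rc t * v)) -
      (a + (rc s + rc s') * k * u + (rc t + rc t') * k * v)
      = (1 - (k + k)) * (rc s * u + rc t * v) by ring.
    by rewrite h subrr mul0r.
  case: q okq {D1 D2 D3} => [[s t] r] /= [/= q1 q2 q3 q4 [q5 q6]].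
  rewrite !m2.
  have e2 x : (x + (x + r)) / 2 = x + r / 2 by lra.
  have e1 x : (x + x) / 2 = x by lra.
  have e3 x : (x + r + x) / 2 = x + r / 2 by lra.
  rewrite !(e1, e2, e3) => E.
  pose q1' := (s, t, r / 2); pose q2' := (s + r / 2, t, r / 2).
  pose q3' := (s, t + r / 2, r / 2); pose q4' := (s + r / 2, t + r / 2, - (r / 2)).
  have T1 : T q1' = tri f (P s t) (P (s + r / 2) t) (P s (t + r / 2)) by [].
  have T2 : T q2' = tri f (P (s + r / 2) t) (P (s + r) t) (P (s + r / 2) (t + r / 2)).
    by rewrite /T /q2' /= (_ : s + r / 2 + r / 2 = s + r) //; lra.
  have T3 : T q3' = tri f (P s (t + r / 2)) (P (s + r / 2) (t + r / 2)) (P s (t + r)).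
    by rewrite /T /q3' /= (_ : t + r / 2 + r / 2 = t + r) //; lra.
  have T4 : T q4' = tri f (P (s + r / 2) (t + r / 2)) (P s (t + r / 2)) (P (s + r / 2) t).
    by rewrite /T /q4' /= !addrK.
  have n2 : `|r / 2| = `|r| / 2 by rewrite normrM (@gtr0_norm _ 2^-1) // invr_gt0.
  have r0 : 0 <= `|r| / 2 by rewrite divr_ge0.
  have E' : nm (T (s, t, r)) <= nm (T q1') + nm (T q2') + nm (T q3') + nm (T q4').
    rewrite T1 T2 T3 T4 /T /= E; apply: le_trans (le_nmD _ _) _; rewrite lerD2r.
    by apply: le_trans (le_nmD _ _) _; rewrite lerD2r; exact: le_nmD.
  have mk s' t' r' : ok (s', t', r') -> `|s' - s| <= `|r| / 2 ->
      `|t' - t| <= `|r| / 2 -> `|r'| = `|r| / 2 ->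
      nm (T (s, t, r)) <= 4 * nm (T (s', t', r')) -> exists q', child (s, t, r) q'.
    by move=> h1 h2 h3 h4 h5; exists (s', t', r'); split.
  have [y1 y2 y3 y4] : [/\ ok q1', ok q2', ok q3' & ok q4'].
    rewrite /ok /q1' /q2' /q3' /q4' /=; clear -q1 q2 q3 q4 q5 q6.
    by do ! split; lra.
  have z0 x : `|x - x| <= `|r| / 2 by rewrite subrr normr0.
  have z1 x : `|x + r / 2 - x| <= `|r| / 2 by rewrite addrC addKr n2.
  have n2' : `|- (r / 2)| = `|r| / 2 by rewrite normrN.
  have [h1|h1] := leP (nm (T (s, t, r))) (4 * nm (T q1')).
    exact (mk _ _ _ y1 (z0 s) (z0 t) n2 h1).
  have [h2|h2] := leP (nm (T (s, t, r))) (4 * nm (T q2')).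
    exact (mk _ _ _ y2 (z1 s) (z0 t) n2 h2).
  have [h3|h3] := leP (nm (T (s, t, r))) (4 * nm (T q3')).
    exact (mk _ _ _ y3 (z0 s) (z1 t) n2 h3).
  have h4 : nm (T (s, t, r)) <= 4 * nm (T q4').
    exact: quarter E' h1 h2 h3.
  exact (mk _ _ _ y4 (z1 s) (z1 t) n2' h4).
have [nx nxP] : exists nx, forall q, ok q -> child q (nx q).
  have /choice[nx hnx] : forall q, exists q', ok q -> child q q'.
    by move=> q; have [/step[q' h]|] := pselect (ok q); [exists q'|exists q].
  by exists nx.
pose Q n := iter n nx (0, 0, 1).
have okQ n : ok (Q n).
  elim: n => [|n IH]; first by split=> /=; lra.
  by have [] := nxP _ IH.
have Q2 n : `|(Q n).2| = 1 / 2 ^+ n.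
  elim: n => [|n IH]; first by rewrite /= normr1 expr0 divr1.
  have [_ _ _ -> _] := nxP _ (okQ n); rewrite -/(Q n) IH exprS; field.
  by rewrite expf_neq0.
have [s hs] : exists l, forall n, `|(Q n).1.1 - l| <= 2 * 1 / 2 ^+ n.
  apply: (geo_lim ler01 (u := fun n => (Q n).1.1)) => n; have [_ h _ _ _] := nxP _ (okQ n).
  by apply: le_trans h _; rewrite -/(Q n) Q2 ler_pdivrMr // ler_pMr ?divr_gt0 ?exprn_gt0 // ler1n.
have [t ht] : exists l, forall n, `|(Q n).1.2 - l| <= 2 * 1 / 2 ^+ n.
  apply: (geo_lim ler01 (u := fun n => (Q n).1.2)) => n; have [_ _ h _ _] := nxP _ (okQ n).
  by apply: le_trans h _; rewrite -/(Q n) Q2 ler_pdivrMr // ler_pMr ?divr_gt0 ?exprn_gt0 // ler1n.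
have TQ n : nm (T (Q 0%N)) <= 4 ^+ n * nm (T (Q n)).
  elim: n => [|n IH]; first by rewrite expr0 mul1r.
  have [_ _ _ _ h] := nxP _ (okQ n); apply: le_trans IH _.
  by rewrite exprSr -mulrA ler_pM2l ?exprn_gt0.
have D0 : D (P s t).
  have ge0 (x : R) (q : nat -> R) : (forall n, `|q n - x| <= 2 * 1 / 2 ^+ n) ->
      (forall n, 0 <= q n) -> 0 <= x.
    move=> qx q0; apply: (@half_pow_ge0 x (2 * 1)); first by lra.
    by move=> n; have := qx n; have := q0 n; rewrite ler_norml => ? /andP[*]; lra.
  apply: pt_convex => //.
  - by apply: (ge0 _ _ hs) => n; have [] := okQ n.
  - by apply: (ge0 _ _ ht) => n; have [] := okQ n.
  - rewrite -subr_ge0; apply: (@half_pow_ge0 _ 4); first by lra.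
    move=> n; have [_ _ h _ _] := okQ n; have := hs n; have := ht n.
    rewrite !ler_norml -mulrA mul1r => /andP[? ?] /andP[? ?].
    by lra.
have [d /cderP dfp] := df _ D0.
pose W := nm u + nm v; have W0 : 0 <= W by rewrite addr_ge0 ?nm_ge0.
suff h e : 0 < e -> nm (T (Q 0%N)) <= e * (30 * W ^+ 2 + 1).
  have -> : tri f a b c = T (Q 0%N).
    by rewrite /T /Q /= !add0r /P /pt rc0 rc1 !mul0r !mul1r !addr0 /u /v !(addrC a) !subrK.
  apply/eqP; rewrite -nm_eq0; apply/eqP/le_anti; rewrite nm_ge0 andbT.
  have w1 : 0 < 30 * W ^+ 2 + 1 by have := sqr_ge0 W; lra.
  apply/ler_addgt0Pl => e e0; rewrite addr0.
  by have := h (e / (30 * W ^+ 2 + 1)) (divr_gt0 e0 w1); rewrite divfK // gt_eqF.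
move=> e0; have [r r0 hr] := dfp e e0.
have W1 : 0 < 5 * W + 1 by lra.
have [n hn] := half_pow_lt (divr_gt0 r0 W1).
have {}hn : 5 * W / 2 ^+ n < r.
  move: hn; rewrite ltr_pdivlMr; last by lra.
  rewrite div1r mulrC => h; apply: le_lt_trans h.
  by rewrite ler_wpM2r ?invr_ge0 ?exprn_ge0 // lerDl.
apply: le_trans (TQ n) _.
set k := (2 ^+ n)^-1 in hn *; have k0 : 0 < k by rewrite invr_gt0 exprn_gt0.
have E4 : 4 ^+ n * (k * k) = 1.
  rewrite -expr2 /k exprVn -exprM mulnC exprM (_ : 2 ^+ 2 = 4 :> R); last by ring.
  by rewrite divff // expf_neq0.
(* The limit point is within [2 * k] of the corner in each coordinate and the edges have scale [k],
   so the whole triangle is within [5 * W * k] of it. *)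
pose Dn : set C := [set z | D z /\ nm (z - P s t) <= 5 * W * k].
have cDn : convexC Dn.
  move=> x y l [Dx hx] [Dy hy] l01; split; first exact: cD.
  exact: disk_convex.
have [Da' Db' Dc'] := okP _ (okQ n).
have dP x y x' y' : nm (P x y - P x' y') <= `|x - x'| * nm u + `|y - y'| * nm v.
  have -> : P x y - P x' y' = rc (x - x') * u + rc (y - y') * v.
    by rewrite /P /pt !rcB; ring.
  by apply: le_trans (le_nmD _ _) _; rewrite !nmM !nm_rc.
have hsn := hs n; have htn := ht n; have h2n := Q2 n.
rewrite mulr1 -/k in hsn htn; rewrite div1r -/k in h2n.
set q := Q n in hsn htn h2n Da' Db' Dc' *.
have u0 := nm_ge0 u; have v0 := nm_ge0 v.
have in1 : Dn (P q.1.1 q.1.2).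
  by split=> //; apply: le_trans (dP _ _ _ _) _; rewrite /W; nra.
have in2 : Dn (P (q.1.1 + q.2) q.1.2).
  split=> //; apply: le_trans (dP _ _ _ _) _.
  have : `|q.1.1 + q.2 - s| <= 2 * k + k.
    rewrite addrAC; apply: le_trans (ler_normD _ _) _; lra.
  by rewrite /W; nra.
have in3 : Dn (P q.1.1 (q.1.2 + q.2)).
  split=> //; apply: le_trans (dP _ _ _ _) _.
  have : `|q.1.2 + q.2 - t| <= 2 * k + k.
    rewrite addrAC; apply: le_trans (ler_normD _ _) _; lra.
  by rewrite /W; nra.
(* [f] minus its linearization at the limit point. The subtracted affine function is written as the
   derivative of a quadratic polynomial, which lets [tri_affine] show that it contributes
   nothing. *)
pose g z := f z - (f (P s t) - d * P s t + d / 2 * (2 * z)).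
have gE z : g z = f z - f (P s t) - d * (z - P s t).
  by rewrite /g; field.
have cg z : Dn z -> cts g z.
  move=> [Dz _]; apply: ctsB; first exact: cf.
  exact: cder_cont (cderD (cder_cst _ z) (cderZ _ (cderZ _ (cder_id z)))).
have gle z : Dn z -> nm (g z) <= e * (5 * W * k).
  move=> [Dz hz]; rewrite gE; apply: le_trans (hr _ _) _.
    by apply: le_lt_trans hz _.
  by rewrite ler_pM2l.
have Tg : tri g (P q.1.1 q.1.2) (P (q.1.1 + q.2) q.1.2) (P q.1.1 (q.1.2 + q.2)) = T q.
  have ca : forall z, cts (fun z => f (P s t) - d * P s t + d / 2 * (2 * z)) z.
    move=> z; exact: cder_cont (cderD (cder_cst _ z) (cderZ _ (cderZ _ (cder_id z)))).
  have sg (x y : C) : D x -> D y -> sint g x y = sint f x y -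
      sint (fun z => f (P s t) - d * P s t + d / 2 * (2 * z)) x y.
    move=> Dx Dy; apply: sintB => l l01; last exact: ca.
    by apply: cf; exact: cD.
  rewrite /tri !sg // /T /tri.
  have := tri_affine (f (P s t) - d * P s t) (d / 2) (P q.1.1 q.1.2)
     (P (q.1.1 + q.2) q.1.2) (P q.1.1 (q.1.2 + q.2)).
  rewrite /tri => /(congr1 -%R); rewrite oppr0 => h.
  by apply: sub3_eq h.
have M0 : 0 <= e * (5 * W * k) by apply: mulr_ge0; [exact: ltW|apply: mulr_ge0; [lra|exact: ltW]].
have := tri_le cDn in1 in2 in3 cg gle M0 (L := 2 * W * k); rewrite Tg => tl.
have : nm (T q) <= 3 * (e * (5 * W * k) * (2 * W * k)).
  apply: tl; apply: le_trans (dP _ _ _ _) _; rewrite ?subrr ?normr0 ?mul0r ?add0r ?addr0.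
  - by rewrite addrC addKr h2n; have [] := edge_bounds k0 u0 v0.
  - have -> : q.1.1 - (q.1.1 + q.2) = - q.2 by ring.
    have -> : q.1.2 + q.2 - q.1.2 = q.2 by ring.
    by rewrite normrN h2n; have [] := edge_bounds k0 u0 v0.
  - have -> : q.1.2 - (q.1.2 + q.2) = - q.2 by ring.
    by rewrite normrN h2n; have [] := edge_bounds k0 u0 v0.
have p4 : 0 <= 4 ^+ n :> R by rewrite exprn_ge0.
move=> /(ler_wpM2l p4) tq; apply: le_trans tq _.
have -> : 4 ^+ n * (3 * (e * (5 * W * k) * (2 * W * k))) = (4 ^+ n * (k * k)) * (e * (30 * W ^+ 2)).
  by ring.
by rewrite E4 mul1r; have := sqr_ge0 W; nra.
Qed.

(** The primitive is the integral from a base point [z0] along segments. By Goursat's theorem for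
    the triangle [z0], [w], [z] its increments are integrals over the short segment from [z] to
    [w]. *)
Theorem primitive_convex (D : set C) f : open D -> convexC D ->
  (forall z, D z -> exists d, cder f z d) ->
  exists F, forall z, D z -> cder F z (f z).
Proof.
move=> /openP oD cD df; have [[z0 Dz0]|noD] := pselect (D !=set0); last first.
  by exists f => z Dz; case: noD; exists z.
have cf z : D z -> cts f z by move=> /df[d]; exact: cder_cont.
have cfD u v : D u -> D v -> cseg f u v.
  by move=> Du Dv t t01; apply: cf; exact: cD.
exists (sint f z0) => z Dz; apply/cderP => e e0.
have [r r0 hr] := oD z Dz; have /ccontP /(_ e e0)[s s0 hs] := cf z Dz.
exists (Num.min r s) => [|w]; first by rewrite lt_min r0.
rewrite lt_min => /andP[wr ws]; have Dw : D w by exact: hr.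
have zw : cseg f z w := cfD z w Dz Dw.
have -> : sint f z0 w - sint f z0 z - f z * (w - z) = sint (fun x : C => f x - f z) z w.
  have czz : cseg (fun _ : C => f z) z w by move=> t _; exact: cts_cst.
  rewrite (sintB zw czz); have -> : sint (fun _ : C => f z) z w = f z * (w - z).
    by rewrite /sint cint_cst mulrC.
  have := goursat cD Dz0 Dw Dz df; rewrite /tri.
  rewrite (sint_rev zw) (sint_rev (cfD z0 z Dz0 Dz)) => h.
  have -> : sint f z0 w = sint f z w + sint f z0 z.
    by apply/eqP; rewrite -subr_eq0 opprD addrA h.
  ring.
apply: sint_le => [t t01|t /andP[t0 t1]].
  by apply: (ctsB (zw t t01)); exact: cts_cst.
apply/ltW/hs; apply: le_lt_trans ws; apply: nm_seg.
by rewrite !ltW.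
Qed.

End Goursat.

Section Cauchy.
Variable R : realType.
Local Notation C := (Cplane R).
Local Notation nm := (@nm R).
Local Notation rc := (@rc R).
Local Notation cRe := (@cRe R).
Local Notation cIm := (@cIm R).
Local Notation cI := (cI R).
Implicit Types (z w a b c d : C) (x y t s r e : R) (f F G : C -> C).

(** * Compactness *)

(** The common replacement for finite subcovers and Lebesgue numbers: compactness in near-covering
    form, applied to the filter of radii tending to [0] from the right. *)
Lemma compact_uniform (T : topologicalType) (K : set T) (P : T -> R -> Prop) :
  compact K -> (forall u s r, s <= r -> P u r -> P u s) ->
  (forall u, K u -> exists2 r, 0 < r & \forall v \near u, K v -> P v r) ->
  exists2 r, 0 < r & forall u, K u -> P u r.
Proof.
move=> /compact_near_coveringP/near_covering_withinP cK mono loc.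
have h : \forall r \near (0 : R)^'+, K `<=` P^~ r.
  apply: cK => u Ku; have [r r0 hr] := loc u Ku.
  exists ([set v | K v -> P v r], [set s | 0 < s < r]) => /=.
    split=> //; near=> s; apply/andP; split; near: s.
      exact: nbhs_right_gt.
    exact: nbhs_right_lt.
  by move=> [v s] /= [hv /andP[_ sr]] Kv; apply: mono (ltW sr) (hv Kv).
have h' : \forall r \near (0 : R)^'+, (K `<=` P^~ r) /\ 0 < r.
  by near=> r; split; near: r; [exact: h|exact: nbhs_right_gt].
near (0 : R)^'+ => r; have [hr r0] : (K `<=` P^~ r) /\ 0 < r by near: r.
by exists r.
Unshelve. all: by end_near. Qed.

Lemma compact_bound (T : topologicalType) (K : set T) (f : T -> R) :
  compact K -> (forall u, K u -> {for u, continuous f}) ->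
  exists2 M, 0 < M & forall u, K u -> f u <= M.
Proof.
(* Writing the bound as [r^-1] makes the property monotone in [r]; the disjunct [r <= 0] keeps it
   monotone past zero. *)
move=> cK cf; have [|u Ku|r r0 hr] := compact_uniform (P := fun u r => f u <= r^-1 \/ r <= 0) cK.
- move=> u s r sr [h|r0]; last by right; apply: le_trans sr r0.
  have [s0|s0] := leP s 0; [by right|left].
  by apply: le_trans h _; rewrite lef_pV2 ?posrE //; apply: lt_le_trans sr.
- pose M : R := `|f u| + 1; have M0 : 0 < M by rewrite ltr_wpDl.
  exists M^-1; rewrite ?invr_gt0 // invrK.
  have h1 : \forall v \near u, ball (f u) 1 (f v) := cf u Ku _ (nbhsx_ballx (f u) 1 ltr01).
  apply: filterS h1 => v; rewrite /= /ball /= => h _; left.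
  by have := ler_norm (f u); move: h; rewrite ltr_norml /M => /andP[]; lra.
- exists r^-1; rewrite ?invr_gt0 // => u /hr [//|]; rewrite leNgt r0 //.
Qed.

Lemma compact_lbound (T : topologicalType) (K : set T) (f : T -> R) :
  compact K -> (forall u, K u -> {for u, continuous f}) ->
  (forall u, K u -> 0 < f u) -> exists2 m, 0 < m & forall u, K u -> m <= f u.
Proof.
move=> cK cf f0; have [|u Ku|r r0 hr] := compact_uniform (P := fun u r => r <= f u) cK.
- by move=> u s r /le_trans; apply.
- exists (f u / 2); first by rewrite divr_gt0 ?f0.
  have e0 : 0 < f u / 2 by rewrite divr_gt0 ?f0.
  have h1 : \forall v \near u, ball (f u) (f u / 2) (f v) := cf u Ku _ (nbhsx_ballx (f u) _ e0).
  apply: filterS h1 => v; rewrite /= /ball /= => h _.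
  by move: h; rewrite ltr_norml => /andP[]; lra.
- by exists r.
Qed.

Lemma itv01_compact : compact [set t : R | 0 <= t <= 1].
Proof.
have -> : [set t : R | 0 <= t <= 1] = `[0, 1]%classic.
  by apply/seteqP; split=> t /=; rewrite in_itv.
exact: segment_compact.
Qed.

Lemma cts01_bound (g : R -> C) : cts01 g ->
  exists2 M, 0 < M & forall t, 0 <= t <= 1 -> nm (g t) <= M.
Proof.
move=> cg; apply: (compact_bound (f := fun t => nm (g t)) itv01_compact) => t t01.
exact: (@continuous_comp _ _ _ g nm t (cg t t01) (@continuous_nm R (g t))).
Qed.

Lemma compact_unif_cts (T : topologicalType) (K : set T) (gam : T -> C) (D : set C) f :
  compact K -> (forall u, K u -> cts gam u) -> open D ->
  (forall u, K u -> D (gam u)) -> (forall z, D z -> cts f z) ->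
  forall e, 0 < e -> exists2 r, 0 < r & forall u, K u -> forall w, nm (w - gam u) < r ->
    D w /\ nm (f w - f (gam u)) <= e.
Proof.
move=> cK cg /openP oD gD cf e e0.
apply: (compact_uniform (P := fun u r => forall w, nm (w - gam u) < r ->
  D w /\ nm (f w - f (gam u)) <= e) cK) => [u s r sr h w ws|u Ku].
  by apply: h; apply: lt_le_trans sr.
have [r1 r10 h1] := oD _ (gD u Ku).
have e2 : 0 < e / 2 by rewrite divr_gt0.
have /ccontP /(_ _ e2)[r2 r20 h2] := cf _ (gD u Ku).
pose r : R := Num.min r1 r2 / 2.
have m0 : 0 < Num.min r1 r2 by rewrite lt_min r10.
have r0 : 0 < r by rewrite divr_gt0.
have rr1 : r + r <= r1 by rewrite -splitr ge_min lexx.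
have rr2 : r + r <= r2 by rewrite -splitr ge_min lexx orbT.
exists r => //; have /cts_atP /(_ r r0) := cg u Ku.
apply: filterS => v hv _ w wv.
have wu : nm (w - gam u) < r + r.
  by apply: le_lt_trans (le_nm_sub (gam v) w (gam u)) _; exact: ltrD.
split; first by apply: h1; apply: lt_le_trans rr1.
apply: le_trans (le_nm_sub (f (gam u)) (f w) (f (gam v))) _.
have k1 := h2 w (lt_le_trans wu rr2); have k2 := h2 (gam v).
rewrite nmB in k2; rewrite (splitr e) lerD ?ltW // nmB k2 //.
by apply: lt_le_trans rr2; rewrite nmB; apply: lt_trans hv _; rewrite ltrDl.
Qed.

(** The comparison slope [d] is free: [d = 0] gives Lipschitz bounds, and the derivative at an
    endpoint gives Taylor remainders. *)
Lemma mvi F f a b d M :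
  (forall t, 0 <= t <= 1 -> cder F (seg a b t) (f (seg a b t))) ->
  (forall t, 0 <= t <= 1 -> nm (f (seg a b t) - d) <= M) ->
  nm (F b - F a - d * (b - a)) <= M * nm (b - a).
Proof.
move=> dF fM; have h1 := antider_seg dF.
have h2 : antider (fun _ => d * (b - a)) (fun t => d * seg a b t).
  split=> t _; last by apply: rderZ; exact: rder_seg.
  exact (rder_cont (rderZ d (rder_seg a b t))).
have := antider_le (M := M * nm (b - a)) (antiderD h1 (antiderZ (-1) h2)).
rewrite !seg0 !seg1.
have -> : F b + -1 * (d * b) - (F a + -1 * (d * a)) = F b - F a - d * (b - a) by ring.
apply=> t /andP[t0 t1].
have -> : f (seg a b t) * (b - a) + -1 * (d * (b - a)) = (f (seg a b t) - d) * (b - a) by ring.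
by rewrite nmM ler_wpM2r ?nm_ge0 // fM // !ltW.
Qed.

(** * Differentiation under the integral sign *)

Section Param.
Variables (D : set C) (G g : C -> C) (k p q : R -> C) (z0 : C).
Hypotheses (oD : open D) (ck : cts01 k) (cp : cts01 p) (cq : cts01 q).
Hypothesis (gD : forall t, 0 <= t <= 1 -> D (p t + z0 * q t)).

Let cgam z : cts01 (fun t => p t + z * q t).
Proof. by move=> t t01; exact (ctsD (cp t01) (ctsM (cts_cst z t) (cq t01))). Qed.

Let cint_ok f z : (forall t, 0 <= t <= 1 -> cts f (p t + z * q t)) ->
  cts01 (fun t => k t * f (p t + z * q t)).
Proof.
move=> h t t01; apply: (ctsM (ck t01)).
exact (cts_comp (f := fun t => p t + z * q t) (@cgam z t t01) (h t t01)).
Qed.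

Lemma cts_cint : (forall z, D z -> cts g z) ->
  cts (fun z => cint (fun t => k t * g (p t + z * q t))) z0.
Proof.
move=> cg; apply/ccontP => e e0.
have [B B0 hB] := cts01_bound ck; have [Q Q0 hQ] := cts01_bound cq.
have e1 : 0 < e / (2 * B) by rewrite divr_gt0 // mulr_gt0.
have [r r0 hr] := compact_unif_cts itv01_compact (@cgam z0) oD gD cg e1.
have near01 w t : nm (w - z0) < r / Q -> 0 <= t <= 1 ->
    nm (p t + w * q t - (p t + z0 * q t)) < r.
  move=> wz t01; have -> : p t + w * q t - (p t + z0 * q t) = (w - z0) * q t by ring.
  rewrite nmM; apply: le_lt_trans (_ : nm (w - z0) * Q < r).
    by rewrite ler_wpM2l ?nm_ge0 // hQ.
  by rewrite -ltr_pdivlMr.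
exists (r / Q); first by rewrite divr_gt0.
move=> w wz; have cw : cts01 (fun t => k t * g (p t + w * q t)).
  apply: cint_ok => t t01; apply: cg.
  by have [] := hr t t01 _ (near01 w t wz t01).
have cz0 : cts01 (fun t => k t * g (p t + z0 * q t)).
  by apply: cint_ok => t t01; apply: cg; exact: gD.
rewrite -(cintB cw cz0).
apply: le_lt_trans (_ : B * (e / (2 * B)) < e).
    apply: cint_le => [t t01|t /andP[t0 t1]].
      apply: ctsB; first exact: cw.
      exact: cz0.
    have t01 : 0 <= t <= 1 by rewrite !ltW.
    rewrite -mulrBr nmM; apply: ler_pM; rewrite ?nm_ge0 ?hB //.
    by have [_] := hr t t01 _ (near01 w t wz t01).
  have -> : B * (e / (2 * B)) = e / 2 by field; lra.
  by lra.
Qed.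

(** The shape [p t + z * q t] covers both variations of a circle that occur below: that of the
    radius, with [q = cis], and that of the center, with [q] constant. Uniform continuity of [g]
    along the compact curve makes the remainders of the integrand uniform in [t]. *)
Lemma cder_cint : (forall z, D z -> cder G z (g z)) -> (forall z, D z -> cts g z) ->
  cder (fun z => cint (fun t => k t * G (p t + z * q t))) z0
    (cint (fun t => k t * q t * g (p t + z0 * q t))).
Proof.
move=> dG cg; apply/cderP => e e0.
have cG z : D z -> cts G z by move=> /dG; exact: cder_cont.
have [B B0 hB] := cts01_bound ck; have [Q Q0 hQ] := cts01_bound cq.
have e1 : 0 < e / (B * Q) by rewrite divr_gt0 // mulr_gt0.
have [r r0 hr] := compact_unif_cts itv01_compact (@cgam z0) oD gD cg e1.
have near01 w t : nm (w - z0) < r / Q -> 0 <= t <= 1 ->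
    nm (p t + w * q t - (p t + z0 * q t)) < r.
  move=> wz t01; have -> : p t + w * q t - (p t + z0 * q t) = (w - z0) * q t by ring.
  rewrite nmM; apply: le_lt_trans (_ : nm (w - z0) * Q < r).
    by rewrite ler_wpM2l ?nm_ge0 // hQ.
  by rewrite -ltr_pdivlMr.
exists (r / Q); first by rewrite divr_gt0.
move=> w wz; have c1 : cts01 (fun t => k t * G (p t + w * q t)).
  apply: cint_ok => t t01; apply: cG.
  by have [] := hr t t01 _ (near01 w t wz t01).
have c2 : cts01 (fun t => k t * G (p t + z0 * q t)).
  by apply: cint_ok => t t01; apply: cG; exact: gD.
have c3 : cts01 (fun t => k t * q t * g (p t + z0 * q t)).
  move=> t t01; apply: (ctsM (ctsM (ck t01) (cq t01))).
  exact (cts_comp (f := fun t => p t + z0 * q t) (@cgam z0 t t01) (cg _ (gD t01))).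
have c4 : cts01 (fun t => (w - z0) * (k t * q t * g (p t + z0 * q t))).
  by move=> t t01; exact (ctsM (cts_cst _ t) (c3 t t01)).
have c5 : cts01 (fun t => k t * G (p t + w * q t) - k t * G (p t + z0 * q t)).
  by move=> t t01; exact (ctsB (c1 t t01) (c2 t t01)).
rewrite mulrC -(cintB c1 c2) -(cintZ _ c3) -(cintB c5 c4).
apply: cint_le => [t t01|t /andP[t0 t1]]; first exact (ctsB (c5 t t01) (c4 t t01)).
have t01 : 0 <= t <= 1 by rewrite !ltW.
set a := p t + z0 * q t; set b := p t + w * q t.
have -> : k t * G b - k t * G a - (w - z0) * (k t * q t * g a) =
    k t * (G b - G a - g a * (b - a)) by rewrite /a /b; ring.
have ab : nm (b - a) < r by exact: near01.
have seg_near s : 0 <= s <= 1 -> nm (seg a b s - a) < r.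
  by move=> s01; apply: le_lt_trans (nm_seg _ _ s01) ab.
have := @mvi G g a b (g a) (e / (B * Q)) _ _.
have hba : nm (b - a) <= nm (w - z0) * Q.
  rewrite (_ : b - a = (w - z0) * q t); last by rewrite /a /b; ring.
  by rewrite nmM ler_wpM2l ?nm_ge0 // hQ.
move=> h; rewrite nmM; apply: le_trans (_ : B * (e / (B * Q) * (nm (w - z0) * Q)) <= _).
  apply: ler_pM; rewrite ?nm_ge0 ?hB //; apply: le_trans (h _ _) _.
  - by move=> s s01; apply: dG; have [] := hr t t01 _ (seg_near s s01).
  - by move=> s s01; have [] := hr t t01 _ (seg_near s s01).
  - by rewrite ler_pM2l.
by rewrite le_eqVlt; apply/orP; left; apply/eqP; field; apply/andP; split; lra.
Qed.

End Param.

End Cauchy.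

Section CauchyFormula.
Variable R : realType.
Local Notation C := (Cplane R).
Local Notation nm := (@nm R).
Local Notation rc := (@rc R).
Local Notation cRe := (@cRe R).
Local Notation cIm := (@cIm R).
Local Notation cI := (cI R).
Implicit Types (z w a b c d : C) (x y t s r e : R) (f F G : C -> C).

(** * Cauchy's formulas on circles *)

Definition cis t : C := cexp (rc (2 * pi * t) * cI).

Lemma cis0 : cis 0 = 1.
Proof. by rewrite /cis mulr0 rc0 mul0r cexp0. Qed.

Lemma cRe_iM t : cRe (rc t * cI) = 0.
Proof. by rewrite cReM cRe_rc cIm_rc cRe_I mulr0 mul0r subr0. Qed.

Lemma cIm_iM t : cIm (rc t * cI) = t.
Proof. by rewrite cImM cRe_rc cIm_rc cRe_I cIm_I mul0r addr0 mulr1. Qed.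

Lemma cis1 : cis 1 = 1.
Proof.
apply: cplx_eq; rewrite /cis ?cRe_cexp ?cIm_cexp cRe_iM cIm_iM expR0 mul1r mulr1.
  by rewrite mulrC mulr_natr cos2pi.
by rewrite mulrC mulr_natr sin2pi.
Qed.

Lemma nm_cis t : nm (cis t) = 1.
Proof. by rewrite nm_cexp cRe_iM expR0. Qed.

Lemma cis_neq0 t : cis t != 0. Proof. exact: cexp_neq0. Qed.

Lemma rder_cis t : rder cis t (rc (2 * pi) * cI * cis t).
Proof.
have h : rder (fun u => 0 + rc u * (rc (2 * pi) * cI)) t (rc (2 * pi) * cI).
  exact: rder_affine.
have := rder_comp h (cder_cexp _).
have E u : cexp (0 + rc u * (rc (2 * pi) * cI)) = cis u.
  by rewrite /cis add0r (rcM _ u) mulrA (mulrC (rc u)).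
have -> : (fun u => cexp (0 + rc u * (rc (2 * pi) * cI))) = cis by apply/funext.
by rewrite E mulrC.
Qed.

Lemma cts_cis t : cts cis t. Proof. exact (rder_cont (rder_cis t)). Qed.

Lemma cts_cisV t : cts (fun u => (cis u)^-1) t.
Proof. exact (ctsV (cis_neq0 t) (@cts_cis t)). Qed.

Lemma cis_int_V : cint (fun t => (cis t)^-1) = 0.
Proof.
pose k := - (rc (2 * pi) * cI).
have k0 : k != 0.
  rewrite oppr_eq0 mulf_neq0 ?cI_neq0 // rc_eq0 mulf_neq0 //.
  by rewrite gt_eqF // pi_gt0.
have h t : rder (fun u => k^-1 * (cis u)^-1) t ((cis t)^-1).
  have := rderZ k^-1 (rder_comp (rder_cis t) (cder_inv (cis_neq0 t))).
  have -> : - cis t ^- 2 * (rc (2 * pi) * cI * cis t) = k * (cis t)^-1.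
    rewrite /k; have := cis_neq0 t; move: (cis t) (rc _ * cI) => x l hx.
    by field.
  by rewrite mulKf.
have /cintE -> : antider (fun t => (cis t)^-1) (fun u => k^-1 * (cis u)^-1).
  by split=> t _; [exact (rder_cont (h t))|exact: h].
by rewrite cis0 cis1 subrr.
Qed.

Section Disk.
Variables (c : C) (rho : R).

Lemma circle_in b z t : nm (b - c) + nm z < rho -> disk c rho (b + z * cis t).
Proof.
rewrite /disk /= => h; apply: le_lt_trans h.
rewrite (_ : b + z * cis t - c = (b - c) + z * cis t); last by ring.
by apply: le_trans (le_nmD _ _) _; rewrite nmM nm_cis mulr1.
Qed.

(** As a function of the complex radius [z], the mean [A z] has derivative the integral of
    [cis t * f (b + z * cis t)]. For [z != 0] this is the integral of a derivative of a periodic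
    function, hence zero, so [A] is constant on the ray from [0] to [s]. *)
Lemma mvp_C1 F f b s : (forall z, disk c rho z -> cder F z (f z)) ->
  (forall z, disk c rho z -> cts f z) -> 0 <= s -> nm (b - c) + s < rho ->
  cint (fun t => F (b + rc s * cis t)) = F b.
Proof.
move=> dF cf s0 bs; have [->|sn0] := eqVneq s 0.
  rewrite (eq_cint (g2 := fun _ => F b)) ?cint_cst // => t _.
  by rewrite rc0 mul0r addr0.
have sp : 0 < s by rewrite lt0r sn0.
pose A z := cint (fun t => 1 * F (b + z * cis t)).
have dA z : nm (b - c) + nm z < rho ->
    cder A z (cint (fun t => 1 * cis t * f (b + z * cis t))).
  move=> bz; apply: (cder_cint (D := disk c rho) (p := fun _ => b)) => //.
  - exact: open_disk.
  - by move=> t _; exact: cts_cst.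
  - by move=> t _; exact: cts_cst.
  - by move=> t _; exact: cts_cis.
  - by move=> t _; exact: circle_in.
have A0 z : z != 0 -> nm (b - c) + nm z < rho ->
    cint (fun t => 1 * cis t * f (b + z * cis t)) = 0.
  move=> z0 bz; pose k := z * (rc (2 * pi) * cI).
  have k0 : k != 0.
    rewrite mulf_neq0 // mulf_neq0 ?cI_neq0 // rc_eq0 mulf_neq0 //.
    by rewrite gt_eqF // pi_gt0.
  have h t : rder (fun u => k^-1 * F (b + z * cis u)) t (1 * cis t * f (b + z * cis t)).
    have h1 : rder (fun u => b + z * cis u) t (0 + z * (rc (2 * pi) * cI * cis t)).
      apply: rderD (rderZ z (rder_cis t)).
      have := rder_affine b 0 t; congr rder.
      by apply/funext => u; rewrite mulr0 addr0.
    have := rderZ k^-1 (rder_comp h1 (dF _ (@circle_in b z t bz))).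
    have -> : k^-1 * (f (b + z * cis t) * (0 + z * (rc (2 * pi) * cI * cis t))) =
       k^-1 * k * (1 * cis t * f (b + z * cis t)) by rewrite /k; ring.
    by rewrite mulVf // !mul1r.
  have /cintE -> : antider (fun t => 1 * cis t * f (b + z * cis t))
      (fun u => k^-1 * F (b + z * cis u)).
    by split=> t _; [exact (rder_cont (h t))|exact: h].
  by rewrite cis0 cis1 subrr.
have in_s t : 0 <= t <= 1 -> nm (b - c) + nm (seg 0 (rc s) t) < rho.
  case/andP=> t0 t1; rewrite /seg add0r subr0 nmM !nm_rc !ger0_norm //.
  by apply: le_lt_trans bs; rewrite lerD2l ler_piMl.
have aA : antider (fun _ => 0) (fun t => A (seg 0 (rc s) t)).
  split=> t t01.
    exact (rder_cont (rder_comp (rder_seg 0 (rc s) t) (dA _ (in_s t t01)))).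
  have t01' : 0 <= t <= 1 by case/andP: t01 => *; rewrite !ltW.
  have := rder_comp (rder_seg 0 (rc s) t) (dA _ (in_s t t01')).
  rewrite A0 ?mul0r //; last exact: in_s.
  rewrite /seg add0r subr0 -rcM rc_eq0 mulf_neq0 //.
  by case/andP: t01 => t0 _; rewrite gt_eqF.
have := antider_le (M := 0) aA; rewrite seg0 seg1 => h.
have {}h : nm (A (rc s) - A 0) <= 0 by apply: h => t _; rewrite nm0.
have -> : cint (fun t => F (b + rc s * cis t)) = A (rc s).
  by apply: eq_cint => t _; rewrite mul1r.
have -> : F b = A 0.
  rewrite /A (eq_cint (g2 := fun _ => F b)) ?cint_cst // => t _.
  by rewrite mul0r addr0 mul1r.
apply/eqP; rewrite -subr_eq0 -nm_eq0; apply/eqP/le_anti.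
by rewrite h nm_ge0.
Qed.

Variable f : C -> C.
Hypothesis df : forall z, disk c rho z -> exists d, cder f z d.

Let cf z : disk c rho z -> cts f z. Proof. by move=> /df[d]; exact: cder_cont. Qed.

Let fprim : exists F, forall z, disk c rho z -> cder F z (f z).
Proof. exact: primitive_convex (@open_disk R c rho) (@open_disk_convex R c rho) df. Qed.

Let center_der F k b s : (forall z, disk c rho z -> cder F z (f z)) ->
  cts01 k -> 0 <= s -> nm (b - c) + s < rho ->
  cder (fun b => cint (fun t => k t * F (rc s * cis t + b * 1))) b
    (cint (fun t => k t * 1 * f (rc s * cis t + b * 1))).
Proof.
move=> dF ck s0 bs; apply: (cder_cint (D := disk c rho) (q := fun _ => 1)).
- exact: open_disk.
- exact: ck.
- by move=> t _; exact (ctsM (cts_cst (rc s) t) (@cts_cis t)).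
- by move=> t _; exact: cts_cst.
- move=> t _; rewrite mulr1 addrC; apply: circle_in.
  by rewrite nm_rc ger0_norm.
- exact: dF.
- exact: cf.
Qed.

Let near_b b s : nm (b - c) + s < rho -> exists2 r, 0 < r &
  forall w, disk b r w -> nm (w - c) + s < rho.
Proof.
move=> bs; exists (rho - (nm (b - c) + s)); first by rewrite subr_gt0.
move=> w; rewrite /disk /= => wb; have := le_nm_sub b w c; lra.
Qed.

(** The version with a continuous derivative applies to a primitive [F] of [f]; differentiating its
    mean value identity in the center [b] gives the identity for [f]. *)
Lemma mvp b s : 0 <= s -> nm (b - c) + s < rho ->
  cint (fun t => f (b + rc s * cis t)) = f b.
Proof.
move=> s0 bs; have [F dF] := fprim.
have h := center_der dF (k := fun _ => 1) (fun t _ => cts_cst 1 t) s0 bs.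
have [r r0 hr] := near_b bs.
have bin : disk c rho b by rewrite /disk /=; lra.
have h2 : cder F b (cint (fun t => 1 * 1 * f (rc s * cis t + b * 1))).
  apply: (cder_near r0 _ h) => w wb.
  rewrite -(mvp_C1 dF cf s0 (hr w wb)).
  by apply: eq_cint => t _; rewrite mul1r mulr1 addrC.
rewrite (cder_unique (dF b bin) h2).
by apply: eq_cint => t _; rewrite !mulr1 mul1r addrC.
Qed.

(** As a function of the radius, the left side has derivative the circle mean of [f], which is [f b]
    by [mvp]; it starts at [0] since [(cis t)^-1] has mean zero. *)
Lemma cauchy_rep F b s : (forall z, disk c rho z -> cder F z (f z)) ->
  0 < s -> nm (b - c) + s < rho ->
  cint (fun t => (cis t)^-1 * F (b + rc s * cis t)) = rc s * f b.
Proof.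
move=> dF s0 bs.
pose B z := cint (fun t => (cis t)^-1 * F (b + z * cis t)).
have dB z : nm (b - c) + nm z < rho ->
    cder B z (cint (fun t => (cis t)^-1 * cis t * f (b + z * cis t))).
  move=> bz; apply: (cder_cint (D := disk c rho) (p := fun _ => b)) => //.
  - exact: open_disk.
  - by move=> t _; exact: cts_cisV.
  - by move=> t _; exact: cts_cst.
  - by move=> t _; exact: cts_cis.
  - by move=> t _; exact: circle_in.
have in_s t : 0 <= t <= 1 -> nm (b - c) + s * t < rho.
  by case/andP=> t0 t1; apply: le_lt_trans bs; rewrite lerD2l ler_piMr // ltW.
have nms t : 0 <= t <= 1 -> nm (seg 0 (rc s) t) = s * t.
  by case/andP=> t0 t1; rewrite /seg add0r subr0 nmM !nm_rc !ger0_norm 1?mulrC // ltW.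
have dBs t : 0 <= t <= 1 -> cder B (seg 0 (rc s) t) (f b).
  move=> t01; have t0 : 0 <= t by case/andP: t01.
  have := dB (seg 0 (rc s) t); rewrite nms // => /(_ (in_s t t01)).
  have -> // : cint (fun t0 => (cis t0)^-1 * cis t0 * f (b + seg 0 (rc s) t * cis t0)) = f b.
  rewrite -(@mvp b (s * t)) ?in_s // ?mulr_ge0 // ?ltW //; apply: eq_cint => u _.
  by rewrite mulVf ?cis_neq0 // mul1r /seg add0r subr0 -rcM (mulrC t).
have := mvi (M := 0) (F := B) (f := fun _ => f b) (d := f b) dBs.
rewrite mul0r => h; have {}h : nm (B (rc s) - B 0 - f b * (rc s - 0)) <= 0.
  by apply: h => t _; rewrite subrr nm0.
have B0 : B 0 = 0.
  rewrite /B (eq_cint (g2 := fun t => F b * (cis t)^-1)) => [|t _]; last first.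
    by rewrite mul0r addr0 mulrC.
  by rewrite cintZ ?cis_int_V ?mulr0 // => t _; exact: cts_cisV.
apply/eqP; rewrite -subr_eq0 -nm_eq0; apply/eqP/le_anti; rewrite nm_ge0 andbT.
by move: h; rewrite B0 !subr0 (mulrC (f b)).
Qed.

(** Differentiating [cauchy_rep] in the center replaces the primitive by [f] on the left and
    produces the derivative of [f] on the right. *)
Lemma cauchy_deriv b s : 0 < s -> nm (b - c) + s < rho ->
  cder f b ((rc s)^-1 * cint (fun t => (cis t)^-1 * f (b + rc s * cis t))).
Proof.
move=> s0 bs; have [F dF] := fprim.
have h := center_der dF (k := fun t => (cis t)^-1) (fun t _ => @cts_cisV t) (ltW s0) bs.
have s1 : rc s != 0 by rewrite rc_eq0 gt_eqF.
have [r r0 hr] := near_b bs.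
have h2 : cder f b ((rc s)^-1 * cint (fun t => (cis t)^-1 * 1 * f (rc s * cis t + b * 1))).
  apply: (cder_near r0 _ (cderZ (rc s)^-1 h)) => w wb.
  rewrite -[RHS](mulKf s1); congr (_ * _); rewrite -(cauchy_rep dF s0 (hr w wb)).
  by apply: eq_cint => t _; rewrite mulr1 addrC.
move: h2; congr cder; congr (_ * _); apply: eq_cint => t _.
by rewrite !mulr1 addrC.
Qed.

Lemma cauchy_deriv1 b s : 0 < s -> nm (b - c) + s < rho ->
  derive1 f b = (rc s)^-1 * cint (fun t => (cis t)^-1 * f (b + rc s * cis t)).
Proof. by move=> s0 bs; apply: cder_derive1; exact: cauchy_deriv. Qed.

Let split_rho b : disk c rho b -> exists2 s, 0 < s & nm (b - c) + s < rho.
Proof. by rewrite /disk /= => h; exists ((rho - nm (b - c)) / 2); lra. Qed.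

Lemma cts_deriv b : disk c rho b -> cts (derive1 f) b.
Proof.
move=> /split_rho[s s0 bs]; have [r r0 hr] := near_b bs.
have h : cts (fun b => cint (fun t => (cis t)^-1 * f (rc s * cis t + b * 1))) b.
  apply: (cts_cint (D := disk c rho) (q := fun _ => 1)).
  - exact: open_disk.
  - by move=> t _; exact: cts_cisV.
  - by move=> t _; exact (ctsM (cts_cst (rc s) t) (@cts_cis t)).
  - by move=> t _; exact: cts_cst.
  - move=> t _; rewrite mulr1 addrC; apply: circle_in.
    by rewrite nm_rc gtr0_norm.
  - exact: cf.
have := ctsM (cts_cst (rc s)^-1 b) h => /ccontP h1; apply/ccontP => e e0.
have [r1 r10 hr1] := h1 e e0; exists (Num.min r r1); first by rewrite lt_min r0.
move=> w; rewrite lt_min => /andP[wr wr1]; have := hr1 w wr1.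
have E u : nm (u - c) + s < rho -> derive1 f u =
    (rc s)^-1 * cint (fun t => (cis t)^-1 * f (rc s * cis t + u * 1)).
  move=> us; rewrite (cauchy_deriv1 s0 us); congr (_ * _).
  by apply: eq_cint => t _; rewrite mulr1 addrC.
by rewrite -(E b bs) -(E w (hr w wr)).
Qed.

Lemma disk_cder b : disk c rho b -> cder f b (derive1 f b).
Proof. by move=> /df[d fd]; rewrite (cder_derive1 fd). Qed.

(** The integral formula for [derive1 f] can itself be differentiated under the integral sign, now
    that [derive1 f] is known to be continuous. *)
Lemma holo_deriv_disk b : disk c rho b -> exists d, cder (derive1 f) b d.
Proof.
move=> /split_rho[s s0 bs]; have [r r0 hr] := near_b bs.
have h := @cder_cint R (disk c rho) f (derive1 f) (fun t => (cis t)^-1)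
  (fun t => rc s * cis t) (fun _ => 1) b.
eexists; apply: (cder_near r0 _ (cderZ (rc s)^-1 (h _ _ _ _ _ _ _))).
- move=> w wb; rewrite (cauchy_deriv1 s0 (hr w wb)); congr (_ * _).
  by apply: eq_cint => t _; rewrite mulr1 addrC.
- exact: open_disk.
- by move=> t _; exact: cts_cisV.
- by move=> t _; exact (ctsM (cts_cst (rc s) t) (@cts_cis t)).
- by move=> t _; exact: cts_cst.
- move=> t _; rewrite mulr1 addrC; apply: circle_in.
  by rewrite nm_rc gtr0_norm.
- exact: disk_cder.
- exact: cts_deriv.
Qed.

Lemma cauchy_est b s M : 0 < s -> nm (b - c) + s < rho ->
  (forall z, disk c rho z -> nm (f z) <= M) -> nm (derive1 f b) <= M / s.
Proof.
move=> s0 bs fM; rewrite (cauchy_deriv1 s0 bs) nmM nmV nm_rc gtr0_norm // mulrC.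
rewrite ler_pM2r ?invr_gt0 //.
have cin t : disk c rho (b + rc s * cis t).
  by apply: circle_in; rewrite nm_rc gtr0_norm.
apply: cint_le => [t t01|t t01].
  apply: (ctsM (@cts_cisV t)).
  apply: (cts_comp (f := fun t => b + rc s * cis t)); last exact: cf.
  exact (ctsD (cts_cst b t) (ctsM (cts_cst (rc s) t) (@cts_cis t))).
by rewrite nmM nmV nm_cis invr1 mul1r fM.
Qed.

End Disk.

End CauchyFormula.

Section Local.
Variable R : realType.
Local Notation C := (Cplane R).
Local Notation nm := (@nm R).
Local Notation rc := (@rc R).
Local Notation cRe := (@cRe R).
Local Notation cIm := (@cIm R).
Local Notation cI := (cI R).
Implicit Types (z w a b c d : C) (x y t s r e : R) (f F G : C -> C) (D : set C).

(** * Local properties of holomorphic functions *)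

Definition hol D f := forall z, D z -> exists d, cder f z d.

Lemma holP D f : holomorphic_on D f <-> hol D f.
Proof. by split=> h z /h /derivableP_cder. Qed.

Lemma hol_sub D D' f : D' `<=` D -> hol D f -> hol D' f.
Proof. by move=> s h z /s; exact: h. Qed.

Lemma hol_cder D f z : hol D f -> D z -> cder f z (derive1 f z).
Proof. by move=> h /h[d fd]; rewrite (cder_derive1 fd). Qed.

Lemma hol_cts D f z : hol D f -> D z -> cts f z.
Proof. by move=> h /h[d]; exact: cder_cont. Qed.

Lemma hol_deriv D f : open D -> hol D f -> hol D (derive1 f).
Proof.
move=> /openP oD hf z Dz; have [r r0 hr] := oD z Dz.
apply: (@holo_deriv_disk R z r) => [w wz|]; first exact: hf (hr w wz).
exact: disk_center.
Qed.

Lemma hol_cst D c : hol D (fun _ => c).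
Proof. by move=> z _; exists 0; exact: cder_cst. Qed.

Lemma hol_id D : hol D id.
Proof. by move=> z _; exists 1; exact: cder_id. Qed.

Lemma holD D f g : hol D f -> hol D g -> hol D (fun z => f z + g z).
Proof. by move=> hf hg z Dz; have [d h] := hf z Dz; have [d' h'] := hg z Dz; eexists; exact: cderD h h'. Qed.

Lemma holB D f g : hol D f -> hol D g -> hol D (fun z => f z - g z).
Proof. by move=> hf hg z Dz; have [d h] := hf z Dz; have [d' h'] := hg z Dz; eexists; exact: cderB h h'. Qed.

Lemma holM D f g : hol D f -> hol D g -> hol D (fun z => f z * g z).
Proof. by move=> hf hg z Dz; have [d h] := hf z Dz; have [d' h'] := hg z Dz; eexists; exact: cderM h h'. Qed.

Lemma holV D f : hol D f -> (forall z, D z -> f z != 0) -> hol D (fun z => (f z)^-1).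
Proof. by move=> hf f0 z Dz; have [d h] := hf z Dz; eexists; exact: cderV (f0 z Dz) h. Qed.

Lemma hol_comp D D' f g : hol D g -> hol D' f -> (forall z, D z -> D' (g z)) ->
  hol D (fun z => f (g z)).
Proof. by move=> hg hf gD z Dz; have [d h] := hg z Dz; have [d' h'] := hf _ (gD z Dz); eexists; exact: cder_comp h h'. Qed.

Lemma holX D f n : hol D f -> hol D (fun z => f z ^+ n).
Proof. by move=> hf z Dz; have [d h] := hf z Dz; eexists; exact: cderX h. Qed.

Lemma disk_sub c b r s : nm (b - c) + s <= r -> disk b s `<=` disk c r.
Proof.
move=> h z; rewrite /disk /= => zb; apply: le_lt_trans (le_nm_sub b z c) _.
by lra.
Qed.

Lemma deriv_bound f c r M b : 0 < r -> hol (disk c r) f ->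
  (forall z, disk c r z -> nm (f z) <= M) -> nm (b - c) <= r / 2 ->
  nm (derive1 f b) <= 4 * M / r.
Proof.
move=> r0 hf fM bc.
(* Circles of radius [r / 4] about points at distance at most [r / 2] from [c] stay strictly inside
   the disk, as [cauchy_est] demands; radius [r / 2] could touch the boundary. *)
have -> : 4 * M / r = M / (r / 4) by field; lra.
apply: (cauchy_est hf) fM; first by lra.
by lra.
Qed.

Lemma lip_bound f c r M z w : 0 < r -> hol (disk c r) f ->
  (forall z, disk c r z -> nm (f z) <= M) ->
  nm (z - c) <= r / 2 -> nm (w - c) <= r / 2 ->
  nm (f w - f z) <= 4 * M / r * nm (w - z).
Proof.
move=> r0 hf fM zc wc.
have sin t : 0 <= t <= 1 -> nm (seg z w t - c) <= r / 2.
  exact: (disk_convex (c := c) (r := r / 2) zc wc).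
have := @mvi R f (derive1 f) z w 0 (4 * M / r).
rewrite mul0r subr0; apply=> t t01.
  by apply: (hol_cder hf); rewrite /disk /=; have := sin t t01; lra.
by rewrite subr0; apply: deriv_bound (sin t t01).
Qed.

Lemma disk_half c r : 0 < r -> disk c (r / 2) `<=` disk c r.
Proof. by move=> r0; apply: disk_subset; lra. Qed.

Lemma taylor1 f c r M z : 0 < r -> hol (disk c r) f ->
  (forall z, disk c r z -> nm (f z) <= M) -> nm (z - c) <= r / 4 ->
  nm (f z - f c - derive1 f c * (z - c)) <= 32 * M / r ^+ 2 * nm (z - c) ^+ 2.
Proof.
move=> r0 hf fM zc; have r20 : 0 < r / 2 by lra.
have hf' : hol (disk c (r / 2)) (derive1 f).
  by apply: hol_sub (hol_deriv (@open_disk R c r) hf); exact: disk_half.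
have f'M w : disk c (r / 2) w -> nm (derive1 f w) <= 4 * M / r.
  by rewrite /disk /= => wc; exact: (deriv_bound r0 hf fM (ltW wc)).
(* The constant 32 is that of [lip_bound] for [derive1 f], which is bounded by [4 * M / r] on the
   disk of radius [r / 2]. *)
have k w : nm (w - c) <= r / 4 -> nm (derive1 f w - derive1 f c) <= 32 * M / r ^+ 2 * nm (w - c).
  move=> wc; have -> : 32 * M / r ^+ 2 = 4 * (4 * M / r) / (r / 2) by field; lra.
  have e : r / 2 / 2 = r / 4 by field.
  by apply: (lip_bound r20 hf' f'M); rewrite ?subrr ?nm0 e //; lra.
have M0 : 0 <= 32 * M / r ^+ 2.
  apply: divr_ge0; last by rewrite exprn_ge0 // ltW.
  apply: mulr_ge0 => //.
  by apply: le_trans (nm_ge0 (f c)) (fM c _); exact: disk_center.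
rewrite expr2 mulrA; apply: (mvi (f := derive1 f)) => t t01.
  apply: (hol_cder hf); rewrite /disk /=; have := nm_seg c z t01.
  by lra.
apply: le_trans (k _ _) _; first by apply: le_trans (nm_seg c z t01) _.
by rewrite ler_wpM2l // nm_seg.
Qed.

Lemma local_bound D f c : open D -> hol D f -> D c ->
  exists r M, [/\ 0 < r, disk c r `<=` D & forall z, disk c r z -> nm (f z) <= M].
Proof.
move=> /openP oD hf Dc; have [r r0 hr] := oD c Dc.
have /ccontP /(_ 1 ltr01)[s s0 hs] := hol_cts hf Dc.
exists (Num.min r s), (nm (f c) + 1); split; first by rewrite lt_min r0.
  by move=> z; rewrite /disk /= lt_min => /andP[zr _]; exact: hr.
move=> z; rewrite /disk /= lt_min => /andP[_ zs]; have := le_nmB (f z) (f c).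
by have := hs z zs; lra.
Qed.

Definition dquot f a z := if z == a then derive1 f a else (f z - f a) / (z - a).

Lemma dquotE f a z : f z - f a = (z - a) * dquot f a z.
Proof.
rewrite /dquot; case: eqVneq => [->|za]; first by rewrite !subrr mul0r.
by rewrite mulrC divfK // subr_eq0.
Qed.

(** Away from [a] this is the quotient rule. At [a] the derivative is half the second derivative:
    subtracting [d2 / 2 * (w - a) ^+ 2] from [f] leaves a function whose derivative differs from
    [derive1 f a] by the quadratically small Taylor remainder of [derive1 f]. This takes the place
    of a theorem on removable singularities. *)
Lemma hol_dquot D f a : open D -> hol D f -> D a -> hol D (dquot f a).
Proof.
move=> oD hf Da z Dz; have [za|za] := eqVneq z a; last first.
  have z0 : z - a != 0 by rewrite subr_eq0.
  eexists; apply: (@cder_near R (fun w => (f w - f a) / (w - a)) _ _ _ (nm (z - a))).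
  - by rewrite nm_gt0.
  - move=> w wz; rewrite /dquot; case: eqVneq => // wa.
    by move: wz; rewrite /disk /= wa nmB ltxx.
  - exact (cder_div (f := fun w => f w - f a) (g := fun w => w - a) z0 (cderB (hol_cder hf Dz) (cder_cst (f a) z)) (cderB (cder_id z) (cder_cst a z))).
rewrite za; have hf' := hol_deriv oD hf.
have [r [M [r0 rD fM]]] := local_bound oD hf' Da.
pose K : R := 32 * M / r ^+ 2.
have K0 : 0 <= K.
  apply: divr_ge0; last by rewrite exprn_ge0 // ltW.
  apply: mulr_ge0 => //.
  by apply: le_trans (nm_ge0 (derive1 f a)) (fM a _); exact: disk_center.
pose d2 := derive1 (derive1 f) a.
exists (d2 / 2); apply/cderP => e e0.
have K1 : 0 < K + 1 by lra.
exists (Num.min (r / 4) (e / (K + 1))).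
  by rewrite lt_min !divr_gt0.
move=> w; rewrite lt_min => /andP[wr we].
have [->|wa] := eqVneq w a; first by rewrite !subrr mulr0 subr0 nm0 mulr0.
have w0 : w - a != 0 by rewrite subr_eq0.
have -> : dquot f a w - dquot f a a - d2 / 2 * (w - a) =
   (f w - d2 / 2 * (w - a) ^+ 2 - (f a - d2 / 2 * (a - a) ^+ 2) - derive1 f a * (w - a)) / (w - a).
  by rewrite /dquot (negbTE wa) eqxx; field.
rewrite nmM nmV ler_pdivrMr ?nm_gt0 //.
apply: le_trans (_ : K * nm (w - a) ^+ 2 * nm (w - a) <= _).
  have E2 : (2 : C) != 0 by rewrite pnatr_eq0.
  apply: (mvi (f := fun z => derive1 f z - d2 * (z - a))
      (F := fun z => f z - d2 / 2 * (z - a) ^+ 2)) => t t01.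
    have h1 := hol_cder (z := seg a w t) hf.
    have Ds : D (seg a w t).
      by apply: rD; rewrite /disk /=; have := nm_seg a w t01; lra.
    have := cderB (h1 Ds) (cderZ (d2 / 2) (cderX 2 (cderB (cder_id _) (cder_cst a _)))).
    congr cder; congr (_ - _); rewrite /= expr1; by field.
  rewrite -addrA -opprD (addrC (d2 * _)) opprD addrA.
  have st := nm_seg a w t01.
  apply: le_trans (taylor1 r0 (hol_sub rD hf') fM _) _; first by lra.
  by rewrite ler_wpM2l // lerXn2r ?nnegrE ?nm_ge0.
have : nm (w - a) * (K + 1) < e by rewrite -ltr_pdivlMr.
have := nm_ge0 (w - a); move: (nm (w - a)) => n n0 hn.
rewrite expr2; have : n * K <= e by nra.
move=> h; have : n * n * (n * K) <= n * n * e by rewrite ler_wpM2l // mulr_ge0.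
by lra.
Qed.

Lemma closed_disk_compact c r : compact [set z | nm (z - c) <= r].
Proof.
pose m : R := `|r| + nm c.
pose sq := [set p : R * R | `[-m, m]%classic p.1 /\ `[-m, m]%classic p.2].
have csq : compact sq.
  exact: (compact_setX (@segment_compact R (-m) m) (@segment_compact R (-m) m)).
pose h (p : R * R) : C := rc p.1 + cI * rc p.2.
have ch p : cts h p.
  apply: (ctsD (f := fun p : R * R => rc p.1) (g := fun p : R * R => cI * rc p.2)).
    exact (cts_rc (f := fun p : R * R => p.1) (@cvg_fst _ _ _ _ _)).
  exact (ctsM (cts_cst cI p) (cts_rc (f := fun p : R * R => p.2) (@cvg_snd _ _ _ _ _))).
apply: (subclosed_compact _ (continuous_compact (continuous_subspaceT ch) csq)).
  have -> : [set z | nm (z - c) <= r] = ~` [set z | r < nm (z - c)].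
    by apply/seteqP; split=> z /=; rewrite leNgt => /negP.
  apply: open_closedC; apply/openP => z /= zr; exists (nm (z - c) - r); first by lra.
  move=> w; rewrite /disk /= => wz; have := le_nm_sub w z c; rewrite (nmB z w); lra.
move=> z /= zr; exists (cRe z, cIm z); last by rewrite /h /= -cplxE.
have zm : nm z <= m.
  have := le_nmB z c; have := ler_norm r; rewrite /m; lra.
split; rewrite /= in_itv /=; rewrite -ler_norml; apply: le_trans zm.
  exact: le_cRe.
exact: le_cIm.
Qed.

Lemma continuous_nm_of (f : C -> C) z : cts f z -> {for z, continuous (fun z => nm (f z))}.
Proof. by move=> cf; exact: (@continuous_comp _ _ _ f nm z cf (@continuous_nm R (f z))). Qed.

Lemma continuous_within (K : set C) (f : C -> R) :
  (forall z, K z -> {for z, continuous f}) -> {within K, continuous f}.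
Proof.
by move=> cf; apply/subspace_continuousP => z Kz; apply: cvg_within_filter; exact: cf.
Qed.

(* If [|h|] had an interior maximum, then [|h|^2 + e |z - c|^2] would violate
   the mean value property of [u h^2 + e (affine)] on a small circle. *)
Lemma max_principle D h c r m : open D -> hol D h -> 0 < r ->
  (forall z, nm (z - c) <= r -> D z) ->
  (forall z, nm (z - c) = r -> nm (h z) <= m) ->
  forall z, nm (z - c) <= r -> nm (h z) <= m.
Proof.
move=> oD hh r0 KD hm z0 z0c.
have m0 : 0 <= m.
  apply: le_trans (nm_ge0 (h (c + rc r))) (hm _ _).
  by rewrite addrC addKr nm_rc gtr0_norm.
suff key e : 0 < e -> nm (h z0) ^+ 2 <= m ^+ 2 + e * r ^+ 2.
  rewrite -(@ler_pXn2r _ 2) ?nnegrE ?nm_ge0 //; apply/ler_addgt0Pl => e e0.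
  have r20 : 0 < r ^+ 2 by rewrite exprn_gt0.
  have := key (e / r ^+ 2); rewrite divr_gt0 // divfK ?gt_eqF // => /(_ isT).
  by rewrite addrC.
move=> e0; pose v z : R := nm (h z) ^+ 2 + e * nm (z - c) ^+ 2.
have cv z : nm (z - c) <= r -> {for z, continuous v}.
  move=> zc; have c1 := continuous_nm_of (hol_cts hh (KD z zc)).
  have c2 : {for z, continuous (fun z => nm (z - c))}.
    by apply: continuous_nm_of; exact (ctsB (cts_id z) (cts_cst c z)).
  exact (ctsRD (ctsRM c1 c1) (ctsRM (ctsR_cst e z) (ctsRM c2 c2))).
have [|b bK bmax] := compact_EVT_max _ (@closed_disk_compact c r) (continuous_within cv).
  by exists z0.
have {}bK : nm (b - c) <= r by move: bK; rewrite inE.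
have {}bmax z : nm (z - c) <= r -> v z <= v b by move=> zr; apply: bmax; rewrite inE.
have vz0 : nm (h z0) ^+ 2 <= v z0 by rewrite lerDl mulr_ge0 ?sqr_ge0 // ltW.
apply: le_trans vz0 (le_trans (bmax _ z0c) _).
have [bc|bc] := eqVneq (nm (b - c)) r.
  by rewrite /v bc lerD2r lerXn2r ?nnegrE ?nm_ge0 ?hm.
have {bc} bc : nm (b - c) < r by rewrite lt_neqAle bc.
exfalso; pose s := (r - nm (b - c)) / 2; have s0 : 0 < s by rewrite /s; lra.
(* A unimodular [u] turns [h b ^+ 2] onto the nonnegative real axis, so that its real part at [b] is
   its modulus. *)
have [u u1 uh] : exists2 u, nm u = 1 & u * h b ^+ 2 = rc (nm (h b) ^+ 2).
  have [hb|hb] := eqVneq (h b) 0.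
    by exists 1; rewrite ?nm1 // hb nm0 !expr0n mulr0.
  have hb0 : nm (h b) != 0 by rewrite nm_eq0.
  exists (cbar (h b) ^+ 2 / rc (nm (h b) ^+ 2)).
    by rewrite nmM nmV nmX nm_cbar nm_rc ger0_norm ?sqr_ge0 // divff // expf_neq0.
  rewrite mulrAC -exprMn (mulrC (cbar _)) mul_cbar expr2 mulfK //.
  by rewrite rc_eq0 expf_neq0.
(* On the circle of radius [s] about [b], [nm (z - c) ^+ 2] is the real part of the affine function
   in the second term. At the center that function exceeds [nm (b - c) ^+ 2] by [s ^+ 2], which is
   the contradiction. *)
pose p z := u * h z ^+ 2 + rc e * (rc (nm (b - c) ^+ 2 + s ^+ 2) + 2 * cbar (b - c) * (z - b)).
have hp : hol (disk c r) p.
  have sub : disk c r `<=` D by move=> z /ltW; exact: KD.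
  apply: holD; first exact: holM (@hol_cst _ u) (holX 2 (hol_sub sub hh)).
  apply: (holM (@hol_cst _ _)); apply: (holD (@hol_cst _ _)).
  by apply: (holM (@hol_cst _ _)); exact: (holB (@hol_id _) (@hol_cst _ _)).
have bs : nm (b - c) + s < r by rewrite /s; lra.
have := mvp hp (ltW s0) bs.
have pb : p b = rc (nm (h b) ^+ 2 + e * (nm (b - c) ^+ 2 + s ^+ 2)).
  by rewrite /p uh subrr mulr0 addr0 -rcM -rcD.
have ple t : cRe (p (b + rc s * cis t)) <= v b.
  set z := b + rc s * cis t.
  have zb : z - b = rc s * cis t by rewrite /z addrC addKr.
  have zc : nm (z - c) <= r.
    apply: ltW; apply: le_lt_trans bs; apply: le_trans (le_nm_sub b z c) _.
    by rewrite addrC lerD2l zb nmM nm_cis nm_rc gtr0_norm // mulr1.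
  apply: le_trans (bmax z zc); rewrite /v /p cReD; apply: lerD.
    apply: le_trans (ler_norm _) (le_trans (le_cRe _) _).
    by rewrite nmM u1 mul1r nmX.
  rewrite cReM cRe_rc cIm_rc mul0r subr0 ler_pM2l //.
  rewrite cReD cRe_rc.
  have -> : z - c = (b - c) + (z - b) by ring.
  have zbs : nm (z - b) ^+ 2 = s ^+ 2.
    by rewrite zb nmM nm_cis nm_rc gtr0_norm // mulr1.
  rewrite -zbs; move: (b - c) (z - b) => x y.
  rewrite !nm_sqr cReD cImD -mulrA cReM; case: x => x1 x2; case: y => y1 y2 /=.
  by rewrite /cRe /cIm /=; lra.
rewrite pb => E.
have cp : cts01 (fun t => p (b + rc s * cis t)).
  move=> t _; apply: (cts_comp (f := fun t => b + rc s * cis t)).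
    exact (ctsD (cts_cst b t) (ctsM (cts_cst (rc s) t) (@cts_cis R t))).
  apply: (hol_cts hp); apply: (disk_sub (b := b) (s := s * 2)).
    by rewrite /s; lra.
  by rewrite /disk /= addrC addKr nmM nm_cis nm_rc gtr0_norm // mulr1; lra.
have : cRe (cint (fun t => p (b + rc s * cis t))) <= v b.
  exact: cint_Re_le cp ple.
rewrite E cRe_rc /v; have : 0 < e * s ^+ 2 by rewrite mulr_gt0 // exprn_gt0.
by lra.
Qed.

End Local.

Section Mapping.
Variable R : realType.
Local Notation C := (Cplane R).
Local Notation nm := (@nm R).
Local Notation rc := (@rc R).
Local Notation cRe := (@cRe R).
Local Notation cIm := (@cIm R).
Local Notation cI := (cI R).
Implicit Types (z w a b c d : C) (x y t s r e m : R) (f F G g h q : C -> C) (D : set C).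

(** * Zeros, open mapping, Hurwitz and Schwarz *)

Lemma hol_neq0_near D f z : open D -> hol D f -> D z -> f z != 0 ->
  exists2 r, 0 < r & forall w, disk z r w -> D w /\ f w != 0.
Proof.
move=> /openP oD hf Dz fz; have [r1 r10 h1] := oD z Dz.
have n0 : 0 < nm (f z) by rewrite nm_gt0.
have /ccontP /(_ _ n0)[r2 r20 h2] := hol_cts hf Dz.
exists (Num.min r1 r2); first by rewrite lt_min r10.
move=> w; rewrite /disk /= lt_min => /andP[w1 w2]; split; first exact: h1.
by apply: contraTneq (h2 w w2) => ->; rewrite sub0r nmN ltxx.
Qed.

Lemma open_neq0 D f : open D -> hol D f -> open [set z | D z /\ f z != 0].
Proof.
move=> oD hf; apply/openP => z [Dz fz]; have [r r0 hr] := hol_neq0_near oD hf Dz fz.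
by exists r.
Qed.

(** If zeros accumulate at [c], repeated use of [dquot] makes [f] divisible by every power of
    [z - c]. The maximum principle bounds the cofactor by [M / s ^+ n] on radius [s = r / 2], so for
    [nm (z - c) <= r / 4] the value [f z] is at most [M / 2 ^+ n] for all [n]. *)
Lemma zero_order f c r : 0 < r -> hol (disk c r) f ->
  (forall z, nm (z - c) <= r / 4 -> f z = 0) \/
  (exists2 s, 0 < s & forall z, 0 < nm (z - c) < s -> f z != 0).
Proof.
move=> r0 hf; have cin : disk c r c by exact: disk_center.
have [|iso] := pselect (exists2 s, 0 < s & forall z, 0 < nm (z - c) < s -> f z != 0).
  by right.
have key n : exists q, hol (disk c r) q /\ forall z, disk c r z -> f z = (z - c) ^+ n * q z.
  elim: n => [|n [q [hq fq]]]; first by exists f; split=> // z _; rewrite mul1r.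
  have [qc|qc] := eqVneq (q c) 0; last first.
    exfalso; apply: iso; have [s s0 hs] := hol_neq0_near (@open_disk R c r) hq cin qc.
    exists s => // z /andP[z0 zs]; have [Dz qz] := hs z zs.
    by rewrite fq // mulf_neq0 // expf_neq0 // -nm_gt0.
  exists (dquot q c); split; first exact: hol_dquot (@open_disk R c r) hq cin.
  move=> z zr; rewrite fq // exprSr -mulrA; congr (_ * _).
  by rewrite -dquotE qc subr0.
left=> z zc; pose s := r / 2; have s0 : 0 < s by rewrite /s; lra.
have sub u : nm (u - c) <= s -> disk c r u by rewrite /disk /= /s; lra.
have [M M0 fM] : exists2 M, 0 < M & forall u, nm (u - c) <= s -> nm (f u) <= M.
  apply: (compact_bound (@closed_disk_compact R c s)) => u us.
  by apply: continuous_nm_of; exact: hol_cts hf (sub u us).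
apply/eqP; rewrite -nm_eq0; apply/eqP/le_anti; rewrite nm_ge0 andbT.
apply/ler_addgt0Pl => e e0; rewrite addr0.
have [n hn] := half_pow_lt (divr_gt0 e0 M0).
have [q [hq fq]] := key n.
have qs u : nm (u - c) <= s -> nm (q u) <= M / s ^+ n.
  apply: (max_principle (@open_disk R c r) hq s0 sub) => v vs.
  rewrite ler_pdivlMr ?exprn_gt0 //; have vr : disk c r v by apply: sub; rewrite vs.
  by have := fM v; rewrite vs lexx fq // nmM nmX vs mulrC; apply.
have zs : nm (z - c) <= s by rewrite /s; lra.
rewrite fq; last exact: sub.
rewrite nmM nmX; apply: le_trans (_ : (s / 2) ^+ n * (M / s ^+ n) <= _).
  apply: ler_pM; rewrite ?exprn_ge0 ?nm_ge0 ?qs // lerXn2r ?nnegrE ?nm_ge0 //.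
    by rewrite divr_ge0 // ltW.
  by rewrite /s; lra.
rewrite expr_div_n mulrACA -mulrA mulrA mulrAC.
have -> : s ^+ n * (2 ^- n / s ^+ n) = 1 / 2 ^+ n.
  by field; rewrite !expf_neq0 // gt_eqF.
by rewrite -ler_pdivlMr // ltW.
Qed.

Lemma conn_clopen D (S : set C) : connected D -> S `<=` D -> S !=set0 -> open S ->
  (forall z, D z -> (forall e, 0 < e -> exists2 w, S w & nm (w - z) < e) -> S z) ->
  forall z, D z -> S z.
Proof.
move=> cD SD S0 oS clS; suff -> : D = S by [].
apply/esym; apply: cD => //.
  by exists S => //; apply/seteqP; split=> z; [move=> Sz; split=> //; exact: SD|case].
exists (closure S); first exact: closed_closure.
apply/seteqP; split=> z; first by move=> Sz; split; [exact: SD|exact: subset_closure].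
move=> [Dz clz]; apply: clS => // e e0.
by have [w [Sw wz]] := clz _ (nbhs_disk z e0); exists w.
Qed.

Lemma identity_theorem D f c r : open D -> connected D -> hol D f -> D c -> 0 < r ->
  (forall z, disk c r z -> f z = 0) -> forall z, D z -> f z = 0.
Proof.
move=> oD cD hf Dc r0 fz.
pose S := [set z | D z /\ exists2 s, 0 < s & forall w, disk z s w -> f w = 0].
suff h : forall z, D z -> S z.
  by move=> z /h[_ [s s0 hs]]; apply: hs; exact: disk_center.
apply: conn_clopen => //.
- by move=> z [].
- by exists c; split=> //; exists r.
- apply/openP => z [Dz [s s0 hs]]; have /openP oD' := oD; have [u u0 hu] := oD' z Dz.
  exists (Num.min u s); first by rewrite lt_min u0.
  move=> w wz; split; first by apply: hu; apply: lt_le_trans wz _; rewrite ge_min lexx.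
  exists (s - nm (w - z)); first by rewrite subr_gt0; apply: lt_le_trans wz _; rewrite ge_min lexx orbT.
  by move=> v vw; apply: hs; apply: (disk_sub (b := w) _ vw); lra.
move=> z Dz cl; split=> //; have /openP oD' := oD; have [u u0 hu] := oD' z Dz.
have [h|[s s0 hs]] := zero_order u0 (hol_sub hu hf).
  by exists (u / 4); [lra|move=> w wz; apply: h; exact: ltW].
exfalso; have [w [Dw [v v0 hv]] wz] := cl s s0.
pose k := Num.min v (s - nm (w - z)) / 2.
have m0 : 0 < Num.min v (s - nm (w - z)) by rewrite lt_min v0 subr_gt0.
have k0 : 0 < k by rewrite /k; lra.
have kv : k < v.
  by apply: lt_le_trans (_ : k + k <= v); [lra|rewrite -splitr ge_min lexx].
have ks : nm (w - z) + k < s.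
  have : k + k <= s - nm (w - z) by rewrite -splitr ge_min lexx orbT.
  by lra.
have [b [b1 b2]] : exists b, nm (b - w) < v /\ 0 < nm (b - z) < s.
  have [wz0|wz0] := eqVneq w z.
    exists (z + rc k); rewrite wz0 (_ : z + rc k - z = rc k); last by ring.
    rewrite nm_rc gtr0_norm //; split=> //; rewrite k0 /=.
    by have := nm_ge0 (w - z); lra.
  by exists w; rewrite subrr nm0 nm_gt0 subr_eq0 wz0 wz.
by have := hs b b2; rewrite hv // eqxx.
Qed.

Lemma circle_min D f c r : open D -> hol D f -> 0 < r ->
  (forall z, nm (z - c) <= r -> D z) -> (forall z, nm (z - c) = r -> f z != 0) ->
  exists2 m, 0 < m & forall z, nm (z - c) = r -> m <= nm (f z).
Proof.
move=> oD hf r0 KD f0.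
have h : cts01 (fun t => f (c + rc r * cis t)).
  move=> t _; apply: (cts_comp (f := fun t => c + rc r * cis t)).
    exact (ctsD (cts_cst c t) (ctsM (cts_cst (rc r) t) (@cts_cis R t))).
  apply: (hol_cts hf); apply: KD.
  by rewrite addrC addKr nmM nm_cis nm_rc gtr0_norm // mulr1.
pose K := [set z : C | nm (z - c) = r].
have cK : compact K.
  apply: (subclosed_compact _ (@closed_disk_compact R c r)); last by move=> z /= ->.
  have -> : K = (fun z => nm (z - c)) @^-1` [set r] by [].
  apply: preimage_closed; last exact: (accessible_closed_set1 (hausdorff_accessible (@Rhausdorff R))).
  by move=> z _; exact (@continuous_nm_of R (fun z => z - c) z (ctsB (cts_id z) (cts_cst c z))).
apply: (compact_lbound (K := K) cK) => z Kz.
  by apply: continuous_nm_of; apply: (hol_cts hf); apply: KD; rewrite Kz.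
by rewrite nm_gt0; exact: f0.
Qed.

(** A zero-free [g] would have an inverse that is larger at the center than on the circle, against
    the maximum principle. This does the work of the argument principle in all that follows. *)
Lemma hurwitz_disk D g c r m : open D -> hol D g -> 0 < r -> 0 < m ->
  (forall z, nm (z - c) <= r -> D z) ->
  (forall z, nm (z - c) = r -> m <= nm (g z)) -> nm (g c) < m ->
  exists2 z, nm (z - c) < r & g z = 0.
Proof.
move=> oD hg r0 m0 KD gm gc; have [//|nz] := pselect (exists2 z, nm (z - c) < r & g z = 0).
have g0 z : nm (z - c) <= r -> g z != 0.
  rewrite le_eqVlt => /orP[/eqP zr|zr].
    by rewrite -nm_gt0; apply: lt_le_trans (gm z zr).
  by apply/eqP => gz; apply: nz; exists z.
have hV : hol [set z | D z /\ g z != 0] (fun z => (g z)^-1).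
  by apply: holV => [|z []//]; apply: hol_sub hg => z [].
have := max_principle (m := m^-1) (open_neq0 oD hg) hV r0.
have cc : nm (c - c) <= r by rewrite subrr nm0 ltW.
move=> /(_ c _ _ c cc) h; exfalso.
have : nm (g c)^-1 <= m^-1.
  apply: h => z zr; first by split; [exact: KD|exact: g0].
  by rewrite nmV lef_pV2 ?posrE ?gm // nm_gt0 g0 // zr.
by rewrite nmV lef_pV2 ?posrE ?nm_gt0 ?g0 // leNgt gc.
Qed.

Lemma good_circle D f c s : open D -> hol D f -> D c -> 0 < s ->
  ~ (exists2 r, 0 < r & forall z, disk c r z -> f z = 0) ->
  exists r, [/\ 0 < r, r < s, forall z, nm (z - c) <= r -> D z &
    forall z, nm (z - c) = r -> f z != 0].
Proof.
move=> oD hf Dc s0 nl; have /openP oD' := oD; have [u u0 hu] := oD' c Dc.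
have [h|[v v0 hv]] := zero_order u0 (hol_sub hu hf).
  exfalso; apply: nl; exists (u / 4); first by lra.
  by move=> z zc; apply: h; exact: ltW.
pose k := Num.min (Num.min u v) s / 2.
have m0 : 0 < Num.min (Num.min u v) s by rewrite !lt_min u0 v0.
have k0 : 0 < k by rewrite /k; lra.
have [ku kv ks] : [/\ k < u, k < v & k < s].
  have : k < Num.min (Num.min u v) s by rewrite /k; lra.
  by rewrite !lt_min => /andP[/andP[]].
exists k; split=> // z zc; first by apply: hu; apply: le_lt_trans zc ku.
by apply: hv; rewrite zc k0.
Qed.

(** On a small circle [f - f c] is at least [m] in modulus. For [w] within [m / 2] of [f c], [f - w]
    is then at least [m / 2] on the circle and smaller at the center, so [hurwitz_disk] applies. *)
Lemma open_map D f c s : open D -> hol D f -> D c -> 0 < s ->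
  ~ (exists2 r, 0 < r & forall z, disk c r z -> f z = f c) ->
  exists2 e, 0 < e & forall w, disk (f c) e w -> exists z, [/\ disk c s z, D z & f z = w].
Proof.
move=> oD hf Dc s0 nl.
have hg w : hol D (fun z => f z - w) := holB hf (@hol_cst R D w).
have [|r [r0 rs KD fr]] := good_circle oD (hg (f c)) Dc s0.
  move=> [r r0 hr]; apply: nl; exists r => // z /hr /eqP.
  by rewrite subr_eq0 => /eqP.
have [m m0 hm] := circle_min oD (hg (f c)) r0 KD fr.
exists (m / 2); first by lra.
move=> w; rewrite /disk /= => wf.
have [] := hurwitz_disk oD (hg w) r0 (_ : 0 < m / 2) KD.
- by lra.
- by move=> z /hm; have := le_nm_sub w (f z) (f c); lra.
- by rewrite nmB.
move=> z zr /eqP; rewrite subr_eq0 => /eqP fz; exists z; split=> //.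
  by apply: lt_trans zr rs.
by apply: KD; exact: ltW.
Qed.

Lemma hol_cst_near D f g : open D -> connected D -> hol D f -> hol D g ->
  (exists c r, [/\ D c, 0 < r & forall z, disk c r z -> f z = g z]) ->
  forall z, D z -> f z = g z.
Proof.
move=> oD cD hf hg [c [r [Dc r0 fg]]] z Dz; apply/eqP; rewrite -subr_eq0; apply/eqP.
apply: (identity_theorem oD cD (holB hf hg) Dc r0) => // w wc.
by rewrite fg // subrr.
Qed.

Lemma strong_max D f c : open D -> connected D -> hol D f -> D c ->
  (forall z, D z -> nm (f z) <= nm (f c)) -> forall z, D z -> f z = f c.
Proof.
move=> oD cD hf Dc fM; apply: (hol_cst_near oD cD hf (@hol_cst R D (f c))).
have [[r r0 hr]|nl] := pselect (exists2 r, 0 < r & forall z, disk c r z -> f z = f c).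
  by exists c, r.
exfalso; have [e e0 he] := open_map oD hf Dc ltr01 nl.
have [fc|fc] := eqVneq (f c) 0.
  have [|z [_ Dz fz]] := he (f c + rc (e / 2)).
    by rewrite /disk /= addrC addKr nm_rc gtr0_norm; lra.
  by have := fM z Dz; rewrite fz fc add0r nm0 nm_rc gtr0_norm; lra.
pose k := e / (2 * nm (f c)); have n0 : 0 < nm (f c) by rewrite nm_gt0.
have k0 : 0 < k by rewrite divr_gt0 // mulr_gt0.
have [|z [_ Dz fz]] := he (f c * rc (1 + k)).
  rewrite /disk /=; have -> : f c * rc (1 + k) - f c = f c * rc k by rewrite rcD rc1; ring.
  rewrite nmM nm_rc gtr0_norm // /k.
  have -> : nm (f c) * (e / (2 * nm (f c))) = e / 2 by field; lra.
  by lra.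
have := fM z Dz; rewrite fz nmM nm_rc gtr0_norm; last by lra.
by rewrite ger_pMr // => h; lra.
Qed.

Lemma disk_connected c r : connected (disk c r).
Proof.
have [r0|r0] := ltP 0 r; last first.
  have -> : disk c r = set0; last exact: connected0.
  apply/seteqP; split=> // z; rewrite /disk /= => h.
  by have := nm_ge0 (z - c); lra.
have -> : disk c r = \bigcup_(z in disk c r) (seg c z @` `[0, 1]%classic).
  apply/seteqP; split=> z.
    move=> zc; exists z => //; exists 1; last by rewrite seg1.
    by rewrite /= in_itv /= ler01 lexx.
  move=> [w wc [t]]; rewrite /= in_itv /= => t01 <-.
  by apply: le_lt_trans wc; exact: nm_seg.
apply: bigcup_connected.
  exists c => z zc; exists 0; last by rewrite seg0.
  by rewrite /= in_itv /= lexx ler01.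
move=> z zc; apply: connected_continuous_connected; first exact: segment_connected.
by apply: continuous_subspaceT => t; exact: cts_seg.
Qed.

Lemma schwarz_le f : hol (disk 0 1) f -> (forall z, disk 0 1 z -> disk 0 1 (f z)) ->
  f 0 = 0 -> forall z, disk 0 1 z -> nm (dquot f 0 z) <= 1.
Proof.
move=> hf f1 f0 z z1; have o0 : disk 0 1 (0 : C) by exact: disk_center.
have hq := hol_dquot (@open_disk R 0 1) hf o0.
apply/ler_addgt0Pl => e e0; rewrite /disk /= subr0 in z1.
(* The first entry puts [z] inside the circle of radius [r < 1]; the second makes the bound [r^-1]
   valid on that circle at most [1 + e]. *)
pose r := Num.max ((1 + nm z) / 2) (1 + e)^-1.
have r0 : 0 < r by rewrite lt_max; have := nm_ge0 z => ?; rewrite divr_gt0 //; lra.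
have r1 : r < 1 by rewrite gt_max invf_lt1; [apply/andP; split; lra|lra].
have zr : nm (z - 0) <= r by rewrite subr0 le_max; apply/orP; left; lra.
have KD w : nm (w - 0) <= r -> disk 0 1 w by move=> h; apply: le_lt_trans h r1.
apply: (max_principle (@open_disk R 0 1) hq r0 KD) zr => w wr.
have := dquotE f 0 w; rewrite f0 !subr0 => E.
have wD : disk 0 1 w by apply: KD; rewrite wr.
have := f1 w wD; rewrite /disk /= subr0 E nmM -[w in nm w]subr0 wr => h.
have : (1 + e)^-1 <= r by rewrite le_max lexx orbT.
have e1 : 0 < 1 + e by lra.
rewrite -(@ler_pM2l _ (1 + e)) // divff ?gt_eqF // => h2.
by have := nm_ge0 (dquot f 0 w); rewrite addrC; nra.
Qed.

Lemma schwarz f : hol (disk 0 1) f -> (forall z, disk 0 1 z -> disk 0 1 (f z)) ->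
  f 0 = 0 -> forall z, disk 0 1 z -> nm (f z) <= nm z.
Proof.
move=> hf f1 f0 z z1; have := dquotE f 0 z; rewrite f0 !subr0 => ->.
by rewrite nmM ler_piMr ?nm_ge0 //; exact: schwarz_le.
Qed.

Lemma schwarz_eq f : hol (disk 0 1) f -> (forall z, disk 0 1 z -> disk 0 1 (f z)) ->
  f 0 = 0 -> (exists z, [/\ disk 0 1 z, z != 0 & nm (f z) = nm z]) ->
  exists2 k, nm k = 1 & forall z, disk 0 1 z -> f z = k * z.
Proof.
move=> hf f1 f0 [z0 [z01 z00 fz]].
have o0 : disk 0 1 (0 : C) by exact: disk_center.
have hq := hol_dquot (@open_disk R 0 1) hf o0.
have E z : f z = z * dquot f 0 z by have := dquotE f 0 z; rewrite f0 !subr0.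
have k1 : nm (dquot f 0 z0) = 1.
  apply: (mulfI (x := nm z0)); first by rewrite nm_eq0.
  by rewrite -nmM -E fz mulr1.
exists (dquot f 0 z0) => // z z1; rewrite E mulrC; congr (_ * _).
apply: (strong_max (@open_disk R 0 1) (@disk_connected 0 1) hq z01 _ z1) => w w1.
by rewrite k1; exact: schwarz_le.
Qed.

End Mapping.

Section Lifting.
Variable R : realType.
Local Notation C := (Cplane R).
Local Notation nm := (@nm R).
Local Notation rc := (@rc R).
Local Notation cRe := (@cRe R).
Local Notation cIm := (@cIm R).
Local Notation cI := (cI R).
Implicit Types (z w a b c d : C) (x y t s r e m : R) (f F G g h q : C -> C) (D : set C).

(** * Inverse functions *)

(** Of the lift [k] only continuity is assumed; a nonzero derivative of [p] then makes it
    differentiable. Both inverse functions and logarithms are obtained in this way. *)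
Lemma cder_lift p h k z d d' r : cts k z -> 0 < r ->
  (forall w, disk z r w -> p (k w) = h w) ->
  cder p (k z) d -> d != 0 -> cder h z d' -> cder k z (d' / d).
Proof.
move=> ck r0 pk [phi [cphi phiz pE]] d0 [psi [cpsi psiz hE]].
have cq : cts (fun w => phi (k w)) z by exact (cts_comp ck cphi).
have q0 : phi (k z) != 0 by rewrite phiz.
have kd : cder (fun w => k z + psi w / phi (k w) * (w - z)) z (d' / d).
  exists (fun w => psi w / phi (k w)); split.
  - exact (ctsM cpsi (ctsV q0 cq)).
  - by rewrite psiz phiz.
  - by move=> w; rewrite subrr mulr0 addr0 addrC addKr.
have n0 : 0 < nm (phi (k z)) by rewrite nm_gt0.
have /ccontP /(_ _ n0)[s s0 hs] := cq.
apply: (cder_near (r := Num.min r s)) kd; first by rewrite lt_min r0.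
move=> w; rewrite /disk /= lt_min => /andP[wr ws].
have qw : phi (k w) != 0.
  by apply: contraTneq (hs w ws) => ->; rewrite sub0r nmN ltxx.
have zr : disk z r z by exact: disk_center.
have := pE (k w); rewrite pk // pk // hE => E.
by rewrite mulrAC E mulrC mulKf // addrC subrK.
Qed.

Definition inj_on D f := forall z w, D z -> D w -> f z = f w -> z = w.

Lemma inj_not_cst D f c : open D -> D c -> inj_on D f ->
  ~ (exists2 r, 0 < r & forall z, disk c r z -> f z = f c).
Proof.
move=> /openP oD Dc fi [r r0 hr]; have [s s0 hs] := oD c Dc.
pose k := Num.min r s / 2.
have m0 : 0 < Num.min r s by rewrite lt_min r0.
have k0 : 0 < k by rewrite /k; lra.
have [kr ks] : k < r /\ k < s.
  have : k < Num.min r s by rewrite /k; lra.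
  by rewrite lt_min => /andP[].
have E : nm (c + rc k - c) = k by rewrite addrC addKr nm_rc gtr0_norm.
have h1 : disk c r (c + rc k) by rewrite /disk /= E.
have h2 : disk c s (c + rc k) by rewrite /disk /= E.
have := fi _ _ (hs _ h2) Dc (hr _ h1).
by move/eqP; rewrite -subr_eq0 -nm_eq0 E gt_eqF.
Qed.

(* If [f' a = 0], Hurwitz gives zeros of [dquot f b] near [a] for every [b]
   close to [a]; injectivity forces them to be at [b], so [f'] vanishes near [a]. *)
Lemma inj_deriv_neq0 D f a : open D -> hol D f -> inj_on D f -> D a -> derive1 f a != 0.
Proof.
move=> oD hf fi Da; apply/negP => /eqP fa0.
have ncst := inj_not_cst oD Da fi.
have hq := hol_dquot oD hf Da.
have qnl : ~ (exists2 r, 0 < r & forall z, disk a r z -> dquot f a z = 0).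
  move=> [r r0 hr]; apply: ncst; exists r => // z /hr qz; apply/eqP.
  by rewrite -subr_eq0 dquotE qz mulr0.
have [r [r0 _ KD qr]] := good_circle oD hq Da ltr01 qnl.
have [m m0 hm] := circle_min oD hq r0 KD qr.
have [M M0 fM] : exists2 M, 0 < M & forall u, nm (u - a) <= r -> nm (f u) <= M.
  apply: (compact_bound (@closed_disk_compact R a r)) => u us.
  by apply: continuous_nm_of; exact: hol_cts hf (KD u us).
have fd := hol_cder hf Da; rewrite fa0 in fd.
have m2 : 0 < m / 4 by lra.
have /cderP /(_ _ m2)[s1 s10 hs1] := fd.
(* On the circle, the numerator of [dquot f b - dquot f a] is at most
   [e * r + 2 * M * e2 = m * r ^+ 2 / 4] and its denominator at least [r ^+ 2 / 2]. So the quotients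
   differ by at most [m / 2], half of the lower bound for [dquot f a]. *)
pose e := m * r / 8; have e0 : 0 < e by rewrite /e; nra.
have /ccontP /(_ _ e0)[s2 s20 hs2] := hol_cts hf Da.
pose e2 := m * r ^+ 2 / (16 * M).
have c5 : 2 * M * e2 = m * r ^+ 2 / 8 by rewrite /e2; field; rewrite gt_eqF.
have e20 : 0 < e2 by rewrite /e2 divr_gt0 ?mulr_gt0 ?exprn_gt0.
have [k k0 hk] : exists2 k, 0 < k & forall b, disk a k b ->
   [/\ nm (b - a) < s1, nm (b - a) < s2, nm (b - a) < r / 2 & nm (b - a) < e2].
  exists (Num.min (Num.min s1 s2) (Num.min (r / 2) e2)).
    by rewrite !lt_min s10 s20 e20 divr_gt0.
  by move=> b; rewrite /disk /= !lt_min => /andP[/andP[? ?] /andP[? ?]]; split.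
have fb0 b : disk a k b -> derive1 f b = 0.
  move=> bk; have [b1 b2 b3 b4] := hk b bk.
  have Db : D b by apply: KD; lra.
  have [z zr qz] : exists2 z, nm (z - a) < r & dquot f b z = 0.
    apply: (hurwitz_disk (m := m / 2) oD (hol_dquot oD hf Db) r0 _ KD); first by lra.
    - move=> z zr; have za : z - a != 0 by rewrite -nm_gt0 zr.
      have zbn : r / 2 <= nm (z - b).
        by have := le_nm_sub b z a; rewrite zr; lra.
      have zb : z - b != 0 by rewrite -nm_gt0; lra.
      have zna : z == a = false by apply/negP => /eqP h; move: za; rewrite h subrr eqxx.
      have znb : z == b = false by apply/negP => /eqP h; move: zb; rewrite h subrr eqxx.
      have := hm z zr; move E1 : (dquot f a z) => q1; move E2 : (dquot f b z) => q2 hmz.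
      have : nm (q2 - q1) <= m / 2.
        have -> : q2 - q1 = ((f a - f b) * (z - a) + (f z - f a) * (b - a)) / ((z - b) * (z - a)).
          by rewrite -E1 -E2 /dquot zna znb; field; rewrite za zb.
        rewrite nmM nmV nmM zr ler_pdivrMr; last by rewrite mulr_gt0 //; lra.
        apply: le_trans (le_nmD _ _) _; rewrite !nmM zr.
        have c1 : nm (f a - f b) <= e by rewrite nmB ltW // hs2.
        have c2 : nm (f z - f a) <= 2 * M.
          apply: le_trans (le_nmD _ _) _; rewrite nmN.
          have := fM z; rewrite zr lexx => /(_ isT).
          by have := fM a; rewrite subrr nm0 => /(_ (ltW r0)); lra.
        have c3 : nm (f a - f b) * r <= e * r by rewrite ler_wpM2r // ltW.
        have c4 : nm (f z - f a) * nm (b - a) <= 2 * M * e2.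
          by rewrite ler_pM ?nm_ge0 // ltW.
        have c6 : m / 2 * (r / 2 * r) <= m / 2 * (nm (z - b) * r).
          by rewrite ler_pM2l; [rewrite ler_pM2r|lra].
        by move: c3; rewrite /e; lra.
      have := le_nmB q1 q2; rewrite (nmB q1); lra.
    - rewrite /dquot; case: eqVneq => [<-|ab].
        by rewrite fa0 nm0; lra.
      have ab0 : a - b != 0 by rewrite subr_eq0.
      rewrite nmM nmV ltr_pdivrMr ?nm_gt0 // nmB (nmB a).
      have := hs1 b b1; rewrite mul0r subr0 => h; apply: le_lt_trans h _.
      by rewrite ltr_pM2r; [lra|rewrite nmB nm_gt0].
  have [zb|zb] := eqVneq z b; first by move: qz; rewrite zb /dquot eqxx.
  have := dquotE f b z; rewrite qz mulr0 => /eqP; rewrite subr_eq0 => /eqP h.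
  have Dz : D z by apply: KD; lra.
  have zb' : z = b := fi z b Dz Db h.
  by exfalso; move: zb; rewrite zb' eqxx.
apply: ncst; exists k => // z zk; apply/eqP; rewrite -subr_eq0 -nm_eq0; apply/eqP/le_anti.
rewrite nm_ge0 andbT.
have sk t : 0 <= t <= 1 -> disk a k (seg a z t).
  by move=> t01; apply: le_lt_trans (nm_seg a z t01) _.
have sD t : 0 <= t <= 1 -> D (seg a z t).
  by move=> /sk /hk[_ _ h _]; apply: KD; lra.
have := @mvi R f (derive1 f) a z 0 0; rewrite !mul0r subr0; apply=> t t01.
  exact: hol_cder hf (sD t t01).
by rewrite fb0 ?subr0 ?nm0 //; exact: sk.
Qed.

Lemma inv_cts D f g w : open D -> hol D f -> inj_on D f ->
  (forall z, D z -> g (f z) = z) -> (f @` D) w ->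
  exists2 r, 0 < r & disk w r `<=` f @` D /\ cts g w.
Proof.
move=> oD hf fi gf [a Da <-]; have ncst := inj_not_cst oD Da fi.
have [e e0 he] := open_map oD hf Da ltr01 ncst; exists e => //; split.
  by move=> w' /he[z [_ Dz <-]]; exists z.
apply/ccontP => s s0; have [k k0 hk] := open_map oD hf Da s0 ncst; exists k => // w' wk.
by have [z [zs Dz <-]] := hk w' wk; rewrite !gf.
Qed.

Lemma open_image D f : open D -> hol D f -> inj_on D f -> open (f @` D).
Proof.
move=> oD hf fi; apply/openP => w [a Da <-].
have [e e0 he] := open_map oD hf Da ltr01 (inj_not_cst oD Da fi).
by exists e => // w' /he[z [_ Dz <-]]; exists z.
Qed.

Lemma hol_inv D f g : open D -> hol D f -> inj_on D f ->
  (forall z, D z -> g (f z) = z) -> hol (f @` D) g.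
Proof.
move=> oD hf fi gf w wf; have [r r0 [rD cg]] := inv_cts oD hf fi gf wf.
have [a Da aw] := wf; have gw : g w = a by rewrite -aw gf.
exists (1 / derive1 f a); apply: (cder_lift (p := f) (h := id) cg r0).
- by move=> w' /rD[z Dz <-]; rewrite gf.
- by rewrite gw; exact (hol_cder hf Da).
- exact: inj_deriv_neq0 oD hf fi Da.
- exact: cder_id.
Qed.

(** * Logarithms *)

Lemma cos_int_period y (n : int) : cos (y + 2 * pi * n%:~R) = cos y :> R.
Proof.
have E (k : nat) (a : R) : cos (a + 2 * pi * k%:R) = cos a :> R.
  have -> : 2 * pi * k%:R = (pi *+ 2) *+ k :> R by rewrite mulr_natr mulr_natl.
  exact: (periodicn (@cosD2pi R) k a).
case: n => k; first exact: E.
rewrite NegzE mulrNz mulrN; have := E k.+1 (y - 2 * pi * k.+1%:R).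
by rewrite subrK.
Qed.

Lemma cos_eq1 y : cos y = 1 :> R -> exists n : int, y = 2 * pi * n%:~R.
Proof.
move=> cy; have p0 : 0 < pi :> R := pi_gt0 R.
have p20 : 0 < 2 * pi :> R by lra.
(* Reduces [y] to [y'] in [[0, 2 * pi[]; injectivity of the cosine on [[0, pi]] then applies to [y']
   or to [2 * pi - y']. *)
pose n := Num.floor (y / (2 * pi)); exists n.
pose y' := y + 2 * pi * (- n)%:~R.
have cy' : cos y' = 1 by rewrite /y' cos_int_period.
have yE : y' = y - 2 * pi * n%:~R by rewrite /y' mulrNz mulrN.
have y0 : 0 <= y'.
  have := Num.Theory.ge_floor (y / (2 * pi)); rewrite -/n ler_pdivlMr // yE; lra.
have y2 : y' < 2 * pi.
  have := lt_succ_floor (y / (2 * pi)); rewrite -/n ltr_pdivrMr // intrD yE; lra.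
suff : y' = 0 by rewrite yE => /eqP; rewrite subr_eq0 => /eqP.
have i0 : (0 : R) \in `[0, pi] by rewrite in_itv /= lexx ltW.
have [yp|yp] := leP y' pi.
  by apply: cos_inj; rewrite ?cos0 ?cy' // in_itv /= y0.
have h : 2 * pi - y' = 0.
  apply: cos_inj; rewrite ?i0 //; first by rewrite in_itv /=; apply/andP; split; lra.
  have h1 := cos_int_period (- y') 1; rewrite mulr1 cosN cy' in h1.
  transitivity (cos (- y' + 2 * pi)); first by congr cos; ring.
  by rewrite h1 cos0.
by move: y2; lra.
Qed.

Lemma cexp_eq1 w : cexp w = 1 -> exists n : int, w = rc (2 * pi * n%:~R) * cI.
Proof.
move=> h; have : nm (cexp w) = 1 by rewrite h nm1.
rewrite nm_cexp -expR0 => /expR_inj w0.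
have : cRe (cexp w) = 1 by rewrite h.
rewrite cRe_cexp w0 expR0 mul1r => /cos_eq1[n wn]; exists n.
by apply: cplx_eq; rewrite ?cRe_iM ?cIm_iM.
Qed.

Lemma cexp_2pi (n : int) : cexp (rc (2 * pi * n%:~R) * cI) = 1.
Proof.
have c1 : cos (2 * pi * n%:~R) = 1 :> R.
  by have := cos_int_period 0 n; rewrite add0r cos0.
apply: cplx_eq; rewrite ?cRe_cexp ?cIm_cexp cRe_iM cIm_iM expR0 mul1r //.
by apply: cos1sin0; rewrite c1 normr1.
Qed.

Lemma cexp_surj z : z != 0 -> exists w, cexp w = z.
Proof.
move=> z0; have n0 : 0 < nm z by rewrite nm_gt0.
pose x := cRe z / nm z; pose y := cIm z / nm z.
have xy : x ^+ 2 + y ^+ 2 = 1.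
  rewrite /x /y !expr_div_n -mulrDl -nm_sqr divff // expf_neq0 // gt_eqF //.
have x1 : -1 <= x <= 1.
  by have := sqr_ge0 y; have := sqr_ge0 (x - 1); have := sqr_ge0 (x + 1) => *; apply/andP; split; nra.
have [th [cth sth]] : exists th : R, cos th = x /\ sin th = y.
  have [y0|y0] := leP 0 y.
    exists (acos x); rewrite acosK ?in_itv // sin_acos //; split=> //.
    by rewrite -xy addrC addKr sqrtr_sqr ger0_norm.
  exists (- acos x); rewrite cosN acosK ?in_itv // sinN sin_acos //; split=> //.
  by rewrite -xy addrC addKr sqrtr_sqr ltr0_norm // opprK.
have ReE (a b : R) : cRe (rc a + cI * rc b) = a.
  by rewrite cReD cReM !cRe_rc !cIm_rc cRe_I mul0r mulr0 subr0 addr0.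
have ImE (a b : R) : cIm (rc a + cI * rc b) = b.
  by rewrite cImD cImM cRe_rc !cIm_rc cRe_I cIm_I mul0r mul1r !add0r.
exists (rc (ln (nm z)) + cI * rc th).
apply: cplx_eq; rewrite ?cRe_cexp ?cIm_cexp ReE ImE lnK ?posrE //.
  by rewrite cth /x mulrC divfK // gt_eqF.
by rewrite sth /y mulrC divfK // gt_eqF.
Qed.

(** A primitive of [z^-1] on a convex disk that omits [0], normalized at [1]; the derivative of
    [cexp (L z) / z] vanishes. All later logarithms are continued by applying [L] to quotients close
    to [1]. *)
Lemma plog_ex : exists L : C -> C, L 1 = 0 /\
  forall z, disk 1 1 z -> cts L z /\ cexp (L z) = z.
Proof.
have nz z : disk 1 1 z -> z != 0.
  by move=> h; apply/eqP => z0; have : nm (z - 1) < 1 := h; rewrite z0 sub0r nmN nm1 ltxx.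
have hV : hol (disk 1 1) (fun z => z^-1) by apply: holV; [exact: hol_id|exact: nz].
have [L0 dL] := primitive_convex (@open_disk R 1 1) (@open_disk_convex R 1 1) hV.
pose L z := L0 z - L0 1.
have {}dL z : disk 1 1 z -> cder L z z^-1.
  by move=> /dL h; have := cderB h (cder_cst (L0 1) z); rewrite subr0.
exists L; split; first by rewrite /L subrr.
move=> z z1; split; first exact: cder_cont (dL z z1).
have o1 : disk 1 1 (1 : C) by exact: disk_center.
pose g z := cexp (L z) / z.
have dg w : disk 1 1 w -> cder g w 0.
  move=> w1; have w0 := nz w w1.
  have := cder_div w0 (cder_comp (dL w w1) (cder_cexp _)) (cder_id w).
  by rewrite mulr1 mulfVK // subrr mul0r.
have := @mvi R g (fun _ => 0) 1 z 0 0; rewrite !mul0r !subr0 => h.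
have {}h : nm (g z - g 1) <= 0.
  apply: h => t t01; last by rewrite nm0.
  by apply: dg; exact: open_disk_convex.
have : g z = g 1.
  by apply/eqP; rewrite -subr_eq0 -nm_eq0; apply/eqP/le_anti; rewrite h nm_ge0.
rewrite /g /L subrr cexp0 divr1 => gz; rewrite -[LHS](divfK (nz z z1)).
by rewrite gz mul1r.
Qed.

End Lifting.

Section Topology.
Variable R : realType.
Local Notation C := (Cplane R).
Local Notation nm := (@nm R).
Local Notation rc := (@rc R).
Local Notation cRe := (@cRe R).
Local Notation cIm := (@cIm R).
Local Notation cI := (cI R).
Implicit Types (z w a b c d : C) (x y t s r e m : R) (f F G g h q : C -> C) (D : set C).

(** * Lifting through the exponential *)

Lemma conn_loc_const (T : topologicalType) (K : set T) (f : T -> C) : connected K ->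
  (forall u, K u -> \forall v \near u, K v -> f v = f u) ->
  forall u v, K u -> K v -> f v = f u.
Proof.
move=> cK loc u v Ku Kv.
pose B := [set w | K w /\ f w = f u].
suff BK : B = K by have [] : B v by rewrite BK.
apply: cK; first by exists u.
- exists (interior [set w | K w -> f w = f u]); first exact: open_interior.
  apply/seteqP; split=> w.
    by move=> [Kw fw]; split=> //; rewrite /interior /= -fw; exact: loc.
  by move=> [Kw /interior_subset fw]; split=> //; exact: fw.
- exists (~` interior [set w | K w -> f w <> f u]).
    by apply: open_closedC; exact: open_interior.
  apply/seteqP; split=> w.
    by move=> [Kw fw]; split=> // /interior_subset; apply.
  move=> [Kw nw]; split=> //; apply: contrapT => fw; apply: nw.
  by rewrite /interior /=; apply: filterS (loc w Kw) => v' h Kv'; rewrite h.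
Qed.

Lemma cexp_eq1_small w : nm w < 1 -> cexp w = 1 -> w = 0.
Proof.
move=> w1 /cexp_eq1[n wn]; move: w1; rewrite wn nmM nmI mulr1 nm_rc normrM.
have p1 : 1 <= `|2 * pi : R|.
  by rewrite gtr0_norm ?mulr_gt0 ?pi_gt0 //; have := pi_ge2 R; lra.
have [->|n0] := eqVneq n 0; first by rewrite mulr0 rc0 mul0r.
have n1 : 1 <= `|n%:~R : R|.
  by rewrite -intr_norm -[1]/(1%:~R) ler_int -gtz0_ge1 normr_gt0.
have h1 : 1 * 1 <= `|2 * pi : R| * `|n%:~R : R| by rewrite ler_pM.
by move=> h2; exfalso; move: h1 h2; rewrite mul1r => h1 h2; have := le_lt_trans h1 h2; rewrite ltxx.
Qed.

Lemma lift_const (d : R -> C) : (forall t, cts d t) ->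
  (forall t, 0 <= t <= 1 -> cexp (d t) = 1) -> forall t, 0 <= t <= 1 -> d t = d 0.
Proof.
move=> cd d1 t t01.
have cK : connected [set t : R | 0 <= t <= 1].
  have -> : [set t : R | 0 <= t <= 1] = `[0, 1]%classic.
    by apply/seteqP; split=> u /=; rewrite in_itv.
  exact: segment_connected.
have loc (u : R) : [set t : R | 0 <= t <= 1] u ->
    \forall v \near u, [set t : R | 0 <= t <= 1] v -> d v = d u.
  move=> u01; have /cts_atP /(_ 1 ltr01) := cd u.
  apply: filterS => v h v01; apply/eqP; rewrite -subr_eq0; apply/eqP.
  by apply: cexp_eq1_small h _; rewrite cexpB (d1 v v01) (d1 u u01) divr1.
by apply: (conn_loc_const cK loc) => //; rewrite /= lexx ler01.
Qed.

(** The square is shrunk to its corner in [2 ^ n] proportional steps. By uniform continuity the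
    quotient of two consecutive shrunk copies of [F] has values in [disk 1 1], so adding principal
    logarithms step by step gives a global one, without patching cells of the square. *)
Lemma box_log (F : R * R -> C) : (forall p, cts F p) -> (forall p, F p != 0) ->
  exists l : R * R -> C, (forall p, cts l p) /\
    forall p, 0 <= p.1 <= 1 -> 0 <= p.2 <= 1 -> cexp (l p) = F p.
Proof.
move=> cF F0.
pose K := [set p : R * R | `[0, 1]%classic p.1 /\ `[0, 1]%classic p.2].
have cK : compact K.
  exact: (compact_setX (@segment_compact R 0 1) (@segment_compact R 0 1)).
pose sc s (p : R * R) : R * R := (s * clamp p.1, s * clamp p.2).
have csc s (p : R * R) : {for p, continuous (sc s)}.
  have c1 : {for p, continuous (fun p : R * R => s * clamp p.1)}.
    apply: ctsRM; first exact: ctsR_cst.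
    exact (@continuous_comp _ _ _ (fun p : R * R => p.1) (@clamp R) p (@cvg_fst _ _ _ _ _) (@continuous_clamp R p.1)).
  have c2 : {for p, continuous (fun p : R * R => s * clamp p.2)}.
    apply: ctsRM; first exact: ctsR_cst.
    exact (@continuous_comp _ _ _ (fun p : R * R => p.2) (@clamp R) p (@cvg_snd _ _ _ _ _) (@continuous_clamp R p.2)).
  exact: cvg_pair c1 c2.
have scK s p : 0 <= s <= 1 -> K (sc s p).
  move=> /andP[s0 s1]; have /andP[a0 a1] := clamp01 p.1; have /andP[b0 b1] := clamp01 p.2.
  by split; rewrite /= in_itv /=; apply/andP; split; nra.
have [m m0 hm] : exists2 m, 0 < m & forall p, K p -> m <= nm (F p).
  apply: (compact_lbound cK) => p _; last by rewrite nm_gt0.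
  exact: (@continuous_comp _ _ _ F nm p (cF p) (@continuous_nm R (F p))).
have [r r0 hr] : exists2 r, 0 < r & forall p, K p -> forall q : R * R,
    `|q.1 - p.1| < r -> `|q.2 - p.2| < r -> nm (F q - F p) < m.
  apply: (compact_uniform (P := fun p r => forall q : R * R,
    `|q.1 - p.1| < r -> `|q.2 - p.2| < r -> nm (F q - F p) < m) cK).
    by move=> p s r sr h q q1 q2; apply: h; apply: lt_le_trans sr.
  move=> p _; have m2 : 0 < m / 2 by lra.
  have /cts_atP /(_ _ m2) /nbhs_ballP[d /= d0 hd] := cF p.
  exists (d / 2); first by lra.
  have d2 : 0 < d / 2 by lra.
  have := nbhsx_ballx p _ d2; apply: filterS => v [/= v1 v2] _ q q1 q2.
  apply: le_lt_trans (le_nm_sub (F p) (F q) (F v)) _.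
  have h1 : nm (F v - F p) < m / 2.
    by apply: hd; split; rewrite /ball /=; [move: v1|move: v2];
      rewrite /ball /= => h; apply: lt_trans h _; lra.
  have h2 : nm (F q - F p) < m / 2.
    apply: hd; split; rewrite /ball /=; [move: v1 q1|move: v2 q2]; rewrite /ball /= => h h'.
      have := ler_distD v.1 p.1 q.1; rewrite (distrC v.1 q.1); lra.
    have := ler_distD v.2 p.2 q.2; rewrite (distrC v.2 q.2); lra.
  by rewrite nmB in h1; lra.
have [n hn] := half_pow_lt r0; set N : R := 2 ^+ n in hn.
have N0 : 0 < N by rewrite exprn_gt0.
have [L [L1 LP]] := plog_ex R.
have key k : (k <= 2 ^ n)%N -> exists l : R * R -> C, (forall p, cts l p) /\
    forall p, cexp (l p) = F (sc (k%:R / N) p).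
  elim: k => [_|k IH kN].
    have [l0 hl0] := cexp_surj (F0 (0, 0)); exists (fun _ => l0); split.
      by move=> p; exact: cts_cst.
    by move=> p; rewrite hl0 /sc !mul0r.
  have [l [cl lE]] := IH (ltnW kN).
  have kN1 j : (j <= 2 ^ n)%N -> 0 <= j%:R / N <= 1.
    move=> jn; apply/andP; split; first by rewrite divr_ge0 // ltW.
    by rewrite ler_pdivrMr // mul1r /N -natrX ler_nat.
  pose rat p := F (sc (k.+1%:R / N) p) / F (sc (k%:R / N) p).
  have ratD p : disk 1 1 (rat p).
    have Kp := scK _ p (kN1 k (ltnW kN)).
    rewrite /disk /=; have -> : rat p - 1 =
        (F (sc (k.+1%:R / N) p) - F (sc (k%:R / N) p)) / F (sc (k%:R / N) p).
      by rewrite /rat; field.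
    rewrite nmM nmV ltr_pdivrMr ?nm_gt0 // mul1r.
    apply: lt_le_trans (hm _ Kp); apply: hr => //.
    - have -> : (sc (k.+1%:R / N) p).1 - (sc (k%:R / N) p).1 = clamp p.1 / N.
        by rewrite /sc /= -natr1; field; rewrite gt_eqF.
      have /andP[a0 a1] := clamp01 p.1.
      rewrite ger0_norm ?divr_ge0 // ?ltW //; apply: le_lt_trans hn.
      by rewrite ler_pM2r ?invr_gt0.
    - have -> : (sc (k.+1%:R / N) p).2 - (sc (k%:R / N) p).2 = clamp p.2 / N.
        by rewrite /sc /= -natr1; field; rewrite gt_eqF.
      have /andP[a0 a1] := clamp01 p.2.
      rewrite ger0_norm ?divr_ge0 // ?ltW //; apply: le_lt_trans hn.
      by rewrite ler_pM2r ?invr_gt0.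
  have crat p : cts rat p.
    by apply: ctsM; [|apply: ctsV]; rewrite ?F0 //; exact (cts_comp (csc _ p) (cF _)).
  exists (fun p => l p + L (rat p)); split=> p.
    have [cL _] := LP _ (ratD p).
    exact (ctsD (cl p) (cts_comp (crat p) cL)).
  have [_ EL] := LP _ (ratD p).
  by rewrite cexpD EL lE /rat mulrC divfK.
have [l [cl lE]] := key (2 ^ n)%N (leqnn _).
exists l; split=> // p p1 p2; rewrite lE /sc natrX -/N divff ?gt_eqF // !mul1r.
by rewrite !clamp_id //; case: p p1 p2.
Qed.

Lemma continuous_pairl (c x : R) : {for x, continuous (fun t : R => (t, c))}.
Proof.
have c1 : {for x, continuous (fun t : R => t)} := @cvg_id _ _.
have c2 : {for x, continuous (fun t : R => c)} by exact: cvg_cst.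
exact: cvg_pair c1 c2.
Qed.

Lemma continuous_pairr (c x : R) : {for x, continuous (fun t : R => (c, t))}.
Proof.
have c1 : {for x, continuous (fun t : R => t)} := @cvg_id _ _.
have c2 : {for x, continuous (fun t : R => c)} by exact: cvg_cst.
exact: cvg_pair c2 c1.
Qed.

Lemma path_log (g : R -> C) : (forall t, cts g t) -> (forall t, g t != 0) ->
  exists l : R -> C, (forall t, cts l t) /\ forall t, 0 <= t <= 1 -> cexp (l t) = g t.
Proof.
move=> cg g0; have [|p|l [cl lE]] := @box_log (fun p => g p.1).
- move=> p; exact (cts_comp (f := fun p : R * R => p.1) (@cvg_fst _ _ _ _ _) (cg p.1)).
- exact: g0.
exists (fun t => l (t, 0)); split=> [t|t t01]; last by rewrite lE //= lexx ler01.
exact (cts_comp (f := fun t : R => (t, 0 : R)) (@continuous_pairl 0 t) (cl _)).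
Qed.

(** For a logarithm [L] of [F], the increment [L (s, 1) - L (s, 0)] is continuous in [s] with values
    in multiples of the period, hence constant; at [s = 1] the loop is constant and the increment
    zero. *)
Lemma homotopy_closed (F : R * R -> C) (l : R -> C) :
  (forall p, cts F p) -> (forall p, F p != 0) ->
  (forall s, 0 <= s <= 1 -> F (s, 0) = F (s, 1)) ->
  (forall t, 0 <= t <= 1 -> F (1, t) = F (1, 0)) ->
  (forall t, cts l t) -> (forall t, 0 <= t <= 1 -> cexp (l t) = F (0, t)) ->
  l 1 = l 0.
Proof.
move=> cF F0 Fs Ft cl lE; have [L [cL LE]] := box_log cF F0.
have z01 : 0 <= (0 : R) <= 1 by rewrite lexx ler01.
have o01 : 0 <= (1 : R) <= 1 by rewrite lexx ler01.
have c1 t0 s : cts (fun s => L (s, t0)) s.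
  exact (cts_comp (f := fun s : R => (s, t0)) (@continuous_pairl t0 s) (cL _)).
have c2 s0 t : cts (fun t => L (s0, t)) t.
  exact (cts_comp (f := fun t : R => (s0, t)) (@continuous_pairr s0 t) (cL _)).
have d1 : L (1, 1) - L (1, 0) = L (0, 1) - L (0, 0).
  have cd s : cts (fun s => L (s, 1) - L (s, 0)) s := ctsB (c1 1 s) (c1 0 s).
  apply: (lift_const cd _ o01) => s s01.
  by rewrite cexpB !LE //= Fs // divff // F0.
have d2 : L (1, 1) - L (1, 0) = L (1, 0) - L (1, 0).
  have cd t : cts (fun t => L (1, t) - L (1, 0)) t := ctsB (c2 1 t) (cts_cst _ t).
  apply: (lift_const cd _ o01) => t t01.
  by rewrite cexpB !LE //= Ft // divff // F0.
have d3 : l 1 - L (0, 1) = l 0 - L (0, 0).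
  have cd t : cts (fun t => l t - L (0, t)) t := ctsB (cl t) (c2 0 t).
  apply: (lift_const cd _ o01) => t t01.
  by rewrite cexpB lE // LE //= divff // F0.
have -> : l 1 = l 1 - L (0, 1) + (L (0, 1) - L (0, 0)) + L (0, 0) by ring.
by rewrite -d1 d2 subrr addr0 d3 subrK.
Qed.

(** * Simply connected sets *)

Lemma within_clamp (g : R -> C) : {within `[0, 1]%classic, continuous g} ->
  forall t, cts (fun t => g (clamp t)) t.
Proof.
move=> /subspace_continuousP cg t; apply/rcontP => e e0.
have := cg (clamp t); rewrite /= in_itv /= => /(_ (clamp01 t)) /(_ _ (nbhs_disk _ e0)).
rewrite /= /nbhs /= => /nbhs_ballP[d /= d0 hd].
have := @continuous_clamp R t _ (nbhsx_ballx (clamp t) d d0).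
move=> /nbhs_ballP[k /= k0 hk]; exists k => // u ut; apply: hd.
  by apply: hk; rewrite /ball /= distrC.
by rewrite /= in_itv /=; exact: clamp01.
Qed.

Lemma within_clamp2 (H : R * R -> C) :
  {within `[0, 1]%classic `*` `[0, 1]%classic, continuous H} ->
  forall p, cts (fun p => H (clamp p.1, clamp p.2)) p.
Proof.
move=> /subspace_continuousP cH p; apply/cts_atP => e e0.
have K2 : (`[0, 1]%classic `*` `[0, 1]%classic) (clamp p.1, clamp p.2).
  by rewrite /= !in_itv /=; split; exact: clamp01.
have := cH _ K2 _ (nbhs_disk _ e0); rewrite nbhs_simpl /= => /nbhs_ballP[d /= d0 hd].
have c1 := @continuous_clamp R p.1 _ (nbhsx_ballx (clamp p.1) d d0).
have c2 := @continuous_clamp R p.2 _ (nbhsx_ballx (clamp p.2) d d0).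
near=> q; apply: hd; last by rewrite /= !in_itv /= !clamp01.
split; rewrite /=; near: q.
  exact: (@cvg_fst _ _ (nbhs p.1) (nbhs p.2) _ _ c1).
exact: (@cvg_snd _ _ (nbhs p.1) (nbhs p.2) _ _ c2).
Unshelve. all: by end_near. Qed.

End Topology.

(** * Logarithms on simply connected domains *)

Section SimplyConnected.
Variable R : realType.
Local Notation C := (Cplane R).
Local Notation nm := (@nm R).
Local Notation rc := (@rc R).
Local Notation cRe := (@cRe R).
Local Notation cIm := (@cIm R).
Local Notation cI := (cI R).
Implicit Types (z w a b c d : C) (x y t s r e m : R) (f F G g h q : C -> C) (D : set C).

Lemma path_connected_connected D : path_connected D -> connected D.
Proof.
move=> pD; have [->|/set0P[p Dp]] := eqVneq D set0; first exact: connected0.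
suff <- : connected_component D p = D by exact: component_connected.
apply/seteqP; split; first exact: connected_component_sub.
move=> z Dz; have [g [cg gD g0 g1]] := pD p z Dp Dz.
exists (g @` `[0, 1]%classic); last first.
  by exists 1; rewrite //= in_itv /= lexx ler01.
split=> //; first by exists 0; rewrite //= in_itv /= lexx ler01.
exact: connected_continuous_connected (@segment_connected R 0 1) cg.
Qed.

(** Concatenation as a sum: at every time one of the two paths rests at the junction [b], so
    continuity follows from that of the summands and nothing has to be glued. The same formula
    concatenates lifts. *)
Definition ccat (u v : R -> C) (b : C) t : C :=
  u (clamp (2 * t)) + v (clamp (2 * t - 1)) - b.

Lemma clamp_eq0 t : t <= 0 -> clamp t = 0.
Proof. by move=> t0; apply/max_idPl; rewrite ge_min t0. Qed.

Lemma clamp_eq1 t : 1 <= t -> clamp t = 1.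
Proof. by move=> t1; rewrite /clamp (min_idPr t1); apply/max_idPr; exact: ler01. Qed.

Lemma ccat0 u v b : v 0 = b -> ccat u v b 0 = u 0.
Proof. have h : 2 * 0 <= (0 : R) by lra.
have h' : 2 * 0 - 1 <= (0 : R) by lra.
by move=> vb; rewrite /ccat (clamp_eq0 h) (clamp_eq0 h') vb addrK. Qed.

Lemma ccat1 u v b : u 1 = b -> ccat u v b 1 = v 1.
Proof. have h : (1 : R) <= 2 * 1 by lra.
have h' : (1 : R) <= 2 * 1 - 1 by lra.
by move=> ub; rewrite /ccat (clamp_eq1 h) (clamp_eq1 h') ub addrAC subrr add0r. Qed.

Lemma ccatP u v b t : u 1 = b -> v 0 = b ->
  ccat u v b t = u (clamp (2 * t)) /\ v (clamp (2 * t - 1)) = b \/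
  ccat u v b t = v (clamp (2 * t - 1)) /\ u (clamp (2 * t)) = b.
Proof.
move=> ub vb; have [h|h] := leP (2 * t) 1.
  have h' : 2 * t - 1 <= 0 by lra.
  by left; rewrite /ccat (clamp_eq0 h') vb addrK.
by right; rewrite /ccat (clamp_eq1 (ltW h)) ub (addrC b) addrK.
Qed.

Lemma cts_ccat u v b : (forall t, cts u t) -> (forall t, cts v t) -> forall t, cts (ccat u v b) t.
Proof.
move=> cu cv t.
have k1 : {for t, continuous (fun t => clamp (2 * t))}.
  have h : {for t, continuous (fun t : R => 2 * t)}.
    by apply: ctsRM; [exact: ctsR_cst|exact: cvg_id].
  exact (@continuous_comp _ _ _ _ (@clamp R) t h (@continuous_clamp R (2 * t))).
have k2 : {for t, continuous (fun t => clamp (2 * t - 1))}.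
  have h : {for t, continuous (fun t : R => 2 * t - 1)} := @cts_aff R 2 (-1) t.
  exact (@continuous_comp _ _ _ _ (@clamp R) t h (@continuous_clamp R (2 * t - 1))).
exact (ctsB (ctsD (cts_comp k1 (cu _)) (cts_comp k2 (cv _))) (cts_cst b t)).
Qed.

(* The two lifts have the same endpoint because their difference lifts the loop
   formed by one path and the reverse of the other, which is null-homotopic. *)
Lemma lift_unique_end D f (u v lu lv : R -> C) : simply_connected D ->
  (forall z, D z -> cts f z) -> (forall z, D z -> f z != 0) ->
  (forall t, cts u t) -> (forall t, cts v t) -> (forall t, cts lu t) -> (forall t, cts lv t) ->
  (forall t, D (u t)) -> (forall t, D (v t)) -> u 0 = v 0 -> u 1 = v 1 ->
  (forall t, 0 <= t <= 1 -> cexp (lu t) = f (u t)) ->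
  (forall t, 0 <= t <= 1 -> cexp (lv t) = f (v t)) ->
  lu 0 = lv 0 -> lu 1 = lv 1.
Proof.
move=> [_ _ scD] cf f0 cu cv clu clv Du Dv uv0 uv1 luE lvE l0.
have c1t : forall t, {for t, continuous (fun t : R => 1 - t)}.
  have -> : (fun t : R => 1 - t) = (fun t => -1 * t + 1) by apply/funext => s; ring.
  exact: cts_aff.
pose v' t := v (1 - t); pose lv' t := lv (1 - t).
have cv' t : cts v' t := cts_comp (c1t t) (cv _).
have clv' t : cts lv' t := cts_comp (c1t t) (clv _).
have v'0 : v' 0 = u 1 by rewrite /v' subr0.
have lv'0 : lv' 0 = lv 1 by rewrite /lv' subr0.
pose j := ccat u v' (u 1).
have jD t : D (j t).
  by rewrite /j; have [[-> _]|[-> _]] := ccatP t (erefl (u 1)) v'0; [exact: Du|exact: Dv].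
have cj t : cts j t := @cts_ccat u v' (u 1) cu cv' t.
pose l t := lu (clamp (2 * t)) + lv' (clamp (2 * t - 1)) - lv 1.
have cl t : cts l t := @cts_ccat lu lv' (lv 1) clu clv' t.
have lE t : 0 <= t <= 1 -> cexp (l t) = f (j t).
  move=> t01; rewrite /l /j cexpB cexpD luE ?clamp01 //.
  have q01 := clamp01 (2 * t - 1).
  have -> : cexp (lv' (clamp (2 * t - 1))) = f (v' (clamp (2 * t - 1))).
    by apply: lvE; apply/andP; split; lra.
  rewrite (lvE 1) ?lexx ?ler01 // -uv1.
  have f1 : f (u 1) != 0 by exact: f0.
  have [[-> ->]|[-> ->]] := ccatP t (erefl (u 1)) v'0; first by rewrite mulfK.
  by rewrite mulrAC divff // mul1r.
have j0 : j 0 = u 0 by exact: ccat0.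
have j1 : j 1 = u 0 by rewrite /j ccat1 // /v' subrr -uv0.
have [H [cH HD H0 H1 Hs]] : null_homotopic D j.
  apply: scD; last by rewrite j0 j1.
    apply: continuous_subspaceT => t; exact: cj.
  by move=> _ [t _ <-].
pose F p := f (H (clamp p.1, clamp p.2)).
have HpD (p : R * R) : D (H (clamp p.1, clamp p.2)).
  by apply: HD; exists (clamp p.1, clamp p.2); rewrite //= !in_itv /= !clamp01.
have cF p : cts F p := cts_comp (@within_clamp2 R H cH p) (cf _ (HpD p)).
have F0 p : F p != 0 := f0 _ (HpD p).
have z01 : 0 <= (0 : R) <= 1 by rewrite lexx ler01.
have o01 : 0 <= (1 : R) <= 1 by rewrite lexx ler01.
have : l 1 = l 0.
  apply: (@homotopy_closed R F l cF F0 _ _ cl) => t t01.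
  - rewrite /F /= !clamp_id //; have [] := Hs t; first by rewrite in_itv.
    by move=> -> ->.
  - by rewrite /F /= !clamp_id // !H1 // in_itv.
  - by rewrite lE // /F /= !clamp_id // H0 // in_itv.
have h1 : (1 : R) <= 2 * 1 by lra.
have h2 : (1 : R) <= 2 * 1 - 1 by lra.
have h3 : 2 * 0 <= (0 : R) by lra.
have h4 : 2 * 0 - 1 <= (0 : R) by lra.
rewrite /l (clamp_eq1 h1) (clamp_eq1 h2) (clamp_eq0 h3) (clamp_eq0 h4).
rewrite /lv' subrr subr0 addrK -l0 => e.
have -> : lu 1 = lu 1 + lu 0 - lv 1 + lv 1 - lu 0 by ring.
by rewrite e; ring.
Qed.

(** [L z] is the endpoint of a lift of [f] along some path from [p] to [z]. The paths are picked by
    choice and do not vary continuously; continuity of [L] comes from the independence of the path,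
    [lift_unique_end]. *)
Lemma sc_log D f : open D -> simply_connected D ->
  (forall z, D z -> cts f z) -> (forall z, D z -> f z != 0) ->
  exists L : C -> C, forall z, D z -> cts L z /\ cexp (L z) = f z.
Proof.
move=> oD scD cf f0; have [[p Dp] pD _] := scD.
have [c0 c0E] := cexp_surj (f0 _ Dp).
have o01 : 0 <= (1 : R) <= 1 by rewrite lexx ler01.
have z01 : 0 <= (0 : R) <= 1 by rewrite lexx ler01.
pose good z (ul : (R -> C) * (R -> C)) := [/\ forall t, cts ul.1 t, forall t, cts ul.2 t,
  forall t, D (ul.1 t), (ul.1 0 = p /\ ul.1 1 = z) &
  (forall t, 0 <= t <= 1 -> cexp (ul.2 t) = f (ul.1 t)) /\ ul.2 0 = c0].
have goodE z : D z -> exists ul, good z ul.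
  move=> Dz; have [g [cg gD g0 g1]] := pD p z Dp Dz.
  pose u t := g (clamp t).
  have cu : forall t, cts u t := within_clamp cg.
  have uD t : D (u t) by apply: gD; exists (clamp t); rewrite //= in_itv /= clamp01.
  have u0 : u 0 = p by rewrite /u clamp_id.
  have [l [cl lE]] := path_log (fun t => cts_comp (cu t) (cf _ (uD t))) (fun t => f0 _ (uD t)).
  exists (u, fun t => l t + (c0 - l 0)); split.
  - exact cu.
  - move=> t; exact (ctsD (cl t) (cts_cst _ t)).
  - exact uD.
  - by rewrite /u /= !clamp_id.
  - split; last by rewrite /= addrC subrK.
    move=> t t01; rewrite /= cexpD cexpB c0E (lE t t01) (lE 0 z01) u0 divff ?mulr1 //; exact: f0.
have [ch chP] : exists ch : C -> (R -> C) * (R -> C), forall z, D z -> good z (ch z).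
  have /choice[ch h] : forall z, exists ul, D z -> good z ul.
    move=> z; have [Dz|nD] := pselect (D z); last by exists (fun=> 0, fun=> 0).
    by have [ul h] := goodE z Dz; exists ul.
  by exists ch.
pose L z := (ch z).2 1.
have LE z : D z -> cexp (L z) = f z.
  by move=> Dz; have [_ _ _ [_ e] [h _]] := chP z Dz; rewrite /L (h 1 o01) e.
exists L => z Dz; split; last exact: LE.
have [Lp [Lp1 LpP]] := plog_ex R.
have [r0 r00 r0D] := (openP D).1 oD z Dz.
have fz := f0 z Dz.
have [r1 r10 hr1] : exists2 r, 0 < r & forall w, nm (w - z) < r -> nm (f w - f z) < nm (f z).
  by apply: ((@ccontP R f z).1 (cf z Dz)); rewrite nm_gt0.
pose r : R := Num.min r0 r1.
have r_gt0 : 0 < r by rewrite lt_min r00.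
have near w : disk z r w -> D w /\ disk 1 1 (f w / f z).
  rewrite /disk /= lt_min => /andP[w0 w1]; split; first exact: r0D.
  have -> : f w / f z - 1 = (f w - f z) / f z by rewrite mulrBl divff.
  by rewrite nmM nmV ltr_pdivrMr ?nm_gt0 // mul1r; exact: hr1.
(* The path chosen for [w] is compared with the path chosen for [z] followed by the segment from [z]
   to [w], whose lift is a principal logarithm. *)
have key w : disk z r w -> L w = L z + Lp (f w / f z).
  move=> wr; have [Dw _] := near w wr.
  have [cu cl uD [u0 u1] [lE l0]] := chP z Dz.
  have [cu' cl' uD' [u0' u1'] [lE' l0']] := chP w Dw.
  set u := (ch z).1 in cu uD u0 u1 lE *; set l := (ch z).2 in cl lE l0 *.
  have sr t : disk z r (seg z w (clamp t)).
    by rewrite /disk /=; apply: le_lt_trans (@nm_seg R z w _ (clamp01 t)) wr.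
  pose sg t := seg z w (clamp t).
  have csg t : cts sg t := cts_comp (@continuous_clamp R t) (@cts_seg R z w _).
  have sg0 : sg 0 = z by rewrite /sg clamp_id // seg0.
  have sg1 : sg 1 = w by rewrite /sg clamp_id // seg1.
  pose ll t := Lp (f (sg t) / f z).
  have cll t : cts ll t.
    have [Ds dS] := near _ (sr t); have [cL _] := LpP _ dS.
    exact (cts_comp (ctsM (cts_comp (csg t) (cf _ Ds)) (cts_cst _ t)) cL).
  have ll0 : ll 0 = 0 by rewrite /ll sg0 divff.
  pose u2 := ccat u sg z; pose l2 t := l (clamp (2 * t)) + ll (clamp (2 * t - 1)) - 0.
  have u20 : u2 0 = p by rewrite /u2 ccat0.
  have u21 : u2 1 = w by rewrite /u2 ccat1.
  have cu2 t : cts u2 t := @cts_ccat u sg z cu csg t.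
  have cl2 t : cts l2 t := @cts_ccat l ll 0 cl cll t.
  have u2D t : D (u2 t).
    rewrite /u2; have [[-> _]|[-> _]] := ccatP t u1 sg0; first exact: uD.
    by have [] := near _ (sr (clamp (2 * t - 1))).
  have l2E t : 0 <= t <= 1 -> cexp (l2 t) = f (u2 t).
    move=> t01; rewrite /l2 /u2 subr0 cexpD lE ?clamp01 //.
    have [_ /LpP[_ h]] := near _ (sr (clamp (2 * t - 1))).
    rewrite /ll /sg h -/(sg (clamp (2 * t - 1))).
    have [[-> ->]|[-> ->]] := ccatP t u1 sg0; first by rewrite divff ?mulr1.
    by rewrite mulrC divfK.
  have l20 : l2 0 = c0.
    have h3 : 2 * 0 <= (0 : R) by lra.
    have h4 : 2 * 0 - 1 <= (0 : R) by lra.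
    by rewrite /l2 subr0 (clamp_eq0 h3) (clamp_eq0 h4) ll0 addr0 l0.
  have l21 : l2 1 = l 1 + ll 1.
    have h3 : (1 : R) <= 2 * 1 by lra.
    have h4 : (1 : R) <= 2 * 1 - 1 by lra.
    by rewrite /l2 subr0 (clamp_eq1 h3) (clamp_eq1 h4).
  have := lift_unique_end scD cf f0 cu' cu2 cl' cl2 uD' u2D _ _ lE' l2E _.
  rewrite u0' u20 u1' u21 l0' l20 => /(_ erefl erefl erefl).
  by rewrite l21 /ll sg1.
have cLp : cts (fun w => L z + Lp (f w / f z)) z.
  have [_ /LpP[cL _]] := near z (@disk_center R z r r_gt0).
  exact (ctsD (cts_cst _ z) (cts_comp (ctsM (cf z Dz) (cts_cst _ z)) cL)).
apply/ccontP => e e0; have [d d0 hd] := (@ccontP R _ z).1 cLp e e0.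
exists (Num.min d r); first by rewrite lt_min d0.
move=> w; rewrite lt_min => /andP[wd wr]; rewrite (key w wr).
have -> : L z = L z + Lp (f z / f z) by rewrite -key //; exact: disk_center.
have := hd w wd; rewrite -/(L z); congr (nm _ < e); congr (_ + _ - _).
by rewrite divff // Lp1 addr0.
Qed.

Lemma hol_log D f L : open D -> hol D f -> (forall z, D z -> cts L z /\ cexp (L z) = f z) ->
  hol D L.
Proof.
move=> oD hf hL z Dz; have [r r0 rD] := (openP D).1 oD z Dz.
have [d hd] := hf z Dz; have [cL _] := hL z Dz.
exists (d / cexp (L z)).
apply: (cder_lift (p := @cexp R) (h := f) cL r0 _ (@cder_cexp R (L z)) (@cexp_neq0 R _) hd).
by move=> w /rD Dw; have [] := hL w Dw.
Qed.

Lemma sc_hol_log D f : open D -> simply_connected D -> hol D f -> (forall z, D z -> f z != 0) ->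
  exists2 L : C -> C, hol D L & forall z, D z -> cexp (L z) = f z.
Proof.
move=> oD scD hf f0.
have [L hL] := sc_log oD scD (fun z => @hol_cts R D f z hf) f0.
by exists L => [|z Dz]; [exact: hol_log hf hL|have [] := hL z Dz].
Qed.

End SimplyConnected.

Section JordanComplement.
Variable R : realType.
Local Notation C := (Cplane R).
Local Notation nm := (@nm R).
Local Notation rc := (@rc R).
Local Notation cRe := (@cRe R).
Local Notation cIm := (@cIm R).
Local Notation cI := (cI R).
Local Notation cis := (@cis R).
Implicit Types (z w a b c d : C) (x y t s r e m : R) (f F G g h q : C -> C) (D J W : set C).

(** * Complement of a Jordan domain *)

Lemma convex_path_connected D : convexC D -> path_connected D.
Proof.
move=> cD z w Dz Dw; exists (seg z w); split; last exact: seg1.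
- apply: continuous_subspaceT => t; exact (@cts_seg R z w t).
- by move=> _ [t /= t01 <-]; apply: cD => //; move: t01; rewrite in_itv.
- exact: seg0.
Qed.

Lemma convex_connected D : convexC D -> connected D.
Proof. by move=> /convex_path_connected /path_connected_connected. Qed.

Lemma image_connected (T : topologicalType) (A : set T) (f : T -> C) : connected A ->
  (forall u, cts f u) -> connected (f @` A).
Proof.
move=> cA cf; apply: connected_continuous_connected cA _.
by apply: continuous_subspaceT => u; exact (cf u).
Qed.

Lemma connected_sub_component D p A : connected A -> A p -> A `<=` D ->
  A `<=` connected_component D p.
Proof. by move=> cA Ap AD z Az; exists A. Qed.

Lemma component_open D p : open D -> open (connected_component D p).
Proof.
move=> oD; apply/openP => z cz; have Dz := connected_component_sub cz.
have [r r0 rD] := (openP D).1 oD z Dz; exists r => // w wr.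
apply: connected_component_trans cz _.
apply: (connected_sub_component (@disk_connected R z r) (disk_center z r0) rD wr).
Qed.

Lemma continuous_fst (p : R * R) : {for p, continuous (fun p : R * R => p.1)}.
Proof. exact: cvg_fst. Qed.

Lemma continuous_snd (p : R * R) : {for p, continuous (fun p : R * R => p.2)}.
Proof. exact: cvg_snd. Qed.

Lemma tietze_plane J (f : C -> R) (M : R) : closed J -> 0 < M ->
  (forall z, J z -> forall e, 0 < e -> exists2 d, 0 < d &
    forall w, J w -> nm (w - z) < d -> `|f w - f z| < e) ->
  (forall z, J z -> `|f z| <= M) ->
  exists2 g : C -> R, (forall z, {for z, continuous g}) & forall z, J z -> g z = f z.
Proof.
move=> cJ M0 cf fM.
pose k (p : R * R) : C := rc p.1 + cI * rc p.2.
have ck p : cts k p.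
  have c1 : cts (fun p : R * R => rc p.1) p := cts_rc (@continuous_fst p).
  have c2 : cts (fun p : R * R => rc p.2) p := cts_rc (@continuous_snd p).
  exact (ctsD c1 (ctsM (cts_cst _ p) c2)).
have kE z : k (cRe z, cIm z) = z by rewrite /k -cplxE.
have cJ' : closed (k @^-1` J) by apply: closed_comp => // p _; exact (ck p).
have wc : {within k @^-1` J, continuous ((f \o k) : R * R -> R^o)}.
  apply/subspace_continuousP => p Jp.
  apply/(@cvgrPdist_lt _ R^o) => e e0; have [d d0 hd] := cf (k p) Jp e e0.
  rewrite near_withinE; have /cts_atP /(_ d d0) := ck p.
  by apply: filterS => q qd Jq; rewrite distrC; apply: hd.
have [g [gE cg _]] := @continuous_bounded_extension (R * R)%type R
    (@pseudometric_normal R (R * R)%type) _ cJ' (f \o k) M M0 wc (fun p => fM (k p)).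
exists (fun z => g (cRe z, cIm z)) => [z|z Jz].
  have h : {for z, continuous (fun z => (cRe z, cIm z))}.
    exact: cvg_pair (@continuous_cRe R z) (@continuous_cIm R z).
  exact (@continuous_comp _ _ _ _ g z h (cg _)).
by rewrite -gE /= ?kE // inE /= kE.
Qed.

Lemma cts_exprz (T : topologicalType) (f : T -> C) (n : int) u : f u != 0 -> cts f u ->
  cts (fun v => f v ^ n) u.
Proof.
move=> f0 cf; have X k : cts (fun v => f v ^+ k) u.
  elim: k => [|k IH]; first exact (cts_cst _ u).
  have -> : (fun v => f v ^+ k.+1) = (fun v => f v * f v ^+ k).
    by apply/funext => v; rewrite exprS.
  exact (ctsM cf IH).
case: n => k; first exact (X k).
have -> : (fun v => f v ^ Negz k) = (fun v => (f v ^+ k.+1)^-1) by [].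
apply: ctsV; [exact: expf_neq0|exact (X k.+1)].
Qed.

Lemma cts_near (T : topologicalType) (f g : T -> C) u : (\forall v \near u, f v = g v) ->
  f u = g u -> cts g u -> cts f u.
Proof.
move=> fg fu /cts_atP cg; apply/cts_atP => e e0.
by apply: filterS2 fg (cg e e0) => v -> ; rewrite fu.
Qed.

Lemma cexp_intz (n : int) z : cexp (n%:~R * z) = cexp z ^ n.
Proof.
have X (k : nat) : cexp (k%:R * z) = cexp z ^+ k.
  elim: k => [|k IH]; first by rewrite mul0r cexp0.
  by rewrite -natr1 mulrDl mul1r cexpD IH exprSr.
case: n => k; first exact: X.
by rewrite NegzE mulrNz mulNr cexpN X.
Qed.

Lemma cexp_ln r : 0 < r -> cexp (rc (ln r)) = rc r.
Proof.
move=> r0; apply: cplx_eq; rewrite ?cRe_cexp ?cIm_cexp !cRe_rc !cIm_rc lnK ?posrE //.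
  by rewrite cos0 mulr1.
by rewrite sin0 mulr0.
Qed.

Lemma nm_far (p : C) (rho r t : R) : nm p < rho -> 2 * rho < r ->
  rho < nm (p + rc r * cis t).
Proof.
move=> h1 h2; have r0 : 0 < r by have := nm_ge0 p; lra.
have := le_nm_sub p (p + rc r * cis t) 0; have := le_nmB (rc r * cis t) (p + rc r * cis t).
have -> : rc r * cis t - (p + rc r * cis t) = - p by ring.
by rewrite nmN nmM nm_rc nm_cis gtr0_norm // mulr1 => k1 k2; lra.
Qed.

(* Gluing [(z - p)^a] off [W] to [exp L / (z - q)^b] on [closure W] gives a
   nonvanishing function on the plane with winding number [a] on big circles. *)
Lemma no_boundary_log W J (p q : C) (a b : int) (L : C -> C) (M rho : R) : open W -> closed J ->
  (forall z, W z -> nm z < rho) -> closure W `\` W `<=` J ->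
  W p -> ~ closure W q -> a != 0 -> 0 < M ->
  (forall z, J z -> forall e, 0 < e -> exists2 d, 0 < d &
    forall w, J w -> nm (w - z) < d -> nm (L w - L z) < e) ->
  (forall z, J z -> nm (L z) <= M) ->
  (forall z, J z -> cexp (L z) = (z - p) ^ a * (z - q) ^ b) -> False.
Proof.
move=> oW cJ Wrho WJ Wp nq a0 M0 cL LM LE.
have ext (k : C -> R) : (forall z w, k (z - w) = k z - k w) -> (forall z, `|k z| <= nm z) ->
    exists2 g : C -> R, (forall z, {for z, continuous g}) & forall z, J z -> g z = k (L z).
  move=> kB kle; apply: (tietze_plane cJ M0) => z Jz; last by apply: le_trans (LM z Jz).
  move=> e e0; have [d d0 hd] := cL z Jz e e0; exists d => // w Jw wz.
  by rewrite -kB; apply: le_lt_trans (hd w Jw wz).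
have [u cu uE] := ext cRe (fun z w => etrans (cReD z (- w)) (congr1 _ (cReN w))) (@le_cRe R).
have [v cv vE] := ext cIm (fun z w => etrans (cImD z (- w)) (congr1 _ (cImN w))) (@le_cIm R).
pose T z := rc (u z) + cI * rc (v z).
have cT z : cts T z := ctsD (cts_rc (cu z)) (ctsM (cts_cst _ z) (cts_rc (cv z))).
have TE z : J z -> T z = L z by move=> Jz; rewrite /T uE // vE // -cplxE.
pose g1 z := (z - p) ^ a.
pose g2 z := cexp (T z) * (z - q) ^ (- b).
have cg1 z : z != p -> cts g1 z.
  move=> zp; apply: cts_exprz; first by rewrite subr_eq0.
  exact (ctsB (cts_id z) (cts_cst _ z)).
have cg2 z : z != q -> cts g2 z.
  move=> zq; apply: ctsM; first exact (cts_comp (cT z) (@cts_cexp R _)).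
  apply: cts_exprz; first by rewrite subr_eq0.
  exact (ctsB (cts_id z) (cts_cst _ z)).
have g1n z : z != p -> g1 z != 0.
  by move=> zp; apply: expfz_neq0; rewrite subr_eq0.
have g2n z : z != q -> g2 z != 0.
  by move=> zq; apply: mulf_neq0; [exact: cexp_neq0|apply: expfz_neq0; rewrite subr_eq0].
pose H z := if `[< closure W z >] then g2 z else g1 z.
have Hin z : closure W z -> H z = g2 z by move=> h; rewrite /H (asboolT h).
have Hout z : ~ closure W z -> H z = g1 z by move=> h; rewrite /H (asboolF h).
have clWq z : closure W z -> z != q by move=> h; apply: contra_notN nq => /eqP <-.
have Wne z : ~ W z -> z != p by move=> h; apply: contra_notN h => /eqP ->.
have H0 z : H z != 0.
  have [h|h] := pselect (closure W z).
    by rewrite (Hin z h); exact (g2n z (clWq z h)).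
  have nW : ~ W z by move=> k; apply: h; exact: subset_closure.
  by rewrite (Hout z h); exact (g1n z (Wne z nW)).
have eqJ z : J z -> z != q -> g2 z = g1 z.
  move=> Jz zq; rewrite /g2 TE // LE // -mulrA -expfzDr ?subr_eq0 //.
  by rewrite subrr expr0z mulr1.
have cH z : cts H z.
  have [Wz|nW] := pselect (W z).
    have cz := subset_closure Wz.
    apply: (cts_near _ (Hin z cz) (cg2 z (clWq z cz))).
    by apply: filterS (open_nbhs_nbhs (conj oW Wz)) => w Ww; apply: Hin; exact: subset_closure.
  have [cz|ncz] := pselect (closure W z); last first.
    apply: (cts_near _ (Hout z ncz) (cg1 z (Wne z nW))).
    have oc : open (~` closure W) by apply: closed_openC; exact: closed_closure.
    by apply: filterS (open_nbhs_nbhs (conj oc ncz)) => w nw; apply: Hout.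
  have zq := clWq z cz; have zp := Wne z nW; have Jz : J z := WJ z (conj cz nW).
  apply/cts_atP => e e0.
  have /cts_atP /(_ e e0) h1 := cg1 z zp; have /cts_atP /(_ e e0) h2 := cg2 z zq.
  apply: filterS2 h1 h2 => w w1 w2; rewrite (Hin z cz).
  have [cw|ncw] := pselect (closure W w); first by rewrite (Hin w cw).
  by rewrite (Hout w ncw) (eqJ z Jz zq).
have rho0 : 0 < rho by exact: le_lt_trans (nm_ge0 p) (Wrho p Wp).
pose r : R := 2 * rho + 1.
have r0 : 0 < r by rewrite /r; lra.
(* Circles about [p] shrinking from radius [r] to the point [p]. The first lies outside [closure W],
   where [H] is [(z - p) ^ a], and its explicit lift [l] gains [a] periods; contractibility forces
   this gain to be zero. *)
pose hc (st : R * R) := p + rc ((1 - st.1) * r) * cis st.2.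
have chc st : cts hc st.
  have k1 : {for st, continuous (fun st : R * R => (1 - st.1) * r)}.
    apply: ctsRM; last exact: ctsR_cst.
    have -> : (fun st : R * R => 1 - st.1) = (fun st => -1 * st.1 + 1) by apply/funext => x; ring.
    exact (@continuous_comp _ _ _ (fun p : R * R => p.1) (fun t : R => -1 * t + 1) st (@continuous_fst st) (@cts_aff R (-1) 1 st.1)).
  have k2 : cts (fun st : R * R => cis st.2) st := cts_comp (f := fun p : R * R => p.2) (@continuous_snd st) (@cts_cis R st.2).
  exact (ctsD (cts_cst _ st) (ctsM (cts_rc k1) k2)).
pose Fh st := H (hc st).
have cFh st : cts Fh st := cts_comp (chc st) (cH _).
pose l t := rc (ln r) * a%:~R + rc (2 * pi * t) * cI * a%:~R.
have cl t : cts l t.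
  have k1 : {for t, continuous (fun t : R => 2 * pi * t)}.
    by apply: ctsRM; [exact: ctsR_cst|exact: cvg_id].
  exact (ctsD (cts_cst _ t) (ctsM (ctsM (cts_rc k1) (cts_cst _ t)) (cts_cst _ t))).
have lE t : 0 <= t <= 1 -> cexp (l t) = Fh (0, t).
  move=> _; rewrite /Fh Hout; last first.
    move=> h; have : nm (hc (0, t)) <= rho.
      rewrite leNgt; apply/negP => k.
      have [w [Ww wk]] := h _ (nbhs_disk (hc (0, t)) (ltac:(by rewrite subr_gt0) : 0 < nm (hc (0, t)) - rho)).
      have := Wrho w Ww; have := le_nmB (hc (0, t)) w; rewrite nmB.
      by move: wk; rewrite /disk /= => k1 k2 k3; lra.
    have r2 : 2 * rho < r by rewrite /r; lra.
    have := nm_far t (Wrho p Wp) r2; have -> : p + rc r * cis t = hc (0, t).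
      by rewrite /hc /= subr0 mul1r.
    by move=> k1 k2; have := lt_le_trans k1 k2; rewrite ltxx.
  rewrite /g1 /hc /= subr0 mul1r addrC addKr /l -mulrDl mulrC cexp_intz cexpD -/(cis t).
  by rewrite cexp_ln.
have := @homotopy_closed R Fh l cFh (fun st => H0 _) _ _ cl lE.
have F01 s : 0 <= s <= 1 -> Fh (s, 0) = Fh (s, 1) by rewrite /Fh /hc /= cis0 cis1.
have F1c t : 0 <= t <= 1 -> Fh (1, t) = Fh (1, 0).
  by rewrite /Fh /hc /= subrr mul0r rc0 !mul0r.
move=> /(_ F01 F1c) /addrI /eqP.
rewrite mulr0 rc0 !mul0r mulr1 mulf_eq0 mulf_eq0 (negPf (cI_neq0 R)) orbF intr_eq0 (negPf a0) orbF.
by rewrite rc_eq0 mulf_eq0 pnatr_eq0 /= gt_eqF // pi_gt0.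
Qed.

Lemma jordan_param J : jordan_curve J -> exists j : R -> C,
  [/\ forall t, cts j t, forall z, J z -> exists2 t, 0 <= t <= 1 & j t = z,
    forall t, J (j t), j 0 = j 1 &
    forall s t, 0 <= s <= 1 -> 0 <= t <= 1 -> j s = j t ->
      [\/ s = t, s = 0 /\ t = 1 | s = 1 /\ t = 0]].
Proof.
move=> [f [cf fi fJ]].
have cU t : unit_circle (cis t) by rewrite /unit_circle /= normE nm_cis rc1.
exists (fun t => f (cis t)); split.
- move=> t; apply/cts_atP => e e0; move/subspace_continuousP: cf => /(_ _ (cU t)).
  move=> /(_ _ (nbhs_disk _ e0)); rewrite nbhs_simpl /= => /nbhsP[d d0 hd].
  have /cts_atP /(_ d d0) := @cts_cis R t; apply: filterS => u ud.
  by apply: hd.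
- move=> z; rewrite -fJ => -[w w1 <-].
  have w1' : nm w = 1 by move: w1; rewrite /unit_circle /= normE => /rc_inj.
  have w0 : w != 0 by rewrite -nm_gt0 w1' ltr01.
  have [v vE] := cexp_surj w0.
  have v0 : cRe v = 0.
    by have := nm_cexp v; rewrite vE w1' => /esym/eqP; rewrite -expR0 (inj_eq (@expR_inj R)) => /eqP.
  pose y := cIm v / (2 * pi).
  have pi2 : 2 * pi != 0 :> R by rewrite mulf_neq0 // gt_eqF // pi_gt0.
  have cy : cis y = w.
    rewrite -vE /cis /y mulrCA divff // mulr1; congr cexp.
    by rewrite [RHS]cplxE v0 rc0 add0r mulrC.
  exists (y - (Num.floor y)%:~R).
    have := floor_le y; have := lt_succ_floor y; rewrite intrD1 => h1 h2.
    by apply/andP; split; lra.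
  congr f; rewrite -cy /cis mulrBr rcB mulrBl cexpB.
  have -> : 2 * pi * (Num.floor y)%:~R = 2 * pi * (Num.floor y)%:~R :> R by [].
  by rewrite cexp_2pi divr1.
- by move=> t; rewrite -fJ; exists (cis t).
- by rewrite cis0 cis1.
- move=> s t s01 t01 /fi; rewrite !inE => /(_ (cU s) (cU t)) e.
  have : cexp (rc (2 * pi * s) * cI - rc (2 * pi * t) * cI) = 1.
    by rewrite cexpB -/(cis s) -/(cis t) e divff // cis_neq0.
  move=> /cexp_eq1[n]; rewrite -mulrBl -rcB => /(mulIf (cI_neq0 R)) /rc_inj.
  rewrite -mulrBr; have pi2 : 2 * pi != 0 :> R by rewrite mulf_neq0 // gt_eqF // pi_gt0.
  move=> /(mulfI pi2) sn.
  have n1 : (n%:~R : R) <= 1%:~R by rewrite -sn; move: s01 t01; lra.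
  have n2 : ((-1)%:~R : R) <= n%:~R by rewrite -sn; move: s01 t01; lra.
  move: n1 n2; rewrite !ler_int => n1 n2.
  have [n0|[n0|n0]] : n = 0 \/ (n = 1 \/ n = -1) by lia.
  + by apply: Or31; apply/eqP; rewrite -subr_eq0 sn n0.
  + by apply: Or33; move: sn; rewrite n0 => sn; split; move: s01 t01 sn; lra.
  + by apply: Or32; move: sn; rewrite n0 => sn; split; move: s01 t01 sn; lra.
Qed.

Lemma closed_jordan J : jordan_curve J -> closed J.
Proof.
move=> [f [cf _ <-]]; apply: compact_closed; first exact: hausdorff_C.
apply: continuous_compact => //.
have -> : @unit_circle R = [set z : C | nm (z - 0) <= 1] `&` [set z : C | 1 <= nm z].
  apply/seteqP; split=> z; rewrite /unit_circle /= normE subr0.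
    by move=> /rc_inj ->.
  by move=> [h1 h2]; congr rc; apply/eqP; rewrite eq_le h1.
apply: compact_closedI; first exact: closed_disk_compact.
by apply: (@closed_comp _ _ nm [set x | 1 <= x]) => [z _|]; [exact: continuous_nm|exact: closed_ge].
Qed.

(** The relation [a * n1 + b * n2 = 0] says that [(z - p) ^ a * (z - q) ^ b] has winding number zero
    along the curve, so its lift along [j] takes equal values at both ends and descends from the
    parameter interval to [J]. *)
Lemma winding_combo J (p q : C) (a b : int) (j l1 l2 : R -> C) (n1 n2 : int) : 
  (forall t, cts j t) -> (forall z, J z -> exists2 t, 0 <= t <= 1 & j t = z) ->
  (forall s t, 0 <= s <= 1 -> 0 <= t <= 1 -> j s = j t ->
      [\/ s = t, s = 0 /\ t = 1 | s = 1 /\ t = 0]) ->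
  (forall t, cts l1 t) -> (forall t, cts l2 t) ->
  (forall t, 0 <= t <= 1 -> cexp (l1 t) = j t - p) ->
  (forall t, 0 <= t <= 1 -> cexp (l2 t) = j t - q) ->
  l1 1 = l1 0 + rc (2 * pi * n1%:~R) * cI -> l2 1 = l2 0 + rc (2 * pi * n2%:~R) * cI ->
  a * n1 + b * n2 = 0 ->
  exists (L : C -> C) (M : R), [/\ 0 < M,
    forall z, J z -> forall e, 0 < e -> exists2 d, 0 < d &
      forall w, J w -> nm (w - z) < d -> nm (L w - L z) < e,
    forall z, J z -> nm (L z) <= M &
    forall z, J z -> cexp (L z) = (z - p) ^ a * (z - q) ^ b].
Proof.
move=> cj Jj jJ cl1 cl2 l1E l2E l11 l21 ab.
pose l t := a%:~R * l1 t + b%:~R * l2 t.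
have cl t : cts l t := ctsD (ctsM (cts_cst _ t) (cl1 t)) (ctsM (cts_cst _ t) (cl2 t)).
have l10 : l 1 = l 0.
  rewrite /l l11 l21; have -> : forall u v x y A B : C, A * (u + x) + B * (v + y) =
    A * u + B * v + (A * x + B * y) by move=> *; ring.
  have I k : rc (2 * pi * k%:~R) * cI = k%:~R * (rc (2 * pi) * cI) :> C.
    have -> : rc (2 * pi * k%:~R) = rc (2 * pi) * k%:~R.
      by rewrite rcM; congr (_ * _); exact: (rmorph_int (real_complex R)).
    by rewrite mulrAC mulrC.
  by rewrite !I !mulrA -!intrM -mulrDl -mulrDl -intrD ab !mul0r addr0.
have z01 : 0 <= (0 : R) <= 1 by rewrite lexx ler01.
have o01 : 0 <= (1 : R) <= 1 by rewrite lexx ler01.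
have ljE s t : 0 <= s <= 1 -> 0 <= t <= 1 -> j s = j t -> l s = l t.
  by move=> s01 t01 /(jJ s t s01 t01)[->|[-> ->]|[-> ->]].
have /choice[tau tauP] : forall z, exists t : R, J z -> 0 <= t <= 1 /\ j t = z.
  move=> z; have [/Jj[t t01 jt]|nJ] := pselect (J z); last by exists 0.
  by exists t.
pose L z := l (tau z).
have Lj t z : 0 <= t <= 1 -> J z -> j t = z -> L z = l t.
  by move=> t01 Jz jt; have [s01 js] := tauP z Jz; apply: ljE => //; rewrite js.
have [M M0 lM] := cts01_bound (fun t _ => cl t).
exists L, M; split=> //.
- move=> z Jz e e0; have [s01 js] := tauP z Jz.
  (* Continuity of [L] on [J] by compactness of the parameter interval: [phi] is positive, since
     [j t = z] implies [l t = L z]. Where [nm (j t - z)] is below the minimum of [phi], the second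
     summand must be positive. *)
  pose phi t : R := nm (j t - z) + Num.max 0 (e - nm (l t - L z)).
  have cphi t : {for t, continuous phi}.
    apply: ctsRD.
      exact (@continuous_comp _ _ _ _ nm t (ctsB (cj t) (cts_cst z t)) (@continuous_nm R _)).
    have h : {for t, continuous (fun t => e - nm (l t - L z))}.
      have -> : (fun t => e - nm (l t - L z)) = (fun t => e + -1 * nm (l t - L z)).
        by apply/funext => x; rewrite mulN1r.
      apply: ctsRD; first exact: ctsR_cst.
      apply: ctsRM; first exact: ctsR_cst.
      exact (@continuous_comp _ _ _ _ nm t (ctsB (cl t) (cts_cst (L z) t)) (@continuous_nm R _)).
    exact (@continuous_max R R (fun _ => 0) (fun t => e - nm (l t - L z)) t (@cvg_cst _ _ _ _ _) h).
  have [m m0 hm] : exists2 m, 0 < m & forall t, [set t : R | 0 <= t <= 1] t -> m <= phi t.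
    apply: (compact_lbound (@itv01_compact R)) => [t _|t t01]; first exact: cphi.
    rewrite /phi; have [jz|jz] := eqVneq (j t) z.
      by rewrite jz subrr nm0 add0r lt_max (Lj t z) // subrr nm0 subr0 e0 orbT.
    by rewrite ltr_pwDl ?nm_gt0 ?subr_eq0 // le_max lexx.
  exists m => // w Jw wm; have [t01 jt] := tauP w Jw.
  have := hm _ t01; rewrite /phi jt -/(L w) => h.
  have : 0 < Num.max 0 (e - nm (L w - L z)) by lra.
  by rewrite lt_max ltxx /= subr_gt0.
- by move=> z Jz; have [t01 _] := tauP z Jz; exact: lM.
- move=> z Jz; have [t01 jt] := tauP z Jz.
  by rewrite /L /l cexpD !cexp_intz (l1E _ t01) (l2E _ t01) jt.
Qed.

Lemma closure_bound W (rho : R) z : closure W z -> (forall z, W z -> nm z < rho) -> nm z <= rho.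
Proof.
move=> cz Wr; rewrite leNgt; apply/negP => k.
have k0 : 0 < nm z - rho by rewrite subr_gt0.
have [w [Ww wk]] := cz _ (nbhs_disk z k0).
have := Wr w Ww; have := le_nmB z w; rewrite nmB.
by move: wk; rewrite /disk /= => k1 k2 k3; lra.
Qed.

Lemma collar_connected (rho : R) : 0 < rho -> rho < 1 -> connected [set z : C | rho <= nm z < 1].
Proof.
move=> r0 r1.
have -> : [set z : C | rho <= nm z < 1] = @cexp R @` [set w : C | ln rho <= cRe w < 0].
  apply/seteqP; split=> z /=.
    move=> /andP[z0 z1]; have znz : z != 0 by rewrite -nm_gt0; lra.
    have [w wE] := cexp_surj znz; exists w => //.
    move: z0 z1; rewrite -wE nm_cexp => z0 z1.
    by rewrite -(@ler_expR R) lnK ?posrE // -(@ltr_expR R) expR0 z0.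
  move=> [w /andP[w0 w1] <-]; rewrite nm_cexp.
  by rewrite -{1}(@lnK R rho) ?posrE // ler_expR w0 -(@expR0 R) ltr_expR.
apply: image_connected => [|u]; last exact (@cts_cexp R u).
apply: convex_connected => a b t /= /andP[a0 a1] /andP[b0 b1] /andP[t0 t1].
have -> : cRe (seg a b t) = (1 - t) * cRe a + t * cRe b.
  by rewrite /seg cReD cReM cReD cReN cRe_rc cIm_rc mul0r subr0; ring.
apply/andP; split; first by nra.
have [h|h] := leP t (1/2); nra.
Qed.

(** A component [X] missing the outer collar would be, like [W], a bounded open set with boundary
    inside [J]. Let [n1] and [n2] be the winding numbers of the curve about a point [p1] of [W] and
    a point [q] of [X]. If [n1 = 0], then [z - p1] has a logarithm on [J], which is impossible for
    [W]. Otherwise [(z - q) ^ n1 * (z - p1) ^ (- n2)] has one, which is impossible for [X]. *)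
Theorem jordan_complement_connected W (rho : R) : 0 < rho -> rho < 1 -> open W -> connected W -> W !=set0 ->
  (forall z, W z -> nm z < rho) -> jordan_curve (boundary W) ->
  connected (disk 0 1 `\` closure W).
Proof.
move=> r0 r1 oW cW [p1 Wp1] Wr jW.
set J := boundary W in jW; set A := disk 0 1 `\` closure W.
have oA : open A.
  rewrite /A setDE; apply: openI; first exact: open_disk.
  by apply: closed_openC; exact: closed_closure.
pose s : R := (1 + rho) / 2.
have colA : [set z : C | s <= nm z < 1] `<=` A.
  move=> z /= /andP[z0 z1]; split; first by rewrite /disk /= subr0.
  by move=> /closure_bound /(_ Wr); move: z0; rewrite /s; lra.
have cs : [set z : C | s <= nm z < 1] (rc s).
  have s0' : 0 <= s by rewrite /s; lra.
  change (is_true (s <= nm (rc s) < 1)); rewrite nm_rc ger0_norm // lexx /= /s; lra.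
suff <- : connected_component A (rc s) = A by exact: component_connected.
apply/seteqP; split; first exact: connected_component_sub.
move=> q Aq; apply: contrapT => nq.
have s0 : 0 < s by rewrite /s; lra.
have s1 : s < 1 by rewrite /s; lra.
have colX : [set z : C | s <= nm z < 1] `<=` connected_component A (rc s).
  exact: (connected_sub_component (collar_connected s0 s1) cs colA).
set X := connected_component A q.
have oX : open X by exact: component_open.
have XA : X `<=` A by exact: connected_component_sub.
have Xq : X q by exact: connected_component_refl.
have Xs z : X z -> nm z < s.
  move=> Xz; rewrite ltNge; apply/negP => sz; apply: nq.
  have [+ _] := XA z Xz; rewrite /disk /= subr0 => z1.
  have h : connected_component A (rc s) z by apply: colX; rewrite /= sz.
  exact: connected_component_trans h (connected_component_sym Xz).
have clX z : closure X z -> closure W z -> ~ W z.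
  move=> cX cWz Wz; have [w [Xw Ww]] := cX _ (open_nbhs_nbhs (conj oW Wz)).
  by have [_] := XA w Xw; apply; exact: subset_closure.
have XJ : closure X `\` X `<=` J.
  move=> z [cX nX]; have zs := closure_bound cX Xs.
  have cWz : closure W z.
    apply: contrapT => ncW; apply: nX.
    have Az : A z by split=> //; rewrite /disk /= subr0; lra.
    have [r rr rA] := (openP A).1 oA z Az.
    have [w [Xw wr]] := cX _ (nbhs_disk z rr).
    apply: connected_component_trans (Xw) _.
    exact: (connected_sub_component (@disk_connected R z r) wr rA (@disk_center R z r rr)).
  split; first exact: cWz.
  rewrite ((interior_id W).1 oW); exact (clX z cX cWz).
have WJ : closure W `\` W `<=` J by move=> z [cz nz]; split=> //; rewrite (interior_id _).1.
have cJ := closed_jordan jW.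
have bW z : J z -> closure W z /\ ~ W z.
  by move=> [h1 h2]; split=> // Wz; apply: h2; rewrite ((interior_id W).1 oW).
have np1 : ~ closure X p1 by move=> h; exact: (clX p1 h (subset_closure Wp1)).
have nqW : ~ closure W q by have [] := Aq.
have [j [cj Jj jJ j01 jinj]] := jordan_param jW.
have jp1 t : j t - p1 != 0.
  by rewrite subr_eq0; apply/eqP => e; have [_ h] := bW _ (jJ t); apply: h; rewrite e.
have jq t : j t - q != 0.
  by rewrite subr_eq0; apply/eqP => e; have [h _] := bW _ (jJ t); apply: nqW; rewrite -e.
have [l1 [cl1 l1E]] := path_log (fun t => ctsB (cj t) (cts_cst p1 t)) jp1.
have [l2 [cl2 l2E]] := path_log (fun t => ctsB (cj t) (cts_cst q t)) jq.
have z01 : 0 <= (0 : R) <= 1 by rewrite lexx ler01.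
have o01 : 0 <= (1 : R) <= 1 by rewrite lexx ler01.
have wind l (p : C) : (forall t, 0 <= t <= 1 -> cexp (l t) = j t - p) -> (forall t, j t - p != 0) ->
    exists n : int, l 1 = l 0 + rc (2 * pi * n%:~R) * cI.
  move=> lE jp; have : cexp (l 1 - l 0) = 1 by rewrite cexpB (lE 1 o01) (lE 0 z01) j01 divff.
  by move=> /cexp_eq1[n h]; exists n; rewrite -h addrC subrK.
have [n1 h1] := wind l1 p1 l1E jp1; have [n2 h2] := wind l2 q l2E jq.
have [n10|n10] := eqVneq n1 0.
  have ab : 1 * n1 + 0 * n2 = 0 by rewrite n10 mulr0 mul0r.
  have [L [M [M0 cL LM LE]]] := winding_combo cj Jj jinj cl1 cl2 l1E l2E h1 h2 ab.
  exact: (no_boundary_log oW cJ Wr WJ Wp1 nqW (oner_neq0 _) M0 cL LM LE).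
have ab : n1 * n2 + (- n2) * n1 = 0 by rewrite mulNr mulrC subrr.
have [L [M [M0 cL LM LE]]] := winding_combo cj Jj jinj cl2 cl1 l2E l1E h2 h1 ab.
exact: (no_boundary_log oX cJ Xs XJ Xq np1 n10 M0 cL LM LE).
Qed.

End JordanComplement.

Section Riemann.
Variable R : realType.
Local Notation C := (Cplane R).
Local Notation nm := (@nm R).
Local Notation rc := (@rc R).
Local Notation cRe := (@cRe R).
Local Notation cIm := (@cIm R).
Local Notation cI := (cI R).
Local Notation cbar := (@cbar R).
Implicit Types (z w a b c d : C) (x y t s r e m : R) (f F G g h : C -> C) (D : set C).

(** * The Riemann mapping theorem *)

Definition mob w z : C := (z - w) / (1 - cbar w * z).

Lemma mob_den w z : nm w < 1 -> nm z < 1 -> 1 - cbar w * z != 0.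
Proof.
move=> w1 z1; rewrite subr_eq0; apply/eqP => e.
have : nm (cbar w * z) < 1 by rewrite nmM nm_cbar; have := nm_ge0 z; have := nm_ge0 w; nra.
by rewrite -e nm1 ltxx.
Qed.

Lemma nm_lt1_sqr z w : w != 0 -> nm z ^+ 2 < nm w ^+ 2 -> nm (z / w) < 1.
Proof.
move=> w0 zw; rewrite nmM nmV ltr_pdivrMr ?nm_gt0 // mul1r.
by have := nm_ge0 z; have := nm_ge0 w; nra.
Qed.

Lemma mob_lt1 w z : nm w < 1 -> nm z < 1 -> nm (mob w z) < 1.
Proof.
move=> w1 z1; apply: nm_lt1_sqr; first exact: mob_den.
have h1 := nm_sqr z; have h2 := nm_sqr w.
have w2 : nm w ^+ 2 < 1 by have := nm_ge0 w; nra.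
have z2 : nm z ^+ 2 < 1 by have := nm_ge0 z; nra.
rewrite h1 in z2; rewrite h2 in w2.
rewrite !nm_sqr; have -> : cRe (1 - cbar w * z) = 1 - (cRe w * cRe z + cIm w * cIm z).
  by case: w {w1 h2 w2} => ? ?; case: z {z1 h1 z2} => ? ? /=; ring.
have -> : cIm (1 - cbar w * z) = cIm w * cRe z - cRe w * cIm z.
  by case: w {w1 h2 w2} => ? ?; case: z {z1 h1 z2} => ? ? /=; ring.
rewrite cReD cImD cReN cImN.
move: (cRe w) (cIm w) (cRe z) (cIm z) w2 z2 => p q u v; clear => w2 z2.
rewrite -subr_gt0; have -> : (1 - (p * u + q * v)) ^+ 2 + (q * u - p * v) ^+ 2 -
   ((u - p) ^+ 2 + (v - q) ^+ 2) = (1 - (u ^+ 2 + v ^+ 2)) * (1 - (p ^+ 2 + q ^+ 2)) by ring.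
by rewrite mulr_gt0 // subr_gt0.
Qed.

Lemma mobK w z : nm w < 1 -> nm z < 1 -> mob (- w) (mob w z) = z.
Proof.
move=> w1 z1; have d1 := mob_den w1 z1.
have d2 : 1 + cbar w * (mob w z) != 0.
  have := mob_den (w := - w) (z := mob w z); rewrite nmN => /(_ w1 (mob_lt1 w1 z1)).
  have -> : cbar (- w) = - cbar w by exact: rmorphN.
  by rewrite mulNr opprK.
have d3 : 1 - cbar w * w != 0 by exact: mob_den.
rewrite /mob; have -> : cbar (- w) = - cbar w by exact: rmorphN.
move: d1 d2 d3; rewrite /mob; move: (cbar w) => v d1 d2 d3.
have e : 1 + v * ((z - w) / (1 - v * z)) = (1 - v * w) / (1 - v * z) by field.
rewrite mulNr opprK opprK e; field.
by rewrite d1 d3.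
Qed.

Lemma mobKr w z : nm w < 1 -> nm z < 1 -> mob w (mob (- w) z) = z.
Proof. by move=> w1 z1; rewrite -{1}(opprK w) mobK ?nmN. Qed.

Lemma mob_self w : mob w w = 0. Proof. by rewrite /mob subrr mul0r. Qed.

Lemma mob0 w : mob w 0 = - w. Proof. by rewrite /mob mulr0 subr0 divr1 sub0r. Qed.

Lemma hol_mob w : nm w < 1 -> hol (disk 0 1) (mob w).
Proof.
move=> w1; apply: holM; first by apply: holB; [exact: hol_id|exact: hol_cst].
apply: holV => [|z]; first by apply: holB; [exact: hol_cst|apply: holM; [exact: hol_cst|exact: hol_id]].
by rewrite /disk /= subr0 => z1; exact: mob_den.
Qed.

Lemma disk01 z : disk 0 1 z = (nm z < 1) :> Prop.
Proof. by rewrite /disk /= subr0. Qed.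

Lemma inj_mob w : nm w < 1 -> inj_on (disk 0 1) (mob w).
Proof. by move=> w1 z z'; rewrite !disk01 => h1 h2 e; rewrite -(mobK w1 h1) e mobK. Qed.

(** * Limits of bounded holomorphic functions along an ultrafilter *)

Section UltraLimit.
Variables (U : set_system nat) (uU : UltraFilter U).

(** One ultrafilter serves all bounded sequences at once. This replaces the diagonal extraction of a
    subsequence in Montel's theorem. *)
Lemma ultra_lim (u : nat -> C) (M : R) : (forall n, nm (u n) <= M) ->
  exists2 l, nm l <= M & forall e, 0 < e -> U [set n | nm (u n - l) < e].
Proof.
move=> uM; have cK := @closed_disk_compact R 0 M.
have FM : (u @ U) [set z | nm (z - 0) <= M].
  change (U [set n | nm (u n - 0) <= M]).
  by apply: filterS (@filterT _ U _) => n _; rewrite /= subr0; exact: uM.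
have [l [/= lM ul]] := cK (u @ U) _ FM.
exists l; first by move: lM; rewrite subr0.
move=> e e0; have [//|h] := in_ultra_setVsetC [set n | nm (u n - l) < e] uU.
have [z [z1 z2]] := ul [set z | ~ nm (z - l) < e] _ h (nbhs_disk l e0).
by exfalso; exact: z1 z2.
Qed.

Lemma ultra_ex (A : set nat) : U A -> exists n, A n.
Proof. by move=> UA; have [n An] := filter_ex UA; exists n. Qed.

(* A pointwise limit of uniformly bounded holomorphic functions is holomorphic,
   because the Taylor remainder is bounded uniformly in the sequence. *)
Lemma ultra_hol D (f : nat -> C -> C) F (M : R) : open D -> 0 < M ->
  (forall n, hol D (f n)) -> (forall n z, D z -> nm (f n z) <= M) ->
  (forall z, D z -> forall e, 0 < e -> U [set n | nm (f n z - F z) < e]) -> hol D F.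
Proof.
move=> oD M0 hf fM fF c Dc; have [r r0 rD] := (openP D).1 oD c Dc.
have hfr n : hol (disk c r) (f n) by exact: hol_sub (hf n).
have fMr n z : disk c r z -> nm (f n z) <= M by move=> /rD; exact: fM.
have [d _ dl] : exists2 d, nm d <= 4 * M / r &
    forall e, 0 < e -> U [set n | nm (derive1 (f n) c - d) < e].
  apply: ultra_lim => n; apply: (deriv_bound r0 (hfr n) (fMr n)).
  by rewrite subrr nm0; lra.
exists d; pose K : R := 32 * M / r ^+ 2.
have K0 : 0 < K by rewrite /K divr_gt0 ?exprn_gt0 // mulr_gt0.
have key z : nm (z - c) <= r / 4 -> nm (F z - F c - d * (z - c)) <= K * nm (z - c) ^+ 2.
  move=> zr; have Dz : D z by apply: rD; rewrite /disk /=; lra.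
  apply/ler_addgt0Pr => e e0.
  pose e1 : R := e / (2 + nm (z - c)).
  have p0 : 0 < 2 + nm (z - c) by have := nm_ge0 (z - c); lra.
  have e10 : 0 < e1 by rewrite divr_gt0.
  have [n [[/= n1 n2] n3]] := ultra_ex (filterI (filterI (fF z Dz e1 e10) (fF c Dc e1 e10)) (dl e1 e10)).
  have t := taylor1 r0 (hfr n) (fMr n) zr; rewrite -/K in t.
  have -> : F z - F c - d * (z - c) = (f n z - f n c - derive1 (f n) c * (z - c)) +
     ((F z - f n z) + ((f n c - F c) + (derive1 (f n) c - d) * (z - c))) by ring.
  apply: le_trans (le_nmD _ _) _; apply: lerD t _.
  apply: le_trans (le_nmD _ _) _; rewrite nmB.
  apply: le_trans (lerD (ltW n1) (le_nmD _ _)) _; rewrite nmM.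
  have n3' := ler_wpM2r (nm_ge0 (z - c)) (ltW n3).
  have -> : e = e1 * (2 + nm (z - c)) by rewrite /e1 divfK // gt_eqF.
  rewrite mulrDr; lra.
apply/cderP => e e0; exists (Num.min (r / 4) (e / K)).
  have r4 : 0 < r / 4 by lra.
  rewrite lt_min r4 /=.
  by rewrite divr_gt0.
move=> w; rewrite lt_min => /andP[w1 w2].
apply: le_trans (key w (ltW w1)) _; rewrite expr2 mulrA ler_wpM2r ?nm_ge0 //.
by rewrite mulrC -ler_pdivlMr // ltW.
Qed.

(** Pointwise limits along [U] are improved to a uniform bound on a circle: if the bound failed for
    [U]-many [n], the points of failure would have a limit [l] on the circle, and the Lipschitz
    bound common to all [f n] near [l] would contradict the lower bound at [l]. *)
Lemma ultra_circle D (f : nat -> C -> C) F c p (M r m : R) : open D -> 0 < M ->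
  (forall n, hol D (f n)) -> (forall n z, D z -> nm (f n z) <= M) ->
  (forall z, D z -> forall e, 0 < e -> U [set n | nm (f n z - F z) < e]) ->
  (forall z, nm (z - c) <= r -> D z) -> D p -> 0 < m ->
  (forall z, nm (z - c) = r -> m <= nm (F z - F p)) ->
  U [set n | forall z, nm (z - c) = r -> m / 2 <= nm (f n z - f n p)].
Proof.
move=> oD M0 hf fM fF rD Dp m0 Fm.
have m40 : 0 < m / 8 by lra.
set A := [set n | _]; have [//|nA] := in_ultra_setVsetC A uU.
have /choice[w wP] : forall n, exists w, (~` A) n -> nm (w - c) = r /\ nm (f n w - f n p) < m / 2.
  move=> n; have [An|] := pselect (A n); first by exists 0.
  move=> /existsNP[z /not_implyP[zr /negP]]; rewrite -ltNge => h.
  by exists z.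
pose w' n := if `[< (~` A) n >] then w n else c.
have r0 : 0 <= r.
  by have [n /wP[<- _]] := ultra_ex nA; exact: nm_ge0.
have w'r n : nm (w' n - c) <= r.
  rewrite /w'; case: asboolP => [/wP[-> _]//|_]; by rewrite subrr nm0.
have wb n : nm (w' n) <= r + nm c.
  by have := le_nmB (w' n) c; have := w'r n; lra.
have [l _ wl] := ultra_lim wb.
have lr : nm (l - c) = r.
  apply/eqP; rewrite -subr_eq0 -normr_le0; apply/ler_addgt0Pr => e e0; rewrite add0r.
  have [n [/= nAn n1]] := ultra_ex (filterI nA (wl e e0)).
  move: n1; rewrite /w' asboolT // => n1; have [w1 _] := wP n nAn.
  have := le_nm_sub (w n) l c; have := le_nm_sub l (w n) c.
  rewrite w1 (nmB l (w n)); have := ltW n1 => h1 h2 h3.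
  by rewrite ler_norml; apply/andP; split; lra.
have Dl : D l by apply: rD; rewrite lr.
have [s s0 sD] := (openP D).1 oD l Dl.
pose K : R := 4 * M / s.
have K0 : 0 < K by rewrite divr_gt0 // mulr_gt0.
have e10 : 0 < Num.min (s / 2) (m / 8 / K).
  by rewrite lt_min (divr_gt0 m40 K0) andbT; lra.
have [n [[[/= nAn n1] n2] n3]] := ultra_ex (filterI (filterI (filterI nA (wl _ e10))
  (fF l Dl _ m40)) (fF p Dp _ m40)).
have [w1 w2] := wP n nAn; move: n1; rewrite /w' asboolT // lt_min => /andP[n1 n1'].
have hfs : hol (disk l s) (f n) by exact: hol_sub (hf n).
have z0 : nm (l - l) <= s / 2 by rewrite subrr nm0; lra.
have := lip_bound s0 hfs (fun z k => fM n z (sD z k)) z0 (ltW n1).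
rewrite -/K => h1.
have h2 : K * nm (w n - l) < m / 8 by rewrite mulrC -ltr_pdivlMr.
exfalso; have := Fm l lr; have -> : F l - F p = (F l - f n l) + ((f n l - f n (w n)) +
   ((f n (w n) - f n p) + (f n p - F p))) by ring.
move=> h3; have h4 := le_trans h3 (le_nmD _ _).
have h5 := le_nmD (f n l - f n (w n)) (f n (w n) - f n p + (f n p - F p)).
have h6 := le_nmD (f n (w n) - f n p) (f n p - F p).
by rewrite (nmB (F l)) in h4; rewrite (nmB (f n l)) in h5; lra.
Qed.

End UltraLimit.

(** Koebe's trick: a square root [g] of [z - c] is injective and never takes both a value and its
    negative, so its image omits a disk about [- g a], and an inversion in that disk makes it
    bounded. *)
Lemma disk_map_ex D c a : open D -> D a -> ~ D c ->
  (forall f, hol D f -> (forall z, D z -> f z != 0) ->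
     exists2 g, hol D g & forall z, D z -> g z ^+ 2 = f z) ->
  exists f, [/\ hol D f, inj_on D f, forall z, D z -> nm (f z) < 1 & f a = 0].
Proof.
move=> oD Da nDc sq.
have hzc : hol D (fun z => z - c) by apply: holB; [exact: hol_id|exact: hol_cst].
have [|g hg gE] := sq _ hzc.
  by move=> z Dz; rewrite subr_eq0; apply: contraPneq Dz => ->.
have gi : inj_on D g.
  by move=> z w Dz Dw e; apply: (addIr (- c)); rewrite -gE // -gE // e.
have g0 z : D z -> g z != 0.
  move=> Dz; apply/eqP => e; apply: nDc; have := gE z Dz; rewrite e expr0n /= => /esym/eqP.
  by rewrite subr_eq0 => /eqP <-.
have [r r0 rg] := (openP _).1 (open_image oD hg gi) (g a) (ex_intro2 _ _ a Da erefl).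
have far z : D z -> r <= nm (g z + g a).
  move=> Dz; rewrite leNgt; apply/negP => h.
  have [|w Dw gw] := rg (- g z); first by rewrite /disk /= -opprD nmN.
  have zw : z = w by apply: (addIr (- c)); rewrite -gE // -gE // gw sqrrN.
  have /eqP := gw; rewrite -zw -subr_eq0 opprK -mulr2n mulrn_eq0 /= => /eqP e.
  by have := g0 z Dz; rewrite e eqxx.
have nz z : D z -> g z + g a != 0.
  by move=> Dz; rewrite -nm_gt0; apply: lt_le_trans (far z Dz).
pose f1 z := rc r / (g z + g a).
have f1le z : D z -> nm (f1 z) <= 1.
  move=> Dz; rewrite nmM nm_rc nmV gtr0_norm // ler_pdivrMr ?mul1r; last by rewrite nm_gt0 nz.
  exact: far.
(* [f1] has modulus at most 1, so the difference is at most 2; dividing by 3 lands in the open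
   disk. *)
exists (fun z => (f1 z - f1 a) * 3^-1); split.
- apply: holM; last exact: hol_cst.
  apply: holB; last exact: hol_cst.
  apply: holM; first exact: hol_cst.
  by apply: holV => //; apply: holD; [exact: hg|exact: hol_cst].
- move=> z w Dz Dw /mulIf; rewrite invr_eq0 pnatr_eq0 /= => /(_ isT) /addIr.
  have rn : rc r != 0 by rewrite rc_eq0 gt_eqF.
  by rewrite /f1 => /(mulfI rn) /invr_inj /addIr; exact: gi.
- move=> z Dz; rewrite nmM nmV -rc_nat nm_rc ger0_norm //.
  rewrite ltr_pdivrMr // mul1r; apply: le_lt_trans (le_nmD _ _) _; rewrite nmN.
  by have := f1le z Dz; have := f1le a Da; lra.
- by rewrite subrr mul0r.
Qed.

(** Hurwitz's argument: if [F p = F c], then [f n - f n p] has a zero inside a small circle about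
    [c] for [U]-many [n]. The circle is smaller than [nm (p - c)], so this contradicts injectivity.
    The points [b1] and [b2] ensure that the limit is not constant. *)
Lemma ultra_inj (U : set_system nat) D (f : nat -> C -> C) F (M : R) b1 b2 : UltraFilter U ->
  open D -> connected D -> 0 < M ->
  (forall n, hol D (f n)) -> (forall n z, D z -> nm (f n z) <= M) ->
  (forall z, D z -> forall e, 0 < e -> U [set n | nm (f n z - F z) < e]) ->
  (forall n, inj_on D (f n)) -> D b1 -> D b2 -> F b1 <> F b2 -> inj_on D F.
Proof.
move=> uU oD cD M0 hf fM fF fi Db1 Db2 Fb p c Dp Dc Fpc; apply: contrapT => pc.
have hF := ultra_hol uU oD M0 hf fM fF.
have hG : hol D (fun z => F z - F p) by apply: holB => //; exact: hol_cst.
have s0 : 0 < nm (p - c) by rewrite nm_gt0 subr_eq0; apply/eqP.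
have [|r [r0 rs rD rn]] := good_circle oD hG Dc s0.
  move=> [r r0 rz]; apply: Fb.
  have Z := identity_theorem oD cD hG Dc r0 rz.
  by have /eqP := Z b1 Db1; have /eqP := Z b2 Db2; rewrite !subr_eq0 => /eqP -> /eqP ->.
have [m m0 hm] := circle_min oD hG r0 rD rn.
have UA := ultra_circle uU oD M0 hf fM fF rD Dp m0 hm.
have m40 : 0 < m / 8 by lra.
have [n [[/= n1 n2] n3]] := ultra_ex uU (filterI (filterI UA (fF c Dc _ m40)) (fF p Dp _ m40)).
have hg : hol D (fun z => f n z - f n p) by apply: holB => //; exact: hol_cst.
have m20 : 0 < m / 2 by lra.
have [|z zr /eqP] := hurwitz_disk oD hg r0 m20 rD n1.
  have -> : f n c - f n p = (f n c - F c) - (f n p - F p) by rewrite Fpc; ring.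
  by apply: le_lt_trans (le_nmD _ _) _; rewrite nmN; lra.
rewrite subr_eq0 => /eqP e; have Dz : D z by apply: rD; lra.
by have zp := fi n z p Dz Dp e; move: zr; rewrite zp => zr; lra.
Qed.

(** Instead of the derivative at [a], the value [nm (f b)] at a second point is maximized, so that
    only values have to pass to the limit. If the maximizer [F] omitted [w], a square root of
    [mob w] after [F] would give a competitor [h] with [F = P] after [h], where [P] is a self-map of
    the disk fixing [0]. Maximality forces equality in Schwarz's lemma for [P], hence a rotation,
    but [P] contains a squaring and is not injective. *)
Theorem riemann_mapping D c a : open D -> connected D -> D a -> ~ D c ->
  (forall f, hol D f -> (forall z, D z -> f z != 0) ->
     exists2 g, hol D g & forall z, D z -> g z ^+ 2 = f z) ->
  exists f, [/\ hol D f, inj_on D f, f @` D = disk 0 1 & f a = 0].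
Proof.
move=> oD cD Da nDc sq.
pose fam f := [/\ hol D f, inj_on D f, forall z, D z -> nm (f z) < 1 & f a = 0].
have [f0 f0P] : exists f, fam f := disk_map_ex oD Da nDc sq.
have [b Db ba] : exists2 b, D b & b != a.
  have [r r0 rD] := (openP D).1 oD a Da; exists (a + rc (r / 2)).
    by apply: rD; rewrite /disk /= addrC addKr nm_rc ger0_norm; lra.
  by rewrite -subr_eq0 addrC addKr rc_eq0; apply/eqP; lra.
pose S := [set x : R | exists2 f, fam f & x = nm (f b)].
have hS : has_sup S.
  split; first by exists (nm (f0 b)), f0.
  by exists 1 => _ [f [_ _ f1 _] ->]; exact: ltW (f1 b Db).
have Sle f : fam f -> nm (f b) <= sup S.
  by move=> fP; apply: sup_upper_bound => //; exists f.
have S0 : 0 < sup S.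
  apply: lt_le_trans (Sle _ f0P); have [_ f0i _ f0a] := f0P.
  by rewrite nm_gt0 -f0a; apply: contraNneq ba => /(f0i _ _ Db Da) ->.
have /choice[f fP] : forall n : nat, exists f, fam f /\ sup S - n.+1%:R^-1 < nm (f b).
  move=> n; have n0 : 0 < n.+1%:R^-1 :> R by rewrite invr_gt0.
  by have [_ [f ff ->] h] := sup_adherent n0 hS; exists f.
(* An ultrafilter finer than the eventual one, so that [n.+1%:R^-1] becomes small along [U] and the
   supremum is attained in the limit. *)
have [U [uU evU]] := ultraFilterLemma (@eventually_filter).
have hf n : hol D (f n) by have [[]] := fP n.
have f1 n z : D z -> nm (f n z) < 1 by move=> Dz; have [[_ _ h _] _] := fP n; exact: h.
have fi n : inj_on D (f n) by have [[]] := fP n.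
have fa n : f n a = 0 by have [[]] := fP n.
have fM n z : D z -> nm (f n z) <= 1 by move=> Dz; exact: ltW (f1 n z Dz).
have /choice[F FP] : forall z, exists l, D z -> nm l <= 1 /\ forall e, 0 < e -> U [set n | nm (f n z - l) < e].
  move=> z; have [Dz|nD] := pselect (D z); last by exists 0.
  by have [l l1 lE] := ultra_lim uU (fun n => fM n z Dz); exists l.
have fF z : D z -> forall e, 0 < e -> U [set n | nm (f n z - F z) < e] by move=> /FP[].
have hF := ultra_hol uU oD ltr01 hf fM fF.
have Fa : F a = 0.
  apply/eqP; rewrite -nm_eq0 eq_le nm_ge0 andbT; apply/ler_addgt0Pr => e e0; rewrite add0r.
  by have [n /= h] := ultra_ex uU (fF a Da e e0); move: h; rewrite fa sub0r nmN => /ltW.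
have Fb : sup S <= nm (F b).
  apply/ler_addgt0Pr => e e0; have e2 : 0 < e / 2 by lra.
  have ev : U [set n | n.+1%:R^-1 < e / 2].
    by apply: evU; exact: near_infty_natSinv_lt (PosNum e2).
  have [n [/= n1 n2]] := ultra_ex uU (filterI ev (fF b Db _ e2)).
  have [_ n3] := fP n; have n4 := le_nmB (f n b) (F b).
  move: n1 n2 n3 n4; move: (nm _) (nm (F b)) (nm (f n b)) (sup S) (n.+1%:R^-1) => x1 x2 x3 x4 x5.
  by clear; move=> h1 h2 h3 h4; lra.
have Fab : F a <> F b.
  by move=> e; move: Fb; rewrite -e Fa nm0; lra.
have Fi := ultra_inj uU oD cD ltr01 hf fM fF fi Da Db Fab.
have F1 z : D z -> nm (F z) < 1.
  move=> Dz; rewrite lt_neqAle; have [Fz _] := FP z Dz; rewrite Fz andbT.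
  apply/eqP => e; apply: Fab.
  have h1 w : D w -> nm (F w) <= nm (F z) by move=> /FP[+ _]; rewrite e.
  have h := strong_max oD cD hF Dz h1.
  by rewrite (h a Da) (h b Db).
have famF : fam F by [].
exists F; split=> //; apply/seteqP; split=> [_ [z Dz <-]|w]; first by rewrite disk01 F1.
rewrite disk01 => w1; apply: contrapT => nw.
have Fd z : D z -> disk 0 1 (F z) by move=> Dz; rewrite disk01 F1.
have hm : hol D (fun z => mob w (F z)) := hol_comp hF (hol_mob w1) Fd.
have [|g hg gE] := sq _ hm.
  move=> z Dz; apply/eqP => e; apply: nw; exists z => //.
  apply: (inj_mob w1); rewrite ?disk01 ?F1 //.
  by rewrite e mob_self.
have m1 z : D z -> nm (mob w (F z)) < 1 by move=> Dz; apply: mob_lt1 => //; exact: F1.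
have g1 z : D z -> nm (g z) < 1.
  by move=> Dz; have := m1 z Dz; rewrite -gE // nmX => h; have := nm_ge0 (g z); nra.
have gd z : D z -> disk 0 1 (g z) by move=> Dz; rewrite disk01 g1.
pose v := g a; have v1 : nm v < 1 by exact: g1.
pose h z := mob v (g z).
have famh : fam h.
  split.
  - exact: hol_comp hg (hol_mob v1) gd.
  - move=> z z' Dz Dz' /(inj_mob v1 (gd z Dz) (gd z' Dz')) e.
    apply: Fi => //; apply: (inj_mob w1); rewrite ?disk01 ?F1 //.
    by rewrite -gE // -gE // e.
  - by move=> z Dz; apply: mob_lt1 => //; exact: g1.
  - by rewrite /h mob_self.
have nv1 : nm (- v) < 1 by rewrite nmN.
have nw1 : nm (- w) < 1 by rewrite nmN.
pose P z := mob (- w) (mob (- v) z ^+ 2).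
have vd z : disk 0 1 z -> disk 0 1 (mob (- v) z).
  by rewrite !disk01 => z1; apply: mob_lt1.
have vd2 z : disk 0 1 z -> disk 0 1 (mob (- v) z ^+ 2).
  by move=> /vd; rewrite !disk01 nmX => z1; rewrite expr_lt1 // nm_ge0.
have hP : hol (disk 0 1) P.
  have h2 : hol (disk 0 1) (fun z => mob (- v) z ^+ 2) := holX 2 (hol_mob nv1).
  exact: hol_comp h2 (hol_mob nw1) vd2.
have Pd z : disk 0 1 z -> disk 0 1 (P z).
  by move=> /vd2; rewrite !disk01 => z1; apply: mob_lt1.
have PE z : D z -> P (h z) = F z.
  by move=> Dz; rewrite /P /h mobK ?g1 // gE // mobK // F1.
have ha : h a = 0 by have [_ _ _ e] := famh.
have P0 : P 0 = 0 by rewrite -ha PE // Fa.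
have hd z : D z -> disk 0 1 (h z) by move=> Dz; have [_ _ k _] := famh; rewrite disk01 k.
have hb : nm (P (h b)) = nm (h b).
  apply/eqP; rewrite eq_le (schwarz hP Pd P0 (hd b Db)) PE //.
  by apply: le_trans (Sle h famh) Fb.
have hb0 : h b != 0.
  by have [_ hi _ _] := famh; rewrite -ha; apply: contraNneq ba => /(hi _ _ Db Da) ->.
have [k k1 kE] := schwarz_eq hP Pd P0 (ex_intro _ (h b) (And3 (hd b Db) hb0 hb)).
have half1 : nm (rc (1 / 2)) < 1 by rewrite nm_rc ger0_norm; lra.
have half2 : nm (- rc (1 / 2)) < 1 by rewrite nmN.
have z1d : disk 0 1 (mob v (rc (1/2))) by rewrite disk01; apply: mob_lt1.
have z2d : disk 0 1 (mob v (- rc (1/2))) by rewrite disk01; apply: mob_lt1.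
(* The points [1 / 2] and [- 1 / 2] have the same square, so [P] identifies their images under
   [mob v]. *)
have e : P (mob v (rc (1 / 2))) = P (mob v (- rc (1 / 2))).
  by rewrite /P !mobK // sqrrN.
rewrite !kE // in e; have k0 : k != 0 by rewrite -nm_gt0 k1 ltr01.
have := inj_mob v1 _ _ (mulfI k0 e); rewrite !disk01 => /(_ half1 half2) /eqP.
rewrite -subr_eq0 opprK -rcD rc_eq0 => /eqP; lra.
Qed.

(* Schwarz applied to the map and to its inverse. *)
Lemma disk_aut f g : hol (disk 0 1) f -> hol (disk 0 1) g ->
  (forall z, disk 0 1 z -> disk 0 1 (f z)) -> (forall z, disk 0 1 z -> disk 0 1 (g z)) ->
  (forall z, disk 0 1 z -> g (f z) = z) -> (forall z, disk 0 1 z -> f (g z) = z) ->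
  exists k w, [/\ nm k = 1, nm w < 1 & forall z, disk 0 1 z -> f z = k * mob w z].
Proof.
move=> hf hg fd gd gf fg.
have d0 : disk 0 1 (0 : C) by rewrite disk01 nm0 ltr01.
pose w := g 0; have w1 : nm w < 1 by rewrite -disk01; exact: gd.
have nw1 : nm (- w) < 1 by rewrite nmN.
have md z : disk 0 1 z -> disk 0 1 (mob w z) by rewrite !disk01; exact: mob_lt1.
have md' z : disk 0 1 z -> disk 0 1 (mob (- w) z) by rewrite !disk01; exact: mob_lt1.
pose P z := f (mob (- w) z); pose Q z := mob w (g z).
have hP : hol (disk 0 1) P := hol_comp (hol_mob nw1) hf md'.
have hQ : hol (disk 0 1) Q := hol_comp hg (hol_mob w1) gd.
have Pd z : disk 0 1 z -> disk 0 1 (P z) by move=> /md' /fd.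
have Qd z : disk 0 1 z -> disk 0 1 (Q z) by move=> /gd /md.
have P0 : P 0 = 0 by rewrite /P mob0 opprK /w fg.
have Q0 : Q 0 = 0 by rewrite /Q mob_self.
have QP z : disk 0 1 z -> Q (P z) = z.
  by move=> dz; rewrite /Q /P gf; [rewrite mobKr //; rewrite -disk01|exact: md'].
pose z0 : C := rc (1 / 2).
have dz0 : disk 0 1 z0 by rewrite disk01 nm_rc ger0_norm; lra.
have z00 : z0 != 0 by rewrite rc_eq0; apply/eqP; lra.
have e : nm (P z0) = nm z0.
  apply/eqP; rewrite eq_le (schwarz hP Pd P0 dz0) /=.
  by have := schwarz hQ Qd Q0 (Pd _ dz0); rewrite QP.
have [k k1 kE] := schwarz_eq hP Pd P0 (ex_intro _ z0 (And3 dz0 z00 e)).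
exists k, w; split=> // z dz; rewrite -kE; last exact: md.
by rewrite /P mobK // -disk01.
Qed.

End Riemann.

Section Dixon.
Variable R : realType.
Local Notation C := (Cplane R).
Local Notation nm := (@nm R).
Local Notation rc := (@rc R).
Local Notation cRe := (@cRe R).
Local Notation cIm := (@cIm R).
Local Notation cI := (cI R).
Implicit Types (z w a b c d p q : C) (x y t r e m : R) (f F G g h : C -> C) (D : set C) (s : seq C).

(** * Cauchy's theorem for polygons of index zero *)

(** A polygon is given by its first vertex [p] and the list [s] of the vertices that follow; it is
    closed when [last p s = p]. *)
Fixpoint pint f p s : C := if s is q :: s' then sint f p q + pint f q s' else 0.

Fixpoint ptr p s : set C :=
  if s is q :: s' then seg p q @` [set t : R | 0 <= t <= 1] `|` ptr q s' else [set p].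

Fixpoint plen p s : R := if s is q :: s' then nm (q - p) + plen q s' else 0.

Lemma pint_nil f p : pint f p [::] = 0. Proof. by []. Qed.
Lemma pint_cons f p q s : pint f p (q :: s) = sint f p q + pint f q s. Proof. by []. Qed.
Lemma plen_nil p : plen p [::] = 0. Proof. by []. Qed.
Lemma plen_cons p q s : plen p (q :: s) = nm (q - p) + plen q s. Proof. by []. Qed.

Lemma ptr_compact p s : compact (ptr p s).
Proof.
elim: s p => [|q s IH] p /=; first exact: compact_set1.
apply: compactU (IH q); apply: continuous_compact (@itv01_compact R).
by apply: continuous_subspaceT => t; exact (@cts_seg R p q t).
Qed.

Lemma ptr_head p s : ptr p s p.
Proof.
case: s => [//|q s] /=; left; exists 0; last exact: seg0.
by rewrite /= lexx ler01.
Qed.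

Lemma plen_ge0 p s : 0 <= plen p s.
Proof. by elim: s p => [//|q s IH] p /=; rewrite addr_ge0 ?nm_ge0. Qed.

Lemma cseg_ptr f p q s : (forall z, ptr p (q :: s) z -> cts f z) -> cseg f p q.
Proof. by move=> h t t01; apply: h; left; exists t. Qed.

Lemma pint_le f p s (M : R) : (forall z, ptr p s z -> cts f z) ->
  (forall z, ptr p s z -> nm (f z) <= M) -> nm (pint f p s) <= M * plen p s.
Proof.
elim: s p => [|q s IH] p cf fM; first by rewrite pint_nil nm0 plen_nil mulr0.
rewrite pint_cons plen_cons; apply: le_trans (le_nmD _ _) _; rewrite mulrDr lerD //; last first.
  by apply: IH => z zp; [apply: cf; right|apply: fM; right].
apply: sint_le; first exact: cseg_ptr cf.
by move=> t /andP[t0 t1]; apply: fM; left; exists t => //=; rewrite !ltW.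
Qed.

Lemma pintB f g p s : (forall z, ptr p s z -> cts f z) -> (forall z, ptr p s z -> cts g z) ->
  pint (fun z => f z - g z) p s = pint f p s - pint g p s.
Proof.
elim: s p => [|q s IH] p cf cg /=; first by rewrite subrr.
rewrite sintB; [|exact: cseg_ptr cf|exact: cseg_ptr cg].
rewrite IH; [ring| |] => z zp; [apply: cf|apply: cg]; by right.
Qed.

Lemma pintZ k f p s : (forall z, ptr p s z -> cts f z) ->
  pint (fun z => k * f z) p s = k * pint f p s.
Proof.
elim: s p => [|q s IH] p cf /=; first by rewrite mulr0.
rewrite sintZ; last exact: cseg_ptr cf.
by rewrite IH ?mulrDr // => z zp; apply: cf; right.
Qed.

Lemma eq_pint f g p s : (forall z, ptr p s z -> f z = g z) -> pint f p s = pint g p s.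
Proof.
elim: s p => [//|q s IH] p fg /=; congr (_ + _); last by apply: IH => z zp; apply: fg; right.
rewrite /sint; congr (_ * _); apply: eq_cint => t /andP[t0 t1].
by apply: fg; left; exists t => //=; rewrite !ltW.
Qed.

Lemma pint_FTC F f p s : (forall z, ptr p s z -> cder F z (f z)) ->
  pint f p s = F (last p s) - F p.
Proof.
elim: s p => [|q s IH] p hF /=; first by rewrite subrr.
rewrite (IH q) => [|z zp]; last by apply: hF; right.
by rewrite (@sint_FTC R F) => [|t t01]; [ring|apply: hF; left; exists t].
Qed.

Lemma pint_cat f p s s' : pint f p (s ++ s') = pint f p s + pint f (last p s) s'.
Proof. by elim: s p => [|q s IH] p /=; rewrite ?add0r // IH addrA. Qed.

Lemma ptr_cat p s s' : ptr p (s ++ s') `<=` ptr p s `|` ptr (last p s) s'.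
Proof.
elim: s p => [|q s IH] p z /=; first by right.
by move=> [h|/IH[h|h]]; [left; left|left; right|right].
Qed.

(** The hypothesis is a quadratic remainder uniform along the polygon, the form that [taylor1]
    delivers; continuity in two variables jointly never enters. *)
Lemma cder_pint (k : C -> C -> C) (d : C -> C) z0 p s (r M : R) : 0 < r -> 0 < M ->
  (forall z, nm (z - z0) < r -> forall w, ptr p s w -> cts (k z) w) ->
  (forall w, ptr p s w -> cts d w) ->
  (forall z, nm (z - z0) < r -> forall w, ptr p s w ->
     nm (k z w - k z0 w - (z - z0) * d w) <= M * nm (z - z0) ^+ 2) ->
  cder (fun z => pint (k z) p s) z0 (pint d p s).
Proof.
move=> r0 M0 ck cd kM; apply/cderP => e e0.
have L0 := plen_ge0 p s; pose L : R := plen p s + 1.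
have Lp : 0 < L by rewrite /L; lra.
exists (Num.min r (e / (M * L))); first by rewrite lt_min r0 divr_gt0 // mulr_gt0.
move=> z; rewrite lt_min => /andP[zr ze].
have z00 : nm (z0 - z0) < r by rewrite subrr nm0.
have c1 w : ptr p s w -> cts (fun w => k z w - k z0 w) w.
  by move=> h; exact (ctsB (ck z zr w h) (ck z0 z00 w h)).
have c2 w : ptr p s w -> cts (fun w => (z - z0) * d w) w.
  by move=> h; exact (ctsM (cts_cst _ w) (cd w h)).
have -> : pint (k z) p s - pint (k z0) p s - pint d p s * (z - z0) =
    pint (fun w => k z w - k z0 w - (z - z0) * d w) p s.
  rewrite (pintB c1 c2) (pintZ _ cd) (mulrC (pint d p s)); congr (_ - _).
  by rewrite (pintB (ck z zr) (ck z0 z00)).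
have c3 w : ptr p s w -> cts (fun w => k z w - k z0 w - (z - z0) * d w) w.
  by move=> h; exact (ctsB (c1 w h) (c2 w h)).
apply: le_trans (pint_le c3 (kM z zr)) _.
have h1 : nm (z - z0) * (M * L) <= e by rewrite -ler_pdivlMr ?mulr_gt0 // ltW.
have n0 := nm_ge0 (z - z0).
have h2 : M * nm (z - z0) ^+ 2 * plen p s <= M * nm (z - z0) ^+ 2 * L.
  by rewrite ler_wpM2l /L ?mulr_ge0 ?exprn_ge0 //; lra.
apply: le_trans h2 _; rewrite expr2; nra.
Qed.

Lemma dquotC f a z : dquot f a z = dquot f z a.
Proof.
rewrite /dquot eq_sym; case: eqVneq => [->//|za].
by rewrite -(opprB (f z)) -(opprB z a) invrN mulrN mulNr opprK.
Qed.

(** Differentiating a divided difference in one node repeats that node. The formula also covers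
    [a = z], so the polygon integral of [dquot] can be differentiated at points of the polygon
    itself. *)
Lemma dquot_cder D f a z : open D -> hol D f -> D a -> D z ->
  cder (dquot f a) z (dquot (dquot f z) z a).
Proof.
move=> oD hf Da Dz; rewrite {2}/dquot; case: eqVneq => [->|za].
  exact: hol_cder (hol_dquot oD hf Dz) Dz.
have h : cder (fun w => (f w - f a) / (w - a)) z
   (((derive1 f z - 0) * (z - a) - (f z - f a) * (1 - 0)) / (z - a) ^+ 2).
  apply: cder_div; first by rewrite subr_eq0 eq_sym.
    by apply: cderB; [exact: hol_cder hf Dz|exact: cder_cst].
  by apply: cderB; [exact: cder_id|exact: cder_cst].
have zan : z - a != 0 by rewrite subr_eq0 eq_sym.
have n0 : 0 < nm (z - a) by rewrite nm_gt0.
have -> : (dquot f z a - dquot f z z) / (a - z) =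
  ((derive1 f z - 0) * (z - a) - (f z - f a) * (1 - 0)) / (z - a) ^+ 2.
  rewrite /dquot eqxx (negPf za) -(opprB z a); move: zan; move: (z - a) (derive1 f z) => u v un.
  by field; rewrite ?oppr_eq0 ?un.
apply: cder_near n0 _ h => w wz; rewrite /dquot ifF //; apply/eqP => wa.
by move: wz; rewrite /disk /= wa nmB ltxx.
Qed.

(** * The index of a closed polygon and the global Cauchy theorem *)

Section Closed.
Variables (p : C) (s : seq C).
Hypothesis closed_s : last p s = p.
Let K := ptr p s.

(** The winding number times the period of [cexp]. The factor is kept, because only vanishing and
    local constancy are used. *)
Definition pidx z : C := pint (fun w => (w - z)^-1) p s.

Lemma pdist z : ~ K z -> exists2 m, 0 < m & forall w, K w -> m <= nm (w - z).
Proof.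
move=> nK; apply: (compact_lbound (@ptr_compact p s)) => [w _|w Kw].
  exact (continuous_nm_of (ctsB (cts_id w) (cts_cst z w))).
by rewrite nm_gt0 subr_eq0; apply: contra_notN nK => /eqP <-.
Qed.

Lemma cts_kernel f z w : cts f w -> w != z -> cts (fun w => f w / (w - z)) w.
Proof.
move=> cf wz; have h : cts (fun w => w - z) w := ctsB (cts_id w) (cts_cst z w).
by apply: (ctsM cf); apply: (ctsV _ h); rewrite subr_eq0.
Qed.

Lemma ne_dist z w (m : R) : 0 < m -> m <= nm (w - z) -> w != z.
Proof. by move=> m0; apply: contraTneq => ->; rewrite subrr nm0 -ltNge. Qed.

Lemma cauchy_kernel f z0 : (forall w, K w -> cts f w) -> ~ K z0 ->
  cder (fun z => pint (fun w => f w / (w - z)) p s) z0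
       (pint (fun w => f w / (w - z0) / (w - z0)) p s).
Proof.
move=> cf nK; have [m m0 hm] := pdist nK.
have [M M0 fM] : exists2 M, 0 < M & forall w, K w -> nm (f w) <= M.
  apply: (compact_bound (@ptr_compact p s)) => w Kw; exact (continuous_nm_of (cf w Kw)).
have m20 : 0 < m / 2 by lra.
have hz z w : nm (z - z0) < m / 2 -> K w -> m / 2 <= nm (w - z).
  by move=> h /hm; have := le_nm_sub z w z0; lra.
pose M' : R := M / (m / 2 * m ^+ 2).
have M'0 : 0 < M' by rewrite divr_gt0 // mulr_gt0 // exprn_gt0.
apply: (cder_pint m20 M'0).
- by move=> z zz w Kw; apply: cts_kernel (cf w Kw) _; exact: ne_dist m20 (hz z w zz Kw).
- move=> w Kw; have wz := ne_dist m0 (hm w Kw).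
  exact (cts_kernel (cts_kernel (cf w Kw) wz) wz).
- move=> z zz w Kw; have k1 := hz z w zz Kw; have k2 := hm w Kw.
  have w1 : w - z != 0 by rewrite subr_eq0; exact: ne_dist m20 k1.
  have w2 : w - z0 != 0 by rewrite subr_eq0; exact: ne_dist m0 k2.
  have -> : f w / (w - z) - f w / (w - z0) - (z - z0) * (f w / (w - z0) / (w - z0)) =
     f w * (z - z0) ^+ 2 / ((w - z) * (w - z0) ^+ 2) by field; rewrite w1 w2.
  rewrite nmM nmV (nmM (f w)) nmX (nmM (w - z)) nmX /M'.
  have p0 : 0 < m / 2 * m ^+ 2 by rewrite mulr_gt0 // exprn_gt0.
  have p1 : m / 2 * m ^+ 2 <= nm (w - z) * nm (w - z0) ^+ 2.
    by apply: ler_pM k1 _; rewrite ?exprn_ge0 ?(ltW m0) ?(ltW m20) // lerXn2r ?nnegrE ?nm_ge0 // ltW.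
  rewrite mulrAC ler_wpM2r ?exprn_ge0 ?nm_ge0 //.
  apply: ler_pM; rewrite ?nm_ge0 ?invr_ge0 ?mulr_ge0 ?exprn_ge0 ?nm_ge0 //; first exact: fM.
  by rewrite lef_pV2 // posrE; exact: lt_le_trans p1.
Qed.

Lemma pidxE z : pidx z = pint (fun w => 1 / (w - z)) p s.
Proof. by apply: eq_pint => w _; rewrite mul1r. Qed.

(** The differentiated kernel has the primitive [- (w - z)^-1], so its integral over a closed
    polygon vanishes. This gives local constancy of the index without knowing that it is
    integral. *)
Lemma pidx_cder z : ~ K z -> cder pidx z 0.
Proof.
move=> nK; have := @cauchy_kernel (fun _ => 1) z (fun w _ => cts_cst _ w) nK.
have -> : (fun z => pint (fun w => 1 / (w - z)) p s) = pidx by apply/funext => u; rewrite pidxE.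
rewrite (@pint_FTC (fun w => - (w - z)^-1)) ?closed_s ?subrr // => w Kw.
have [m m0 hm] := pdist nK; have wz := ne_dist m0 (hm w Kw).
have wz0 : w - z != 0 by rewrite subr_eq0.
have h : cder (fun w => w - z) w (1 - 0) by apply: cderB; [exact: cder_id|exact: cder_cst].
have h1 := cderV (f := fun w => w - z) wz0 h.
have h2 := cderN h1.
have -> : 1 / (w - z) / (w - z) = - (- (1 - 0) / (w - z) ^+ 2) by field.
exact: h2.
Qed.

Lemma pidx_near z : ~ K z -> exists2 r, 0 < r & forall w, disk z r w -> ~ K w /\ pidx w = pidx z.
Proof.
move=> nK; have [m m0 hm] := pdist nK; exists m => // w wz.
have out u : disk z m u -> ~ K u.
  by move=> uz /hm; rewrite leNgt => /negP.
split; first exact: out.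
have := @mvi R pidx (fun _ => 0) z w 0 0 _ _; rewrite !mul0r !subr0 => h.
apply/eqP; rewrite -subr_eq0 -nm_eq0 eq_le nm_ge0 andbT; apply: h => t t01.
  apply: pidx_cder; apply: out; apply: (open_disk_convex (disk_center z m0) wz t01).
by rewrite nm0.
Qed.

Lemma pidx_connected A : connected A -> (forall z, A z -> ~ K z) ->
  forall z w, A z -> A w -> pidx w = pidx z.
Proof.
move=> cA AK; apply: (conn_loc_const cA) => z Az.
have [r r0 h] := pidx_near (AK z Az).
by apply: filterS (nbhs_disk z r0) => w /h[_ ->].
Qed.

Lemma ptr_bounded : exists2 M, 0 < M & forall w, K w -> nm w < M.
Proof.
have [M M0 h] := compact_bound (@ptr_compact p s) (fun w _ => @continuous_nm R w).
by exists (M + 1) => [|w /h]; lra.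
Qed.

Lemma pidx_far (M : R) : 0 < M -> (forall w, K w -> nm w < M) -> forall z, M <= nm z -> pidx z = 0.
Proof.
move=> M0 KM z zM; have hD : hol (disk 0 M) (fun w => (w - z)^-1).
  apply: holV => [|w]; first by apply: holB; [exact: hol_id|exact: hol_cst].
  by rewrite /disk /= subr0 subr_eq0 => wM; apply: contraTneq zM => <-; rewrite -ltNge.
have [F hF] := primitive_convex (@open_disk R 0 M) (@open_disk_convex R 0 M) hD.
rewrite /pidx (@pint_FTC F) ?closed_s ?subrr // => w /KM wM; apply: hF.
by rewrite /disk /= subr0.
Qed.

Section Domain.
Variables (D : set C) (f : C -> C).
Hypotheses (oD : open D) (KD : K `<=` D) (hf : hol D f).
Hypothesis idx0 : forall z, ~ D z -> pidx z = 0.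

Lemma dquot_bound z0 : D z0 -> exists r M, [/\ 0 < r, 0 < M, disk z0 r `<=` D &
  forall w z, K w -> disk z0 r z -> nm (dquot f w z) <= M].
Proof.
move=> Dz0; have [r [M0 [r0 rD fM0]]] := local_bound oD hf Dz0.
have [Mk Mk0 fMk] : exists2 M, 0 < M & forall w, K w -> nm (f w) <= M.
  apply: (compact_bound (@ptr_compact p s)) => w Kw; exact (continuous_nm_of (hol_cts hf (KD Kw))).
have M00 : 0 <= M0 by apply: le_trans (nm_ge0 _) (fM0 z0 (disk_center z0 r0)).
have r40 : 0 < r / 4 by lra.
pose B1 : R := 4 * M0 / r; pose B2 : R := (Mk + M0) / (r / 4).
have B10 : 0 <= B1 by rewrite divr_ge0 ?mulr_ge0 // ltW.
have B20 : 0 < B2 by rewrite divr_gt0 //; lra.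
have hfr : hol (disk z0 r) f := hol_sub rD hf.
exists (r / 4), (B1 + B2); split=> //; first by lra.
  by move=> z; rewrite /disk /= => h; apply: rD; rewrite /disk /=; lra.
move=> w z Kw; rewrite /disk /= => zr; have zr2 : nm (z - z0) <= r / 2 by lra.
have [wr|wr] := leP (nm (w - z0)) (r / 2).
  suff : nm (dquot f w z) <= B1 by lra.
  rewrite /dquot; case: eqVneq => [_|zw]; first exact: deriv_bound r0 hfr fM0 wr.
  rewrite nmM nmV ler_pdivrMr ?nm_gt0 ?subr_eq0 //.
  exact: lip_bound r0 hfr fM0 wr zr2.
suff : nm (dquot f w z) <= B2 by lra.
have zw : r / 4 <= nm (z - w).
  by have := le_nm_sub z w z0; rewrite (nmB w z); lra.
have zw0 : 0 < nm (z - w) by lra.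
rewrite /dquot ifF; last by apply/negP => /eqP e; move: zw0; rewrite e subrr nm0 ltxx.
rewrite nmM nmV /B2; apply: ler_pM; rewrite ?nm_ge0 ?invr_ge0 ?nm_ge0 //.
  apply: le_trans (le_nmD _ _) _; rewrite nmN addrC lerD ?fMk // fM0 //.
  by rewrite /disk /=; lra.
by rewrite lef_pV2 ?posrE.
Qed.

Lemma cder_dixon z0 : D z0 ->
  cder (fun z => pint (dquot f z) p s) z0 (pint (dquot (dquot f z0) z0) p s).
Proof.
move=> Dz0; have [r [M [r0 M0 rD dM]]] := dquot_bound Dz0.
have r40 : 0 < r / 4 by lra.
have K0 : 0 < 32 * M / r ^+ 2 by rewrite divr_gt0 ?exprn_gt0 // mulr_gt0.
apply: (cder_pint r40 K0).
- move=> z zr w Kw; have Dz : D z by apply: rD; rewrite /disk /=; lra.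
  exact (hol_cts (hol_dquot oD hf Dz) (KD Kw)).
- by move=> w Kw; exact (hol_cts (hol_dquot oD (hol_dquot oD hf Dz0) Dz0) (KD Kw)).
- move=> z zr w Kw; have Dw := KD Kw.
  have hq := hol_sub rD (hol_dquot oD hf Dw).
  have := taylor1 r0 hq (fun z => dM w z Kw) (ltW zr).
  rewrite (cder_derive1 (dquot_cder oD hf Dw Dz0)) !(dquotC f _ w).
  by rewrite (mulrC (z - z0)).
Qed.

(** Dixon's proof. The integral [h] of the divided difference on [D] and the Cauchy integral [h1] of
    [f] off [D] agree wherever both are defined and the index is zero, so they glue to an entire
    function. It tends to zero at infinity and hence vanishes. *)
Theorem pint_dquot z0 : D z0 -> pint (dquot f z0) p s = 0.
Proof.
move=> Dz0.
pose h z := pint (dquot f z) p s; pose h1 z := pint (fun w => f w / (w - z)) p s.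
pose H z := if `[< D z >] then h z else h1 z.
have cf w : K w -> cts f w by move=> Kw; exact (hol_cts hf (KD Kw)).
have overlap z : D z -> ~ K z -> pidx z = 0 -> h z = h1 z.
  move=> Dz nK z0'; have [m m0 hm] := pdist nK.
  have ne w (Kw : K w) : w != z := ne_dist m0 (hm w Kw).
  have c1 w : K w -> cts (fun w => f w / (w - z)) w by move=> Kw; exact (cts_kernel (cf w Kw) (ne w Kw)).
  have c2 w : K w -> cts (fun w => 1 / (w - z)) w by move=> Kw; exact (cts_kernel (cts_cst 1 w) (ne w Kw)).
  have c3 w : K w -> cts (fun w => f z * (1 / (w - z))) w.
    by move=> Kw; exact (ctsM (cts_cst _ w) (c2 w Kw)).
  have -> : h z = pint (fun w => f w / (w - z) - f z * (1 / (w - z))) p s.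
    apply: eq_pint => w Kw; rewrite /dquot (negPf (ne w Kw)) mul1r mulrBl //.
  by rewrite (pintB c1 c3) (pintZ _ c2) -pidxE z0' mulr0 subr0.
have Hin z : D z -> H z = h z by move=> Dz; rewrite /H (asboolT Dz).
have Hout z : ~ K z -> pidx z = 0 -> H z = h1 z.
  move=> nK z0'; have [Dz|nD] := pselect (D z); first by rewrite (Hin z Dz) (overlap z Dz nK z0').
  by rewrite /H (asboolF nD).
have hH : hol setT H.
  move=> z _; have [Dz|nD] := pselect (D z).
    have [r r0 rD] := (openP D).1 oD z Dz.
    exists (pint (dquot (dquot f z) z) p s); apply: (cder_near r0 _ (cder_dixon Dz)).
    by move=> w /rD Dw; rewrite Hin.
  have nK : ~ K z by move=> /KD.
  have [r r0 rn] := pidx_near nK.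
  exists (pint (fun w => f w / (w - z) / (w - z)) p s).
  apply: (cder_near r0 _ (cauchy_kernel cf nK)) => w /rn[nw e].
  by rewrite Hout // e idx0.
have [M M0 KM] := ptr_bounded.
have [Mf Mf0 fMf] : exists2 M, 0 < M & forall w, K w -> nm (f w) <= M.
  apply: (compact_bound (@ptr_compact p s)) => w Kw; exact (continuous_nm_of (cf w Kw)).
have L0 := plen_ge0 p s.
rewrite -/(h z0) -Hin //; apply/eqP; rewrite -nm_eq0 eq_le nm_ge0 andbT.
apply/ler_addgt0Pr => e e0; rewrite add0r.
(* On the circle of radius [M + B] the denominators are at least [B], so the integral is at most
   [Mf / B * plen p s <= e]; the term [nm z0] puts [z0] inside. *)
pose B : R := nm z0 + Mf * plen p s / e + 1.
have q0 : 0 <= Mf * plen p s / e by rewrite divr_ge0 ?mulr_ge0 // ltW.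
have B0 : 0 < B by rewrite /B; have := nm_ge0 z0; lra.
have rho0 : 0 < M + B by lra.
have hz0 : nm (z0 - 0) <= M + B by rewrite subr0 /B; lra.
apply: (max_principle (@openT _) hH rho0 _ _ hz0) => // z; rewrite subr0 => zr.
have zM : M <= nm z by rewrite zr; lra.
have nK : ~ K z by move=> /KM; lra.
have far w : K w -> B <= nm (w - z).
  by move=> /KM; have := le_nmB z w; rewrite (nmB z w) zr; lra.
rewrite (Hout z nK (pidx_far M0 KM zM)).
have c1 w : K w -> cts (fun w => f w / (w - z)) w.
  by move=> Kw; exact (cts_kernel (cf w Kw) (ne_dist B0 (far w Kw))).
have b1 w : K w -> nm (f w / (w - z)) <= Mf / B.
  move=> Kw; have Bw := far w Kw; rewrite nmM nmV; apply: ler_pM; rewrite ?nm_ge0 ?invr_ge0 ?nm_ge0 //.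
    exact: fMf.
  by rewrite lef_pV2 ?posrE //; exact: lt_le_trans Bw.
apply: le_trans (pint_le c1 b1) _.
rewrite mulrAC ler_pdivrMr // -ler_pdivrMl // mulrC /B.
by have := nm_ge0 z0; lra.
Qed.

End Domain.

(* Apply the previous theorem to [f w * (w - p)] at [p]. *)
Theorem cauchy_pint D f : open D -> K `<=` D -> hol D f -> (forall z, ~ D z -> pidx z = 0) ->
  pint f p s = 0.
Proof.
move=> oD KD hf idx0; have Dp : D p by apply: KD; exact: ptr_head.
pose F w := f w * (w - p).
have hF : hol D F by apply: (holM hf); apply: holB; [exact: hol_id|exact: hol_cst].
rewrite -(pint_dquot oD KD hF idx0 Dp); apply: eq_pint => w Kw; rewrite /dquot.
case: eqVneq => [->|wp]; last first.
  by rewrite /F subrr mulr0 subr0 mulfK // subr_eq0.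
have h1 : cder (fun w => w - p) p (1 - 0) by apply: cderB; [exact: cder_id|exact: cder_cst].
have := cderM (hol_cder hf Dp) h1; rewrite subrr mulr0 add0r subr0 mulr1 => h.
by rewrite (cder_derive1 h).
Qed.

End Closed.

Lemma ptr_seg p q D : (forall t, 0 <= t <= 1 -> D (seg p q t)) -> ptr p [:: q] `<=` D.
Proof.
move=> h z /= [[t /= t01 <-]|->]; first exact: h.
by rewrite -(seg1 p q); apply: h; rewrite lexx ler01.
Qed.

Lemma polygon_connected D p z : open D -> connected D -> D p -> D z ->
  (exists2 s, ptr p s `<=` D & last p s = z) /\ (exists2 s, ptr z s `<=` D & last z s = p).
Proof.
move=> oD cD Dp Dz.
pose S := [set z | (exists2 s, ptr p s `<=` D & last p s = z) /\
                   (exists2 s, ptr z s `<=` D & last z s = p)].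
have step u w r : 0 < r -> disk u r `<=` D -> disk u r w -> S u -> S w.
  move=> r0 rD wr [[s1 s1D s1z] [s2 s2D s2p]].
  have zw : ptr u [:: w] `<=` D.
    by apply: ptr_seg => t t01; apply: rD; exact: open_disk_convex (disk_center u r0) wr t01.
  split.
    exists (s1 ++ [:: w]); last by rewrite last_cat.
    by move=> v /ptr_cat[|]; [exact: s1D|rewrite s1z; exact: zw].
  exists (u :: s2) => //= v [[t /= t01 <-]|]; last exact: s2D.
  by apply: rD; exact: open_disk_convex wr (disk_center u r0) t01.
have SD : S `<=` D by move=> u [_ [s sD _]]; apply: sD; exact: ptr_head.
apply: (conn_clopen (S := S) cD SD _ _ _ Dz).
- by exists p; split; exists [::] => //= u ->.
- apply/openP => u Su; have [r r0 rD] := (openP D).1 oD u (SD u Su).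
  by exists r => // w wr; exact: step r0 rD wr Su.
- move=> u Du hu; have [r r0 rD] := (openP D).1 oD u Du.
  have r20 : 0 < r / 2 by lra.
  have [w Sw wu] := hu _ r20.
  have wrD : disk w (r / 2) `<=` D.
    move=> v; rewrite /disk /= => vw; apply: rD; rewrite /disk /=.
    by have := le_nm_sub w v u; lra.
  by apply: (step w u (r / 2) r20 wrD _ Sw); rewrite /disk /= nmB.
Qed.

(** Polygons from [p] to [z] and back from [z] to [p] are chosen independently, so that a polygon
    never has to be reversed. A primitive on a small disk accounts for the increments. *)
Lemma hol_primitive D f : open D -> connected D -> hol D f ->
  (forall p s, last p s = p -> ptr p s `<=` D -> forall z, ~ D z -> pidx p s z = 0) ->
  exists F, forall z, D z -> cder F z (f z).
Proof.
move=> oD cD hf idx; have [->|/set0P[p Dp]] := eqVneq D set0; first by exists (fun=> 0).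
have /choice[a aP] : forall z, exists s, D z -> ptr p s `<=` D /\ last p s = z.
  move=> z; have [Dz|nD] := pselect (D z); last by exists [::].
  by have [[s h1 h2] _] := polygon_connected oD cD Dp Dz; exists s.
have /choice[b bP] : forall z, exists s, D z -> ptr z s `<=` D /\ last z s = p.
  move=> z; have [Dz|nD] := pselect (D z); last by exists [::].
  by have [_ [s h1 h2]] := polygon_connected oD cD Dp Dz; exists s.
have cl q s : last q s = q -> ptr q s `<=` D -> pint f q s = 0.
  by move=> e h; apply: (cauchy_pint e oD h hf); exact: idx.
exists (fun z => pint f p (a z)) => z Dz.
have [r r0 rD] := (openP D).1 oD z Dz.
have hfr : hol (disk z r) f := hol_sub rD hf.
have [G hG] := primitive_convex (@open_disk R z r) (@open_disk_convex R z r) hfr.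
have key w : disk z r w -> G w + (pint f p (a z) - G z) = pint f p (a w).
  move=> wr; have Dw := rD w wr.
  have [a1 a2] := aP z Dz; have [a1' a2'] := aP w Dw; have [b1 b2] := bP w Dw.
  have sg t : 0 <= t <= 1 -> disk z r (seg z w t).
    by move=> t01; exact: open_disk_convex (disk_center z r0) wr t01.
  have e1 : pint f p (a w ++ b w) = 0.
    apply: cl => [|u /ptr_cat[|]]; first by rewrite last_cat a2'.
      exact: a1'.
    by rewrite a2'; exact: b1.
  have e2 : pint f p (a z ++ w :: b w) = 0.
    apply: cl => [|u /ptr_cat[|]]; first by rewrite last_cat a2.
      exact: a1.
    by rewrite a2 /=; move=> [[t /= t01 <-]|]; [apply: rD; exact: sg|exact: b1].
  rewrite pint_cat a2' in e1; rewrite pint_cat a2 pint_cons in e2.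
  have e3 : sint f z w = G w - G z by apply: sint_FTC => t t01; apply: hG; exact: sg.
  have -> : pint f p (a w) = - pint f w (b w) by apply/eqP; rewrite -addr_eq0 e1.
  by apply/eqP; rewrite -addr_eq0 -{}e2 e3; apply/eqP; ring.
have := cderD (hG z (disk_center z r0)) (cder_cst (pint f p (a z) - G z) z).
by rewrite addr0; exact: (cder_near r0 key).
Qed.

Lemma cder0_const D f : open D -> connected D -> (forall z, D z -> cder f z 0) ->
  forall z w, D z -> D w -> f w = f z.
Proof.
move=> oD cD f0; apply: (conn_loc_const cD) => z Dz.
have [r r0 rD] := (openP D).1 oD z Dz.
apply: filterS (nbhs_disk z r0) => w wr _.
have := @mvi R f (fun _ => 0) z w 0 0 _ _; rewrite !mul0r !subr0 => h.
apply/eqP; rewrite -subr_eq0 -nm_eq0 eq_le nm_ge0 andbT; apply: h => t t01.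
  by apply: f0; apply: rD; apply: (open_disk_convex (disk_center z r0) wr t01).
by rewrite nm0.
Qed.

Lemma primitive_log D f : open D -> connected D -> hol D f -> (forall z, D z -> f z != 0) ->
  (forall g, hol D g -> exists G, forall z, D z -> cder G z (g z)) ->
  exists2 L, hol D L & forall z, D z -> cexp (L z) = f z.
Proof.
move=> oD cD hf f0 prim; have [D0|/set0P[p Dp]] := eqVneq D set0.
  by exists (fun=> 0) => z; rewrite D0.
have hq : hol D (fun z => derive1 f z * (f z)^-1).
  by apply: holM; [exact: hol_deriv|exact: holV].
have [G hG] := prim _ hq.
have [c cE] := cexp_surj (f0 p Dp).
have cst : forall z, D z -> cder (fun z => f z * cexp (- G z)) z 0.
  move=> u Du; have fu := f0 u Du.
  have h1 := cder_comp (f := @cexp R) (g := fun z => - G z) (cderN (hG u Du)) (@cder_cexp R _).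
  have h2 := cderM (f := f) (g := fun z => cexp (- G z)) (hol_cder hf Du) h1.
  have <- : derive1 f u * cexp (- G u) + f u * (cexp (- G u) * - (derive1 f u * (f u)^-1)) = 0.
    by field.
  exact: h2.
exists (fun z => G z + (c - G p)).
  move=> z Dz; exists (derive1 f z * (f z)^-1 + 0).
  by apply: cderD; [exact: hG|exact: cder_cst].
move=> z Dz; have := cder0_const oD cD cst Dp Dz; rewrite !cexpN cexpD cexpB cE => <-.
by rewrite mulrC divfK // cexp_neq0.
Qed.

Theorem index_hol_log D f : open D -> connected D -> hol D f -> (forall z, D z -> f z != 0) ->
  (forall p s, last p s = p -> ptr p s `<=` D -> forall z, ~ D z -> pidx p s z = 0) ->
  exists2 L, hol D L & forall z, D z -> cexp (L z) = f z.
Proof.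
by move=> oD cD hf f0 idx; apply: primitive_log => // g hg; exact: hol_primitive.
Qed.

Lemma convex_hol_log D f : open D -> convexC D -> hol D f -> (forall z, D z -> f z != 0) ->
  exists2 L, hol D L & forall z, D z -> cexp (L z) = f z.
Proof.
move=> oD cD hf f0; apply: primitive_log => //; first exact: convex_connected.
by move=> g hg; exact: primitive_convex.
Qed.

Lemma hol_sqrt D f L : hol D L -> (forall z, D z -> cexp (L z) = f z) ->
  exists2 g, hol D g & forall z, D z -> g z ^+ 2 = f z.
Proof.
move=> hL LE; exists (fun z => cexp (2^-1 * L z)).
  have h : hol D (fun z => 2^-1 * L z) := holM (@hol_cst R D 2^-1) hL.
  apply: (hol_comp (D' := setT) h) => // z _; exists (cexp z); exact (@cder_cexp R z).
move=> z Dz; rewrite -LE // expr2 -cexpD; congr cexp.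
by field.
Qed.

End Dixon.

Section Cover.
Variable R : realType.
Local Notation C := (Cplane R).
Local Notation nm := (@nm R).
Local Notation rc := (@rc R).
Local Notation cRe := (@cRe R).
Local Notation cIm := (@cIm R).
Local Notation cI := (cI R).
Implicit Types (z w a b c d p q : C) (x y t r e m : R) (f F G g h : C -> C) (D : set C) (s : seq C).

(** * The exponential cover of a doubly connected domain *)

Lemma image_connected_on (T : topologicalType) (A : set T) (f : T -> C) : connected A ->
  (forall u, A u -> cts f u) -> connected (f @` A).
Proof.
move=> cA cf; apply: connected_continuous_connected cA _.
by apply: continuous_in_subspaceT => u; rewrite inE => /cf.
Qed.

(** The condition [r <= nm z] keeps [0] out of the disk, so a branch of the logarithm through [a1]
    lifts it to a connected set [Q]. This is the local step that carries a property of all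
    logarithms of one point to all logarithms of a nearby one. *)
Lemma cexp_branch z r c1 c2 a1 : 0 < r -> r <= nm z -> disk z r c1 -> disk z r c2 ->
  cexp a1 = c1 -> exists Q a2, [/\ connected Q, Q a1, Q a2, cexp a2 = c2 &
    forall w, Q w -> disk z r (cexp w)].
Proof.
move=> r0 rz d1 d2 e1; have [L [_ LP]] := plog_ex R.
have z0 : z != 0 by rewrite -nm_gt0; lra.
have near w : disk z r w -> disk 1 1 (w / z).
  rewrite /disk /= => wz; have -> : w / z - 1 = (w - z) / z by rewrite mulrBl divff.
  by rewrite nmM nmV ltr_pdivrMr ?nm_gt0 // mul1r; exact: lt_le_trans rz.
have c10 : c1 != 0 by rewrite -e1 cexp_neq0.
pose k w := a1 - L (c1 / z) + L (w / z).
have kE w : disk z r w -> cexp (k w) = w.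
  move=> wz; have [_ h1] := LP _ (near _ wz); have [_ h2] := LP _ (near _ d1).
  by rewrite /k cexpD cexpB e1 h1 h2; field; rewrite z0 c10.
have k1 : k c1 = a1 by rewrite /k subrK.
exists (k @` disk z r), (k c2); split.
- apply: image_connected_on; first exact: disk_connected.
  move=> w wz; have [cL _] := LP _ (near _ wz).
  have h : cts (fun w => w / z) w := ctsM (cts_id w) (cts_cst _ w).
  exact (ctsD (cts_cst _ w) (cts_comp h cL)).
- by exists c1.
- by exists c2.
- exact: kE.
- by move=> _ [w wz <-]; rewrite kE.
Qed.

Lemma half_plane_connected x : connected [set w : C | cRe w < x].
Proof.
apply: convex_connected => a b t /= a0 b0 /andP[t0 t1].
have -> : cRe (seg a b t) = (1 - t) * cRe a + t * cRe b.
  by rewrite /seg cReD cReM cReD cReN cRe_rc cIm_rc mul0r subr0; ring.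
have [h|h] := leP t (1/2); nra.
Qed.

Lemma half_plane_connected' x : connected [set w : C | x <= cRe w].
Proof.
apply: convex_connected => a b t /= a0 b0 /andP[t0 t1].
have -> : cRe (seg a b t) = (1 - t) * cRe a + t * cRe b.
  by rewrite /seg cReD cReM cReD cReN cRe_rc cIm_rc mul0r subr0; ring.
nra.
Qed.

Lemma strip_connected x y : connected [set w : C | x <= cRe w < y].
Proof.
apply: convex_connected => a b t /= /andP[a0 a1] /andP[b0 b1] /andP[t0 t1].
have -> : cRe (seg a b t) = (1 - t) * cRe a + t * cRe b.
  by rewrite /seg cReD cReM cReD cReN cRe_rc cIm_rc mul0r subr0; ring.
apply/andP; split; first by nra.
by have [h|h] := leP t (1/2); nra.
Qed.

Lemma cexp_lt (z : C) x : 0 < x -> (nm (cexp z) < x) = (cRe z < ln x).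
Proof. by move=> x0; rewrite nm_cexp -{1}(@lnK R x) ?posrE // ltr_expR. Qed.

Lemma neg_far (M x : R) : 0 < M -> M <= `|- (M + `|x| + 1)|.
Proof.
move=> M0; have h := normr_ge0 x; rewrite normrN ger0_norm; lra.
Qed.

Lemma neg_far2 (M x : R) : 0 < M -> - (M + `|x| + 1) < x.
Proof. by move=> M0; have := ler_norm (- x); rewrite normrN; lra. Qed.

Lemma collar_radius (rho : R) : 0 < rho -> rho < 1 ->
  [/\ 0 < (1 + rho) / 2, (1 + rho) / 2 < 1 & rho < (1 + rho) / 2].
Proof. by move=> h1 h2; split; lra. Qed.

Section Domain.
Variables (W : set C) (rho : R).
Hypotheses (rho0 : 0 < rho) (rho1 : rho < 1) (oW : open W) (cW : connected W) (W0 : W 0).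
Hypothesis Wrho : forall z, W z -> nm z < rho.
Let A : set C := disk 0 1 `\` closure W.
Hypothesis cA : connected A.
Let At : set C := [set w | A (cexp w)].

Lemma cover_base_open : open A.
Proof.
rewrite /A setDE; apply: openI; first exact: open_disk.
by apply: closed_openC; exact: closed_closure.
Qed.

Lemma cover_base_neq0 z : A z -> z != 0.
Proof. by move=> [_ nz]; apply: contra_notN nz => /eqP ->; exact: subset_closure. Qed.

Lemma cover_open : open At.
Proof. by apply: open_comp cover_base_open => z _; exact (@cts_cexp R z). Qed.

Lemma cover_collar w : ln ((1 + rho) / 2) <= cRe w < 0 -> At w.
Proof.
move=> /andP[w0 w1]; have [s0 s1 s2] := collar_radius rho0 rho1.
split; first by rewrite /disk /= subr0 cexp_lt // ln1.
move=> /closure_bound /(_ Wrho); apply/negP; rewrite -ltNge.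
by apply: lt_le_trans s2 _; rewrite leNgt cexp_lt // -leNgt.
Qed.

(** The outer collar of [A] lifts to one connected vertical strip that contains all logarithms of
    its points. Those points of [A] all of whose logarithms lie in the component of this strip form
    an open and relatively closed subset, so connectedness of [A] suffices. *)
Lemma cover_connected : connected At.
Proof.
pose x0 := ln ((1 + rho) / 2); have [s0 s1 s2] := collar_radius rho0 rho1.
have x00 : x0 < 0 by rewrite /x0 ln_lt0 // s0.
have Gx : [set w : C | x0 <= cRe w < 0] (rc x0).
  by change (is_true (x0 <= x0 < 0)); rewrite lexx.
have GA : [set w : C | x0 <= cRe w < 0] `<=` At by move=> w; exact: cover_collar.
pose X := connected_component At (rc x0).
have GX : [set w : C | x0 <= cRe w < 0] `<=` X.
  exact: connected_sub_component (@strip_connected x0 0) Gx GA.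
pose S := [set z | A z /\ forall w, cexp w = z -> X w].
have AS : forall z, A z -> S z.
  have disk_in z : A z -> exists r, [/\ 0 < r, r <= nm z & disk z r `<=` A].
    move=> Az; have [r r0 rA] := (openP A).1 cover_base_open z Az.
    have nz : 0 < nm z by rewrite nm_gt0 cover_base_neq0.
    exists (Num.min r (nm z)); split; first by rewrite lt_min r0.
      by rewrite ge_min lexx orbT.
    by move=> w; rewrite /disk /= lt_min => /andP[wr _]; apply: rA.
  have trans z r c1 c2 : 0 < r -> r <= nm z -> disk z r `<=` A -> disk z r c1 -> disk z r c2 ->
      (forall w, cexp w = c1 -> X w) -> forall w, cexp w = c2 -> X w.
    move=> r0 rz rA d1 d2 h w wE.
    have [Q [a2 [cQ Qw Qa aE Qd]]] := cexp_branch r0 rz d2 d1 wE.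
    apply: connected_component_trans (h a2 aE) _.
    by apply: (connected_sub_component cQ Qa _ Qw) => u Qu; apply: rA; exact: Qd.
  apply: (conn_clopen (S := S) cA).
  - by move=> z [].
  - exists (rc ((1 + rho) / 2)); split.
      by have := GA _ Gx; rewrite /At /= /x0 cexp_ln.
    move=> w wE; apply: GX; rewrite /=.
    have e : expR (cRe w) = (1 + rho) / 2 by rewrite -nm_cexp wE nm_rc gtr0_norm.
    by rewrite /x0 -e expRK lexx /= -expR_lt1 e.
  - apply/openP => z [Az h]; have [r [r0 rz rA]] := disk_in z Az.
    exists r; first exact r0.
    move=> w wz; split; first exact (rA w wz).
    exact: trans r0 rz rA (disk_center z r0) wz h.
  - move=> z Az hz; split; first exact Az.
    have [r [r0 rz rA]] := disk_in z Az.
    have [w [_ h] wz] := hz r r0.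
    exact: trans r0 rz rA wz (disk_center z r0) h.
suff <- : X = At by exact: component_connected.
apply/seteqP; split; first exact: connected_component_sub.
by move=> w /AS[_]; apply.
Qed.

(** Every point off the cover can be led to infinity without meeting the polygon. Where [cexp z] is
    outside the disk, the right half-plane is used. Over [W], which is connected and contains [0],
    the logarithms of a point can be pushed to a left half-plane; hence the set [S] of points over
    which the index vanishes is all of [W]. The boundary of [W] follows by local constancy. *)
Lemma cover_index p s : last p s = p -> ptr p s `<=` At -> forall z, ~ At z -> pidx p s z = 0.
Proof.
move=> cl KA z nz; have nK u : ~ At u -> ~ ptr p s u by move=> h /KA.
have [M M0 KM] := ptr_bounded p s.
have far0 := pidx_far cl M0 KM.
have [dz|ndz] := pselect (disk 0 1 (cexp z)); last first.
  have zr : 0 <= cRe z.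
    by rewrite leNgt; apply/negP => h; apply: ndz; rewrite /disk /= subr0 cexp_lt // ln1.
  rewrite -(far0 (rc M)) ?nm_rc ?gtr0_norm //.
  apply: (pidx_connected cl (@half_plane_connected' 0)); rewrite /= ?cRe_rc ?(ltW M0) // => u u0.
  apply: nK => -[]; rewrite /disk /= subr0 cexp_lt // ln1; lra.
have Ez : closure W (cexp z) by apply: contrapT => h; exact: nz.
have outW u : W (cexp u) -> ~ ptr p s u.
  by move=> h; apply: nK => -[_]; apply; exact: subset_closure.
have [e e0 eW] := (openP W).1 oW 0 W0.
have small u : nm (cexp u) < e -> pidx p s u = 0.
  rewrite cexp_lt // => ue; pose v : R := - (M + `|ln e| + 1).
  have vM : M <= `|v| := neg_far (ln e) M0.
  rewrite -(far0 (rc v)) ?nm_rc //.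
  apply: (pidx_connected cl (@half_plane_connected (ln e))) => //; last first.
    exact: neg_far2 (ln e) M0.
  move=> w /=; rewrite -cexp_lt // => we; apply: outW; apply: eW.
  by rewrite /disk /= subr0.
pose S := [set c | W c /\ forall u, cexp u = c -> pidx p s u = 0].
have WS : forall c, W c -> S c.
  have disk_in c : W c -> c != 0 -> exists r, [/\ 0 < r, r <= nm c & disk c r `<=` W].
    move=> Wc c0; have [r r0 rA] := (openP W).1 oW c Wc.
    exists (Num.min r (nm c)); split; first by rewrite lt_min r0 nm_gt0.
      by rewrite ge_min lexx orbT.
    by move=> w; rewrite /disk /= lt_min => /andP[wr _]; apply: rA.
  have trans c r c1 c2 : 0 < r -> r <= nm c -> disk c r `<=` W -> disk c r c1 -> disk c r c2 ->
      (forall w, cexp w = c1 -> pidx p s w = 0) -> forall w, cexp w = c2 -> pidx p s w = 0.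
    move=> r0 rz rA d1 d2 h w wE.
    have [Q [a2 [cQ Qw Qa aE Qd]]] := cexp_branch r0 rz d2 d1 wE.
    rewrite -(h a2 aE); apply: (pidx_connected cl cQ _ Qa Qw) => u Qu.
    by apply: outW; apply: rA; exact: Qd.
  have S0 : S 0 by split=> // u /eqP; rewrite (negPf (cexp_neq0 u)).
  apply: (conn_clopen (S := S) cW).
  - by move=> c [].
  - by exists 0.
  - apply/openP => c [Wc h]; have [->|c0] := eqVneq c 0.
      exists e; first exact e0.
      move=> w we; split; first exact (eW w we).
      by move=> u uE; apply: small; rewrite uE; move: we; rewrite /disk /= subr0.
    have [r [r0 rz rA]] := disk_in c Wc c0.
    exists r; first exact r0.
    move=> w wz; split; first exact (rA w wz).
    exact: trans r0 rz rA (disk_center c r0) wz h.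
  - move=> c Wc hc; have [->|c0] := eqVneq c 0; first exact S0.
    split; first exact Wc.
    have [r [r0 rz rA]] := disk_in c Wc c0.
    have [w [_ h] wz] := hc r r0.
    exact: trans r0 rz rA wz (disk_center c r0) h.
have [r r0 rn] := pidx_near cl (nK z nz).
have [L [L1 LP]] := plog_ex R.
have d11 : disk 1 1 (1 : C) by apply: disk_center.
have [cL _] := LP 1 d11; have [d d0 hd] := (@ccontP R L 1).1 cL r r0.
have ez0 := cexp_neq0 z; have nz0 : 0 < nm (cexp z) by rewrite nm_gt0.
have k0 : 0 < Num.min d 1 * nm (cexp z) by rewrite mulr_gt0 // lt_min d0 ltr01.
(* A point [c] of [W] so close to [cexp z] that one of its logarithms lies in the disk about [z] on
   which the index is constant. *)
have [c [Wc cz]] := Ez _ (nbhs_disk (cexp z) k0).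
have cd : nm (c / cexp z - 1) < Num.min d 1.
  have -> : c / cexp z - 1 = (c - cexp z) / cexp z by rewrite mulrBl divff.
  by rewrite nmM nmV ltr_pdivrMr.
move: cd; rewrite lt_min => /andP[cd c1].
have [_ LE] := LP _ c1.
have [_ h] := WS c Wc.
have rz : disk z r (z + L (c / cexp z)).
  by rewrite /disk /= addrC addKr; have := hd _ cd; rewrite L1 subr0.
have [_ <-] := rn _ rz; apply: h.
by rewrite cexpD LE mulrC divfK.
Qed.

Lemma cover_uniform : exists f, [/\ hol At f, inj_on At f & f @` At = disk 0 1].
Proof.
have [_ s1 _] := collar_radius rho0 rho1.
have [x0 x0P] : exists z, At z.
  exists (rc (ln ((1 + rho) / 2))); apply: cover_collar.
  change (is_true (ln ((1 + rho) / 2) <= ln ((1 + rho) / 2) < 0)); rewrite lexx /=.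
  by rewrite ln_lt0 // s1 andbT; have [] := collar_radius rho0 rho1.
have n0 : ~ At 0 by move=> [h _]; move: h; rewrite cexp0 disk01 nm1 ltxx.
have sq f : hol At f -> (forall z, At z -> f z != 0) ->
    exists2 g, hol At g & forall z, At z -> g z ^+ 2 = f z.
  move=> hf f0; have [L hL LE] := index_hol_log cover_open cover_connected hf f0 cover_index.
  exact (hol_sqrt hL LE).
have [f [h1 h2 h3 _]] := riemann_mapping cover_open cover_connected x0P n0 sq.
exists f; split; [exact h1|exact h2|exact h3].
Qed.

End Domain.
End Cover.

Section Deck.
Variable R : realType.
Local Notation C := (Cplane R).
Local Notation nm := (@nm R).
Local Notation rc := (@rc R).
Local Notation cRe := (@cRe R).
Local Notation cIm := (@cIm R).
Local Notation cI := (cI R).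
Local Notation cbar := (@cbar R).
Implicit Types (z w a b c d p q u v : C) (x y t r e m : R) (f F G g h : C -> C) (D : set C).

(** * Fixed-point-free automorphisms of the disk *)

Lemma cRe_div a b : cRe (a / b) = cRe (a * cbar b) / nm b ^+ 2.
Proof.
have [->|b0] := eqVneq b 0; first by rewrite invr0 mulr0 nm0 expr0n invr0 mulr0.
have e : a / b = a * cbar b * rc (nm b ^- 2).
  have n0 : cbar b != 0 by rewrite -nm_gt0 nm_cbar nm_gt0.
  by rewrite rcV -mul_cbar; field; rewrite b0 n0.
by rewrite e cReM cIm_rc cRe_rc mulr0 subr0.
Qed.

(** The Cayley map of the disk onto the upper half-plane that sends the boundary point [c] to
    infinity. *)
Definition cayley c z : C := cI * ((c + z) / (c - z)).

Lemma cayley_den c z : nm c = 1 -> nm z < 1 -> c - z != 0.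
Proof. by move=> c1 z1; rewrite subr_eq0; apply: contraTneq z1 => <-; rewrite c1 ltxx. Qed.

Lemma cIm_cayley c z : nm c = 1 -> nm z < 1 -> 0 < cIm (cayley c z).
Proof.
move=> c1 z1; have d0 := cayley_den c1 z1.
rewrite /cayley cImM cRe_I cIm_I mul0r add0r mul1r cRe_div divr_gt0 ?exprn_gt0 ?nm_gt0 //.
have h1 := nm_sqr c; have h2 := nm_sqr z; rewrite c1 expr1n in h1.
have z2 : nm z ^+ 2 < 1 by have := nm_ge0 z; nra.
have -> : cRe ((c + z) * cbar (c - z)) = (cRe c ^+ 2 + cIm c ^+ 2) - (cRe z ^+ 2 + cIm z ^+ 2).
  by clear; case: c => ? ?; case: z => ? ? /=; ring.
by rewrite -h1 -h2 subr_gt0.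
Qed.

Lemma cayley_surj c u : nm c = 1 -> 0 < cIm u -> exists2 z, nm z < 1 & cayley c z = u.
Proof.
move=> c1 u0; have c0 : c != 0 by rewrite -nm_gt0 c1 ltr01.
have ui : u + cI != 0.
  apply/eqP => /(congr1 cIm); rewrite cImD cIm_I => h.
  by have : cIm u + 1 = 0 := h; lra.
exists (c * ((u - cI) / (u + cI))).
  rewrite nmM c1 mul1r; apply: nm_lt1_sqr => //.
  rewrite !nm_sqr !cReD !cImD cReN cImN cRe_I cIm_I.
  by move: (cRe u) (cIm u) u0 => x y; clear => y0; nra.
have i0 := cI_neq0 R; have two0 : (2 : C) != 0 by rewrite pnatr_eq0.
rewrite /cayley; have -> : c + c * ((u - cI) / (u + cI)) = c * (2 * u / (u + cI)) by field.
have -> : c - c * ((u - cI) / (u + cI)) = c * (2 * cI / (u + cI)) by field.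
by field; rewrite ?c0 ?i0 ?ui.
Qed.

Lemma cayley_inj c z w : nm c = 1 -> nm z < 1 -> nm w < 1 -> cayley c z = cayley c w -> z = w.
Proof.
move=> c1 z1 w1 /(mulfI (cI_neq0 R)) e; have d1 := cayley_den c1 z1; have d2 := cayley_den c1 w1.
have c0 : c != 0 by rewrite -nm_gt0 c1 ltr01.
have two0 : (2 : C) != 0 by rewrite pnatr_eq0.
have : (c + z) * (c - w) = (c + w) * (c - z) by apply/eqP; rewrite -eqr_div // e.
move=> /eqP; rewrite -subr_eq0.
have -> : (c + z) * (c - w) - (c + w) * (c - z) = 2 * c * (z - w) by ring.
by rewrite !mulf_eq0 (negPf two0) (negPf c0) /= subr_eq0 => /eqP.
Qed.

Lemma hol_cayley c : nm c = 1 -> hol (disk 0 1) (cayley c).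
Proof.
move=> c1; apply: holM; first exact: hol_cst.
apply: holM; first by apply: holD; [exact: hol_cst|exact: hol_id].
apply: holV => [|z]; first by apply: holB; [exact: hol_cst|exact: hol_id].
by rewrite disk01; exact: cayley_den.
Qed.

(** The fixed point equation is a quadratic whose two roots have a product of modulus 1. Without a
    fixed point in the disk neither root has modulus below 1, so both lie on the circle. *)
Lemma mob_fixed_circle (k w : C) : nm k = 1 -> nm w < 1 ->
  (forall z, nm z < 1 -> k * mob w z <> z) ->
  exists2 c, nm c = 1 & k * (c - w) = c * (1 - cbar w * c).
Proof.
move=> k1 w1 nofix.
have w0 : w != 0.
  apply/eqP => e; apply: (nofix 0); first by rewrite nm0 ltr01.
  by rewrite mob0 e oppr0 mulr0.
have a0 : cbar w != 0 by rewrite -nm_gt0 nm_cbar nm_gt0.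
have two0 : (2 : C) != 0 by rewrite pnatr_eq0.
have k0 : k != 0 by rewrite -nm_gt0 k1 ltr01.
pose s := sqrtC ((k - 1) ^+ 2 + 4 * cbar w * k * w).
have s2 : s ^+ 2 = (k - 1) ^+ 2 + 4 * cbar w * k * w by exact: sqrtCK.
have root z : k * (z - w) = z * (1 - cbar w * z) -> 1 <= nm z.
  move=> e; rewrite leNgt; apply/negP => z1; apply: (nofix z z1).
  by rewrite /mob mulrA e mulfK // mob_den.
pose z1 := (1 - k + s) / (2 * cbar w); pose z2 := (1 - k - s) / (2 * cbar w).
have four0 : (4 : C) != 0 by rewrite pnatr_eq0.
have quad z (t : C) : t ^+ 2 = s ^+ 2 -> z = (1 - k + t) / (2 * cbar w) ->
    k * (z - w) = z * (1 - cbar w * z).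
  move=> ts zE; apply/eqP; rewrite -subr_eq0; apply/eqP.
  have e : 4 * cbar w * (k * (z - w) - z * (1 - cbar w * z)) =
      (2 * cbar w * z - (1 - k)) ^+ 2 - ((k - 1) ^+ 2 + 4 * cbar w * k * w) by ring.
  have /eqP : 4 * cbar w * (k * (z - w) - z * (1 - cbar w * z)) = 0.
    rewrite e -s2 -ts zE; have -> : 2 * cbar w * ((1 - k + t) / (2 * cbar w)) = 1 - k + t.
      by field; rewrite a0.
    by ring.
  by rewrite mulf_eq0 mulf_eq0 (negPf four0) (negPf a0) /= => /eqP.
have q1 := quad z1 s erefl erefl.
have q2 : k * (z2 - w) = z2 * (1 - cbar w * z2) by apply: (quad z2 (- s)); rewrite ?sqrrN.
have prod : nm z1 * nm z2 = 1.
  rewrite -nmM; have -> : z1 * z2 = - (k * w / cbar w).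
    have -> : z1 * z2 = ((1 - k) ^+ 2 - s ^+ 2) / (4 * cbar w ^+ 2).
      by rewrite /z1 /z2; field; rewrite a0.
    by rewrite s2; field; rewrite a0.
  by rewrite nmN nmM nmM nmV nm_cbar k1 mul1r divff // nm_eq0.
exists z1 => //; have h1 := root _ q1; have h2 := root _ q2; nra.
Qed.

(** An automorphism fixing [c] becomes affine once [c] is sent to infinity. The coefficients are
    read off from the factorization of [c - k * mob w z] that the fixed point equation allows. *)
Lemma cayley_mob (k w c z : C) : nm k = 1 -> nm w < 1 -> nm c = 1 -> nm z < 1 ->
  k * (c - w) = c * (1 - cbar w * c) ->
  cayley c (k * mob w z) =
    (1 - cbar w * c) ^+ 2 / (k * (1 - cbar w * w)) * cayley c z +
    cI * ((1 - cbar w * c) ^+ 2 / (k * (1 - cbar w * w)) +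
          2 * c * (1 - cbar w * c) * cbar w / (k * (1 - cbar w * w)) - 1).
Proof.
move=> k1 w1 c1 z1 fx.
have k0 : k != 0 by rewrite -nm_gt0 k1 ltr01.
have d1 := mob_den w1 z1; have d2 := mob_den w1 w1.
have d3 := cayley_den c1 z1; have d4 := cayley_den c1 w1.
have kap : 1 - cbar w * c != 0.
  rewrite subr_eq0; apply/eqP => e.
  have : nm (cbar w * c) < 1 by rewrite nmM nm_cbar c1 mulr1.
  by rewrite -e nm1 ltxx.
have c0 : c != 0 by rewrite -nm_gt0 c1 ltr01.
have ct : c - k * mob w z = k * (1 - cbar w * w) * (c - z) / ((1 - cbar w * c) * (1 - cbar w * z)).
  have -> : c - k * mob w z = c * (1 - cbar w * c) / (1 - cbar w * c) - k * mob w z by rewrite mulfK.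
  rewrite -fx /mob; move: (cbar w) kap d1 => v kap d1; field.
  by rewrite kap d1.
have cay (y : C) : c - y != 0 -> cayley c y = cI * (2 * c / (c - y) - 1).
  by move=> h; rewrite /cayley; congr (_ * _); field.
have d5 : c - k * mob w z != 0.
  by rewrite ct mulf_neq0 ?invr_neq0 ?mulf_neq0.
rewrite (cay _ d5) (cay _ d3) ct; move: d1 d2 d3 kap; move: (cbar w) => v d1 d2 d3 kap.
clear - k0 d1 d2 d3 kap c0; move: cI => i.
by field; rewrite k0 d1 d2 d3 kap.
Qed.

Lemma half_plane_affine (al be : C) : al != 0 ->
  (forall u, 0 < cIm u -> 0 < cIm (al * u + be)) ->
  (forall v, 0 < cIm v -> exists2 u, 0 < cIm u & al * u + be = v) ->
  exists x y : R, [/\ 0 < x, al = rc x & be = rc y].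
Proof.
move=> al0 hp sj.
have im x y : cIm (al * (rc x + cI * rc y) + be) = cRe al * y + cIm al * x + cIm be.
  by case: al {hp sj al0} => ? ?; case: be => ? ? /=; ring.
have imu x y : cIm (rc x + cI * rc y) = y by rewrite /=; ring.
have pos x y : 0 < y -> 0 < cRe al * y + cIm al * x + cIm be.
  by move=> y0; rewrite -im; apply: hp; rewrite imu.
have al_im : cIm al = 0.
  apply/eqP; apply/negPn/negP => m0.
  have := pos (- (cRe al + cIm be) / cIm al) 1 ltr01.
  by rewrite mulr1 mulrC divfK //; lra.
have pos' y : 0 < y -> 0 < cRe al * y + cIm be.
  by move=> /(pos 0); rewrite al_im mul0r addr0.
have re0 : cRe al != 0.
  by apply: contraNneq al0 => e; apply/eqP; apply: cplx_eq; rewrite ?e ?al_im.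
have re_pos : 0 < cRe al.
  rewrite lt_neqAle eq_sym re0 leNgt; apply/negP => neg.
  have y0 : 0 < `|cIm be| / (- cRe al) + 1.
    have h : 0 <= `|cIm be| / (- cRe al) by rewrite divr_ge0 // oppr_ge0 ltW.
    by lra.
  have := pos' _ y0; rewrite mulrDr mulr1 invrN mulrN mulrN mulrCA divff // mulr1.
  by have := ler_norm (cIm be); lra.
have be_im : cIm be = 0.
  apply/eqP; rewrite eq_le; apply/andP; split; rewrite leNgt; apply/negP => h.
    have [|u u0 uE] := sj (cI * rc (cIm be / 2)).
      by rewrite cImM cRe_I cIm_I cRe_rc cIm_rc mul0r add0r mul1r; lra.
    have := congr1 cIm uE; rewrite [u]cplxE im.
    have -> : cIm (cI * rc (cIm be / 2)) = cIm be / 2 by rewrite /=; ring.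
    by rewrite al_im mul0r addr0; nra.
  have y0 : 0 < - cIm be / (2 * cRe al) by rewrite divr_gt0; lra.
  have := pos' _ y0; have -> : cRe al * (- cIm be / (2 * cRe al)) = - cIm be / 2 by field.
  by lra.
exists (cRe al), (cRe be); split=> //; apply: cplx_eq => //.
Qed.

Lemma sin_gt0_itv t : 0 <= t < 2 * pi -> 0 < sin t -> 0 < t < pi.
Proof.
move=> /andP[t0 t2] st; have [tp|tp] := ltP t pi.
  by rewrite andbT lt_neqAle t0 andbT; apply: contraTneq st => <-; rewrite sin0 ltxx.
have : 0 <= sin (t - pi) by apply: sin_ge0_pi; apply/andP; split; lra.
by have := sinDpi (t - pi); rewrite subrK => e; move: st; rewrite e => h1 h2; exfalso; lra.
Qed.

Lemma strip_log_unique a b : cexp a = cexp b -> 0 < cIm a < pi -> 0 < cIm b < pi -> a = b.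
Proof.
move=> e a0 b0; have /cexp_eq1[n nE] : cexp (a - b) = 1 by rewrite cexpB e divff // cexp_neq0.
have im : cIm a - cIm b = 2 * pi * n%:~R.
  by have := congr1 cIm nE; rewrite cImD cImN => ->; rewrite cImM cRe_I cIm_I cRe_rc mulr1 mulr0 addr0.
have p0 := pi_gt0 R.
have h1 : (n%:~R : R) < 1%:~R.
  by rewrite -(ltr_pM2l p0) -(@ltr_pM2l _ 2) // mulrA -im; lra.
have h2 : ((-1)%:~R : R) < n%:~R.
  by rewrite -(ltr_pM2l p0) -(@ltr_pM2l _ 2) // mulrA mulrA -im; lra.
move: h1 h2; rewrite !ltr_int => h1 h2; have n0 : n = 0 by lia.
by apply/eqP; rewrite -subr_eq0 nE n0 mulr0 rc0 mul0r.
Qed.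

(** The sine of [cIm (L z)] is positive, so on the connected disk this imaginary part cannot cross a
    multiple of [pi]; the shift by [n] periods is determined at [0]. *)
Lemma strip_log L : hol (disk 0 1) L -> (forall z, disk 0 1 z -> 0 < cIm (cexp (L z))) ->
  exists n : int, forall z, disk 0 1 z -> 0 < cIm (L z - rc (2 * pi * n%:~R) * cI) < pi.
Proof.
move=> hL Lp; have d0 : disk 0 1 (0 : C) by rewrite disk01 nm0 ltr01.
have p0 := pi_gt0 R.
pose n := Num.floor (cIm (L 0) / (2 * pi)); exists n.
pose k z := L z - rc (2 * pi * n%:~R) * cI.
have kim z : cIm (k z) = cIm (L z) - 2 * pi * n%:~R.
  by rewrite /k cImD cImN cImM cRe_I cIm_I cRe_rc mulr1 mulr0 addr0.
have sk z : disk 0 1 z -> 0 < sin (cIm (k z)).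
  move=> /Lp; have -> : L z = k z + rc (2 * pi * n%:~R) * cI by rewrite /k subrK.
  by rewrite cexpD cexp_2pi mulr1 cIm_cexp pmulr_rgt0 ?expR_gt0.
have k0 : 0 < cIm (k 0) < pi.
  apply: sin_gt0_itv (sk 0 d0); rewrite kim /n.
  have h1 := floor_le (cIm (L 0) / (2 * pi)); have h2 := lt_succ_floor (cIm (L 0) / (2 * pi)).
  have p2 : 0 < 2 * pi :> R by lra.
  rewrite ler_pdivlMr // in h1; rewrite intrD1 ltr_pdivrMr // in h2.
  by apply/andP; split; lra.
have ck : forall z, disk 0 1 z -> {for z, continuous (fun z => cIm (k z))}.
  move=> z dz; have h : cts k z := ctsB (hol_cts hL dz) (cts_cst _ z).
  exact (@continuous_comp _ _ _ k cIm z h (@continuous_cIm R _)).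
have cD : connected ((fun z => cIm (k z)) @` disk 0 1).
  apply: connected_continuous_connected (@disk_connected R 0 1) _.
  by apply: continuous_in_subspaceT => z; rewrite inE; exact: ck.
move/connected_intervalP in cD.
move=> z dz; rewrite -/(k z); have I0 : ((fun z => cIm (k z)) @` disk 0 1) (cIm (k 0)) by exists 0.
have Iz : ((fun z => cIm (k z)) @` disk 0 1) (cIm (k z)) by exists z.
move: k0 => /andP[k0 k1].
apply/andP; split; rewrite ltNge; apply/negP => h.
  have [|w dw wE] := cD _ _ Iz I0 0; first by rewrite h ltW.
  by have := sk w dw; rewrite wE sin0 ltxx.
have [|w dw wE] := cD _ _ I0 Iz pi; first by rewrite h ltW.
by have := sk w dw; rewrite wE sinpi ltxx.
Qed.

(** The height of a horizontal strip above the real axis, with [None] for the upper half-plane. Both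
    occur as models, since the deck transformation may be parabolic or hyperbolic. *)
Definition pos_height (o : option R) : bool := if o is Some h then 0 < h else true.

Definition below (o : option R) y : bool := if o is Some h then y < h else true.

Definition strip (o : option R) : set C := [set u | 0 < cIm u /\ below o (cIm u)].

(* Conjugating a fixed-point-free automorphism to the half-plane by a Cayley
   map sending a boundary fixed point to infinity gives an affine map; it is a
   translation, or becomes one on the strip after taking a logarithm. *)
Theorem deck_translation f g : hol (disk 0 1) f -> hol (disk 0 1) g ->
  (forall z, disk 0 1 z -> disk 0 1 (f z)) -> (forall z, disk 0 1 z -> disk 0 1 (g z)) ->
  (forall z, disk 0 1 z -> g (f z) = z) -> (forall z, disk 0 1 z -> f (g z) = z) ->
  (forall z, disk 0 1 z -> f z <> z) ->
  exists (P : C -> C) (b : R) (o : option R), [/\ hol (disk 0 1) P /\ inj_on (disk 0 1) P,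
    P @` disk 0 1 = strip o, b != 0,
    pos_height o & forall z, disk 0 1 z -> P (f z) = P z + rc b].
Proof.
move=> hf hg fd gd gf fg nofix.
have [k [w [k1 w1 fE]]] := disk_aut hf hg fd gd gf fg.
have [|c c1 fx] := mob_fixed_circle k1 w1.
  move=> z z1; have dz : disk 0 1 z; first by rewrite disk01.
  by rewrite -(fE z dz); exact: nofix.
pose T := cayley c.
have hT := hol_cayley c1.
have iT : inj_on (disk 0 1) T by move=> z z'; rewrite !disk01; exact: cayley_inj.
have TH z : disk 0 1 z -> 0 < cIm (T z) by rewrite disk01; exact: cIm_cayley.
have sT u : 0 < cIm u -> exists2 z, disk 0 1 z & T z = u.
  by move=> /(cayley_surj c1)[z z1 zE]; exists z; rewrite ?disk01.
have [al [be [al0 Tf]]] : exists al be : C, al != 0 /\ forall z, disk 0 1 z -> T (f z) = al * T z + be.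
  have k0 : k != 0 by rewrite -nm_gt0 k1 ltr01.
  have kap : 1 - cbar w * c != 0.
    rewrite subr_eq0; apply/eqP => e.
    have : nm (cbar w * c) < 1 by rewrite nmM nm_cbar c1 mulr1.
    by rewrite -e nm1 ltxx.
  exists ((1 - cbar w * c) ^+ 2 / (k * (1 - cbar w * w))), (cI * ((1 - cbar w * c) ^+ 2 / (k * (1 - cbar w * w)) +
          2 * c * (1 - cbar w * c) * cbar w / (k * (1 - cbar w * w)) - 1)); split.
    by rewrite mulf_neq0 ?invr_neq0 ?mulf_neq0 ?expf_neq0 // mob_den.
  by move=> z dz; rewrite fE // /T cayley_mob // -disk01.
have [| |x [y [x0 alE beE]]] := half_plane_affine al0 (be := be).
- by move=> u /sT[z dz <-]; rewrite -Tf //; apply: TH; exact: fd.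
- move=> v /sT[z dz <-]; exists (T (g z)); first by apply: TH; exact: gd.
  by rewrite -Tf ?fg //; exact: gd.
have [x1|x1] := eqVneq x 1.
  exists T, y, None; split=> //.
  - apply/seteqP; split=> [_ [z dz <-]|u [u0 _]]; first by split=> //; exact: TH.
    by have [z dz zE] := sT u u0; exists z.
  - apply/eqP => y0; have d0 : disk 0 1 (0 : C) by rewrite disk01 nm0 ltr01.
    apply: (nofix 0 d0); apply: iT => //; first exact: fd.
    by rewrite Tf // alE beE x1 y0 rc0 rc1 mul1r addr0.
  - by move=> z dz; rewrite Tf // alE beE x1 rc1 mul1r.
(* The finite real fixed point of the affine map. Moved to [0], it leaves multiplication by [x],
   which the logarithm turns into translation by [ln x] on a strip of height [pi]. *)
pose c0 : R := y / (1 - x).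
have c0E : y - c0 = - (x * c0) by rewrite /c0; field; rewrite subr_eq0 eq_sym.
pose u z := T z - rc c0.
have uH z : disk 0 1 z -> 0 < cIm (u z).
  by move=> dz; rewrite /u cImD cImN cIm_rc oppr0 addr0; exact: TH.
have hu : hol (disk 0 1) u by apply: holB => //; exact: hol_cst.
have u0 z : disk 0 1 z -> u z != 0.
  by move=> /uH; apply: contraTneq => ->; rewrite ltxx.
have uf z : disk 0 1 z -> u (f z) = rc x * u z.
  move=> dz; rewrite /u Tf // alE beE mulrBr -addrA -rcB c0E rcN rcM //.
have d0 : disk 0 1 (0 : C) by rewrite disk01 nm0 ltr01.
have [L0 hL0 L0E] := convex_hol_log (@open_disk R 0 1) (@open_disk_convex R 0 1) hu u0.
have [n nE] := strip_log hL0 (fun z dz => etrans (congr1 (fun v => 0 < cIm v) (L0E z dz)) (uH z dz)).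
pose L z := L0 z - rc (2 * pi * n%:~R) * cI.
have LE z : disk 0 1 z -> cexp (L z) = u z.
  by move=> dz; rewrite /L cexpB cexp_2pi divr1 L0E.
have iE : u = fun z => T z - rc c0 by [].
exists L, (ln x), (Some pi); split; [split| | |exact: pi_gt0|].
- by apply: holB => //; exact: hol_cst.
- move=> z z' dz dz' e; apply: iT => //; apply: (addIr (- rc c0)).
  have h : u z = u z' by rewrite -LE // -LE // e.
  exact: h.
- apply/seteqP; split=> [_ [z dz <-]|v [v0 v1]].
    by have /andP[] := nE z dz.
  have [|z dz zE] := sT (cexp v + rc c0).
    rewrite cImD cIm_rc addr0 cIm_cexp mulr_gt0 ?expR_gt0 //.
    by apply: sin_gt0_pi; rewrite v0.
  exists z => //; apply: strip_log_unique; [|exact: nE|by rewrite v0].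
  by rewrite LE // /u zE addrK.
- by rewrite ln_eq0 // x1.
- move=> z dz; apply: strip_log_unique; [|exact: nE (fd z dz)|].
    by rewrite cexpD !LE ?uf ?cexp_ln // ?(mulrC (rc x)) //; exact: fd.
  by have := nE z dz; rewrite -/(L z) => h; rewrite cImD cIm_rc addr0.
Qed.

End Deck.

Section Annulus.
Variable R : realType.
Local Notation C := (Cplane R).
Local Notation nm := (@nm R).
Local Notation rc := (@rc R).
Local Notation cRe := (@cRe R).
Local Notation cIm := (@cIm R).
Local Notation cI := (cI R).
Implicit Types (z w a b c d p q u v : C) (x y t r e m : R) (f F G g h : C -> C) (D U V W : set C).

(** * Moduli of annuli *)

Lemma rc_2pin n : rc (2 * pi * n%:R) * cI = n%:R * (rc (2 * pi) * cI).
Proof. by rewrite (rcM (2 * pi)) rc_nat mulrAC mulrC. Qed.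

Lemma cexp_period z n : cexp (z + n%:R * (rc (2 * pi) * cI)) = cexp z.
Proof. by rewrite cexpD -rc_2pin (pmulrn 1 n) cexp_2pi mulr1. Qed.

(* [T] plays the role of the uniformization of the cover [exp^-1 (A)] by a
   strip, on which the deck transformation is the translation by [b]. *)
Lemma cover_descends (A : set C) (T : C -> C) (b : R) (o : option R) :
  open A -> (forall z, A z -> z != 0) -> b != 0 -> pos_height o ->
  hol [set w | A (cexp w)] T -> inj_on [set w | A (cexp w)] T ->
  T @` [set w | A (cexp w)] = strip o ->
  (forall w, A (cexp w) -> T (w + rc (2 * pi) * cI) = T w + rc b) ->
  exists (r s : R) (q : C -> C), [/\ 0 <= r, r < s & [/\ hol A q, inj_on A q &
    q @` A = [set z | r < nm z < s]]].
Proof.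
move=> oA A0 b0 o0 hT iT TE Tb.
have p0 := pi_gt0 R.
pose be := `|b|; have be0 : 0 < be by rewrite normr_gt0.
have Tn w n : A (cexp w) -> T (w + n%:R * (rc (2 * pi) * cI)) = T w + n%:R * rc b.
  move=> Aw; elim: n => [|n IH]; first by rewrite !mul0r !addr0.
  have -> : w + n.+1%:R * (rc (2 * pi) * cI) = w + n%:R * (rc (2 * pi) * cI) + rc (2 * pi) * cI.
    by rewrite -addrA; congr (_ + _); rewrite -natr1 mulrDl mul1r.
  have h : A (cexp (w + n%:R * (rc (2 * pi) * cI))) by rewrite cexp_period.
  rewrite (Tb _ h) IH -addrA; congr (_ + _).
  by rewrite -natr1 mulrDl mul1r.
(* Scales the translation by [b] to a period of [G]. Then [G] takes equal values on exactly the
   logarithms of one point of [A], so it descends to an injective [q]. *)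
pose k : R := 2 * pi / be; have k0 : 0 < k by rewrite divr_gt0 //; lra.
pose G w := cexp (rc k * cI * T w).
have nmG w : nm (G w) = expR (- (k * cIm (T w))).
  rewrite /G nm_cexp; congr expR.
  rewrite cReM cReM cImM cRe_rc cIm_rc cRe_I cIm_I; ring.
have Gb w n : cexp (rc k * cI * (w + n%:R * rc b)) = cexp (rc k * cI * w).
  have kb : rc k * cI * (n%:R * rc b) = rc (k * (n%:R * b)) * cI.
    by rewrite (rcM k) (rcM n%:R) rc_nat mulrAC.
  rewrite mulrDr cexpD; have [bn|bn] := leP 0 b.
    have -> : rc k * cI * (n%:R * rc b) = rc (2 * pi * n%:R) * cI.
      rewrite kb; congr (rc _ * _).
      by rewrite /k /be ger0_norm //; field.
    by rewrite (pmulrn 1 n) cexp_2pi mulr1.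
  have -> : rc k * cI * (n%:R * rc b) = - (rc (2 * pi * n%:R) * cI).
    rewrite kb -mulNr -rcN; congr (rc _ * _).
    by rewrite /k /be ltr0_norm //; field; rewrite lt_eqF.
  by rewrite cexpN (pmulrn 1 n) cexp_2pi invr1 mulr1.
have Gper w n : A (cexp w) -> G (w + n%:R * (rc (2 * pi) * cI)) = G w.
  by move=> Aw; rewrite /G Tn // Gb.
have per w w' : cexp w = cexp w' -> exists n : nat,
    w = w' + n%:R * (rc (2 * pi) * cI) \/ w' = w + n%:R * (rc (2 * pi) * cI).
  move=> e; have /cexp_eq1[[n|n] nE] : cexp (w - w') = 1 by rewrite cexpB e divff // cexp_neq0.
    exists n; left; have -> : n%:R * (rc (2 * pi) * cI) = w - w'; last by rewrite addrC subrK.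
    by rewrite nE -pmulrn rc_2pin.
  exists n.+1; right; have -> : n.+1%:R * (rc (2 * pi) * cI) = w' - w; last by rewrite addrC subrK.
  by rewrite -opprB nE NegzE mulrNz mulrN rcN mulNr opprK -pmulrn rc_2pin.
have Gfib w w' : A (cexp w) -> cexp w = cexp w' -> G w = G w'.
  move=> Aw e; have [n [h|h]] := per w w' e; last by rewrite h Gper.
  by rewrite h Gper // -e.
have Ginj w w' : A (cexp w) -> A (cexp w') -> G w = G w' -> cexp w = cexp w'.
  move=> Aw Aw' e.
  have /cexp_eq1[n nE] : cexp (rc k * cI * T w - rc k * cI * T w') = 1.
    by rewrite cexpB -/(G w) -/(G w') e divff // cexp_neq0.
  have kn : rc k != 0 by rewrite rc_eq0 gt_eqF.
  have dT : T w - T w' = rc (be * n%:~R).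
    apply: (mulfI (mulf_neq0 kn (cI_neq0 R))); rewrite mulrBr nE (mulrAC (rc k) cI) -(rcM k).
    by congr (rc _ * _); rewrite /k; field; rewrite gt_eqF.
  have [m [h|h]] : exists m : nat, T w = T w' + m%:R * rc b \/ T w' = T w + m%:R * rc b.
    have bb : be = b \/ be = - b by rewrite /be; case: (leP 0 b) => h; [left; exact: ger0_norm|right; exact: ltr0_norm].
    move: dT; case: n {nE} => m dT.
      exists m; case: bb dT => -> dT; [left|right].
        by rewrite -rc_nat -rcM mulrC -dT addrC subrK.
      by rewrite -rc_nat -rcM mulrC; have := dT; rewrite mulNr rcN => /(congr1 -%R); rewrite opprK opprB => <-; rewrite addrC subrK.
    exists m.+1; move: dT; rewrite NegzE mulrNz mulrN rcN => dT.
    case: bb dT => -> dT; [right|left].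
      by rewrite -rc_nat -rcM mulrC; move: dT => /(congr1 -%R); rewrite opprK opprB => <-; rewrite addrC subrK.
    by rewrite -rc_nat -rcM mulrC; move: dT; rewrite mulNr rcN opprK => <-; rewrite addrC subrK.
  - have -> : w = w' + m%:R * (rc (2 * pi) * cI); last exact: cexp_period.
    by apply: iT; rewrite /= ?cexp_period // Tn.
  - have -> : w' = w + m%:R * (rc (2 * pi) * cI); last by rewrite cexp_period.
    by apply: iT; rewrite /= ?cexp_period // Tn.
have /choice[lg lgP] : forall z, exists w, A z -> cexp w = z.
  move=> z; have [/A0 /cexp_surj[w wE]|nA] := pselect (A z); last by exists 0.
  by exists w.
pose q z := G (lg z).
have Alg z : A z -> A (cexp (lg z)) by move=> Az; rewrite lgP.
have qG w : A (cexp w) -> q (cexp w) = G w.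
  by move=> Aw; rewrite /q; apply: Gfib; rewrite lgP.
pose r : R := if o is Some h then expR (- (k * h)) else 0.
have rE u : 0 < cIm u -> below o (cIm u) = (r < expR (- (k * cIm u))).
  move=> u0; rewrite /r; case: o {TE o0 r} => [h|] /=; last by rewrite expR_gt0.
  by rewrite ltr_expR ltrN2 ltr_pM2l.
exists r, 1, q; split; first by rewrite /r; case: o {TE o0 r rE} => [h|]; rewrite ?expR_ge0.
  rewrite /r; case: o o0 {TE r rE} => [h h0|_]; last exact: ltr01.
  by rewrite expR_lt1 oppr_lt0 mulr_gt0.
split.
- move=> z Az; have [r0 r00 rA] := (openP A).1 oA z Az; have z0 := A0 z Az.
  pose e := Num.min r0 (nm z); have e0 : 0 < e by rewrite lt_min r00 nm_gt0.
  have [L [_ LP]] := plog_ex R.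
  have hL : hol (disk 1 1) L := hol_log (@open_disk R 1 1) (@hol_id R _) LP.
  have near w : disk z e w -> disk 1 1 (w / z) /\ A w.
    rewrite /disk /= lt_min => /andP[w1 w2]; split; last exact: rA.
    have -> : w / z - 1 = (w - z) / z by rewrite mulrBl divff.
    by rewrite nmM nmV ltr_pdivrMr ?nm_gt0 // mul1r.
  have hq1 : hol (disk z e) (fun w => w / z) by apply: holM; [exact: hol_id|exact: hol_cst].
  have hl : hol (disk z e) (fun w => lg z + L (w / z)).
    apply: holD; first exact: hol_cst.
    by apply: (hol_comp hq1 hL) => w /near[].
  have lE w : disk z e w -> cexp (lg z + L (w / z)) = w.
    by move=> /near[/LP[_ h] _]; rewrite cexpD h lgP // mulrC divfK.
  have hTl : hol (disk z e) (fun w => T (lg z + L (w / z))).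
    by apply: (hol_comp hl hT) => w wz /=; rewrite lE //; have [] := near w wz.
  have hG : hol (disk z e) (fun w => G (lg z + L (w / z))).
    have h2 : hol (disk z e) (fun w => rc k * cI * T (lg z + L (w / z))) := holM (@hol_cst R _ _) hTl.
    apply: (hol_comp (D' := setT) (f := @cexp R) h2) => // v _; exists (cexp v); exact (@cder_cexp R v).
  have [d hd] := hG z (disk_center z e0); exists d; apply: (cder_near e0 _ hd) => w wz.
  by have [_ Aw] := near w wz; rewrite -qG lE.
- by move=> z z' Az Az' /(Ginj _ _ (Alg z Az) (Alg z' Az')); rewrite !lgP.
- apply/seteqP; split=> [_ [z Az <-]|v /andP[v0 v1]].
    have [u0 u1] : strip o (T (lg z)) by rewrite -TE; exists (lg z) => //; exact: Alg.
    rewrite /= /q nmG; apply/andP; split; first by rewrite -rE.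
    by rewrite expR_lt1 oppr_lt0 mulr_gt0.
  have vn : v != 0.
    rewrite -nm_gt0; apply: le_lt_trans v0; rewrite /r.
    by case: o {TE o0 r rE} => [h|]; rewrite ?expR_ge0.
  have [l lE] := cexp_surj vn.
  pose u := l / (rc k * cI).
  have kn : rc k != 0 by rewrite rc_eq0 gt_eqF.
  have lu : l = rc k * cI * u by rewrite /u mulrC divfK // mulf_neq0 // cI_neq0.
  have lre : cRe l = - (k * cIm u).
    by rewrite lu cReM cReM cImM cRe_rc cIm_rc cRe_I cIm_I; ring.
  have nv : nm v = expR (- (k * cIm u)) by rewrite -lE nm_cexp lre.
  have u0 : 0 < cIm u by move: v1; rewrite nv expR_lt1 oppr_lt0 pmulr_rgt0.
  have : strip o u by split=> //; rewrite rE // -nv.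
  rewrite -TE => -[w Aw wE]; exists (cexp w) => //.
  by rewrite qG // /G wE -lu.
Qed.

Lemma conf_comp (A B E : set C) : conformally_equivalent A B -> conformally_equivalent B E ->
  conformally_equivalent A E.
Proof.
move=> [f [/holP hf fb]] [g [/holP hg gb]]; exists (g \o f); split.
  apply/holP; apply: hol_comp hf hg _ => z Az; have [fAB _ _] := fb; exact: fAB.
exact: (set_bij_comp fb gb).
Qed.

Lemma conf_intro (A B : set C) f : hol A f -> inj_on A f -> f @` A = B -> conformally_equivalent A B.
Proof.
move=> hf fi <-; exists f; split; first exact/holP.
split; first by move=> z Az; exists z.
- by move=> z w; rewrite !inE => Az Aw; exact: fi.
- by move=> _ [z Az <-]; exists z.
Qed.

Lemma annulus_round W (rho : R) : 0 < rho -> rho < 1 -> open W -> connected W -> W 0 ->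
  (forall z, W z -> nm z < rho) -> connected (disk 0 1 `\` closure W) ->
  exists r s : R, [/\ 0 <= r, r < s &
    conformally_equivalent (disk 0 1 `\` closure W) [set z | r < nm z < s]].
Proof.
move=> rho0 rho1 oW cW W0 Wr cA.
have [f [hf fi fE]] := cover_uniform rho0 rho1 oW cW W0 Wr cA.
pose At : set C := [set w | (disk 0 1 `\` closure W) (cexp w)].
have oA := @cover_base_open R W; have oAt : open At := @cover_open R W.
pose per := rc (2 * pi) * cI; have per0 : per != 0.
  by rewrite mulf_neq0 ?cI_neq0 // rc_eq0 mulf_neq0 // gt_eqF // pi_gt0.
have cper w : cexp (w + per) = cexp w.
  by have := cexp_period w 1; rewrite mul1r.
have cperN w : cexp (w - per) = cexp w by rewrite -{2}(subrK per w) cper.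
have Ap w : At w -> At (w + per) by rewrite /At /= cper.
have An w : At w -> At (w - per) by rewrite /At /= cperN.
have /choice[g gP] : forall z, exists w, disk 0 1 z -> At w /\ f w = z.
  move=> z; have [|nd] := pselect (disk 0 1 z); last by exists 0.
  by rewrite -fE => -[w Aw wE]; exists w.
have gf w : At w -> g (f w) = w.
  move=> Aw; have df : disk 0 1 (f w) by rewrite -fE; exists w.
  have [Ag e] := gP _ df; exact (fi _ _ Ag Aw e).
have fd w : At w -> disk 0 1 (f w) by move=> Aw; rewrite -fE; exists w.
have hg : hol (disk 0 1) g by rewrite -fE; exact: hol_inv.
have Ag z : disk 0 1 z -> At (g z) by move=> /gP[].
have fg z : disk 0 1 z -> f (g z) = z by move=> /gP[].
pose t z := f (g z + per); pose s z := f (g z - per).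
have ht : hol (disk 0 1) t.
  apply: (hol_comp _ hf) => [|z dz]; first by apply: holD => //; exact: hol_cst.
  exact: Ap (Ag z dz).
have hs : hol (disk 0 1) s.
  apply: (hol_comp _ hf) => [|z dz]; first by apply: holB => //; exact: hol_cst.
  exact: An (Ag z dz).
have td z : disk 0 1 z -> disk 0 1 (t z) by move=> dz; apply: fd; exact: Ap (Ag z dz).
have sd z : disk 0 1 z -> disk 0 1 (s z) by move=> dz; apply: fd; exact: An (Ag z dz).
have st z : disk 0 1 z -> s (t z) = z.
  by move=> dz; rewrite /s /t gf ?addrK ?fg //; exact: Ap (Ag z dz).
have ts z : disk 0 1 z -> t (s z) = z.
  by move=> dz; rewrite /s /t gf ?subrK ?fg //; exact: An (Ag z dz).
have nofix z : disk 0 1 z -> t z <> z.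
  move=> dz; rewrite /t -{2}(fg z dz) => /(fi _ _ (Ap _ (Ag z dz)) (Ag z dz)) /eqP.
  by rewrite -subr_eq0 addrC addKr (negPf per0).
have [P [b [ob [[hP Pi] PE b0 hob Pt]]]] := deck_translation ht hs td sd st ts nofix.
have hT : hol At (fun w => P (f w)) := hol_comp hf hP fd.
have iT : inj_on At (fun w => P (f w)).
  by move=> w w' Aw Aw' e; exact (fi _ _ Aw Aw' (Pi _ _ (fd w Aw) (fd w' Aw') e)).
have TE : (fun w => P (f w)) @` At = strip ob.
  rewrite -PE; apply/seteqP; split=> [_ [w Aw <-]|_ [z dz <-]].
    by exists (f w) => //; exact: fd.
  by exists (g z); [exact: Ag|rewrite fg].
have Tb w : At w -> P (f (w + per)) = P (f w) + rc b.
  by move=> Aw; rewrite -Pt ?/t ?gf //; exact: fd.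
have A0 z : (disk 0 1 `\` closure W) z -> z != 0 := @cover_base_neq0 R W W0 z.
have [r [s' [q [r0 rs [hq qi qE]]]]] := cover_descends oA A0 b0 hob hT iT TE Tb.
exists r, s'; split=> //; exact: conf_intro hq qi qE.
Qed.

Lemma topological_disk_connected V : topological_disk V -> connected V.
Proof. by move=> [_ [_ pV _]]; exact: path_connected_connected. Qed.

(** The Riemann map of [V] is a homeomorphism near [closure U], so it carries the Jordan boundary
    along and reduces the claim to a domain [W] containing [0] inside a smaller disk. *)
Theorem annulus_has_modulus U V c : topological_disk V -> ~ V c -> jordan_disk U ->
  compactly_contained U V -> exists m : \bar R, has_modulus (V `\` closure U) m.
Proof.
move=> tV nVc [tU jU] [kU UV].
have [oV [_ pV scV]] := tV; have [oU [[p Up] pU scU]] := tU.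
have cV := topological_disk_connected tV; have cU := topological_disk_connected tU.
have sUV : U `<=` V by move=> z Uz; apply: UV; exact: subset_closure.
have sq f : hol V f -> (forall z, V z -> f z != 0) ->
    exists2 g, hol V g & forall z, V z -> g z ^+ 2 = f z.
  by move=> hf f0; have [L hL LE] := sc_hol_log oV tV.2 hf f0; exact (hol_sqrt hL LE).
have [f [hf fi fE f0]] := riemann_mapping oV cV (sUV p Up) nVc sq.
have fd z : V z -> disk 0 1 (f z) by move=> Vz; rewrite -fE; exists z.
have cf z : V z -> cts f z by move=> Vz; exact (hol_cts hf Vz).
have hfU : hol U f := hol_sub sUV hf.
have fiU : inj_on U f by move=> z w Uz Uw; apply: fi; exact: sUV.
pose W := f @` U; pose E := f @` closure U.
have oW : open W := open_image oU hfU fiU.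
have cW : connected W by apply: image_connected_on => // z /sUV; exact: cf.
have W0 : W 0 by exists p.
have cE : compact E.
  apply: continuous_compact kU; apply: continuous_in_subspaceT => z; rewrite inE => /UV; exact: cf.
have clE : closed E := compact_closed (@hausdorff_C R) cE.
have WE : closure W = E.
  apply/seteqP; split.
    move=> w cw; rewrite ((closure_id E).1 clE); apply: closure_subset cw => _ [z Uz <-].
    by exists z => //; exact: subset_closure.
  move=> _ [z cz <-] B /nbhsP[e e0 eB].
  have [d d0 hd] := (@ccontP R f z).1 (cf z (UV z cz)) e e0.
  have [w [Uw wz]] := cz _ (nbhs_disk z d0).
  by exists (f w); split; [exists w|apply: eB; exact: hd].
have [m m0 Em] : exists2 m, 0 < m & forall z, E z -> m <= 1 - nm z.
  apply: (compact_lbound cE) => [z _|_ [z /UV Vz <-]].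
    have -> : (fun z => 1 - nm z) = (fun z => 1 + -1 * nm z) by apply/funext => x; rewrite mulN1r.
    apply: ctsRD; first exact: ctsR_cst.
    by apply: ctsRM; [exact: ctsR_cst|exact: continuous_nm].
  by rewrite subr_gt0 -disk01; exact: fd.
(* The cap [1 / 2] keeps [rho] positive; halving [m1] in [rho] makes the bound on [W] strict. *)
pose m1 : R := Num.min m (1 / 2).
have m10 : 0 < m1 by rewrite lt_min m0; lra.
have m11 : m1 <= 1 / 2 by rewrite ge_min lexx orbT.
have m1m : m1 <= m by rewrite ge_min lexx.
pose rho : R := 1 - m1 / 2.
have rho0 : 0 < rho by rewrite /rho; lra.
have rho1 : rho < 1 by rewrite /rho; lra.
have Wr z : W z -> nm z < rho.
  move=> Wz; have : E z by rewrite -WE; exact: subset_closure.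
  by move=> /Em; rewrite /rho; lra.
have jW : jordan_curve (boundary W).
  have [j [cj ji jE]] := jU; exists (f \o j).
  have jV z : unit_circle z -> V (j z).
    move=> uz; have [cz _] : boundary U (j z) by rewrite -jE; exists z.
    exact: UV.
  have bE : boundary W = f @` boundary U.
    rewrite /boundary WE ((interior_id W).1 oW) ((interior_id U).1 oU).
    apply/seteqP; split=> [_ [[z cz <-] nW]|_ [z [cz nU] <-]].
      by exists z => //; split=> // Uz; apply: nW; exists z.
    split; first by exists z.
    by move=> [w Uw /(fi _ _ (sUV w Uw) (UV z cz)) e]; apply: nU; rewrite -e.
  split.
  - move/subspace_continuousP: cj => cj; apply/subspace_continuousP => z uz.
    exact: (cvg_comp _ _ (cj z uz) (cf _ (jV z uz))).
  - move=> z w; rewrite !inE => uz uw /= e; apply: ji; rewrite ?inE //.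
    by apply: fi e; exact: jV.
  - by rewrite bE -jE image_comp.
have cA := jordan_complement_connected rho0 rho1 oW cW (ex_intro _ 0 W0) Wr jW.
have [r [s [r0 rs conf]]] := annulus_round rho0 rho1 oW cW W0 Wr cA.
exists (round_modulus r s%:E), r, s%:E; split=> //.
have -> : round_annulus r s%:E = [set z | r < nm z < s].
  apply/seteqP; split=> z; rewrite /round_annulus /= lte_fin.
    by move=> [h1 h2]; apply/andP.
  by move=> /andP[].
apply: conf_comp conf; apply: (conf_intro (f := f)).
- by apply: hol_sub hf => z [].
- by move=> z w [Vz _] [Vw _]; exact: fi.
- rewrite WE; apply/seteqP; split=> [_ [z [Vz nz] <-]|w [dw nw]].
    split; first exact: fd.
    by move=> [w cw /(fi _ _ (UV w cw) Vz) e]; apply: nz; rewrite -e.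
  move: dw; rewrite -fE => -[z Vz zE]; exists z => //; split=> // cz.
  by apply: nw; exists z.
Qed.

Lemma round_modulus_gt0 (r : R) (s : \bar R) : 0 <= r -> (r%:E < s)%E -> (0 < round_modulus r s)%E.
Proof.
move=> r0; case: s => [s||] //=; rewrite ?ltry // lte_fin => rs.
case: eqVneq => [_|rn]; first exact: ltry.
have rp : 0 < r by rewrite lt_def rn.
rewrite lte_fin mulr_gt0 ?invr_gt0 ?mulr_gt0 ?pi_gt0 // ln_gt0 //.
by rewrite ltr_pdivlMr // mul1r.
Qed.

(** Once some round model exists, [xget] returns the modulus of a round model, and each such modulus
    is positive or infinite. *)
Theorem annulus_modulus_gt0 U V c : topological_disk V -> ~ V c -> jordan_disk U ->
  compactly_contained U V -> (0 < modulus (V `\` closure U))%E.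
Proof.
move=> tV nVc jU UV; have hm := annulus_has_modulus tV nVc jU UV.
have [r [s [r0 rs _ e]]] : has_modulus (V `\` closure U) (modulus (V `\` closure U)).
  by have [m mP] := hm; exact: (xgetI 0%E mP).
by rewrite e; exact: round_modulus_gt0.
Qed.

End Annulus.

Section Porous.
Variable R : realType.
Local Notation C := (Cplane R).
Local Notation nm := (@nm R).
Local Notation rc := (@rc R).
Local Notation cRe := (@cRe R).
Local Notation cIm := (@cIm R).
Local Notation cI := (cI R).
Implicit Types (z w c : C) (a b x y t r s : R) (X : set C) (S : set (R * R)).

(** * Porous sets are null *)

Local Notation mu2 := (@lebesgue_measure R \x @lebesgue_measure R)%E.

Definition holes X (k r0 : R) := forall z r, X z -> 0 < r -> r <= r0 ->
  exists c, disk c (k * r) `<=` disk z r `\` X.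

Definition porous X := exists k r0 : R, [/\ 0 < k, k <= 1, 0 < r0 & holes X k r0].

Definition square a b s : set (R * R) := `[a, a + s]%classic `*` `[b, b + s]%classic.

Definition planar X : set (R * R) := [set p | X (p.1 +i* p.2)%C].

(** An upper bound on outer measure, in the form of a measurable cover, so that [S] itself may be
    arbitrary. *)
Definition covered S t : Prop :=
  exists2 B, measurable B /\ S `<=` B & (mu2 B <= t%:E)%E.

Lemma covered_square a b s : 0 <= s -> covered (square a b s) (s ^+ 2).
Proof.
move=> s0; exists (square a b s).
  by split=> //; apply: measurableX; exact: measurable_itv.
rewrite product_measure1E ?measurable_itv //; try exact: measurable_itv.
have len x : lebesgue_measure `[x, x + s]%classic = s%:E :> \bar R.
  rewrite lebesgue_measure_itv /= lte_fin; case: ltP => [_|h].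
    by rewrite -EFinB; congr EFin; ring.
  by congr EFin; lra.
suff -> : (lebesgue_measure `[a, (a + s)%R]%classic * lebesgue_measure `[b, (b + s)%R]%classic = (s ^+ 2)%:E)%E by [].
by rewrite expr2 EFinM; congr (_ * _)%E; exact: len.
Qed.

Lemma coveredS S S' t : S `<=` S' -> covered S' t -> covered S t.
Proof. by move=> SS [B [mB S'B] Bt]; exists B => //; split=> //; exact: subset_trans S'B. Qed.

Lemma coveredU S S' t t' : covered S t -> covered S' t' -> covered (S `|` S') (t + t').
Proof.
move=> [B [mB SB] Bt] [B' [mB' SB'] Bt']; exists (B `|` B').
  by split; [exact: measurableU|exact: setUSS].
have h : (mu2 (B `|` B') <= mu2 B + mu2 B')%E by exact: measureU2.
by apply: le_trans h _; rewrite EFinD; exact: leeD.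
Qed.

Lemma covered_seq (I : eqType) (l : seq I) (F : I -> set (R * R)) t :
  (forall i, i \in l -> covered (F i) t) ->
  covered [set p | exists2 i, i \in l & F i p] ((size l)%:R * t).
Proof.
elim: l => [|i l IH] h.
  exists set0; first by split=> // p [].
  by rewrite measure0 mul0r.
have h1 := coveredU (h i (mem_head _ _)) (IH (fun j jl => h j (mem_behead (s := i :: l) jl))).
have -> : (size (i :: l))%:R * t = t + (size l)%:R * t by rewrite /= -natr1 mulrDl mul1r addrC.
apply: coveredS h1 => p [j]; rewrite inE => /orP[/eqP->|jl] Fp; first by left.
by right; exists j.
Qed.

Lemma cell_ex (k : nat) x s : (0 < k)%N -> 0 < s -> 0 <= x -> x <= s ->
  exists i : 'I_k, i%:R * (s / k%:R) <= x <= (i%:R + 1) * (s / k%:R).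
Proof.
move=> k0 s0 x0 xs; have kR : 0 < k%:R :> R by rewrite ltr0n.
have sk : 0 < s / k%:R by rewrite divr_gt0.
have [xe|xl] := eqVneq x s.
  case: k k0 kR sk => // k _ kR sk; exists ord_max; rewrite xe /= natr1.
  have e : k.+1%:R * (s / k.+1%:R) = s by rewrite mulrCA divff ?gt_eqF // mulr1.
  by rewrite e lexx andbT -[leRHS]e ler_pM2r // ler_nat.
have xs' : x < s by rewrite lt_neqAle xl.
pose y := x / (s / k%:R).
have y0 : 0 <= y by rewrite divr_ge0 // ltW.
have yk : y < k%:R by rewrite ltr_pdivrMr // mulrCA divff ?gt_eqF // mulr1.
have := trunc_itv y0; set n := Num.trunc y => /andP[n1 n2].
have nk : (n < k)%N by rewrite -(ltr_nat R); exact: le_lt_trans yk.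
exists (Ordinal nk) => /=; apply/andP; split.
  by rewrite -ler_pdivlMr.
by rewrite -ler_pdivrMr // natr1 ltW.
Qed.

Lemma nm_cplx (p q : R * R) : nm ((p.1 +i* p.2)%C - (q.1 +i* q.2)%C : C) <= `|p.1 - q.1| + `|p.2 - q.2|.
Proof. exact: (le_nm_ReIm ((p.1 +i* p.2)%C - (q.1 +i* q.2)%C : C)). Qed.

Lemma cell_bound (m : nat) x x' t : m%:R * t <= x <= (m%:R + 1) * t ->
  m%:R * t <= x' <= (m%:R + 1) * t -> `|x - x'| <= t.
Proof.
move=> /andP[h1 h2] /andP[h3 h4]; rewrite ler_norml; rewrite mulrDl mul1r in h2 h4.
by apply/andP; split; lra.
Qed.

(** Either the disk of radius [s / 4] about the center of the square misses [X] and is itself large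
    enough, or it contains a point of [X] and porosity at scale [s / 4] gives a hole whose center is
    still in the square. *)
Lemma porous_hole X (k r0 : R) a b s : 0 < k -> k <= 1 -> 
  holes X k r0 ->
  0 < s -> s <= r0 -> exists c, [/\ a <= cRe c <= a + s, b <= cIm c <= b + s &
    forall w, disk c (k * (s / 4)) w -> ~ X w].
Proof.
move=> k0 k1 hX s0 sr; pose c0 : C := ((a + s / 2) +i* (b + s / 2))%C.
have c0in c : nm (c - c0) < s / 2 -> a <= cRe c <= a + s /\ b <= cIm c <= b + s.
  move=> h; have := le_cRe (c - c0); have := le_cIm (c - c0).
  have -> : cRe (c - c0) = cRe c - (a + s / 2) by case: (c).
  have -> : cIm (c - c0) = cIm c - (b + s / 2) by case: (c).
  rewrite !ler_norml => /andP[h1 h2] /andP[h3 h4].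
  by split; apply/andP; split; lra.
have s4 : 0 < s / 4 by lra.
have [[x [Xx xc]]|nX] := pselect (exists x : C, X x /\ nm (x - c0) < s / 4).
  have [|c hc] := hX x (s / 4) Xx s4; first by lra.
  have [|cx _] := hc c; first by apply: disk_center; rewrite mulr_gt0.
  have [|h1 h2] := c0in c.
    by have := le_nm_sub x c c0; move: cx; rewrite /disk /= => h3 h4; lra.
  by exists c; split=> // w /hc[].
exists c0; have [|h1 h2] := c0in c0; first by rewrite subrr nm0; lra.
split=> // w wc Xw; apply: nX; exists w; split=> //.
by move: wc; rewrite /disk /= => h; nra.
Qed.

(** Cut the square into [K * K] cells. The cell containing the center of the hole misses [X],
    because [8 / k < K] makes twice its side smaller than the radius of the hole. Each generation
    thus keeps at most the fraction [1 - K ^- 2] of the area. *)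
Lemma porous_covered X (k r0 : R) (K : nat) : 0 < k -> k <= 1 -> 0 < r0 ->
  holes X k r0 ->
  (0 < K)%N -> 8 / k < K%:R ->
  forall n a b s, 0 < s -> s <= r0 ->
    covered (planar X `&` square a b s) ((1 - K%:R ^- 2) ^+ n * s ^+ 2).
Proof.
move=> k0 k1 r00 hX K0 Kk; have KR : 0 < K%:R :> R by rewrite ltr0n.
elim=> [|n IH] a b s s0 sr.
  rewrite expr0 mul1r; apply: coveredS (covered_square a b (ltW s0)); exact: subIsetr.
pose t := s / K%:R; have t0 : 0 < t by rewrite divr_gt0.
have ts : t <= r0.
  have K1 : 1 <= K%:R :> R by rewrite ler1n.
  by apply: le_trans sr; rewrite ler_pdivrMr // ler_peMr // ltW.
have [c [cx cy hc]] := porous_hole a b k0 k1 hX s0 sr.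
have [i0 i0P] : exists i : 'I_K, i%:R * t <= cRe c - a <= (i%:R + 1) * t.
  by apply: cell_ex => //; move: cx; lra.
have [j0 j0P] : exists i : 'I_K, i%:R * t <= cIm c - b <= (i%:R + 1) * t.
  by apply: cell_ex => //; move: cy; lra.
pose cell (ij : 'I_K * 'I_K) := square (a + ij.1%:R * t) (b + ij.2%:R * t) t.
pose l := enum (predC1 (i0, j0)).
have cl ij : ij \in l -> covered (planar X `&` cell ij) ((1 - K%:R ^- 2) ^+ n * t ^+ 2).
  by move=> _; exact: IH.
have -> : (1 - K%:R ^- 2) ^+ n.+1 * s ^+ 2 = (size l)%:R * ((1 - K%:R ^- 2) ^+ n * t ^+ 2).
  have -> : size l = (K * K).-1.
    by rewrite /l -cardE cardC1 card_prod !card_ord.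
  have -> : ((K * K).-1)%:R = K%:R ^+ 2 - 1 :> R.
    by rewrite -subn1 natrB ?muln_gt0 ?K0 // natrM expr2.
  rewrite /t exprSr; field; by rewrite gt_eqF.
apply: coveredS (covered_seq cl) => p [Xp /= [p1 p2]].
move: p1 p2; rewrite /= !in_itv /= => /andP[p1 p1'] /andP[p2 p2'].
have [i iP] : exists i : 'I_K, i%:R * t <= p.1 - a <= (i%:R + 1) * t.
  by apply: cell_ex => //; lra.
have [j jP] : exists i : 'I_K, i%:R * t <= p.2 - b <= (i%:R + 1) * t.
  by apply: cell_ex => //; lra.
exists (i, j); last first.
  split=> //; rewrite /cell /square /= !in_itv /=.
  move: iP jP => /andP[q1 q2] /andP[q3 q4]; rewrite mulrDl mul1r in q2; rewrite mulrDl mul1r in q4.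
  by split; apply/andP; split; lra.
rewrite mem_enum inE /=; apply/eqP => -[ei ej]; subst i0 j0.
apply: (hc _ _ Xp); rewrite /disk /=.
have -> : c = ((cRe c) +i* (cIm c))%C by case: (c).
apply: le_lt_trans (nm_cplx p (cRe c, cIm c)) _ => /=.
have b1 := cell_bound iP i0P; have b2 := cell_bound jP j0P.
have -> : p.1 - cRe c = (p.1 - a) - (cRe c - a) by ring.
have -> : p.2 - cIm c = (p.2 - b) - (cIm c - b) by ring.
have h : 2 * t < k * (s / 4).
  have e : 8 * s < K%:R * k * s by rewrite ltr_pM2r // -ltr_pdivrMr.
  rewrite /t mulrA ltr_pdivrMr //; lra.
lra.
Qed.

Theorem porous_null X : porous X -> planar_null X.
Proof.
move=> [k [r0 [k0 k1 r00 hX]]].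
pose K := (Num.trunc (8 / k)).+1.
have K0 : (0 < K)%N by [].
have q0 : 0 <= 8 / k by rewrite divr_ge0 // ltW.
have Kk : 8 / k < K%:R by have /andP[_ h] := trunc_itv q0.
have KR : 1 <= K%:R :> R by rewrite ler1n.
pose q : R := 1 - K%:R ^- 2.
have q1 : `|q| < 1.
  have h1 : 0 < K%:R ^- 2 :> R by rewrite invr_gt0 exprn_gt0 //; lra.
  have h2 : K%:R ^- 2 <= 1 :> R by rewrite invf_le1 ?exprn_gt0 // ?exprn_ege1 //; lra.
  by rewrite ger0_norm /q; lra.
have sq a b : mu2.-negligible (planar X `&` square a b r0).
  have /choice[B BP] : forall n, exists B, [/\ measurable B, planar X `&` square a b r0 `<=` B &
      (mu2 B <= (q ^+ n * r0 ^+ 2)%:E)%E].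
    move=> n; have [B [mB SB] Bt] := porous_covered k0 k1 r00 hX K0 Kk n a b r00 (lexx r0).
    by exists B.
  have mI : measurable (\bigcap_n B n).
    by apply: bigcap_measurable => [|n _]; [exists 0%N|have [] := BP n].
  exists (\bigcap_n B n); split=> //; last first.
    by move=> p Sp n _; have [_ h _] := BP n; exact: h.
  apply/eqP; rewrite eq_le measure_ge0 andbT.
  apply/lee_addgt0Pr => e e0; rewrite add0e.
  have /cvgrPdist_lt /(_ e e0) [N _ hN] := cvg_geometric (r0 ^+ 2) q1.
  have [_ _ h] := BP N.
  have sub : \bigcap_n B n `<=` B N by move=> p; exact.
  have mN : measurable (B N) by have [] := BP N.
  have h1 : (mu2 (\bigcap_n B n) <= mu2 (B N))%E by apply: le_measure; rewrite ?inE.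
  apply: le_trans h1 (le_trans h _); rewrite lee_fin.
  have := hN N (leqnn N); rewrite /= sub0r normrN => h2.
  by rewrite mulrC; apply: le_trans (ler_norm _) (ltW h2).
(* Integer multiples of [r0] are written with differences of naturals, so that the squares tiling
   the plane are numbered through [pickle]. *)
have grid x : exists n : nat * nat, (n.1%:R - n.2%:R) * r0 <= x <= (n.1%:R - n.2%:R) * r0 + r0.
  have h1 := floor_le (x / r0); have h2 := lt_succ_floor (x / r0).
  move: h1 h2; rewrite intrD1; case: (Num.floor (x / r0)) => n h1 h2.
    exists (n, 0%N) => /=; rewrite subr0; rewrite ler_pdivlMr // in h1; rewrite ltr_pdivrMr // in h2.
    by rewrite h1 /=; move: h2; rewrite mulrDl mul1r => /ltW.
  exists (0%N, n.+1) => /=; rewrite sub0r; rewrite ler_pdivlMr // in h1; rewrite ltr_pdivrMr // in h2.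
  have e : (Negz n)%:~R = - n.+1%:R :> R by rewrite NegzE mulrNz.
  by rewrite e in h1 h2; rewrite h1 /=; move: h2; rewrite mulrDl mul1r => /ltW.
pose F (m : nat) : set (R * R) := if (unpickle m : option ((nat * nat) * (nat * nat))) is Some (n1, n2) then
  planar X `&` square ((n1.1%:R - n1.2%:R) * r0) ((n2.1%:R - n2.2%:R) * r0) r0 else set0.
have hF m : mu2.-negligible (F m).
  rewrite /F; case: (unpickle m) => [[n1 n2]|]; first exact: sq.
  exact: negligible_set0.
apply: negligibleS (negligible_bigcup hF) => p Xp.
have [n1 h1] := grid p.1; have [n2 h2] := grid p.2.
exists (pickle (n1, n2)) => //; rewrite /F pickleK; split=> //.
Qed.

End Porous.

Section Expanding.
Variable R : realType.
Local Notation C := (Cplane R).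
Local Notation nm := (@nm R).
Local Notation rc := (@rc R).
Implicit Types (z w c x y u v : C) (r s t e m : R) (f g h : C -> C) (X O Kc : set C).

(** * Expanding repellers are porous *)

Section Repeller.
Variables (O Kc X : set C) (g : C -> C).
Hypotheses (oO : open O) (cK : compact Kc) (KO : Kc `<=` O) (XK : X `<=` Kc) (clX : closed X).
Hypotheses (hg : hol O g) (gX : forall x, X x -> X (g x)).
Hypothesis g4 : forall x, X x -> 4 <= nm (derive1 g x).

Lemma uniform_bound : exists r M, [/\ 0 < r, 0 < M &
  forall x, Kc x -> disk x r `<=` O /\ forall z, disk x r z -> nm (g z) <= M].
Proof.
have cid u : Kc u -> cts (fun z => z) u by move=> _; exact (cts_id u).
have cg z : O z -> cts g z by move=> Oz; exact (hol_cts hg Oz).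
have [r r0 hr] := compact_unif_cts cK cid oO KO cg ltr01.
have [M M0 gM] : exists2 M, 0 < M & forall u, Kc u -> nm (g u) <= M.
  by apply: (compact_bound cK) => u Ku; exact (continuous_nm_of (cg u (KO Ku))).
exists r, (M + 1); split=> //; first by lra.
move=> x Kx; split=> z zx; have [Oz h] := hr x Kx z zx; first exact: Oz.
by have := le_nmB (g z) (g x); have := gM x Kx; lra.
Qed.

(** The parameter [s] matters: at distance [s * rho] from [x] the relative error of the linear
    approximation is only [s]. Along an expanding orbit these errors form a geometric series, which
    bounds the distortion. *)
Lemma one_step : exists rho B : R, [/\ 0 < rho, 4 <= B &
  [/\ forall x, X x -> disk x rho `<=` O,
      forall x, X x -> nm (derive1 g x) <= B &
      forall x s z w, X x -> 0 <= s -> s <= 1 -> nm (z - x) <= s * rho -> nm (w - x) <= s * rho ->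
        nm (g z - g w - derive1 g x * (z - w)) <= s * nm (z - w)]].
Proof.
have [r [M [r0 M0 hr]]] := uniform_bound.
pose k : R := 32 * M / r ^+ 2.
have k0 : 0 < k by rewrite divr_gt0 ?exprn_gt0 // mulr_gt0.
pose rho : R := Num.min (r / 8) (1 / k).
have rho0 : 0 < rho by rewrite lt_min divr_gt0 // divr_gt0.
have rho1 : rho <= r / 8 by rewrite ge_min lexx.
have rhok : k * rho <= 1.
  by rewrite mulrC -ler_pdivlMr // /rho ge_min lexx orbT.
exists rho, (4 * M / r + 4); split=> //.
  by rewrite lerDr divr_ge0 ?mulr_ge0 // ltW.
split.
- by move=> x /XK /hr[h _] z zx; apply: h; move: zx; rewrite /disk /=; lra.
- move=> x /XK /hr[h1 h2]; have hd : hol (disk x r) g := hol_sub h1 hg.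
  have := deriv_bound r0 hd h2 (b := x); rewrite subrr nm0 => h.
  by apply: le_trans (h _) _; lra.
move=> x s z w /XK /hr[h1 h2] s0 s1 zx wx.
have hd : hol (disk x r) g := hol_sub h1 hg.
have r20 : 0 < r / 2 by lra.
have hd' : hol (disk x (r / 2)) (derive1 g).
  exact: (hol_sub (@disk_half R x r r0) (hol_deriv (@open_disk R x r) hd)).
have b' v : disk x (r / 2) v -> nm (derive1 g v) <= 4 * M / r.
  by rewrite /disk /= => vx; apply: (deriv_bound r0 hd h2); exact: ltW.
have sr : s * rho <= r / 8 by nra.
have lip v : nm (v - x) <= s * rho -> nm (derive1 g v - derive1 g x) <= s.
  move=> vx; have x0 : nm (x - x) <= r / 2 / 2 by rewrite subrr nm0; lra.
  have v0 : nm (v - x) <= r / 2 / 2 by lra.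
  apply: le_trans (lip_bound r20 hd' b' x0 v0) _.
  have -> : 4 * (4 * M / r) / (r / 2) = k by rewrite /k; field; rewrite gt_eqF.
  apply: le_trans (ler_wpM2l (ltW k0) vx) _.
  by rewrite mulrCA; nra.
have sg t : 0 <= t <= 1 -> nm (seg w z t - x) <= s * rho by move=> t01; exact: (@disk_convex R x (s * rho) w z t wx zx t01).
have := @mvi R g (derive1 g) w z (derive1 g x) s _ _; apply.
  move=> t t01; apply: (hol_cder hd); rewrite /disk /=.
  by apply: le_lt_trans (sg t t01) _; lra.
by move=> t t01; apply: lip; exact: sg.
Qed.

(** The modulus of the derivative of [iter n g] at [x], as a product along the orbit; see
    [cder_iter]. *)
Fixpoint lam n x : R := if n is n'.+1 then nm (derive1 g x) * lam n' (g x) else 1.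

Lemma lamS n x : lam n.+1 x = nm (derive1 g x) * lam n (g x). Proof. by []. Qed.

Lemma iterX n x : X x -> X (iter n g x).
Proof. by move=> Xx; elim: n => [//|n IH]; rewrite iterS; exact: gX. Qed.

Lemma lam_last n x : lam n.+1 x = lam n x * nm (derive1 g (iter n g x)).
Proof.
elim: n x => [|n IH] x; first by rewrite /= mulr1 mul1r.
by rewrite lamS IH lamS mulrA iterSr.
Qed.

Lemma lam_ge n x : X x -> 4 ^+ n <= lam n x.
Proof.
elim: n x => [|n IH] x Xx; first by rewrite expr0.
rewrite lamS exprS; apply: ler_pM => //; first exact: g4.
by apply: IH; exact: gX.
Qed.

Lemma lam_gt0 n x : X x -> 0 < lam n x.
Proof. by move=> /(lam_ge n); apply: lt_le_trans; rewrite exprn_gt0. Qed.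

Lemma lam_mono j n x : X x -> (j <= n)%N -> lam j x <= lam n x.
Proof.
move=> Xx /subnK <-; elim: (n - j)%N => [|k IH]; first by rewrite add0n.
apply: le_trans IH _; rewrite addSn lam_last.
have := g4 (iterX (k + j) Xx); have := lam_gt0 (k + j) Xx; nra.
Qed.

Lemma cder_iter n x : X x -> exists2 d, cder (iter n g) x d & nm d = lam n x.
Proof.
elim: n x => [|n IH] x Xx.
  by exists 1; [exact: cder_id|rewrite nm1].
have [d hd dE] := IH _ (gX Xx).
exists (d * derive1 g x).
  have -> : iter n.+1 g = fun z => iter n g (g z) by apply/funext => z; rewrite iterSr.
  by apply: cder_comp hd; apply: hol_cder hg _; apply: KO; exact: XK.
by rewrite nmM dE lamS mulrC.
Qed.

(** On a disk inside the invariant set all iterates are bounded by the same constant, so Cauchy's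
    estimate bounds their derivatives at the center, which however grow like [4 ^+ n]. *)
Lemma X_no_interior x r : 0 < r -> ~ (disk x r `<=` X).
Proof.
move=> r0 dX; have Xx : X x by apply: dX; exact: disk_center.
have [M M0 KM] := compact_bound cK (fun u _ => @continuous_nm R u).
have hn n : hol (disk x r) (iter n g).
  by move=> z zr; have [d hd _] := cder_iter n (dX z zr); exists d.
have bn n z : disk x r z -> nm (iter n g z) <= M.
  by move=> /dX Xz; apply: KM; apply: XK; exact: iterX.
have le n : 4 ^+ n <= 4 * M / r.
  have [d hd dE] := cder_iter n Xx; apply: le_trans (lam_ge n Xx) _; rewrite -dE.
  rewrite -(cder_derive1 hd); apply: (deriv_bound r0 (hn n) (bn n)).
  by rewrite subrr nm0; lra.
pose q : R := 4 * M / r; have q0 : 0 < q by rewrite divr_gt0 // mulr_gt0.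
have iq : 0 < q^-1 by rewrite invr_gt0.
have [n hn'] := half_pow_lt iq.
have h2 : q < 2 ^+ n.
  by rewrite -ltf_pV2 ?posrE ?exprn_gt0 // -[X in X < _]mul1r.
have h3 : 2 ^+ n <= 4 ^+ n :> R by apply: lerXn2r; rewrite ?nnegrE //; lra.
by have := le n; rewrite -/q => h4; have := lt_le_trans h2 (le_trans h3 h4); rewrite ltxx.
Qed.

Lemma uniform_hole t : 0 < t -> exists2 e, 0 < e & forall y, X y ->
  exists c, disk c e `<=` disk y t `\` X.
Proof.
move=> t0; have cX : compact X := subclosed_compact clX cK XK.
apply: (compact_uniform (P := fun y e => exists c, disk c e `<=` disk y t `\` X) cX).
  move=> u s r sr [c hc]; exists c; apply: subset_trans hc; exact: disk_subset.
move=> u Xu; have t20 : 0 < t / 2 by lra.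
have /existsNP[v /not_implyP[vu nXv]] := @X_no_interior u (t / 2) t20.
have oX : open (disk u (t / 2) `\` X).
  by rewrite setDE; apply: openI; [exact: open_disk|exact: closed_openC].
have [e e0 he] := (openP _).1 oX v (conj vu nXv).
exists e => //; apply: filterS (nbhs_disk u t20) => y yu _; exists v => w /he[wu nXw].
split=> //; move: wu yu; rewrite /disk /= => wu yu.
by have := le_nm_sub u w y; rewrite (nmB u y); lra.
Qed.

(** The Bowen ball: points whose orbit follows that of [x] within [rho] up to time [n]. *)
Definition Dn (rho : R) n x : set C := [set z | forall j, (j <= n)%N -> nm (iter j g z - iter j g x) < rho].

Section Step.
Variables (rho B : R).
Hypotheses (rho0 : 0 < rho) (B4 : 4 <= B).
Hypothesis stepO : forall x, X x -> disk x rho `<=` O.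
Hypothesis gB : forall x, X x -> nm (derive1 g x) <= B.
Hypothesis step : forall x s z w, X x -> 0 <= s -> s <= 1 -> nm (z - x) <= s * rho ->
  nm (w - x) <= s * rho -> nm (g z - g w - derive1 g x * (z - w)) <= s * nm (z - w).

Lemma step_le x s z w : X x -> 0 <= s -> s <= 1 -> nm (z - x) <= s * rho -> nm (w - x) <= s * rho ->
  (nm (derive1 g x) - s) * nm (z - w) <= nm (g z - g w) <= (nm (derive1 g x) + s) * nm (z - w).
Proof.
move=> Xx s0 s1 zx wx; have := step Xx s0 s1 zx wx; rewrite mulrBl mulrDl -nmM => h.
have h1 := le_nmB (g z - g w) (derive1 g x * (z - w)).
have h2 := le_nmB (derive1 g x * (z - w)) (g z - g w); rewrite (nmB (derive1 g x * _)) in h2.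
by apply/andP; split; lra.
Qed.

Lemma step_expand x z : X x -> nm (z - x) <= rho -> 2 * nm (z - x) <= nm (g z - g x).
Proof.
move=> Xx zx; have x0 : nm (x - x) <= rho by rewrite subrr nm0 ltW.
have := @step_le x 1 z x Xx ler01 (lexx 1); rewrite mul1r => /(_ zx x0) /andP[h _].
by have := g4 Xx; have := nm_ge0 (z - x); nra.
Qed.

Lemma DnS n x z : Dn rho n.+1 x z -> nm (z - x) < rho /\ Dn rho n (g x) (g z).
Proof.
move=> h; split; first exact: (h 0%N).
by move=> j jn; rewrite -!iterSr; exact: h.
Qed.

Lemma Dn_small n x z : X x -> Dn rho n x z -> nm (z - x) < rho / 2 ^+ n.
Proof.
elim: n x z => [|n IH] x z Xx; first by move=> /(_ 0%N isT); rewrite expr0 divr1.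
move=> /DnS[zx /(IH _ _ (gX Xx)) h]; have := step_expand Xx (ltW zx) => h2.
rewrite exprS invfM mulrA mulrAC ltr_pdivlMr // mulrC.
exact: le_lt_trans h2 h.
Qed.

(** The arithmetic of the inductive step of [distortion]: with [l >= 4], the slack between the
    constants for [q] and for [q / 2] pays for the error [q / 2] of one step. *)
Lemma pow2_arith (q l L d : R) : 0 < q -> q <= 1 -> 0 <= d -> 4 <= l -> 0 < L ->
  (1 / 2 + q / 2 / 2) * (l * L) * d <= (1 / 2 + q / 2) * L * ((l - q / 2) * d) /\
  (2 - q) * L * ((l + q / 2) * d) <= (2 - q / 2) * (l * L) * d.
Proof.
move=> q0 q1 d0 l4 L0; have Ld : 0 <= L * d by rewrite mulr_ge0 // ltW.
split; rewrite -subr_ge0.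
  have -> : (1 / 2 + q / 2) * L * ((l - q / 2) * d) - (1 / 2 + q / 2 / 2) * (l * L) * d =
     (L * d) * (q / 4 * (l - 1 - q)) by field.
  by rewrite mulr_ge0 // mulr_ge0; lra.
have -> : (2 - q / 2) * (l * L) * d - (2 - q) * L * ((l + q / 2) * d) =
   (L * d) * (q / 2 * (l - 2 + q)) by field.
by rewrite mulr_ge0 // mulr_ge0; lra.
Qed.

(** With [n] steps to go, a point of the Bowen ball is within [rho / 2 ^+ n] of [x] by [Dn_small],
    so the first step has relative error at most [1 / 2 ^+ n]. The constants start at [1] and move
    towards [1 / 2] and [2] without reaching them, which makes the induction close. *)
Lemma distortion n x z w : X x -> Dn rho n x z -> Dn rho n x w ->
  (1 / 2 + 1 / 2 ^+ n / 2) * lam n x * nm (z - w) <= nm (iter n g z - iter n g w) <=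
  (2 - 1 / 2 ^+ n) * lam n x * nm (z - w).
Proof.
elim: n x z w => [|n IH] x z w Xx hz hw.
  by rewrite expr0 /= divr1; apply/andP; split; lra.
have [_ gz] := DnS hz; have [_ gw] := DnS hw.
have /andP[i1 i2] := IH _ _ _ (gX Xx) gz gw.
pose q : R := 1 / 2 ^+ n.
have q0 : 0 < q by rewrite divr_gt0 // exprn_gt0.
have q1 : q <= 1 by rewrite ler_pdivrMr ?exprn_gt0 // mul1r exprn_ege1 //; lra.
have qS : 1 / 2 ^+ n.+1 = q / 2 by rewrite exprS invfM /q; field; rewrite expf_neq0.
have qr : rho / 2 ^+ n.+1 = q / 2 * rho by rewrite -qS; field; rewrite expf_neq0.
have zx := ltW (Dn_small Xx hz); have wx := ltW (Dn_small Xx hw).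
rewrite qr in zx wx.
have q20 : 0 <= q / 2 by lra.
have q21 : q / 2 <= 1 by lra.
have /andP[s1 s2] := step_le Xx q20 q21 zx wx.
have L0 := lam_gt0 n (gX Xx); have l4 := g4 Xx.
have [p1 p2] := pow2_arith q0 q1 (nm_ge0 (z - w)) l4 L0.
rewrite qS !iterSr lamS -/q in i1 i2 *; apply/andP; split.
  apply: le_trans p1 _; apply: le_trans i1.
  by apply: ler_wpM2l s1; rewrite mulr_ge0 ?(ltW L0) //; lra.
apply: le_trans p2; apply: le_trans i2 _.
by apply: ler_wpM2l s2; rewrite mulr_ge0 ?(ltW L0) //; lra.
Qed.

Lemma distortion_le n x z w : X x -> Dn rho n x z -> Dn rho n x w ->
  lam n x * nm (z - w) <= 2 * nm (iter n g z - iter n g w) /\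
  nm (iter n g z - iter n g w) <= 2 * (lam n x * nm (z - w)).
Proof.
move=> Xx hz hw; have /andP[h1 h2] := distortion Xx hz hw.
have p0 : 0 <= lam n x * nm (z - w) by rewrite mulr_ge0 ?nm_ge0 // ltW // lam_gt0.
have q0 : 0 < 1 / 2 ^+ n :> R by rewrite divr_gt0 // exprn_gt0.
rewrite -mulrA in h1; rewrite -mulrA in h2; split; nra.
Qed.

Lemma step_surj x y : X x -> nm (y - g x) < rho -> exists2 z, nm (z - x) < rho & g z = y.
Proof.
move=> Xx yx; pose s : R := (nm (y - g x) + rho) / 2; have rho0' := rho0.
have s0 : 0 < s by rewrite /s; have := nm_ge0 (y - g x); lra.
have s1 : s < rho by rewrite /s; lra.
have ys : nm (y - g x) < s by rewrite /s; lra.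
have hq : hol O (fun z => g z - y) by apply: holB => //; exact: hol_cst.
have [| | |z zs /eqP] := @hurwitz_disk R O (fun z => g z - y) x s s oO hq s0 s0.
- by move=> z zx; apply: (stepO Xx); rewrite /disk /=; lra.
- move=> z zx; have := @step_expand x z Xx; rewrite zx => /(_ (ltW s1)) h.
  by have := le_nm_sub y (g z) (g x); lra.
- by rewrite nmB.
by rewrite subr_eq0 => /eqP zE; exists z => //; lra.
Qed.

(** Pulls [w] back along the orbit one step at a time; each step is surjective near [x] by Hurwitz's
    argument, since [g] expands by at least 2 there. *)
Lemma Dn_surj n x w : X x -> nm (w - iter n g x) < rho -> exists2 z, Dn rho n x z & iter n g z = w.
Proof.
elim: n x w => [|n IH] x w Xx wx.
  by exists w => // j; rewrite leqn0 => /eqP ->.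
rewrite iterSr in wx; have [y hy yE] := IH _ _ (gX Xx) wx.
have [z zx zE] := step_surj Xx (hy 0%N isT).
exists z; last by rewrite iterSr zE.
by move=> [|j] jn //; rewrite !iterSr zE; exact: hy.
Qed.

Lemma Dn_half n x z c : X x -> Dn rho n x z -> iter n g z = c -> nm (c - iter n g x) < rho / 2 ->
  forall j, (j <= n)%N -> nm (iter j g z - iter j g x) < rho / 2.
Proof.
move=> Xx hz zc cx j; rewrite leq_eqVlt => /orP[/eqP ->|jn]; first by rewrite zc.
have := step_expand (iterX j Xx) (ltW (hz j (ltnW jn))); have := hz _ jn.
by rewrite !iterS; lra.
Qed.

(** Let [n] be the first time with [2 * rho <= lam n x * r]. A hole of radius [e] near [iter n g x]
    is pulled back to a hole about [z], which stays inside [disk x r] because distances are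
    distorted by at most 2. Minimality of [n] gives [lam n x * r < 2 * rho * B], so the pulled back
    hole is a fixed fraction of [r]. *)
Lemma expanding_holes e : 0 < e -> (forall y, X y -> exists c, disk c e `<=` disk y (rho / 2) `\` X) ->
  exists k, [/\ 0 < k, k <= 1 & holes X k rho].
Proof.
(* [th] is the size of the pulled back hole measured at time [n]. The bound [e / 2] keeps its image
   inside the given hole after distortion by 2; the other bound gives
   [(B + 1) * (2 * th) <= rho / 2], which keeps all intermediate images in the Bowen ball. *)
move=> e0 he; pose th : R := Num.min (e / 2) (rho / (4 * (B + 1))).
have B4' := B4; have rho0' := rho0; have B1 : 0 < B + 1 by lra.
have th0 : 0 < th by rewrite lt_min !divr_gt0 // mulr_gt0.
(* Chosen so that [k1 * r * lam n x < th], by the upper bound on [lam n x * r]. *)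
pose k1 : R := th / (2 * rho * B).
have k10 : 0 < k1 by rewrite divr_gt0 // mulr_gt0 ?mulr_gt0 //; lra.
exists (Num.min k1 1); split; rewrite ?lt_min ?k10 ?ltr01 ?ge_min ?lexx ?orbT //.
move=> x r Xx r0 rr.
have ex : exists n, 2 * rho / r <= lam n x.
  have q0 : 0 < (2 * rho / r)^-1 by rewrite invr_gt0 divr_gt0 // mulr_gt0.
  have [n hn] := half_pow_lt q0; exists n.
  have h2 : 2 * rho / r < 2 ^+ n.
    by rewrite -ltf_pV2 ?posrE ?exprn_gt0 ?divr_gt0 ?mulr_gt0 // -[X in X < _]mul1r.
  apply: le_trans (ltW h2) (le_trans _ (lam_ge n Xx)).
  by apply: lerXn2r; rewrite ?nnegrE //; lra.
have [n hn min] : exists2 n, 2 * rho / r <= lam n x & forall m : nat, 2 * rho / r <= lam m x -> (n <= m)%N.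
  by case: (ex_minnP ex) => n h1 h2; exists n.
have n0 : (0 < n)%N.
  rewrite lt0n; apply/eqP => n0; move: hn; rewrite n0 /= ler_pdivrMr // mul1r; lra.
have L0 := lam_gt0 n Xx.
have hlam : lam n x * r < 2 * rho * B.
  case: n n0 hn min L0 => // n _ hn min L0.
  have h : lam n x < 2 * rho / r.
    by rewrite ltNge; apply/negP => /min; rewrite ltnn.
  rewrite ltr_pdivlMr // in h; rewrite lam_last mulrAC.
  have h1 := gB (iterX n Xx); have h2 := nm_ge0 (derive1 g (iter n g x)); have h3 := g4 (iterX n Xx).
  have h4 : 0 < lam n x * r by rewrite mulr_gt0 // lam_gt0.
  by nra.
have Yn := iterX n Xx; have [c hc] := he _ Yn.
have [cy nXc] := hc c (disk_center c e0).
have cr : nm (c - iter n g x) < rho by move: cy; rewrite /disk /=; lra.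
have [z hz zc] := Dn_surj Xx cr.
have zh := Dn_half Xx hz zc cy.
exists z => w; rewrite /disk /= => wz.
have wz' : nm (w - z) * lam n x < th.
  have h1 : nm (w - z) < k1 * r.
    by apply: lt_le_trans wz _; rewrite ler_wpM2r ?(ltW r0) // ge_min lexx.
  have h2 : nm (w - z) * lam n x <= k1 * r * lam n x by rewrite ler_wpM2r ?ltW.
  apply: le_lt_trans h2 _; rewrite -mulrA (mulrC r) /k1 mulrAC ltr_pdivrMr; last by rewrite !mulr_gt0 //; lra.
  by rewrite ltr_pM2l.
have th1 : th <= e / 2 by rewrite ge_min lexx.
have th2 : th * (4 * (B + 1)) <= rho.
  by rewrite -ler_pdivlMr ?mulr_gt0 // ge_min lexx orbT.
(* The distortion bound presupposes membership in the Bowen ball, so both are proved together: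
   distortion at time [j] and the one-step factor [B + 1] give membership at time [j.+1]. *)
have wD j : (j <= n)%N -> Dn rho j x w.
  have zD i : (i <= n)%N -> Dn rho i x z by move=> hi u ui; apply: hz; exact: leq_trans hi.
  elim: j => [_|j IH jn].
    move=> i; rewrite leqn0 => /eqP -> /=.
    have h1 := zh 0%N isT; have h2 := lam_mono Xx (leq0n n); rewrite /= in h1 h2.
    have h3 := le_nm_sub z w x; have h4 := nm_ge0 (w - z).
    have h5 : nm (w - z) < th by nra.
    have h6 : th * 4 <= rho by nra.
    by lra.
  have wj := IH (ltnW jn); move=> i; rewrite leq_eqVlt => /orP[/eqP->|]; last by rewrite ltnS; exact: wj.
  have [_ d2] := distortion_le Xx wj (zD j (ltnW jn)).
  have lj := lam_mono Xx (ltnW jn).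
  have b1 : nm (iter j g w - iter j g z) <= 2 * th.
    apply: le_trans d2 _; rewrite ler_pM2l //; apply: le_trans (ltW wz').
    by rewrite mulrC ler_wpM2l ?nm_ge0.
  have c1 := ltW (wj j (leqnn j)); have c2 := ltW (zD j (ltnW jn) j (leqnn j)).
  have := @step_le (iter j g x) 1 (iter j g w) (iter j g z) (iterX j Xx) ler01 (lexx 1).
  rewrite mul1r => /(_ c1 c2) /andP[_ h]; rewrite !iterS.
  have h7 : nm (g (iter j g w) - g (iter j g z)) <= rho / 2.
    apply: le_trans h _; have hB := gB (iterX j Xx).
    have h8 := nm_ge0 (iter j g w - iter j g z).
    have h9 : (nm (derive1 g (iter j g x)) + 1) * nm (iter j g w - iter j g z) <= (B + 1) * (2 * th).
      apply: ler_pM => //; [by have := nm_ge0 (derive1 g (iter j g x)); lra|by lra].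
    by lra.
  have h10 := zh j.+1 jn; rewrite !iterS in h10.
  have := le_nm_sub (g (iter j g z)) (g (iter j g w)) (g (iter j g x)); lra.
have wn := wD n (leqnn n).
have [_ d2] := distortion_le Xx wn hz.
have we : disk c e (iter n g w).
  by rewrite /disk /= -zc; apply: le_lt_trans d2 _; rewrite (mulrC (lam n x)); lra.
have [wy nXw] := hc _ we; split; last by move=> Xw; apply: nXw; exact: iterX.
have xD : Dn rho n x x by move=> j _; rewrite subrr nm0.
have [d1 _] := distortion_le Xx wn xD.
move: wy; rewrite /disk /= => wy.
have h1 : lam n x * nm (w - x) < lam n x * r.
  have : 2 * rho <= lam n x * r by rewrite -ler_pdivrMr.
  by lra.
by move: h1; rewrite ltr_pM2l.
Qed.

End Step.

Theorem expanding_porous : porous X.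
Proof.
have [rho [B [rho0 B4 [h1 h2 h3]]]] := one_step.
have t0 : 0 < rho / 2 by lra.
have [e e0 he] := uniform_hole t0.
have [k [k0 k1 hk]] := expanding_holes rho0 B4 h1 h2 h3 e0 he.
by exists k, rho.
Qed.

End Repeller.
End Expanding.

Section BoxDynamics.
Variable R : realType.
Local Notation C := (Cplane R).
Local Notation nm := (@nm R).
Local Notation rc := (@rc R).
Implicit Types (z w c x y u v : C) (r s t e : R) (f g h : C -> C) (A B D K U V W : set C).

(** * Components and puzzle pieces *)

Lemma comp_of A z : A z -> components A (connected_component A z).
Proof. by move=> Az; exists z. Qed.

Lemma comp_eq A V z : components A V -> V z -> V = connected_component A z.
Proof. by move=> [w Aw <-] /same_connected_component. Qed.

Lemma comp_sub A V : components A V -> V `<=` A.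
Proof. by move=> [w Aw <-]; exact: connected_component_sub. Qed.

Lemma comp_connected A V : components A V -> connected V.
Proof. by move=> [w Aw <-]; exact: component_connected. Qed.

Lemma comp_open A V : open A -> components A V -> open V.
Proof. by move=> oA [w Aw <-]; exact: component_open. Qed.

Lemma comp_neq0 A V : components A V -> V !=set0.
Proof. by move=> [w Aw <-]; exists w; exact: connected_component_refl. Qed.

Lemma comp_max A V S z : components A V -> connected S -> S `<=` A -> S z -> V z -> S `<=` V.
Proof. by move=> cV cS SA Sz Vz; rewrite (comp_eq cV Vz); exact: connected_sub_component. Qed.

Lemma comp_disj A V V' z : components A V -> components A V' -> V z -> V' z -> V = V'.
Proof. by move=> cV cV' Vz V'z; rewrite (comp_eq cV Vz) (comp_eq cV' V'z). Qed.

Lemma comp_diff_open A V : open A -> components A V -> open (A `\` V).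
Proof.
move=> oA cV; apply/openP => z [Az nVz].
have oz := component_open (p := z) oA.
have [r r0 rc] := (openP _).1 oz z (connected_component_refl Az).
exists r => // w /rc cw; split; first exact: connected_component_sub cw.
move=> Vw; apply: nVz; rewrite (comp_eq cV Vw).
exact: connected_component_sym.
Qed.

Lemma compact_comp A V K : open A -> components A V -> compact K -> K `<=` A -> compact (K `&` V).
Proof.
move=> oA cV cK KA; have -> : K `&` V = K `&` ~` (A `\` V).
  apply/seteqP; split=> z [Kz h]; split=> //; first by move=> [_]; apply.
  by apply: contrapT => nV; apply: h; split=> //; exact: KA.
by apply: compact_closedI => //; apply: open_closedC; exact: comp_diff_open.
Qed.

(** Disjointness of the closures makes each member relatively closed in the union, even if the
    family is infinite, so a component cannot leave it. *)
Lemma comp_of_family E (P : set (set C)) A z : (forall B, P B -> open B /\ connected B) ->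
  trivIset P closure -> E = \bigcup_(B in P) B -> P A -> A z -> connected_component E z = A.
Proof.
move=> hP tP EE PA Az; have Ez : E z by rewrite EE; exists A.
have [oA cA] := hP A PA.
apply/seteqP; split; last first.
  by apply: connected_sub_component => //; rewrite EE => w Aw; exists A.
move=> w Xw; have cX : connected (connected_component E z) by exact: component_connected.
have AX : A `<=` connected_component E z.
  by apply: connected_sub_component => // v Av; rewrite EE; exists A.
apply: (conn_clopen (S := A) cX AX _ oA _ Xw); first by exists z.
move=> v Xv hv; have : E v by exact: connected_component_sub Xv.
rewrite EE => -[B PB Bv]; have -> // : A = B.
apply: tP => //; exists v; split; last exact: subset_closure.
by move=> N /nbhsP[e e0 eN]; have [u Au uv] := hv e e0; exists u; split=> //; exact: eN.
Qed.

Lemma finite_compact_union (P : set (set C)) (K : set C -> set C) : finite_set P ->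
  (forall A, P A -> compact (K A)) -> compact (\bigcup_(A in P) K A).
Proof.
move=> /finite_seqP[s ->] h.
have -> : \bigcup_(A in [set` s]) K A = \big[setU/set0]_(A <- s) K A by rewrite bigcup_seq.
rewrite big_seq; elim/big_ind: _ => [||A As]; [exact: compact0|exact: compactU|exact: h].
Qed.

Lemma finite_bound (P : set (set C)) (f : set C -> nat) : finite_set P ->
  exists M, forall A, P A -> (f A <= M)%N.
Proof.
move=> /finite_seqP[s ->]; exists (\max_(A <- s) f A) => A As.
by rewrite (big_rem A) //= leq_maxl.
Qed.

(** * Iterated domains of a box mapping and their components *)

Section Iterates.
Variable F : plane_map R.
Hypothesis bF : box_mapping F.

Lemma iter_dom_le n : iter_dom F n.+1 `<=` iter_dom F n.
Proof.
elim: n => [|n IH] z [sz Fz]; first exact: box_src_tgt sz.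
by split=> //; exact: IH.
Qed.

Lemma iter_dom_mono m n : (m <= n)%N -> iter_dom F n `<=` iter_dom F m.
Proof.
move=> /subnK <-; elim: (n - m)%N => [|k IH]; first by rewrite add0n.
by apply: subset_trans IH; rewrite addSn; exact: iter_dom_le.
Qed.

Lemma iter_dom_shift k n z : iter_dom F (k + n) z -> iter_dom F n (iter k F z).
Proof. by elim: k z => [//|k IH] z /= [_ /IH]; rewrite -iterSr. Qed.

Lemma iter_dom_tgt n z : iter_dom F n z -> tgt F z.
Proof. by move=> /(iter_dom_mono (leq0n n)). Qed.

Lemma hol_src : hol (src F) F.
Proof. by apply/holP; exact: box_holomorphic. Qed.

Lemma iter_dom_open n : open (iter_dom F n).
Proof.
elim: n => [|n IH]; first exact: box_tgt_open.
apply/openP => z [sz Fz].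
have [r r0 hr] := (openP _).1 (box_src_open bF) z sz.
have [e e0 he] := (openP _).1 IH _ Fz.
have [d d0 hd] := (@ccontP R F z).1 (hol_cts hol_src sz) e e0.
exists (Num.min r d); first by rewrite lt_min r0.
move=> w; rewrite /disk /= lt_min => /andP[wr wd]; split; first exact: hr.
by apply: he; exact: hd.
Qed.

Lemma hol_iter n : hol (iter_dom F n) (iter n F).
Proof.
elim: n => [|n IH] z.
  by move=> _; exists 1; exact: cder_id.
move=> [sz Fz]; have [d hd] := IH _ Fz; have [d' hd'] := hol_src sz.
exists (d * d'); have -> : iter n.+1 F = fun z => iter n F (F z).
  by apply/funext => w; rewrite iterSr.
exact: (cder_comp (f := iter n F) hd' hd).
Qed.

Lemma nonescaping_shift k z : nonescaping F z -> nonescaping F (iter k F z).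
Proof. by move=> Kz n _; apply: iter_dom_shift; exact: Kz. Qed.

Lemma nonescaping_src z : nonescaping F z -> src F z.
Proof. by move=> /(_ 1%N I)[]. Qed.

Lemma jordan_disk_open_conn A : jordan_disk A -> open A /\ connected A.
Proof. by move=> [tA _]; split; [have [] := tA|exact: topological_disk_connected]. Qed.

Lemma tgt_comp V : components (tgt F) V -> jordan_disk V.
Proof.
have [P [_ jP tP PE]] := box_tgt bF.
move=> [z]; rewrite {1}PE => -[A PA Az] <-.
have h B : P B -> open B /\ connected B by move=> /jP /jordan_disk_open_conn.
by rewrite (comp_of_family h tP PE PA Az); exact: jP.
Qed.

Lemma finite_tgt : finite_set (components (tgt F)).
Proof.
have [P [fP jP tP PE]] := box_tgt bF; apply: sub_finite_set fP => V [z].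
rewrite {1}PE => -[A PA Az] <-.
have h B : P B -> open B /\ connected B by move=> /jP /jordan_disk_open_conn.
by rewrite (comp_of_family h tP PE PA Az).
Qed.

Lemma src_comp_sub U V z : components (src F) U -> components (tgt F) V -> U z -> V z -> U `<=` V.
Proof.
move=> cU cV Uz Vz; apply: (comp_max cV (comp_connected cU) _ Uz Vz).
by apply: subset_trans (comp_sub cU) _; exact: box_src_tgt.
Qed.

Lemma src_family U V z (P : set (set C)) : components (src F) U -> components (tgt F) V -> U z -> V z ->
  (forall A, P A -> jordan_disk A /\ compactly_contained A V) -> trivIset P closure ->
  V `&` src F = \bigcup_(A in P) A -> P U.
Proof.
move=> cU cV Uz Vz jP tP PE.
have sz : src F z := comp_sub cU Uz.
have [A PA Az] : (\bigcup_(A in P) A) z by rewrite -PE.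
have h B : P B -> open B /\ connected B by move=> /jP[/jordan_disk_open_conn].
have AE := comp_of_family h tP PE PA Az.
suff -> : U = A by [].
apply/seteqP; split.
  rewrite -AE; apply: connected_sub_component => //; first exact: comp_connected cU.
  move=> w Uw; split; last exact: comp_sub cU _ Uw.
  exact: src_comp_sub cU cV Uz Vz _ Uw.
apply: (comp_max cU (h A PA).2 _ Az Uz) => w Aw.
have : (V `&` src F) w by rewrite PE; exists A.
by case.
Qed.

Lemma src_comp U V z : components (src F) U -> components (tgt F) V -> U z -> V z ->
  U <> V -> jordan_disk U /\ compactly_contained U V.
Proof.
move=> cU cV Uz Vz UV; have [cV'|[P [jP tP PE]]] := box_src bF cV.
  by case: UV; exact: comp_disj cU cV' Uz Vz.
exact: jP (src_family cU cV Uz Vz jP tP PE).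
Qed.

Lemma image_comp_tgt U : components (src F) U -> components (tgt F) (F @` U).
Proof. by move=> cU; have [] := box_proper bF cU. Qed.

Lemma comp_preimage_compact U K : components (src F) U -> compact K -> K `<=` tgt F ->
  compact (U `&` F @^-1` K).
Proof.
move=> cU cK KT; have [cV pV] := box_proper bF cU.
have -> : U `&` F @^-1` K = U `&` F @^-1` (K `&` F @` U).
  apply/seteqP; split=> z [Uz h]; split=> //; last by case: h.
by apply: pV => [|z []//]; apply: compact_comp (box_tgt_open bF) cV cK KT.
Qed.

(** * Box mappings with finitely many source components *)

Section FiniteComponents.
Hypothesis fin : finite_set (components (src F)).
Hypothesis noperm : no_permutation F.

Lemma src_preimage_compact K : compact K -> K `<=` tgt F -> compact (src F `&` F @^-1` K).
Proof.
move=> cK KT; have -> : src F `&` F @^-1` K =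
    \bigcup_(U in components (src F)) (U `&` F @^-1` K).
  apply/seteqP; split=> z.
    by move=> [sz Kz]; exists (connected_component (src F) z); [exact: comp_of|split=> //; exact: connected_component_refl].
  by move=> [U cU [Uz Kz]]; split=> //; exact: comp_sub cU _ Uz.
by apply: finite_compact_union => // U cU; exact: comp_preimage_compact.
Qed.

Lemma src_compact_in V : components (tgt F) V -> ~ components (src F) V ->
  exists K, [/\ compact K, K `<=` V & V `&` src F `<=` K].
Proof.
move=> cV ncV; pose P : set (set C) := [set U | components (src F) U /\ U `<=` V].
have hP U : P U -> compactly_contained U V.
  move=> [cU UV]; have [z Uz] := comp_neq0 cU.
  have [|_ //] := src_comp cU cV Uz (UV z Uz).
  by move=> e; apply: ncV; rewrite -e.
exists (\bigcup_(U in P) closure U); split.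
- apply: finite_compact_union => [|U /hP[]//].
  by apply: sub_finite_set fin => U [].
- by move=> z [U /hP[_ UV]]; exact: UV.
- move=> z [Vz sz]; have cU := comp_of sz; have Uz := connected_component_refl sz.
  exists (connected_component (src F) z); last exact: subset_closure.
  by split=> //; exact: src_comp_sub cU cV Uz Vz.
Qed.

(** Induction on the escape time of [y]. If [V] is not a source component, its part of the source
    has compact closure in [V], being a finite union of compactly contained disks. If it is one, [F]
    maps it properly onto the next target component, and the compact set found there is pulled
    back. *)
Lemma escape_compact n V y : components (tgt F) V -> V y -> iter_dom F n y -> ~ src F (iter n F y) ->
  exists K, [/\ compact K, K `<=` V & V `&` iter_dom F n.+1 `<=` K].
Proof.
elim: n V y => [|n IH] V y cV Vy dy ny.
(* The base case and the inductive step open with the same alternative, and in both a [V] that is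
   not a source component is settled at once. *)
all: have [cVs|ncV] := pselect (components (src F) V); last first.
- have [K [cK KV VK]] := src_compact_in cV ncV; exists K; split=> // z [Vz [sz _]].
  exact: VK.
- by case: ny; exact: comp_sub cVs _ Vy.
- have [K [cK KV VK]] := src_compact_in cV ncV; exists K; split=> // z [Vz [sz _]].
  exact: VK.
have cV' := image_comp_tgt cVs; move: dy => [sy dy]; rewrite iterSr in ny.
have [|K [cK KV VK]] := IH _ (F y) cV' _ dy ny; first by exists y.
exists (V `&` F @^-1` K); split.
- by apply: comp_preimage_compact => //; apply: subset_trans KV _; exact: comp_sub cV'.
- by move=> z [].
- by move=> z [Vz [sz dz]]; split=> //; apply: VK; split=> //; exists z.
Qed.

Lemma tgt_compact V : components (tgt F) V ->
  exists n K, [/\ compact K, K `<=` V & V `&` iter_dom F n `<=` K].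
Proof.
move=> cV; have [cVs|ncV] := pselect (components (src F) V); last first.
  have [K [cK KV VK]] := src_compact_in cV ncV; exists 1%N, K; split=> // z [Vz [sz _]].
  exact: VK.
have [n [_ [[y [Vy dy] <-] ny]]] := noperm cVs.
by have [K hK] := escape_compact cV Vy dy ny; exists n.+1, K.
Qed.

Lemma escape_level : exists M K, [/\ compact K, K `<=` tgt F & iter_dom F M `<=` K].
Proof.
have /choice[n nP] : forall V, exists n, components (tgt F) V ->
    exists K, [/\ compact K, K `<=` V & V `&` iter_dom F n `<=` K].
  move=> V; have [/tgt_compact[n h]|h] := pselect (components (tgt F) V); last by exists 0%N.
  by exists n.
have /choice[K KP] : forall V, exists K, components (tgt F) V ->
    [/\ compact K, K `<=` V & V `&` iter_dom F (n V) `<=` K].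
  move=> V; have [/nP[K h]|h] := pselect (components (tgt F) V); last by exists set0.
  by exists K.
have [M hM] := finite_bound n finite_tgt.
exists M, (\bigcup_(V in components (tgt F)) K V); split.
- by apply: finite_compact_union finite_tgt _ => V /KP[].
- by move=> z [V cV]; have [_ KV _] := KP V cV; move=> /KV; exact: comp_sub cV z.
- move=> z dz; have Tz := iter_dom_tgt dz; have cV := comp_of Tz.
  exists (connected_component (tgt F) z) => //; have [_ _] := KP _ cV; apply.
  by split; [exact: connected_component_refl|apply: iter_dom_mono dz; exact: hM].
Qed.

(** The compact set at level [N] is pulled back by [F] to level [N.+1]; since the whole source is
    proper over compact subsets of [tgt F], the same [M] serves every [N]. *)
Lemma escape_compacts : exists M, forall N, exists K,
  [/\ compact K, K `<=` iter_dom F N & iter_dom F (N + M) `<=` K].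
Proof.
have [M [K0 [cK0 K0T K0M]]] := escape_level; exists M; elim=> [|N [K [cK KN NK]]].
  by exists K0.
exists (src F `&` F @^-1` K); split.
- by apply: src_preimage_compact => // z /KN /iter_dom_tgt.
- by move=> z [sz Kz]; split=> //; exact: KN.
- by move=> z [sz dz]; split=> //; exact: NK.
Qed.

(** If the source and target components of the orbit agreed at all times, the images of the source
    component of [z] would stay in source components forever, contrary to the no permutation
    condition. *)
Lemma level_change z : nonescaping F z ->
  exists k, connected_component (tgt F) (iter k F z) <> connected_component (src F) (iter k F z).
Proof.
move=> Kz; apply: contrapT => /forallNP h.
have E k : connected_component (tgt F) (iter k F z) = connected_component (src F) (iter k F z).
  exact: contrapT (h k).
have sk k : src F (iter k F z) by apply: nonescaping_src; exact: nonescaping_shift.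
pose U := connected_component (src F) z.
have cU : components (src F) U := comp_of (sk 0%N).
have img n : iter n F @` U `<=` connected_component (src F) (iter n F z).
  elim: n => [|n IH]; first by move=> _ [w Uw <-].
  move=> _ [w Uw <-] /=; have Uw' := IH _ (ex_intro2 _ _ w Uw erefl).
  have cn := comp_of (sk n); have cT := image_comp_tgt cn.
  suff : connected_component (tgt F) (iter n.+1 F z) (F (iter n F w)) by rewrite E.
  have -> : connected_component (tgt F) (iter n.+1 F z) = F @` connected_component (src F) (iter n F z).
    apply/esym; apply: comp_eq cT _; exists (iter n F z); last by rewrite iterS.
    exact: connected_component_refl.
  by exists (iter n F w).
have [n [_ [[w [Uw _] <-] nw]]] := noperm cU.
by apply: nw; apply: (connected_component_sub (img n _ (ex_intro2 _ _ w Uw erefl))).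
Qed.

Lemma esup_ge (u : nat -> \bar R) (m : \bar R) :
  (forall N : nat, exists2 k : nat, (N <= k)%N & (m <= u k)%E) -> (m <= limn_esup u)%E.
Proof.
move=> h; rewrite limn_esup_lim; apply: lime_ge; first exact: is_cvg_esups.
apply: nearW => N; have [k Nk mk] := h N.
by apply: le_trans mk _; apply: ereal_sup_ubound; exists k.
Qed.

Lemma tgt_proper V : components (tgt F) V -> exists c, ~ V c.
Proof.
move=> cV; have [[oV _] [j [_ _ jE]]] := tgt_comp cV.
exists (j 1); have : boundary V (j 1) by rewrite -jE; exists 1; rewrite // /unit_circle /= normr1.
by move=> [_ nI] Vj; apply: nI; rewrite ((interior_id V).1 oV).
Qed.

Lemma comp_modulus_gt0 z : src F z ->
  connected_component (tgt F) z <> connected_component (src F) z -> (0 < comp_modulus F z)%E.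
Proof.
move=> sz ne; have Tz : tgt F z := box_src_tgt bF sz.
have cU := comp_of sz; have cV := comp_of Tz.
have Uz := connected_component_refl sz; have Vz := connected_component_refl Tz.
rewrite /comp_modulus; case: asboolP => // _.
have [|jU UV] := src_comp cU cV Uz Vz; first by move=> e; apply: ne.
have [c nVc] := tgt_proper cV; have [tV _] := tgt_comp cV.
exact: annulus_modulus_gt0 tV nVc jU UV.
Qed.

(** The modulus depends only on the source component, so returning infinitely often to one component
    means attaining the same value infinitely often. *)
Lemma comp_modulus_eq z w U : components (src F) U -> U z -> U w -> comp_modulus F z = comp_modulus F w.
Proof.
move=> cU Uz Uw; have sz := comp_sub cU Uz; have Tz := box_src_tgt bF sz.
have e1 : connected_component (src F) z = connected_component (src F) w.
  by rewrite -(comp_eq cU Uz) -(comp_eq cU Uw).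
have cV := comp_of Tz; have Vz := connected_component_refl Tz.
have Vw := src_comp_sub cU cV Uz Vz Uw.
by rewrite /comp_modulus -e1 -(comp_eq cV Vw).
Qed.

(* Pigeonhole: the orbit returns infinitely often to one of the finitely many
   components of the source that are not components of the target. *)
Theorem nonescaping_well_inside : nonescaping F = well_inside F.
Proof.
apply/seteqP; split; last by move=> z [d _ []].
move=> z Kz; pose bad k := connected_component (tgt F) (iter k F z) <> connected_component (src F) (iter k F z).
have inf N : exists2 k, (N <= k)%N & bad k.
  have [k hk] := level_change (nonescaping_shift N Kz); exists (N + k)%N; first exact: leq_addr.
  by rewrite /bad addnC iterD.
have sk k : src F (iter k F z) by apply: nonescaping_src; exact: nonescaping_shift.
have [U [cU hU]] : exists U, components (src F) U /\ forall N : nat, exists k : nat, [/\ (N <= k)%N, bad k & U (iter k F z)].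
  apply: contrapT => /forallNP nU.
  have /choice[N NP] : forall U, exists N : nat, components (src F) U ->
      forall k : nat, (N <= k)%N -> bad k -> ~ U (iter k F z).
    move=> U; have [cU|h] := pselect (components (src F) U); last by exists 0%N.
    have /not_andP[//|/existsNP[N hN]] := nU U; exists N => _ k Nk bk Uk.
    by apply: hN; exists k.
  have [M hM] := finite_bound N fin.
  have [k Mk bk] := inf M; have cU := comp_of (sk k).
  apply: (NP _ cU k _ bk (connected_component_refl (sk k))).
  exact: leq_trans (hM _ cU) Mk.
have [k0 [_ b0 Uk0]] := hU 0%N.
have m0 : (0 < comp_modulus F (iter k0 F z))%E by apply: comp_modulus_gt0.
set m := comp_modulus F (iter k0 F z) in m0.
have sup : (m <= limn_esup (fun k => comp_modulus F (iter k F z)))%E.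
  apply: esup_ge => N; have [k [Nk _ Uk]] := hU N; exists k => //.
  by rewrite /m (comp_modulus_eq cU Uk0 Uk).
have [d d0 dm] : exists2 d : R, 0 < d & (d%:E < m)%E.
  case: m m0 {sup} => [m|_|//]; last by exists 1 => //; rewrite ltry.
  by rewrite lte_fin => m0; exists (m / 2); rewrite ?lte_fin; lra.
by exists d => //; split=> //; exact: lt_le_trans sup.
Qed.

End FiniteComponents.
End Iterates.
End BoxDynamics.

Section OffCritical.
Variable R : realType.
Local Notation C := (Cplane R).
Local Notation nm := (@nm R).
Local Notation rc := (@rc R).
Implicit Types (z w c x y p q u v : C) (r s t e : R) (f g h k : C -> C) (A B D K P Q U V W : set C).

(** * Lifting disks through a box mapping *)

Lemma local_injectivity D f u : open D -> hol D f -> D u -> derive1 f u != 0 ->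
  exists2 r, 0 < r & disk u r `<=` D /\ inj_on (disk u r) f.
Proof.
move=> oD hf Du d0; have [r1 r10 h1] := (openP D).1 oD u Du.
have e0 : 0 < nm (derive1 f u) / 2 by rewrite divr_gt0 // nm_gt0.
have [r2 r20 h2] := (@ccontP R (derive1 f) u).1 (hol_cts (hol_deriv oD hf) Du) _ e0.
pose r := Num.min r1 r2; have r0 : 0 < r by rewrite lt_min r10.
have rD : disk u r `<=` D by move=> z; rewrite /disk /= lt_min => /andP[zr _]; exact: h1.
exists r => //; split=> // z w zr wr fzw; apply: contrapT => zw.
have n0 : 0 < nm (w - z) by rewrite nm_gt0 subr_eq0 eq_sym; apply/eqP.
have sg t : 0 <= t <= 1 -> disk u r (seg z w t) by move=> t01; exact: open_disk_convex zr wr t01.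
have := @mvi R f (derive1 f) z w (derive1 f u) (nm (derive1 f u) / 2) _ _.
rewrite fzw subrr sub0r nmN nmM => h.
have : nm (derive1 f u) * nm (w - z) <= nm (derive1 f u) / 2 * nm (w - z).
  apply: h => t t01; first by apply: (hol_cder hf); apply: rD; exact: sg.
  by apply: ltW; apply: h2; have := sg t t01; rewrite /disk /= lt_min => /andP[].
by rewrite ler_pM2r // => h3; move: e0; lra.
Qed.

Section UniformInverse.
Variables (D Q : set C) (f : C -> C).
Hypotheses (oD : open D) (hf : hol D f) (cQ : compact Q) (QD : Q `<=` D).
Hypothesis f'0 : forall p, Q p -> derive1 f p != 0.

(** Inverse branches on disks of one radius about all points of the compact [Q] allow a lift to be
    continued in steps of fixed size. *)
Lemma uniform_inverse : exists r e, [/\ 0 < r, 0 < e & forall p, Q p ->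
  [/\ disk p r `<=` D, inj_on (disk p r) f & disk (f p) e `<=` f @` disk p r]].
Proof.
have [r r0 hr] : exists2 r, 0 < r & forall p, Q p -> disk p r `<=` D /\ inj_on (disk p r) f.
  apply: (compact_uniform (P := fun p r => disk p r `<=` D /\ inj_on (disk p r) f) cQ).
    move=> u s r sr [h1 h2]; have sub := @disk_subset R u s r sr.
    split; first exact: subset_trans h1.
    by move=> z w /sub zr /sub wr; exact: h2.
  move=> u Qu; have [r r0 [h1 h2]] := local_injectivity oD hf (QD Qu) (f'0 Qu).
  have r20 : 0 < r / 2 by lra.
  exists (r / 2) => //; apply: filterS (nbhs_disk u r20) => v vu _.
  have sub : disk v (r / 2) `<=` disk u r.
    by move=> z; move: vu; rewrite /disk /= => vu zv; have := le_nm_sub v z u; lra.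
  split; first exact: subset_trans h1.
  by move=> z w /sub zr /sub wr; exact: h2.
have [e e0 he] : exists2 e, 0 < e & forall p, Q p -> disk (f p) e `<=` f @` disk p r.
  apply: (compact_uniform (P := fun p e => disk (f p) e `<=` f @` disk p r) cQ).
    by move=> u s e se; apply: subset_trans; exact: disk_subset.
  move=> u Qu; have [h1 h2] := hr u Qu; have r20 : 0 < r / 2 by lra.
  have sub : disk u (r / 2) `<=` disk u r by exact: disk_half.
  have hf2 : hol (disk u (r / 2)) f := hol_sub (subset_trans sub h1) hf.
  have i2 : inj_on (disk u (r / 2)) f by move=> z w /sub zr /sub wr; exact: h2.
  have [e e0 he] := (openP _).1 (open_image (@open_disk R u (r / 2)) hf2 i2) (f u)
    (ex_intro2 _ _ u (disk_center u r20) erefl).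
  have e20 : 0 < e / 2 by lra.
  have [d d0 hd] := (@ccontP R f u).1 (hol_cts hf (QD Qu)) _ e20.
  have m0 : 0 < Num.min d (r / 2) by rewrite lt_min d0.
  exists (e / 2) => //; apply: filterS (nbhs_disk u m0) => v.
  rewrite /disk /= lt_min => /andP[vd vr] _ y; rewrite /disk /= => yv.
  have [|z zu zy] := he y.
    by rewrite /disk /=; have := hd v vd; have := le_nm_sub (f v) y (f u); lra.
  exists z => //; move: zu; rewrite /disk /= => zu.
  by have := le_nm_sub u z v; rewrite (nmB u v); lra.
by exists r, e; split=> // p Qp; have [h1 h2] := hr p Qp; split=> //; exact: he.
Qed.

End UniformInverse.

Section Lift.
Variables (D Q : set C) (f h : C -> C) (x : C) (s : R).
Hypotheses (oD : open D) (hf : hol D f) (cQ : compact Q) (QD : Q `<=` D).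
Hypothesis f'0 : forall p, Q p -> derive1 f p != 0.
Hypotheses (s0 : 0 < s) (s1 : s < 1) (hh : hol (disk 0 1) h) (Dx : D x) (h0 : h 0 = f x).
Hypothesis DQ : forall p z, D p -> disk 0 s z -> f p = h z -> Q p.

Lemma lift_step (inv : C -> C -> C) r e eta sg sg' k : 0 < r -> 0 < e ->
  (forall p, Q p -> [/\ disk p r `<=` D, inj_on (disk p r) f & disk (f p) e `<=` f @` disk p r]) ->
  (forall p y, Q p -> (f @` disk p r) y -> disk p r (inv p y) /\ f (inv p y) = y) ->
  (forall z w, nm z <= s -> nm (w - z) < eta -> nm (h w - h z) < e) ->
  0 <= sg -> sg < sg' -> sg' <= s -> sg' - sg <= eta ->
  (forall z, z = 0 \/ nm z < sg -> [/\ cts k z, D (k z) & f (k z) = h z]) -> k 0 = x ->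
  exists k', [/\ hol (disk 0 sg') k', forall z, disk 0 sg' z -> D (k' z) /\ f (k' z) = h z & k' 0 = x].
Proof.
move=> r0 e0 hQ invP hu sg0 sgs sgS sgeta kP k0; have s1' := s1.
have sg'0 : 0 < sg' by lra.
pose c : R := sg / sg'.
have c0 : 0 <= c by rewrite divr_ge0 // ltW.
have c1 : c < 1 by rewrite ltr_pdivrMr // mul1r.
have csg : c * sg' = sg by rewrite /c divfK // gt_eqF.
pose b w := rc c * w.
have nb w : nm (b w) = c * nm w by rewrite nmM nm_rc ger0_norm.
have bP w : nm w < sg' -> b w = 0 \/ nm (b w) < sg.
  move=> ws; have [c00|cn] := eqVneq c 0; first by left; rewrite /b c00 rc0 mul0r.
  by right; rewrite nb -csg ltr_pM2l // lt_def cn.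
have bs w : nm w < sg' -> nm (b w) < s.
  by move=> ws; rewrite nb; have := nm_ge0 w; nra.
have wb w : nm w < sg' -> nm (w - b w) < eta.
  move=> ws; have -> : w - b w = rc (1 - c) * w by rewrite /b rcB rc1 mulrBl mul1r.
  by rewrite nmM nm_rc ger0_norm; have := nm_ge0 w; nra.
have Qk w : nm w < sg' -> Q (k (b w)).
  move=> ws; have [_ Dk fk] := kP _ (bP w ws).
  by apply: (DQ Dk _ fk); rewrite /disk /= subr0; exact: bs.
have hin w : nm w < sg' -> disk (f (k (b w))) e (h w).
  move=> ws; have [_ _ fk] := kP _ (bP w ws); rewrite /disk /= fk.
  by apply: hu; [exact: ltW (bs w ws)|exact: wb].
pose k' w := inv (k (b w)) (h w).
have k'P w : nm w < sg' -> disk (k (b w)) r (k' w) /\ f (k' w) = h w.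
  move=> ws; have [_ _ im] := hQ _ (Qk w ws).
  by apply: invP (Qk w ws) _; apply: im; exact: hin.
exists k'; split.
- move=> w; rewrite /disk /= subr0 => ws.
  set p := k (b w); have Qp : Q p by exact: Qk.
  have [pD pi pe] := hQ p Qp.
  have hfp : hol (disk p r) f := hol_sub pD hf.
  have li z : disk p r z -> inv p (f z) = z.
    by move=> zp; have [i1 i2] := invP p (f z) Qp (ex_intro2 _ _ z zp erefl); exact: pi.
  have hinv := hol_inv (@open_disk R p r) hfp pi li.
  have hw : (f @` disk p r) (h w) by apply: pe; exact: hin.
  have dw : disk 0 1 w by rewrite disk01; lra.
  have [d1 hd1] := hinv _ hw; have [d2 hd2] := hh dw.
  have hcomp : cder (fun z => inv p (h z)) w (d1 * d2) := cder_comp (f := inv p) hd2 hd1.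
  have [qp fq] := k'P w ws; rewrite -/p in qp.
  have q' : inv p (h w) = k' w by [].
  (* Near [w] the branches based at [p] and at [k (b v)] have to agree. Half of the gap between
     [k' w] and the boundary of [disk p r] leaves room for both to lie in the disk about [k (b v)],
     where [f] is injective. *)
  pose m : R := (r - nm (k' w - p)) / 2.
  have m0 : 0 < m by move: qp; rewrite /disk /m /= => qp; lra.
  have [a1 a10 ha1] := (@ccontP R (fun z => inv p (h z)) w).1 (cder_cont hcomp) m m0.
  have cb : cts (fun w => k (b w)) w.
    have cbw : cts b w := ctsM (cts_cst _ w) (cts_id w).
    by have [ck _ _] := kP _ (bP w ws); exact (cts_comp cbw ck).
  have [a2 a20 ha2] := (@ccontP R (fun w => k (b w)) w).1 cb m m0.
  have ee : 0 < e - nm (h w - f p) by have := hin w ws; rewrite /disk /= -/p; lra.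
  have [a3 a30 ha3] := (@ccontP R h w).1 (cder_cont hd2) _ ee.
  pose a := Num.min (Num.min a1 a2) (Num.min a3 (sg' - nm w)).
  have a0 : 0 < a by rewrite !lt_min a10 a20 a30 subr_gt0 ws.
  exists (d1 * d2); apply: (cder_near a0 _ hcomp) => v.
  rewrite /disk /= !lt_min => /andP[/andP[v1 v2] /andP[v3 v4]].
  have vs : nm v < sg' by have := le_nmB v w; lra.
  have hv : (f @` disk p r) (h v).
    by apply: pe; rewrite /disk /=; have := le_nm_sub (h w) (h v) (f p); have := ha3 v v3; lra.
  have [i1 i2] := invP p (h v) Qp hv; have [j1 j2] := k'P v vs.
  have [_ vi _] := hQ _ (Qk v vs); apply: vi => //; last by rewrite i2 j2.
  rewrite /disk /=; have b1 := ha1 v v1; have b2 := ha2 v v2; rewrite q' in b1.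
  have t1 := le_nm_sub (k' w) (inv p (h v)) (k (b v)).
  have t2 := le_nm_sub p (k' w) (k (b v)); rewrite (nmB p) -/p in t2.
  by move: b1 b2; rewrite -/p /m => b1 b2; lra.
- move=> w; rewrite /disk /= subr0 => ws; have [q1 q2] := k'P w ws.
  by have [pD _ _] := hQ _ (Qk w ws); split=> //; exact: pD.
- have z0 : nm 0 < sg' by rewrite nm0.
  have b0 : b 0 = 0 by rewrite /b mulr0.
  have [q1 q2] := k'P 0 z0; have Qx := Qk 0 z0; rewrite b0 k0 in q1 Qx.
  have [_ xi _] := hQ x Qx; apply: xi => //; first exact: disk_center.
  by rewrite q2 h0.
Qed.

(** Radial continuation in steps of length [eta]. The radii [sg j] are capped at [s] and reach it
    after finitely many steps; from then on there is nothing left to extend. *)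
Lemma disk_lift : exists k, [/\ hol (disk 0 s) k,
  forall z, disk 0 s z -> D (k z) /\ f (k z) = h z & k 0 = x].
Proof.
have [r [e [r0 e0 hQ]]] := uniform_inverse oD hf cQ QD f'0.
have /choice[inv0 inv0P] : forall py : C * C, exists q, Q py.1 -> (f @` disk py.1 r) py.2 ->
    disk py.1 r q /\ f q = py.2.
  move=> [p y] /=; have [[q qp qy]|nq] := pselect ((f @` disk p r) y); last by exists 0.
  by exists q.
pose inv p y := inv0 (p, y).
have invP p y : Q p -> (f @` disk p r) y -> disk p r (inv p y) /\ f (inv p y) = y.
  by move=> Qp fy; exact: (inv0P (p, y)).
have s1' := s1; have s0' := s0.
have [eta eta0 hu] : exists2 eta, 0 < eta & forall z w, nm z <= s -> nm (w - z) < eta -> nm (h w - h z) < e.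
  have KD u : [set z : C | nm (z - 0) <= s] u -> disk 0 1 u by rewrite /disk /=; lra.
  have e20 : 0 < e / 2 by lra.
  have [eta eta0 h1] := compact_unif_cts (@closed_disk_compact R 0 s) (fun u _ => cts_id u)
    (@open_disk R 0 1) KD (fun z dz => hol_cts hh dz) e20.
  exists eta => // z w zs wz; have := h1 z; rewrite /= subr0 => /(_ zs w wz)[_]; lra.
have start sg : 0 < sg -> sg <= s -> sg <= eta ->
    exists k, [/\ hol (disk 0 sg) k, forall z, disk 0 sg z -> D (k z) /\ f (k z) = h z & k 0 = x].
  move=> sg0 sgs sge.
  apply: (lift_step (inv := inv) (sg := 0) (k := fun=> x) r0 e0 hQ invP hu) => //.
  - by rewrite subr0.
  - move=> z [->|]; last by have := nm_ge0 z; lra.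
    split=> //; exact (cts_cst x _).
pose sg (j : nat) : R := Num.min s (j.+1%:R * eta).
have sg0 j : 0 < sg j by rewrite lt_min s0 mulr_gt0.
have sgs j : sg j <= s by rewrite ge_min lexx.
have key j : exists k, [/\ hol (disk 0 (sg j)) k,
    forall z, disk 0 (sg j) z -> D (k z) /\ f (k z) = h z & k 0 = x].
  elim: j => [|j [k [hk kP k0]]].
    by apply: start => //; rewrite ge_min mul1r lexx orbT.
  have mono : sg j <= sg j.+1.
    by rewrite le_min sgs /= ge_min ler_pM2r // ler_nat leqnSn orbT.
  have step : sg j.+1 - sg j <= eta.
    rewrite /sg -(natr1 j.+1) mulrDl mul1r; case: (leP s (j.+1%:R * eta)) => h1.
      have : Num.min s (j.+1%:R * eta + eta) <= s by rewrite ge_min lexx.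
      by lra.
    have : Num.min s (j.+1%:R * eta + eta) <= j.+1%:R * eta + eta by rewrite ge_min lexx orbT.
    by lra.
  have [sgE|sgN] := eqVneq (sg j.+1) (sg j); first by rewrite sgE; exists k.
  have sgl : sg j < sg j.+1 by rewrite lt_neqAle eq_sym sgN.
  have in_disk z : z = 0 \/ nm z < sg j -> disk 0 (sg j) z.
    by move=> [->|zs]; [exact: disk_center|rewrite /disk /= subr0].
  apply: (lift_step (inv := inv) (sg := sg j) (k := k) r0 e0 hQ invP hu (ltW (sg0 j)) sgl) => //.
  move=> z /in_disk dz; have [Dk fk] := kP z dz; split=> //.
  exact (hol_cts hk dz).
have [J hJ] : exists J : nat, s <= J.+1%:R * eta.
  have t0 : 0 <= s / eta by rewrite divr_ge0 ?ltW.
  exists (Num.trunc (s / eta)); have /andP[_ h1] := trunc_itv t0.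
  by rewrite -ler_pdivrMr // ltW.
have [k [h1 h2 h3]] := key J; have E : sg J = s by apply/min_idPl.
by exists k; rewrite -E.
Qed.

End Lift.
End OffCritical.

Section OffCritical.
Variable R : realType.
Local Notation C := (Cplane R).
Local Notation nm := (@nm R).
Local Notation rc := (@rc R).
Implicit Types (z w c x y p u v : C) (r s t e rho : R) (f g h : C -> C) (A B D K P Q U V W : set C).

(** * Points with orbits off the critical set *)

Section Box.
Variable F : plane_map R.
Hypothesis bF : box_mapping F.
Hypothesis fin : finite_set (components (src F)).
Hypothesis noperm : no_permutation F.

(* A lower bound for the derivative at [x] of the Kobayashi metric of [iter_dom F n]. *)
Definition rad n x (rho : R) := exists h, [/\ hol (disk 0 1) h,
  forall z, disk 0 1 z -> iter_dom F n (h z), h 0 = x & nm (derive1 h 0) = rho].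

Definition noncrit N x := connected_component (iter_dom F N) x `&` crit F = set0.

Lemma rad_in n x rho : rad n x rho -> iter_dom F n x.
Proof. by move=> [h [_ hd <- _]]; apply: hd; rewrite disk01 nm0. Qed.

(** The piece [P] of depth [N] about [x] has no critical points, so [F] has local inverses on
    [src F] cut with [P]. Restricting [h] to radius [s] makes its image lie in a compact set, whose
    preimage in [P] is compact as well; that is the [Q] of [disk_lift], and the factor [s] is its
    price. *)
Lemma rad_lift N n x rho s : (N <= n.+1)%N -> src F x -> noncrit N x -> 0 < s -> s < 1 ->
  rad n (F x) rho -> derive1 F x != 0 /\ rad n.+1 x (s * rho / nm (derive1 F x)).
Proof.
move=> Nn sx nc s0 s1 rx; have dFx := rad_in rx.
have dx : iter_dom F n.+1 x by [].
have dNx := iter_dom_mono bF Nn dx.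
move: rx => [h [hh hd h0 hrho]].
set P := connected_component (iter_dom F N) x in nc.
have cP : components (iter_dom F N) P := comp_of dNx.
have Px : P x := connected_component_refl dNx.
have oP : open P := comp_open (@iter_dom_open R F bF N) cP.
pose D := src F `&` P; have oD : open D := openI (box_src_open bF) oP.
have hF : hol D F by apply: hol_sub (hol_src bF) => z [].
have f'0 p : D p -> derive1 F p != 0.
  move=> [sp Pp]; apply/eqP => e; suff : (P `&` crit F) p by rewrite nc.
  by split.
have s1' := s1.
pose H := h @` [set z : C | nm (z - 0) <= s].
have sub z : nm (z - 0) <= s -> disk 0 1 z by rewrite /disk /=; lra.
have cH : compact H.
  apply: continuous_compact (@closed_disk_compact R 0 s).
  by apply: continuous_in_subspaceT => z; rewrite inE => /sub dz; exact (hol_cts hh dz).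
have Hn : H `<=` iter_dom F n by move=> _ [z /sub dz <-]; exact: hd.
have cQ0 : compact (src F `&` F @^-1` H).
  by apply: src_preimage_compact => //; apply: subset_trans Hn _; exact: iter_dom_tgt.
have Q0N : src F `&` F @^-1` H `<=` iter_dom F N.
  by move=> z [sz Hz]; apply: (iter_dom_mono bF Nn); split=> //; exact: Hn.
pose Q := (src F `&` F @^-1` H) `&` P.
have cQ : compact Q := compact_comp (@iter_dom_open R F bF N) cP cQ0 Q0N.
have QD : Q `<=` D by move=> z [[sz _] Pz].
have DQ p z : D p -> disk 0 s z -> F p = h z -> Q p.
  move=> [sp Pp] dz e; split=> //; split=> //; exists z; last by rewrite e.
  exact: ltW.
have [k [hk kP k0]] := disk_lift oD hF cQ QD (fun p Qp => f'0 p (QD p Qp)) s0 s1 hh (conj sx Px) h0 DQ.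
have Fx0 : derive1 F x != 0 by apply: f'0.
split=> //; exists (fun z => k (rc s * z)).
have dsz z : disk 0 1 z -> disk 0 s (rc s * z).
  by rewrite /disk /= !subr0 nmM nm_rc gtr0_norm // => z1; rewrite gtr_pMr.
have hlin : hol (disk 0 1) (fun z => rc s * z) := holM (@hol_cst R _ _) (@hol_id R _).
split.
- exact: (hol_comp hlin hk dsz).
- by move=> z dz; have [[sk _] e] := kP _ (dsz z dz); split=> //; rewrite e; apply: hd;
    have := dsz z dz; rewrite disk01 /disk /= subr0; lra.
- by rewrite mulr0.
have d0 : disk 0 s (0 : C) := disk_center 0 s0.
have [kd hkd] := hk 0 d0.
have hFk : cder (fun z => F (k z)) 0 (derive1 F x * kd).
  by apply: cder_comp hkd _; rewrite k0; apply: hol_cder hF _.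
have hFh : cder h 0 (derive1 F x * kd).
  by apply: (cder_near s0 _ hFk) => z dz; have [_] := kP z dz.
have kdE : nm kd = rho / nm (derive1 F x).
  by rewrite -hrho (cder_derive1 hFh) nmM mulrC mulKf // nm_eq0.
have hsz : cder (fun z => rc s * z) 0 (rc s * 1) := cderZ (rc s) (cder_id 0).
have hk2 : cder (fun z => k (rc s * z)) 0 (kd * (rc s * 1)).
  by apply: (cder_comp (f := k) hsz); rewrite mulr0.
by rewrite (cder_derive1 hk2) nmM mulr1 nm_rc gtr0_norm // kdE mulrC mulrA.
Qed.

Lemma derive1_iterS m x : iter_dom F m.+1 x ->
  derive1 (iter m.+1 F) x = derive1 (iter m F) (F x) * derive1 F x.
Proof.
move=> [sx dx]; have h1 := hol_cder (hol_src bF) sx.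
have h2 := hol_cder (@hol_iter R F bF m) dx.
have -> : iter m.+1 F = fun z => iter m F (F z) by apply/funext => w; rewrite iterSr.
by rewrite (cder_derive1 (cder_comp (f := iter m F) h1 h2)).
Qed.

Lemma nm_neq0 z : z != 0 -> nm z != 0.
Proof. by rewrite nm_eq0. Qed.

Lemma quot_step (s a b r : R) m : a != 0 -> b != 0 ->
  s ^+ m.+1 * r / (a * b) = s * (s ^+ m * r / a) / b.
Proof. by move=> a0 b0; rewrite exprS; field; rewrite a0 b0. Qed.

Lemma quot_step2 (t u v d a b : R) : a != 0 -> b != 0 ->
  (1 + t) * (u * (v * d / a) / b) = v * ((1 + t) * u) * d / (a * b).
Proof. by move=> a0 b0; field; rewrite a0 b0. Qed.

Lemma rad_lifts N m x rho s : 0 < s -> s < 1 -> iter_dom F m x ->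
  (forall j, (j < m)%N -> noncrit N (iter j F x)) -> rad N (iter m F x) rho ->
  derive1 (iter m F) x != 0 /\ rad (N + m) x (s ^+ m * rho / nm (derive1 (iter m F) x)).
Proof.
move=> s0 s1; elim: m x => [|m IH] x dx nc rx.
  rewrite (cder_derive1 (cder_id x)) oner_neq0 nm1 divr1 expr0 mul1r addn0; split=> //.
have [sx dFx] := dx; rewrite iterSr in rx.
have [d1 r1] := IH (F x) dFx (fun j jm => eq_ind _ (noncrit N) (nc j.+1 jm) _ (iterSr j F x)) rx.
have [|d2 r2] := @rad_lift N (N + m)%N x _ s _ sx (nc 0%N isT) s0 s1 r1; first by rewrite -addnS leq_addr.
rewrite (derive1_iterS dx); split; first exact (mulf_neq0 d1 d2).
rewrite nmM addnS.
have -> : s ^+ m.+1 * rho / (nm (derive1 (iter m F) (F x)) * nm (derive1 F x)) =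
   s * (s ^+ m * rho / nm (derive1 (iter m F) (F x))) / nm (derive1 F x).
  exact (quot_step s rho m (nm_neq0 d1) (nm_neq0 d2)).
exact r2.
Qed.

(** Points of [K] have a uniform distance to the complement of [iter_dom F N], so an analytic disk
    in the deeper level can be stretched about its center by a factor above 1 and still fit in the
    shallower one. *)
Lemma rad_scale N M K : compact K -> K `<=` iter_dom F N -> iter_dom F (N + M) `<=` K ->
  exists2 t, 0 < t & forall x rho, rad (N + M) x rho -> rad N x ((1 + t) * rho).
Proof.
move=> cK KN NK.
have [d d0 hd] := compact_unif_cts cK (fun u _ => cts_id u) (@iter_dom_open R F bF N) KN
  (fun z _ => cts_id z) ltr01.
have [B B0 KB] := compact_bound cK (fun u _ => @continuous_nm R u).
(* Two points of [K] are at most [2 * B] apart, so stretching displaces each point by less than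
   [d]. *)
pose t : R := d / (2 * B + 1); have B1 : 0 < 2 * B + 1 by lra.
have t0 : 0 < t by rewrite divr_gt0.
exists t => // x rho [h [hh hdom h0 hrho]].
have d01 : disk 0 1 (0 : C) by rewrite disk01 nm0.
exists (fun z => h z + rc t * (h z - x)); split.
- apply: holD => //; apply: holM; first exact: hol_cst.
  by apply: holB => //; exact: hol_cst.
- move=> z dz; have Kz := NK _ (hdom z dz); have Kx := NK _ (hdom 0 d01); rewrite h0 in Kx.
  have [|//] := hd (h z) Kz (h z + rc t * (h z - x)) _.
  rewrite addrC addKr nmM nm_rc gtr0_norm //.
  have h1 := le_nmD (h z) (- x); rewrite nmN in h1; have h2 := KB _ Kz; have h3 := KB _ Kx.
  have h4 : nm (h z - x) < 2 * B + 1 by lra.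
  by rewrite /t mulrAC ltr_pdivrMr // ltr_pM2l.
- by rewrite h0 subrr mulr0 addr0.
- have c1 := hol_cder hh d01.
  have c2 := cderD c1 (cderZ (rc t) (cderB c1 (cder_cst x 0))).
  rewrite (cder_derive1 c2) subr0 -{1}(mul1r (derive1 h 0)) -mulrDl nmM hrho.
  by rewrite -rc1 -rcD nm_rc ger0_norm //; lra.
Qed.

Lemma bernoulli (e : R) m : 0 <= e -> e <= 1 -> 1 - m%:R * e <= (1 - e) ^+ m.
Proof.
move=> e0 e1; elim: m => [|m IH]; first by rewrite mul0r subr0 expr0.
rewrite exprS -natr1; have mR : 0 <= m%:R * e by rewrite mulr_ge0.
have h := ler_wpM2l (ltac:(lra) : 0 <= 1 - e) IH.
by apply: le_trans h; nra.
Qed.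

(** Balances the two effects: [M] lifts cost [s ^+ M], one stretching gains [1 + t]. By Bernoulli's
    inequality an [s] close to 1 leaves a net gain. *)
Lemma shrink_factor (t : R) M : 0 < t -> exists s, [/\ 0 < s, s < 1 & 1 < (1 + t) * s ^+ M].
Proof.
move=> t0; pose e : R := t / ((2 * (1 + t)) * (M%:R + 1)).
have M0 : 0 <= M%:R :> R by [].
have p0 : 0 < 2 * (1 + t) * (M%:R + 1) by rewrite !mulr_gt0 //; lra.
have e0 : 0 < e by rewrite divr_gt0.
have e1 : e < 1.
  rewrite ltr_pdivrMr // mul1r; nra.
have eM : (M%:R + 1) * e * (2 * (1 + t)) = t.
  by rewrite /e; field; apply/andP; split; rewrite gt_eqF //; lra.
exists (1 - e); split; [lra|lra|].
have h := bernoulli M (ltW e0) (ltW e1).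
have h2 : (1 + t) * (1 - M%:R * e) <= (1 + t) * (1 - e) ^+ M by rewrite ler_wpM2l //; lra.
apply: lt_le_trans h2; nra.
Qed.

(** For each depth a closed, forward invariant set on which [F] expands; together these sets exhaust
    [off_crit F]. *)
Definition offset N : set C := [set x | nonescaping F x /\ forall k, noncrit N (iter k F x)].

Lemma offset_iter N k x : offset N x -> offset N (iter k F x).
Proof.
move=> [Kx h]; split; first exact: nonescaping_shift.
by move=> j; rewrite -iterD; exact: h.
Qed.

Lemma offset_mono N N' : (N <= N')%N -> offset N `<=` offset N'.
Proof.
move=> NN x [Kx h]; split=> // k; rewrite /noncrit -subset0 => z [cz kz].
have Kk := nonescaping_shift k Kx.
have : (connected_component (iter_dom F N) (iter k F x) `&` crit F) z.
  split=> //; apply: (connected_sub_component (@component_connected _ _ _) _ _ cz).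
    by apply: connected_component_refl; exact: Kk.
  apply: subset_trans (@connected_component_sub _ _ _) _; exact: iter_dom_mono.
by rewrite h.
Qed.

Lemma chain_iter q j x : iter_dom F (q + j) x -> derive1 (iter (q + j) F) x =
  derive1 (iter j F) (iter q F x) * derive1 (iter q F) x.
Proof.
elim: q x => [|q IH] x; first by rewrite (cder_derive1 (cder_id x)) mulr1.
move=> dx; have [sx dFx] := dx.
have dxq : iter_dom F q.+1 x := iter_dom_mono bF (leq_addr j q.+1) dx.
rewrite addSn (derive1_iterS dx) (IH (F x) dFx) (derive1_iterS dxq) (iterSr q F x).
by rewrite mulrA.
Qed.

(** Start from a disk of radius [d] about the endpoint of a long orbit and pull it back: every block
    of [M1] steps gains [be > 1], while division by the derivative accumulates. The resulting disk
    lies in the bounded set [K0], so its derivative is at most [4 * B]; the derivative of the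
    iterate therefore has to be large. *)
Theorem expansion N : exists q : nat, forall x, offset N x -> 4 <= nm (derive1 (iter q F) x).
Proof.
have [M hM] := escape_compacts bF fin noperm.
have [M0 [K0 [cK0 _ K0M]]] := escape_level bF fin noperm.
(* At least [M0], which puts [iter_dom F N'] inside the compact set [K0] and thus bounds it. *)
pose N' := (maxn N (maxn M0 1))%N.
have NN' : (N <= N')%N by rewrite leq_maxl.
have MN' : (M0 <= N')%N by rewrite leq_max leq_maxl orbT.
pose M1 := M.+1.
have [K [cK KN NK]] := hM N'.
have NK1 : iter_dom F (N' + M1) `<=` K.
  by apply: subset_trans NK; apply: (iter_dom_mono bF); rewrite leq_add2l leqnSn.
have [t t0 scale] := rad_scale cK KN NK1.
have [s [s0 s1 st]] := shrink_factor M1 t0.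
have [d d0 hd] := compact_unif_cts cK (fun u _ => cts_id u) (@iter_dom_open R F bF N') KN
  (fun z _ => cts_id z) ltr01.
have base y : nonescaping F y -> rad N' y d.
  move=> Ky; have Ky' : K y by apply: NK; exact: Ky.
  exists (fun z => y + rc d * z); split.
  - by apply: holD; [exact: hol_cst|apply: holM; [exact: hol_cst|exact: hol_id]].
  - move=> z; rewrite disk01 => z1; have [|//] := hd y Ky' (y + rc d * z) _.
    by rewrite addrC addKr nmM nm_rc gtr0_norm // gtr_pMr.
  - by rewrite mulr0 addr0.
  - have c1 := cderD (cder_cst y 0) (cderZ (rc d) (cder_id 0)).
    by rewrite (cder_derive1 c1) add0r mulr1 nm_rc gtr0_norm.
have [B B0 KB] := compact_bound cK0 (fun u _ => @continuous_nm R u).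
have bound x rho : rad N' x rho -> rho <= 4 * B.
  move=> [h [hh hdom _ <-]].
  have hB z : disk 0 1 z -> nm (h z) <= B.
    by move=> dz; apply: KB; apply: K0M; apply: (iter_dom_mono bF MN'); exact: hdom.
  have := deriv_bound (b := 0) ltr01 hh hB; rewrite subrr nm0 divr1; apply.
  lra.
pose be := (1 + t) * s ^+ M1.
have X' x : offset N x -> offset N' x by exact: offset_mono.
have key j x : offset N' x -> derive1 (iter (j * M1) F) x != 0 /\
    rad N' x (be ^+ j * d / nm (derive1 (iter (j * M1) F) x)).
  elim: j x => [|j IH] x ox.
    rewrite mul0n (cder_derive1 (cder_id x)) oner_neq0 nm1 divr1 expr0 mul1r; split=> //.
    by apply: base; have [] := ox.
  have [n1 r1] := IH _ (offset_iter M1 ox); have [Kx nc] := ox.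
  have [n2 r2] := @rad_lifts N' M1 x _ s s0 s1 (Kx M1 I) (fun j _ => nc j) r1.
  have dx : iter_dom F (M1 + j * M1) x := Kx _ I.
  rewrite mulSn (chain_iter dx).
  split; first exact (mulf_neq0 n1 n2).
  rewrite nmM.
  have := scale _ _ r2; congr (rad N' x _).
  by rewrite exprSr; exact (quot_step2 _ _ _ _ (nm_neq0 n1) (nm_neq0 n2)).
have be1 : 1 < be by exact: st.
pose g : R := be - 1; have g0 : 0 < g by rewrite /g; lra.
have bern j : 1 + j%:R * g <= be ^+ j.
  have -> : be = 1 + g by rewrite /g; ring.
  elim: j => [|j IH]; first by rewrite mul0r addr0 expr0.
  rewrite exprS -natr1; have mR : 0 <= j%:R * g by rewrite mulr_ge0 // ltW.
  have h := ler_wpM2l (ltac:(lra) : 0 <= 1 + g) IH.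
  by apply: le_trans h; nra.
(* [16 * B] is four times the bound [4 * B] on [rad], which leaves the factor 4 for the
   derivative. *)
have [j hj] : exists j : nat, 16 * B / d <= be ^+ j.
  have q0 : 0 <= 16 * B / d / g by rewrite !divr_ge0 ?mulr_ge0 // ltW.
  have /andP[_ h] := trunc_itv q0; exists (Num.trunc (16 * B / d / g)).+1.
  apply: le_trans (bern _); rewrite ltr_pdivrMr // in h; lra.
exists (j.+1 * M1)%N.
move=> x /X' ox; have [n1 /bound] := key j.+1 x ox.
have nd : 0 < nm (derive1 (iter (j.+1 * M1) F) x) by rewrite nm_gt0.
rewrite ler_pdivrMr // => h1.
have h2 : 16 * B <= be ^+ j.+1 * d.
  rewrite ler_pdivrMr // in hj; rewrite exprS -mulrA; apply: le_trans hj _.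
  by rewrite ler_peMl ?(ltW be1) // mulr_ge0 ?(ltW d0) // exprn_ge0 //; lra.
by rewrite -(ler_pM2l (x := 4 * B)) ?mulr_gt0 //; lra.
Qed.

(** Nonescaping passes to limits because each [iter_dom F n] contains a compact set that contains a
    deeper level. The condition on critical points passes to limits because the piece of depth [N]
    about an orbit point is open and shared by nearby points. *)
Lemma offset_closed N : closed (offset N).
Proof.
have [M hM] := escape_compacts bF fin noperm.
move=> x cx; have Kx : nonescaping F x.
  move=> n _; have [K [cK Kn nK]] := hM n; apply: Kn.
  have clK := compact_closed (@hausdorff_C R) cK; rewrite ((closure_id K).1 clK).
  by apply: closure_subset cx => y [Ky _]; apply: nK; exact: Ky.
split=> // k; rewrite /noncrit -subset0 => c [cc crc].
have Kk : iter_dom F N (iter k F x) by exact: (nonescaping_shift k Kx).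
have oQ := component_open (p := iter k F x) (@iter_dom_open R F bF N).
have [e e0 he] := (openP _).1 oQ _ (connected_component_refl Kk).
have [d d0 hd] := (@ccontP R (iter k F) x).1 (hol_cts (@hol_iter R F bF k) (Kx k I)) e e0.
have [w [[Kw ncw] wx]] := cx _ (nbhs_disk x d0).
have h := same_connected_component (he _ (hd w wx)).
by have : (connected_component (iter_dom F N) (iter k F w) `&` crit F) c by [rewrite -h]; rewrite ncw.
Qed.

Lemma offset_null N : planar_null (offset N).
Proof.
have [q h4] := expansion N; have [M hM] := escape_compacts bF fin noperm.
have [K [cK Kq qK]] := hM q.
apply: porous_null.
apply: (@expanding_porous R (iter_dom F q) K (offset N) (iter q F)) => //.
- exact: iter_dom_open.
- by move=> x [Kx _]; apply: qK; exact: Kx.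
- exact: offset_closed.
- exact: hol_iter.
- by move=> x; exact: offset_iter.
Qed.

(* The level [N] is the largest depth of a piece of the puzzle neighborhood. *)
Lemma off_crit_offset : off_crit F `<=` \bigcup_N offset N.
Proof.
move=> x [Kx [c0|[W [[P [fP PP WE]] cW _] hW]]].
  by exists 0%N => //; split=> // k; rewrite /noncrit c0 setI0.
have /choice[dep depP] : forall A, exists n, P A -> components (iter_dom F n) A.
  move=> A; have [/PP[n h]|h] := pselect (P A); last by exists 0%N.
  by exists n.
have [N hN] := finite_bound dep fP.
exists N => //; split=> // k; rewrite /noncrit -subset0 => c [cc crc].
have Wc := cW c crc; move: Wc; rewrite WE => -[A PA Ac].
apply: (hW k); rewrite WE; exists A => //.
have Kk : iter_dom F N (iter k F x) by exact: (nonescaping_shift k Kx).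
apply: (comp_max (depP A PA) (@component_connected _ _ _) _ cc Ac).
  apply: subset_trans (@connected_component_sub _ _ _) _.
  by apply: (iter_dom_mono bF); exact: hN.
exact: connected_component_refl.
Qed.

Theorem off_crit_null : planar_null (off_crit F).
Proof.
apply: negligibleS (negligible_bigcup offset_null) => p h.
by have [N _ hN] := off_crit_offset h; exists N.
Qed.

End Box.
End OffCritical.

Section Restriction.
Variable R : realType.
Local Notation C := (Cplane R).
Implicit Types (z w c x y : C) (A B D K P U V W : set C).

(** * The restriction to the critical components *)

Variable F : plane_map R.
Hypothesis bF : box_mapping F.
Hypothesis noperm : no_permutation F.

Definition crit_comp U := components (src F) U /\ U `&` crit F !=set0.

Definition crit_src : set C := \bigcup_(U in crit_comp) U.

Definition crit_restriction : plane_map R := PlaneMap crit_src (tgt F) F.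
Local Notation F1 := crit_restriction.

Lemma crit_src_sub : crit_src `<=` src F.
Proof. by move=> z [U [cU _]]; exact: comp_sub cU z. Qed.

Lemma crit_src_comp U : components crit_src U <-> crit_comp U.
Proof.
have key z V : crit_comp V -> V z -> connected_component crit_src z = V.
  move=> hV Vz; have [cV _] := hV; apply/seteqP; split; last first.
    apply: connected_sub_component Vz _; first exact: comp_connected cV.
    by move=> w Vw; exists V.
  apply: (comp_max cV (@component_connected _ _ _) _ _ Vz); last first.
    by apply: connected_component_refl; exists V.
  by apply: subset_trans (@connected_component_sub _ _ _) _; exact: crit_src_sub.
split; first by move=> [z [V hV Vz] <-]; rewrite (key z V).
move=> hU; have [cU _] := hU; have [z Uz] := comp_neq0 cU.
by exists z; [exists U|exact: key].
Qed.

Lemma crit_crit_restriction : crit F1 = crit F.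
Proof.
apply/seteqP; split=> z [sz dz]; split=> //; first exact: crit_src_sub.
exists (connected_component (src F) z); last exact: connected_component_refl.
by split; [exact: comp_of|exists z; split=> //; exact: connected_component_refl].
Qed.

Lemma finite_crit_src : finite_set (components crit_src).
Proof.
apply: sub_finite_set (finite_image (connected_component (src F)) (box_crit bF)).
by move=> U /crit_src_comp[cU [c [Uc kc]]]; exists c => //; rewrite -(comp_eq cU Uc).
Qed.

Lemma box_crit_restriction : box_mapping F1.
Proof.
split.
- by apply: bigcup_open => U [cU _]; exact: comp_open (box_src_open bF) cU.
- exact: (box_tgt_open bF).
- exact: subset_trans crit_src_sub (box_src_tgt bF).
- by move=> z /crit_src_sub; exact: box_holomorphic.
- move=> _ [z /crit_src_sub sz <-]; apply: (box_maps bF); by exists z.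
- by rewrite crit_crit_restriction; exact: box_crit.
- exact: (box_tgt bF).
- move=> V cV; have [cVs|[P [jP tP PE]]] := box_src bF cV.
    have [Vk|nVk] := pselect (V `&` crit F !=set0).
      by left; apply/crit_src_comp.
    (* A target component that was a source component without critical points now meets the source
       in the empty set, which is the union of the empty family of disks. *)
    right; exists set0; split=> //.
    rewrite bigcup_set0 -subset0 => z [Vz [U [cU Uk] Uz]]; apply: nVk.
    by rewrite (comp_disj cVs cU Vz Uz).
  pose P' : set (set C) := [set U | crit_comp U /\ U `<=` V].
  have P'P : P' `<=` P.
    move=> U [[cU _] UV]; have [z Uz] := comp_neq0 cU.
    exact: (src_family bF cU cV Uz (UV z Uz) jP tP PE).
  right; exists P'; split.
  + by move=> A /P'P; exact: jP.
  + by move=> A B /P'P PA /P'P PB; exact: tP.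
  + apply/seteqP; split=> z.
      move=> [Vz [U hU Uz]]; exists U => //; split=> //.
      by have [cU _] := hU; exact: (@src_comp_sub R F bF U V z cU cV Uz Vz).
    by move=> [U [hU UV] Uz]; split; [exact: UV|exists U].
- by move=> A /crit_src_comp[cA _]; exact: (box_proper bF).
Qed.

(** Source components are pieces of depth 1 and target components of depth 0; each branch is a
    single branch of [F], so the composition has length [n = 1]. *)
Lemma induced_crit_restriction : induced_from F1 F.
Proof.
have e1 : iter_dom F 1 = src F.
  apply/seteqP; split=> [z []//|z sz]; split=> //.
  by apply: (box_maps bF); exists z.
split.
- exists crit_comp => // U [cU _]; exists 1%N; by rewrite e1.
- exists (components (tgt F)); first by move=> U cU; exists 0%N.
  by rewrite connected_component_cover.
- move=> A /crit_src_comp[cA _]; exists 1%N, (fun=> A); split=> // i.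
  by rewrite ltnS leqn0 => /eqP ->; split=> // _ [z Az <-].
Qed.

Lemma iter_dom_crit_restriction m y : (forall j, (j < m)%N -> crit_src (iter j F y)) ->
  tgt F (iter m F y) -> iter_dom F1 m y.
Proof.
elim: m y => [//|m IH] y h ty; split; first exact: (h 0%N).
apply: IH => [j jm|]; last by rewrite -iterSr.
by rewrite /= -iterSr; exact: h.
Qed.

(* Follow the orbit leaving [src F] until it first leaves [crit_src]. *)
Lemma no_permutation_crit_restriction : no_permutation F1.
Proof.
move=> A /crit_src_comp[cA _]; have [n [_ [[y [Ay dy] <-] ny]]] := noperm cA.
have ex : exists m, `[< ~ crit_src (iter m F y) >].
  by exists n; apply/asboolP => /crit_src_sub.
case: (ex_minnP ex) => m /asboolP nm hm.
have mn : (m <= n)%N by apply: hm; apply/asboolP => /crit_src_sub.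
have hj j : (j < m)%N -> crit_src (iter j F y).
  move=> jm; apply: contrapT => /asboolP /hm; by rewrite leqNgt jm.
have ty : tgt F (iter m F y).
  apply: (iter_dom_shift (k := m) (n := 0)); rewrite addn0.
  exact: (iter_dom_mono bF mn).
exists m, (iter m F y); split=> //; exists y => //; split=> //.
exact: iter_dom_crit_restriction.
Qed.

Lemma natural_crit_restriction : dynamically_natural F1.
Proof.
have b1 := box_crit_restriction; have np := no_permutation_crit_restriction.
split=> //; first exact: off_crit_null b1 finite_crit_src np.
exact: nonescaping_well_inside b1 finite_crit_src np.
Qed.

End Restriction.

Theorem proposition4p5 (R : realType) (F : plane_map R) (Uhat : set (Cplane R)) :
  box_mapping F ->
  no_permutation F ->
  (forall V, components (tgt F) V ->
     V `&` crit F !=set0 \/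
     exists W, [/\ open W, W !=set0, W `<=` V & W `&` src F = set0]) ->
  finite_puzzle_union F Uhat ->
  nice F Uhat ->
  compactly_contained Uhat (tgt F) ->
  exists F1 : plane_map R,
    [/\ box_mapping F1, induced_from F1 F, dynamically_natural F1,
        crit_visiting F Uhat `<=` crit F1 & crit F1 `<=` crit F].
Proof.
move=> bF noperm _ _ _ _; exists (crit_restriction F).
rewrite crit_crit_restriction; split=> //.
- exact: box_crit_restriction.
- exact: induced_crit_restriction.
- exact: natural_crit_restriction.
- by move=> c [].
Qed.
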